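(* Let $\alpha\in\mathbb{R}$, $z=(0,1)$, let $T>0$ be sufficiently small (depending on $\alpha$), and let $\omega\in C^0((0,T),L^1_\perp(\mathbb{R}^2_+)\cap L^{4/3}(\mathbb{R}^2_+))$ be the unique mild solution on $(0,T)$ of the vorticity equation $\partial_t\omega+u\cdot\nabla\omega=\Delta\omega$, $u(t)=\mathrm{BS}_+[\omega(t)]$, in $\mathbb{R}^2_+$ such that $\omega(t)\rightharpoonup\alpha\delta_z$ as $t\to0$, $\sup_{0<t<T}\|\omega(t)\|_{L^1}<\infty$, and $\sup_{0<t<T}t^\beta\|\omega(t)-\alpha G_t(\cdot-z)\|_{L^{4/3}}<\infty$ for some $\beta<1/4$. Then the velocity field satisfies $$\sup_{t\in(0,T)}\|u(t)\|_{L^p}<\infty\qquad\forall\,p\in(1,2).$$ As a consequence, the kinetic energy $\|u(t)\|_{L^2}^2$ is finite for all $t\in(0,T)$.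
   Context: Notation: $\mathbb{R}^2_+=\{x=(x_1,x_2)\in\mathbb{R}^2: x_2>0\}$; for $x=(x_1,x_2)$, $x^\perp=(-x_2,x_1)$ and $x^*=(x_1,-x_2)$. $L^p$ norms are over $\mathbb{R}^2_+$. Gaussian and Poisson kernels: $G_t(x)=\frac{1}{4\pi t}e^{-|x|^2/(4t)}$, $P(x)=\frac1\pi\frac{x_2}{x_1^2+x_2^2}$. Stokes semigroup (vorticity form, no-slip condition): $(S(t)\omega_0)(x)=\int_{\mathbb{R}^2_+}K(x,y,t)\,\omega_0(y)\,dy$ for $x\in\mathbb{R}^2_+$, $t>0$, where $K(x,y,t)=G_t(x-y)-G_t(x-y^* )-K_0(x,y,t)$ and $$K_0(x,y,t)=-2\,\partial_{x_2}\int_{\mathbb{R}}\int_0^{y_2}G_t(x-\zeta^* )\,P(y-\zeta)\,d\zeta_2\,d\zeta_1 .$$ For $F\in L^1(\mathbb{R}^2_+)^2$, $(S(t)\,\mathrm{div}F)(x):=-\int_{\mathbb{R}^2_+}\nabla_yK(x,y,t)\cdot F(y)\,dy$. Biot--Savart law in the half-plane: $\mathrm{BS}_+[\omega](x)=\frac1{2\pi}\int_{\mathbb{R}^2_+}\Bigl(\frac{(x-y)^\perp}{|x-y|^2}-\frac{(x-y^* )^\perp}{|x-y^*|^2}\Bigr)\omega(y)\,dy$. No-slip space: $L^1_\perp(\mathbb{R}^2_+)=\{\omega\in L^1(\mathbb{R}^2_+):\gamma[\omega]=0\}$, where $\gamma[\omega](x_1)=\frac1\pi\int_{\mathbb{R}^2_+}\frac{y_2}{(x_1-y_1)^2+y_2^2}\,\omega(y)\,dy$,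 $x_1\in\mathbb{R}$. Mild solution on $(0,T)$: a function $\omega\in C^0((0,T),L^1_\perp(\mathbb{R}^2_+)\cap L^{4/3}(\mathbb{R}^2_+))$ such that, with $u(s)=\mathrm{BS}_+[\omega(s)]$, $$\omega(t)=S(t-t_0)\omega(t_0)-\int_{t_0}^tS(t-s)\,\mathrm{div}\bigl(u(s)\omega(s)\bigr)\,ds\qquad\text{whenever }0<t_0<t<T.$$ Weak convergence: $C_0(\mathbb{R}^2_+)$ is the space of continuous functions on $\mathbb{R}^2_+$ vanishing at infinity and on $\partial\mathbb{R}^2_+$; $\mu_n\rightharpoonup\mu$ for finite Radon measures on $\mathbb{R}^2_+$ means $\langle\mu_n,\phi\rangle\to\langle\mu,\phi\rangle$ for all $\phi\in C_0(\mathbb{R}^2_+)$. $\delta_z$ is the Dirac mass at $z$. For all sufficiently small $T>0$ (depending on $\alpha$) a mild solution with the properties listed in the claim exists and is unique. *)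

(* Defs.v *)
From HB Require Import structures.
From mathcomp Require Import all_boot all_order all_algebra.
From mathcomp Require Import all_classical all_reals all_analysis.

Set Implicit Arguments.
Unset Strict Implicit.
Unset Printing Implicit Defensive.
Import Order.TTheory GRing.Theory Num.Theory.
Import numFieldNormedType.Exports.

Local Open Scope classical_set_scope.
Local Open Scope ring_scope.

(* Every real-valued integral below is the total [Rintegral], which returns 0
   when the extended-real integral is infinite. *)

Section HalfPlane.
Context {R : realType}.
Implicit Types (x y z : R * R) (a t s p : R) (f : R * R -> R).
Implicit Types (v F : R * R -> R * R).

Notation mu1 := (@lebesgue_measure R).

Notation plane := (measurableTypeR R * measurableTypeR R)%type.

Definition leb2 : {measure set plane -> \bar R} := (mu1 \x mu1)%E.

Definition Hplus : set (R * R) := [set x | 0 < x.2].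

Definition perp x : R * R := (- x.2, x.1).
Definition refl x : R * R := (x.1, - x.2).
Definition dot x y : R := x.1 * y.1 + x.2 * y.2.

(* Euclidean norm: the library norm on [R * R] is the sup norm. *)
Definition enorm x : R := Num.sqrt (x.1 ^+ 2 + x.2 ^+ 2).

Definition d1 f x : R := derive1 (fun r : R => f (r, x.2)) x.1.
Definition d2 f x : R := derive1 (fun r : R => f (x.1, r)) x.2.

Definition gauss t x : R :=
  (4 * pi * t)^-1 * expR (- (enorm x ^+ 2) / (4 * t)).

Definition poisson x : R := pi^-1 * (x.2 / (x.1 ^+ 2 + x.2 ^+ 2)).

Definition K0 x y t : R :=
  - 2 * d2 (fun x' =>
    \int[mu1]_zeta1 \int[mu1]_(zeta2 in `[0, y.2])
      (gauss t (x' - refl (zeta1, zeta2)) * poisson (y - (zeta1, zeta2)))) x.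

Definition K x y t : R :=
  gauss t (x - y) - gauss t (x - refl y) - K0 x y t.

Definition stokes t f x : R := \int[leb2]_(y in Hplus) (K x y t * f y).

(* [S(t) div F]: the divergence is moved onto the kernel. *)
Definition stokes_div t F x : R :=
  - \int[leb2]_(y in Hplus)
      dot (d1 (fun y' => K x y' t) y, d2 (fun y' => K x y' t) y) (F y).

Definition BS_kernel x y : R * R :=
  (enorm (x - y) ^+ 2)^-1 *: perp (x - y)
  - (enorm (x - refl y) ^+ 2)^-1 *: perp (x - refl y).

Definition BS f x : R * R :=
  (2 * pi)^-1 *: (\int[leb2]_(y in Hplus) ((BS_kernel x y).1 * f y),
                  \int[leb2]_(y in Hplus) ((BS_kernel x y).2 * f y)).

Definition trace f a : R :=
  pi^-1 * \int[leb2]_(y in Hplus) (y.2 / ((a - y.1) ^+ 2 + y.2 ^+ 2) * f y).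

Definition Lpnorm p f : \bar R := Lnorm leb2 p%:E (EFin \o (f \_ Hplus)).

Definition inLp p f : Prop :=
  measurable_fun (Hplus : set plane) (f : plane -> R) /\ (Lpnorm p f < +oo)%E.

(* For [f] in L^1 the integral defining [trace f] converges only for almost
   every [a], hence the almost-everywhere equality. *)
Definition noslip f : Prop :=
  inLp 1 f /\ {ae mu1, forall a, trace f a = 0}.

(* An L^p-valued curve is given by a family of representatives;
   [cont_Lp T p w] is its continuity on (0, T). *)
Definition cont_Lp (T p : R) (w : R -> R * R -> R) : Prop :=
  forall t, 0 < t < T -> Lpnorm p (w s \- w t) @[s --> t] --> 0%E.

(* The Duhamel integral is evaluated pointwise: the identity between elements
   of L^1 is an identity for almost every [x] in the half-plane. *)
Definition mild_solution (T : R) (w : R -> R * R -> R) : Prop :=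
  [/\ forall t, 0 < t < T -> noslip (w t) /\ inLp (4 / 3) (w t),
      cont_Lp T 1 w,
      cont_Lp T (4 / 3) w
    & forall t0 t, 0 < t0 -> t0 < t -> t < T ->
      {ae leb2, forall x, Hplus x ->
        w t x = stokes (t - t0) (w t0) x
                - \int[mu1]_(s in `]t0, t[)
                    stokes_div (t - s) (fun y => w s y *: BS (w s) y) x}].

Definition in_C0 (phi : R * R -> R) : Prop :=
  [/\ {within Hplus, continuous phi},
      forall e, 0 < e -> exists M, forall x,
        Hplus x -> M < enorm x -> `|phi x| < e
    & forall b : R, phi x @[x --> within Hplus (nbhs (b, 0))] --> 0].

Definition weak_cvg_dirac (w : R -> R * R -> R) (alpha : R) z : Prop :=
  forall phi, in_C0 phi ->
    \int[leb2]_(x in Hplus) (phi x * w t x) @[t --> 0^'+]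
      --> alpha * \int[\d_z]_(x in Hplus) phi x.

Definition sup_time (T : R) (g : R -> \bar R) : \bar R :=
  ereal_sup [set g t | t in `]0, T[].

End HalfPlane.

(* Main.v *)
Require Import Defs.
From HB Require Import structures.
From mathcomp Require Import all_boot all_order all_algebra.
From mathcomp Require Import all_classical all_reals all_analysis.
From mathcomp Require Import measurable_realfun interval_inference.
From mathcomp Require Import ring lra.

(* Let [F = u omega].  The kernel of the Biot-Savart law is at most [1 / |x - y|],
   so a Hardy-Littlewood-Sobolev bound gives [|F(t)|_1 <= C |omega(t)|_{4/3}^2],
   and [beta < 1/4] makes this [<= C t^(-1/2)].  Letting [t0 -> 0] in the mild
   formulation,
     omega(t) = alpha K(., z, t) + int_0^t int grad_y K(., y, t - s) . F(s, y).
   The gradient of the kernel consists of a heat part, a function of [x - y] of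
   zero mean, and a wall part, concentrated near the boundary; weighted by
   [1 + |x - y|] and [1 + 2 x_2] respectively, both have [L^1] norm at most
   [C (t - s)^(-1/2)], and [int_0^t ds / sqrt (s (t - s))] is bounded.
   Let [N(x) = x^perp / |x|^2].  Applying the Biot-Savart law, whose kernel is the
   difference of [N] at a point and at its mirror image, and subtracting its value
   at [y] on the heat part, writes [u(t)] as a superposition of differences
   [N(. - a) - N(. - b)] with weights of bounded total mass even after
   multiplication by [1 + |a - b|].  Such a difference has [L^p] norm at most
   [C (1 + |a - b|)] precisely when [1 < p < 2].
   For [p = 2], [omega(t)] in [L^1] and [L^(4/3)] bounds the large values of [u],
   and [u] in [L^(3/2)] the small ones. *)

(** The velocity is borderline: [|N|] is [1 / |x|], whose power [p] is integrable at the origin for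
    [p < 2] but at infinity only for [p > 2]. Below [2] every vortex must be paired with an opposite
    one, and the distance between the two is the price. The mirror image is a partner at distance
    [2 x_2]. This is affordable for the wall part of the gradient; for the heat part it would
    require a moment of [F(s, .)] in the height, and none is available. There the zero mean provides
    a partner at distance [|x - y|], whatever the height of [y]. This is why the gradient is split
    and why the two weights differ. The second obstacle is measurability. A mild solution is a curve
    in [L^1], without joint measurability in time and space, whereas the space-time integral is
    handled by Tonelli and Fubini. The vorticity is therefore replaced by a jointly measurable
    version, equal to it almost everywhere at each time. As a real integral is [0] when it diverges,
    exchanging integrals also rests on finiteness statements, valid for almost every [x]. *)

Set Implicit Arguments. Unset Strict Implicit. Unset Printing Implicit Defensive.
Import Order.TTheory GRing.Theory Num.Theory.
Import numFieldNormedType.Exports.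
Local Open Scope classical_set_scope.
Local Open Scope ring_scope.

(** * Product measures and Lebesgue integrals *)

(* The library's sigma-finite instance of [m1 \x m2] is shadowed by the one for
   subprobabilities; [prodm] is a copy carrying the general instance. *)
Definition prodm d1 d2 (T1 : measurableType d1) (T2 : measurableType d2)
    (R : realType) (m1 : {sigma_finite_measure set T1 -> \bar R})
    (m2 : {sigma_finite_measure set T2 -> \bar R}) :
  set (T1 * T2)%type -> \bar R := (m1 \x m2)%E.

HB.instance Definition _ d1 d2 (T1 : measurableType d1) (T2 : measurableType d2)
    (R : realType) (m1 : {sigma_finite_measure set T1 -> \bar R})
    (m2 : {sigma_finite_measure set T2 -> \bar R}) :=
  Measure.copy (prodm m1 m2) (m1 \x m2)%E.

Lemma prodm_sigma_finite d1 d2 (T1 : measurableType d1) (T2 : measurableType d2)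
    (R : realType) (m1 : {sigma_finite_measure set T1 -> \bar R})
    (m2 : {sigma_finite_measure set T2 -> \bar R}) :
  sigma_finite setT (prodm m1 m2).
Proof.
have /sigma_finiteP[F [TF ndF Foo]] := sigma_finiteT m1.
have /sigma_finiteP[G [TG ndG Goo]] := sigma_finiteT m2.
exists (fun n => F n `*` G n).
  apply/seteqP; split => // -[x y] _.
  have [n _ Fnx] : (\bigcup_i F i) x by rewrite -TF.
  have [k _ Gky] : (\bigcup_i G i) y by rewrite -TG.
  exists (maxn n k) => //; split => /=.
  - by move: x Fnx; exact/subsetPset/ndF/leq_maxl.
  - by move: y Gky; exact/subsetPset/ndG/leq_maxr.
move=> k; have [? ?] := Foo k; have [? ?] := Goo k.
split; first exact: measurableX.
by rewrite /prodm product_measure1E// lte_mul_pinfty// ge0_fin_numE.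
Qed.

HB.instance Definition _ d1 d2 (T1 : measurableType d1) (T2 : measurableType d2)
    (R : realType) (m1 : {sigma_finite_measure set T1 -> \bar R})
    (m2 : {sigma_finite_measure set T2 -> \bar R}) :=
  Measure_isSigmaFinite.Build _ _ _ (prodm m1 m2) (prodm_sigma_finite m1 m2).

Section Tonelli.
Context d1 d2 (T1 : measurableType d1) (T2 : measurableType d2) (R : realType)
  (m1 : {sigma_finite_measure set T1 -> \bar R})
  (m2 : {sigma_finite_measure set T2 -> \bar R}).
Implicit Type f : (T1 * T2)%type -> \bar R.

Lemma prodm_tonelli1 f : measurable_fun setT f -> (forall z, 0 <= f z)%E ->
  (\int[prodm m1 m2]_z f z = \int[m1]_x \int[m2]_y f (x, y))%E.
Proof. by move=> mf f0; rewrite /prodm fubini_tonelli1. Qed.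

Lemma prodm_tonelli2 f : measurable_fun setT f -> (forall z, 0 <= f z)%E ->
  (\int[prodm m1 m2]_z f z = \int[m2]_y \int[m1]_x f (x, y))%E.
Proof. by move=> mf f0; rewrite /prodm fubini_tonelli2. Qed.

End Tonelli.

Section LebesgueTools.

Definition pushforwardm d d' (T1 : measurableType d) (T2 : measurableType d')
    (R : realType) (m : {measure set T1 -> \bar R}) (f : T1 -> T2)
    (mf : measurable_fun setT f) : {measure set T2 -> \bar R} :=
  measure_function_pushforward__canonical__measure_function_Measure m mf.

(** No integrability is assumed: the integrals of the positive and of the negative part are
    measurable by Tonelli, and [fine] of their difference is measurable wherever the real integral
    falls back to [0]. This covers [avg], [wall] and [bs], which are such integrals. *)
Lemma measurable_Rintegral_param d1 d2 (T1 : measurableType d1)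
    (T2 : measurableType d2) (R : realType)
    (m2 : {sigma_finite_measure set T2 -> \bar R}) (f : T1 * T2 -> R) :
  measurable_fun [set: (T1 * T2)%type] f ->
  measurable_fun setT (fun x => \int[m2]_y f (x, y)).
Proof.
move=> mf.
have mE : measurable_fun [set: (T1 * T2)%type] (fun z => (f z)%:E) by exact/measurable_EFinP.
rewrite /Rintegral; apply: measurableT_comp => //.
rewrite (_ : (fun _ => _) =
    (fubini_F m2 (fun z => (f z)%:E)^\+) \- (fubini_F m2 (fun z => (f z)%:E)^\-))%E; last first.
  apply/funext => x; rewrite [LHS]integralE /fubini_F /=.
  by congr (_ - _)%E; apply: eq_integral => y _; rewrite ?funeposE ?funenegE.
apply: emeasurable_funB.
  by apply: measurable_fun_fubini_tonelli_F => //; exact: measurable_funepos.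
by apply: measurable_fun_fubini_tonelli_F => //; exact: measurable_funeneg.
Qed.

Lemma affine_preimage_itv (R : realType) (a b u v : R) : 0 < b ->
  (fun x => a + b * x) @^-1` `]u, v] = `](u - a) / b, (v - a) / b]%classic.
Proof.
move=> b0; apply/seteqP; split => x /=; rewrite !in_itv/= ltr_pdivrMr// ler_pdivlMr// => /andP[h1 h2]; apply/andP; split; lra.
Qed.

Lemma measurable_affine (R : realType) (a b : R) :
  measurable_fun setT (fun x : R => a + b * x).
Proof. by apply: measurable_funD => //; exact: measurable_funM. Qed.

(** Both sides are measures in [A] that agree on half-open intervals, and Lebesgue measure is the
    only such measure. *)
Lemma lebesgue_measure_affine (R : realType) (a b : R) (A : set R) :
  0 < b -> measurable A ->
  lebesgue_measure A =
  (b%:E * @lebesgue_measure R ((fun x => (a + b * x)%R) @^-1` A))%E.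
Proof.
move=> b0 mA.
have bge : 0 <= b by exact: ltW.
pose phi : measurableTypeR R -> measurableTypeR R := fun x => a + b * x.
have mphi : measurable_fun setT phi by exact: measurable_affine.
pose nu : {measure set (measurableTypeR R) -> \bar R} := mscale (NngNum bge) (pushforwardm (@lebesgue_measure R) mphi).
rewrite [RHS](_ : _ = nu A)//.
apply: lebesgue_measure_unique => //.
move=> X [[u v]] _ <-.
rewrite /= (_ : nu _ = (b%:E * lebesgue_measure ((fun x => (a + b * x)%R) @^-1` `]u, v]))%E)//.
rewrite affine_preimage_itv//.
rewrite !lebesgue_measure_itv/= !lte_fin ltr_pdivrMr// mulfVK ?gt_eqF// ltrD2r.
case: ifPn => uv; last by rewrite mule0.
rewrite -!EFinB -EFinM; congr (_%:E); field.
by rewrite gt_eqF.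
Qed.

Lemma ge0_integral_affine (R : realType) (a b : R) (f : R -> \bar R) :
  b != 0 -> measurable_fun setT f -> (forall x, 0 <= f x)%E ->
  (\int[lebesgue_measure]_x f x =
   `|b|%:E * \int[lebesgue_measure]_x f (a + b * x)%R)%E.
Proof.
have pos (a' b' : R) (h : R -> \bar R) : 0 < b' -> measurable_fun setT h -> (forall x, 0 <= h x)%E ->
  (\int[lebesgue_measure]_x h x =
   b'%:E * \int[lebesgue_measure]_x h (a' + b' * x)%R)%E.
  move=> b0 mh h0.
  have bge : 0 <= b' by exact: ltW.
  pose phi : measurableTypeR R -> measurableTypeR R := fun x => a' + b' * x.
  have mphi : measurable_fun setT phi by exact: measurable_affine.
  pose nu : {measure set (measurableTypeR R) -> \bar R} := mscale (NngNum bge) (pushforwardm (@lebesgue_measure R) mphi).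
  rewrite (eq_measure_integral nu); last by move=> A mA _; exact: lebesgue_measure_affine.
  by rewrite ge0_integral_mscale// ge0_integral_pushforward.
have neg (h : R -> \bar R) : measurable_fun setT h -> (forall x, 0 <= h x)%E ->
  (\int[lebesgue_measure]_x h x = \int[lebesgue_measure]_x h (- x)%R)%E.
  move=> mh h0.
  rewrite (eq_measure_integral (pushforward (@lebesgue_measure R) (-%R : _ -> measurableTypeR R))); last first.
    by move=> A mA _; exact/esym/lebesgue_measureN.
  by rewrite ge0_integral_pushforward.
move=> b0 mf f0; have [b1|b1|b1] := ltgtP b 0; last by rewrite b1 eqxx in b0.
- rewrite neg// (pos (- a) (- b))//; last 2 first.
  + by rewrite oppr_gt0.
  + exact: measurableT_comp.
  rewrite ltr0_norm//; congr (_ * _)%E; apply: eq_integral => x _; congr f; ring.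
- by rewrite (pos a b)// gtr0_norm.
Qed.

Lemma ge0_integral_translate (R : realType) (c : R) (f : R -> \bar R) :
  measurable_fun setT f -> (forall x, 0 <= f x)%E ->
  (\int[lebesgue_measure]_x f (x - c)%R = \int[lebesgue_measure]_x f x)%E.
Proof.
move=> mf f0; rewrite (@ge0_integral_affine _ (- c) 1 f)// ?oner_eq0// normr1 mul1e.
by apply: eq_integral => x _; rewrite mul1r addrC.
Qed.

Lemma ge0_integral_reflect (R : realType) (c : R) (f : R -> \bar R) :
  measurable_fun setT f -> (forall x, 0 <= f x)%E ->
  (\int[lebesgue_measure]_x f (c - x)%R = \int[lebesgue_measure]_x f x)%E.
Proof.
move=> mf f0; rewrite (@ge0_integral_affine _ c (- 1) f)// ?oppr_eq0 ?oner_eq0//.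
rewrite normrN normr1 mul1e.
by apply: eq_integral => x _; rewrite mulN1r.
Qed.

End LebesgueTools.

(* The threshold [A] below is half the mean value of [k] with respect to [w]. *)
Lemma integral_pow_superposition d1 d2 (X : measurableType d1) (L : measurableType d2)
    (R : realType) (m1 : {sigma_finite_measure set X -> \bar R})
    (m2 : {sigma_finite_measure set L -> \bar R}) (p C W : R)
    (k : X * L -> R) (w : L -> R) :
  1 < p -> 0 <= C -> 0 < W ->
  measurable_fun [set: (X * L)%type] k -> measurable_fun setT w ->
  (forall z, 0 <= k z) -> (forall l, 0 <= w l) ->
  (forall l, \int[m1]_x (k (x, l) `^ p)%:E <= C%:E)%E ->
  (\int[m2]_l (w l)%:E <= W%:E)%E ->
  (\int[m1]_x ((\int[m2]_l (k (x, l) * w l)%:E) `^ p) <= (2 `^ p * W `^ p * C)%:E)%E.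
Proof.
move=> p1 C0 W0 mk mw k0 w0 kC wW.
have p0 : 0 < p by rewrite (lt_trans _ p1).
have mkw : measurable_fun [set: (X * L)%type] (fun z => (k z * w z.2)%:E).
  by apply/measurable_EFinP/measurable_funM => //; exact: measurableT_comp.
have mkp : measurable_fun [set: (X * L)%type] (fun z => (k z `^ p * w z.2)%:E).
  apply/measurable_EFinP/measurable_funM => //; last exact: measurableT_comp.
  exact: (measurableT_comp (measurable_powR p) mk).
pose J x := (\int[m2]_l (k (x, l) `^ p * w l)%:E)%E.
pose U x := (\int[m2]_l (k (x, l) * w l)%:E)%E.
have J0 x : (0 <= J x)%E.
  by apply: integral_ge0 => l _; rewrite lee_fin mulr_ge0// powR_ge0.
have U0 x : (0 <= U x)%E.
  by apply: integral_ge0 => l _; rewrite lee_fin mulr_ge0.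
have mJ : measurable_fun setT J.
  by apply: (measurable_fun_fubini_tonelli_F (fun z => (k z `^ p * w z.2)%:E)) => // z; rewrite lee_fin mulr_ge0// powR_ge0.
have mU : measurable_fun setT U.
  by apply: (measurable_fun_fubini_tonelli_F (fun z => (k z * w z.2)%:E)) => // z; rewrite lee_fin mulr_ge0.
(* Pointwise [k <= A^(1-p) k^p + A]: either [k <= A], or [k = k^(1-p) k^p] with [1 - p < 0].
   Integrated against [w], this replaces Hoelder's inequality. *)
have UA (A : R) x : 0 < A -> (U x <= (A `^ (1 - p))%:E * J x + A%:E * W%:E)%E.
  move=> A0.
  have mkpx : measurable_fun setT (fun l => (k (x, l) `^ p * w l)%:E).
    exact: (measurable_fun_pair2 x mkp).
  have -> : ((A `^ (1 - p))%:E * J x = \int[m2]_l ((A `^ (1 - p))%:E * (k (x, l) `^ p * w l)%:E))%E.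
    rewrite ge0_integralZl//; last by rewrite lee_fin powR_ge0.
    by move=> l _; rewrite lee_fin mulr_ge0// powR_ge0.
  apply: (@le_trans _ _ (\int[m2]_l ((A `^ (1 - p))%:E * (k (x, l) `^ p * w l)%:E) + \int[m2]_l (A%:E * (w l)%:E))%E); last first.
    rewrite leeD2l// ge0_integralZl//; last 3 first.
    - exact/measurable_EFinP.
    - by move=> l _; rewrite lee_fin.
    - by rewrite lee_fin ltW.
    by rewrite lee_wpmul2l// lee_fin ltW.
  rewrite -ge0_integralD//; last 4 first.
  - by move=> l _; rewrite -EFinM lee_fin !mulr_ge0// powR_ge0.
  - by apply: measurable_funeM.
  - by move=> l _; rewrite -EFinM lee_fin mulr_ge0// ltW.
  - by apply: measurable_funeM; exact/measurable_EFinP.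
  apply: ge0_le_integral => //.
  - by move=> l _; rewrite lee_fin mulr_ge0.
  - exact: (measurable_fun_pair2 x mkw).
  - apply: emeasurable_funD; first exact: measurable_funeM.
    by apply: measurable_funeM; exact/measurable_EFinP.
  move=> l _; rewrite -!EFinM -EFinD lee_fin mulrA -mulrDl ler_wpM2r//.
  have [kA|Ak] := leP (k (x, l)) A.
    by rewrite (le_trans kA)// lerDr mulr_ge0// powR_ge0.
  apply: ler_wpDr; first exact: ltW.
  rewrite -[leLHS](@powRr1 _ (k (x, l)))// -[in leLHS](@subrK _ p 1).
  rewrite powRD; last by rewrite (gt_eqF (lt_trans A0 Ak)) implybT.
  rewrite ler_wpM2r ?powR_ge0//.
  rewrite -[1 - p]opprB !powRN lef_pV2 ?posrE ?powR_gt0//; last exact: (lt_trans A0).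
  by rewrite ge0_ler_powR ?nnegrE ?(ltW A0) ?(ltW (lt_trans A0 Ak)) ?subr_ge0 ?ltW.
have UJ x : (U x `^ p <= (2 `^ p * W `^ (p - 1))%:E * J x)%E.
  have cst0 : 0 < 2 `^ p * W `^ (p - 1) by rewrite mulr_gt0// powR_gt0.
  have [Jy|Jy] := eqVneq (J x) +oo%E.
    by rewrite Jy gt0_muley ?lte_fin// leey.
  have Jfin : J x \is a fin_num by rewrite ge0_fin_numE// ltey.
  have [j j0 jE] : exists2 j, 0 <= j & J x = j%:E.
    by exists (fine (J x)); [rewrite fine_ge0|rewrite fineK].
  (* The threshold [1] only serves to show that [U x] is finite when [J x] is, so that [U x] itself
     may enter the next choice of [A]. *)
  have := UA 1 x ltr01; rewrite jE powR1 !mul1e -EFinD => UW.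
  have Ufin : U x \is a fin_num by rewrite ge0_fin_numE// (le_lt_trans UW)// ltry.
  have [u u0 uE] : exists2 u, 0 <= u & U x = u%:E.
    by exists (fine (U x)); [rewrite fine_ge0|rewrite fineK].
  rewrite uE poweR_EFin -EFinM lee_fin.
  have [->|un0] := eqVneq u 0.
    by rewrite powR0 ?gt_eqF// mulr_ge0// ltW.
  have up : 0 < u by rewrite lt_neqAle eq_sym un0.
  have A0 : 0 < u / (2 * W) by rewrite divr_gt0// mulr_gt0.
  have := UA _ x A0; rewrite uE jE -!EFinM -EFinD lee_fin => H.
  have {}H : u / 2 <= (u / (2 * W)) `^ (1 - p) * j.
    have e : u / (2 * W) * W = u / 2 by field; rewrite gt_eqF.
    rewrite e in H; lra.
  have -> : u `^ p = 2 `^ p * W `^ (p - 1) * ((u / (2 * W)) `^ (p - 1) * (u / 2)).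
    have -> : u / (2 * W) = (u / 2) / W by field; rewrite gt_eqF.
    rewrite powRM ?divr_ge0 ?invr_ge0 ?(ltW W0)//.
    rewrite -powR_inv1 ?(ltW W0)// -powRrM mulN1r powRN.
    rewrite -mulrA; have WW : W `^ (p - 1) != 0 by rewrite gt_eqF// powR_gt0.
    have -> : W `^ (p - 1) * ((u / 2) `^ (p - 1) * (W `^ (p - 1))^-1 * (u / 2)) = (u / 2) `^ (p - 1) * (u / 2) by field.
    rewrite -[X in _ * (_ * X)](@powRr1 _ (u / 2)) ?divr_ge0//.
    rewrite -powRD ?subrK; last by rewrite gt_eqF ?implybT// divr_gt0.
    by rewrite -powRM// ?divr_ge0//; congr (_ `^ _); field.
  rewrite ler_wpM2l ?(ltW cst0)//.
  rewrite (le_trans (ler_wpM2l _ H)) ?powR_ge0// mulrA -powRD; last by rewrite (gt_eqF A0) implybT.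
  by rewrite (_ : p - 1 + (1 - p) = 0) ?powRr0 ?mul1r//; ring.
apply: (@le_trans _ _ (\int[m1]_x ((2 `^ p * W `^ (p - 1))%:E * J x))%E).
  apply: ge0_le_integral => //.
  - by move=> x _; rewrite poweR_ge0.
  - exact: (measurableT_comp (measurable_poweR _)).
  - exact: measurable_funeM.
  - by move=> x _; exact: UJ.
rewrite ge0_integralZl//; last by rewrite lee_fin mulr_ge0// powR_ge0.
rewrite /J (fubini_tonelli (fun z => (k z `^ p * w z.2)%:E))//=; last first.
  by move=> z; rewrite lee_fin mulr_ge0// powR_ge0.
have -> : 2 `^ p * W `^ p * C = (2 `^ p * W `^ (p - 1)) * (C * W).
  suff -> : W `^ p = W `^ (p - 1) * W by ring.
  rewrite -[X in _ = _ * X](@powRr1 _ W) ?ltW// -powRD ?subrK//.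
  by rewrite (gt_eqF W0) implybT.
rewrite [leRHS]EFinM lee_wpmul2l//; first by rewrite lee_fin mulr_ge0// powR_ge0.
apply: (@le_trans _ _ (\int[m2]_l (C%:E * (w l)%:E))%E).
  apply: ge0_le_integral => //.
  - by move=> l _; apply: integral_ge0 => x _; rewrite lee_fin mulr_ge0// powR_ge0.
  - by apply: (measurable_fun_fubini_tonelli_G (fun z => (k z `^ p * w z.2)%:E)) => // z; rewrite lee_fin mulr_ge0// powR_ge0.
  - by apply: measurable_funeM; exact/measurable_EFinP.
  move=> l _.
  under eq_integral do rewrite EFinM.
  rewrite ge0_integralZr//; last 3 first.
  - apply/measurable_EFinP; apply: (measurableT_comp (measurable_powR p)).
    exact: (measurable_fun_pair1 l mk).
  - by move=> x _; rewrite lee_fin powR_ge0.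
  - by rewrite lee_fin.
  by rewrite lee_wpmul2r// lee_fin.
rewrite ge0_integralZl//; last 2 first.
- exact/measurable_EFinP.
- by move=> l _; rewrite lee_fin.
by rewrite [leRHS]EFinM lee_wpmul2l// lee_fin.
Qed.

(** * Power integrals on the line and the time integral of the Duhamel formula *)

Section PowerIntegrals.
Context {R : realType}.
Notation mu := (@lebesgue_measure R).

Lemma continuous_powR (e x : R) : 0 < x -> {for x, continuous (fun r : R => r `^ e)}.
Proof.
move=> x0; have [d _] := is_derive1_powR e x0.
by apply: differentiable_continuous; apply/derivable1_diffP.
Qed.

Lemma integral_powR_itv (e a b : R) : e != 0 -> 0 < a -> a < b ->
  (\int[mu]_(r in `[a, b]) (r `^ (e - 1))%:E = ((b `^ e - a `^ e) / e)%:E)%E.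
Proof.
move=> e0 a0 ab.
have b0 : 0 < b by exact: lt_trans ab.
rewrite (@continuous_FTC2 _ _ (fun r => e^-1 * r `^ e))//.
- by rewrite -EFinB -mulrBr mulrC.
- apply: continuous_in_subspaceT => x; rewrite inE/= in_itv/= => /andP[ax _].
  by apply: continuous_powR; exact: lt_le_trans ax.
- split.
  + move=> x; rewrite in_itv/= => /andP[ax _].
    have x0 : 0 < x by exact: lt_trans ax.
    by have [d _] := is_derive1_powR e x0; apply: derivableM; [exact: derivable_cst|exact: d].
  + apply: cvg_at_right_filter; apply: cvgM; first exact: cvg_cst.
    exact: continuous_powR.
  + apply: cvg_at_left_filter; apply: cvgM; first exact: cvg_cst.
    exact: continuous_powR.
- move=> x; rewrite in_itv/= => /andP[ax _].
  have x0 : 0 < x by exact: lt_trans ax.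
  have H := is_derive1_powR e x0.
  rewrite derive1E; have -> : 'D_1 (fun r => e^-1 * r `^ e) x = e^-1 * (e * x `^ (e - 1)).
    by rewrite deriveM// derive_cst scaler0 addr0 derive_val.
  by rewrite mulrA mulVf// mul1r.
Qed.

(** The fundamental theorem applies away from the singularity; the intervals [[b / (n + 2), b]]
    exhaust []0, b]] and monotone convergence concludes. Starting at [n + 2] keeps the left endpoint
    strictly below [b]. *)
Lemma integral_powR_near0 (e b : R) : 0 < e -> 0 < b ->
  (\int[mu]_(r in `]0%R, b]) (r `^ (e - 1))%:E <= (b `^ e / e)%:E)%E.
Proof.
move=> e0 b0.
pose F (n : nat) : set (measurableTypeR R) := `[b / n.+2%:R, b]%classic.
have -> : `]0, b]%classic = \bigcup_n F n.
  apply/seteqP; split => [x|x [n _]]; rewrite /F /= !in_itv/=.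
    move=> /andP[x0 xb]; exists (Num.truncn (b / x)) => //=.
    rewrite in_itv/= xb andbT ler_pdivrMr// mulrC -ler_pdivrMr//.
    by rewrite (le_trans (ltW (truncnS_gt _)))// ler_nat.
  move=> /andP[bx ->]; rewrite andbT (lt_le_trans _ bx)//.
  by rewrite divr_gt0.
have mF n : measurable (F n) by exact: measurable_itv.
have mp n : measurable_fun (F n) (fun r => (r `^ (e - 1))%:E).
  by apply/measurable_EFinP/measurable_funTS; exact: measurable_powR.
have := @ge0_nondecreasing_set_cvg_integral _ _ _ F (fun r => (r `^ (e - 1))%:E) mu.
move=> /(_ _ mF mp) H; apply: cvge_le; last apply: H.
- exact: eventually_filter.
- apply: nearW => n; rewrite /F integral_powR_itv ?gt_eqF ?divr_gt0//; last first.
    by rewrite ltr_pdivrMr// ltr_pMr// ltr1n.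
  by rewrite lee_fin ler_wpM2r ?invr_ge0 ?(ltW e0)// gerBl powR_ge0.
- move=> m n mn; apply/subsetPset => x; rewrite /F/= !in_itv/= => /andP[h ->].
  by rewrite andbT (le_trans _ h)// ler_wpM2l ?(ltW b0)// lef_pV2 ?posrE// ler_nat.
- by move=> i x _; rewrite lee_fin powR_ge0.
Qed.

Lemma integral_powR_infty (e : R) : e < 0 ->
  (\int[mu]_(r in `[1%R, +oo[) (r `^ (e - 1))%:E <= (- e^-1)%:E)%E.
Proof.
move=> e0.
pose F (n : nat) : set (measurableTypeR R) := `[1, n.+2%:R]%classic.
have -> : `[1%R, +oo[%classic = \bigcup_n F n.
  apply/seteqP; split => [x|x [n _]]; rewrite /F /= !in_itv/=.
    rewrite andbT => x1; exists (Num.truncn x) => //=.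
    rewrite in_itv/= x1 /=.
    by rewrite (le_trans (ltW (truncnS_gt _)))// ler_nat.
  by move=> /andP[-> _].
have mF n : measurable (F n) by exact: measurable_itv.
have mp n : measurable_fun (F n) (fun r => (r `^ (e - 1))%:E).
  by apply/measurable_EFinP/measurable_funTS; exact: measurable_powR.
have := @ge0_nondecreasing_set_cvg_integral _ _ _ F (fun r => (r `^ (e - 1))%:E) mu.
move=> /(_ _ mF mp) H; apply: cvge_le; last apply: H.
- exact: eventually_filter.
- apply: nearW => n; rewrite /F integral_powR_itv ?lt_eqF ?ltr1n//.
  rewrite lee_fin powR1 -[leRHS]mul1r mulrN -mulNr ler_wnM2r ?invr_le0 ?(ltW e0)//.
  by rewrite lerBrDl subrr powR_ge0.
- move=> m n mn; apply/subsetPset => x; rewrite /F/= !in_itv/= => /andP[-> h] /=.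
  by rewrite (le_trans h)// ler_nat.
- by move=> i x _; rewrite lee_fin powR_ge0.
Qed.

Lemma ge0_integral_abs_le (f : R -> \bar R) :
  measurable_fun setT f -> (forall x, 0 <= f x)%E ->
  (\int[mu]_x f `|x|%R <= 2%:E * \int[mu]_(x in `[0%R, +oo[) f x)%E.
Proof.
move=> mf f0.
have mI : measurable (`[0%R, +oo[%classic : set R) by exact: measurable_itv.
pose h := f \_ `[0%R, +oo[%classic.
have mh : measurable_fun setT h by apply/(measurable_restrictT _ mI); exact: measurable_funTS.
have h0 x : (0 <= h x)%E by rewrite /h patchE; case: ifP.
rewrite [in leRHS]integral_mkcond -/h mule_natl mule2n.
have mhN : measurable_fun setT (fun x : R => h (0 - x)%R).
  by apply: (measurableT_comp mh); exact: measurable_funB.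
rewrite -[X in (_ <= X + _)%E](ge0_integral_reflect 0 mh h0).
rewrite -ge0_integralD//.
apply: ge0_le_integral => //.
- exact: (measurableT_comp mf).
- exact: emeasurable_funD.
move=> x _; have [x0|x0] := leP 0 x.
  rewrite ger0_norm// [X in (_ <= _ + X)%E](_ : _ = f x); first by rewrite leeDr.
  by rewrite /h patchE ifT// inE/= in_itv/= x0.
rewrite ltr0_norm// sub0r.
rewrite [X in (_ <= X + _)%E](_ : _ = f (- x)%R); first by rewrite leeDl.
by rewrite /h patchE ifT// inE/= in_itv/= andbT oppr_ge0 ltW.
Qed.

Lemma integral_inv_add_sqr (rho : R) : 0 < rho ->
  (\int[mu]_x ((rho ^+ 2 + x ^+ 2)^-1)%:E <= (pi / rho)%:E)%E.
Proof.
move=> r0.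
have mf : measurable_fun setT (fun x : R => ((rho ^+ 2 + x ^+ 2)^-1)%:E).
  apply/measurable_EFinP; apply: continuous_measurable_fun => x.
  apply: cvgV; first by rewrite gt_eqF// ltr_pwDl ?sqr_ge0 ?exprn_gt0.
  by apply: cvgD; [exact: cvg_cst|exact: exprn_continuous].
rewrite (@ge0_integral_affine _ 0 rho)// ?gt_eqF//; last first.
  by move=> x; rewrite lee_fin invr_ge0 addr_ge0 ?sqr_ge0.
have mg : measurable_fun setT (fun x : R => ((oneDsqr x)^-1)%:E).
  by apply/measurable_EFinP; apply: continuous_measurable_fun; exact: continuous_oneDsqrV.
have mgn : measurable_fun setT (fun x : R => ((oneDsqr `|x|)^-1)%:E).
  exact: (measurableT_comp mg).
have -> : (pi / rho)%:E = (`|rho|%:E * ((rho ^- 2)%:E * (2%:E * (pi / 2)%:E)))%E.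
  rewrite gtr0_norm// -!EFinM; congr (_%:E); field; exact: lt0r_neq0.
rewrite lee_wpmul2l// -integral0y_oneDsqr.
apply: (@le_trans _ _ ((rho ^- 2)%:E * \int[mu]_x ((oneDsqr `|x|)^-1)%:E)%E); last first.
  rewrite lee_wpmul2l//; first by rewrite lee_fin invr_ge0 sqr_ge0.
  by apply: (@ge0_integral_abs_le (fun x => ((oneDsqr x)^-1)%:E)).
rewrite -ge0_integralZl//; last first.
- by rewrite lee_fin invr_ge0 sqr_ge0.
apply: ge0_le_integral => //.
- by move=> x _; rewrite lee_fin invr_ge0 addr_ge0 ?sqr_ge0.
- exact: (measurableT_comp mf (measurable_affine 0 rho)).
- exact: measurable_funeM.
move=> x _; rewrite -EFinM lee_fin /oneDsqr.
rewrite -normrX (ger0_norm (sqr_ge0 x)) add0r exprMn.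
by rewrite -[X in X + _]mulr1 -mulrDr invfM.
Qed.

(** A Beta integral, of exact value [pi]. From [sqrt t <= sqrt s + sqrt (t - s)] the integrand is at
    most [1 / sqrt t] times [1 / sqrt s + 1 / sqrt (t - s)], and each of the two summands integrates
    to at most [2 sqrt t]. *)
Lemma integral_invsqrt_itv (t : R) : 0 < t ->
  (\int[mu]_(s in `]0%R, t[) ((Num.sqrt (t - s))^-1 * (Num.sqrt s)^-1)%:E <= 8%:E)%E.
Proof.
move=> t0.
have sq (r : R) : 0 < r -> (Num.sqrt r)^-1 = r `^ (2^-1 - 1).
  move=> r0; rewrite -(powR12_sqrt (ltW r0)) -powRN; congr (_ `^ _); by field.
have half : 0 < 2^-1 :> R by rewrite invr_gt0.
pose g (s : R) : \bar R := ((fun s : R => (s `^ (2^-1 - 1))%:E) \_ `]0, t]%classic) s.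
have mI : measurable (`]0%R, t]%classic : set R) by exact: measurable_itv.
have mg : measurable_fun setT g.
  apply/(measurable_restrictT _ mI); apply/measurable_EFinP/measurable_funTS.
  exact: measurable_powR.
have g0 s : (0 <= g s)%E by rewrite /g patchE; case: ifP => // _; rewrite lee_fin powR_ge0.
have gI : (\int[mu]_s g s <= (2 * Num.sqrt t)%:E)%E.
  rewrite /g -integral_mkcond (le_trans (integral_powR_near0 half t0))//.
  by rewrite lee_fin (powR12_sqrt (ltW t0)) invrK mulrC.
have mJ : measurable (`]0%R, t[%classic : set R) by exact: measurable_itv.
rewrite integral_mkcond.
pose h (s : R) : \bar R := ((Num.sqrt t)^-1%:E * (g s + g (t - s)%R))%E.
have mgt : measurable_fun setT (fun s : R => g (t - s)%R).
  by apply: (measurableT_comp mg); exact: measurable_funB.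
have st0 : 0 < Num.sqrt t by rewrite sqrtr_gt0.
apply: (@le_trans _ _ (\int[mu]_s h s)%E).
  apply: ge0_le_integral => //.
  - by move=> s _; rewrite patchE; case: ifP => // _; rewrite lee_fin mulr_ge0 ?invr_ge0 ?sqrtr_ge0.
  - apply/(measurable_restrictT _ mJ); apply/measurable_EFinP/measurable_funTS.
    have msq : measurable_fun setT (fun x : R => (Num.sqrt x)^-1).
      rewrite (_ : (fun _ => _) = (fun x : R => if 0 < x then x `^ (2^-1 - 1) else 0)).
        apply: measurable_fun_ifT => //; exact: measurable_fun_ltr.
      apply/funext => x; case: ifPn => [|x0]; first exact: sq.
      by rewrite ler0_sqrtr ?invr0// leNgt.
    apply: measurable_funM => //; apply: (measurableT_comp msq).
    exact: measurable_funB.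
  - by apply: measurable_funeM; exact: emeasurable_funD.
  move=> s _; rewrite patchE; case: ifPn => [|_]; last first.
    by rewrite /h mule_ge0 ?adde_ge0// lee_fin invr_ge0 ltW.
  rewrite inE/= in_itv/= => /andP[s0 st].
  have ts0 : 0 < t - s by rewrite subr_gt0.
  rewrite /h /g !patchE !ifT ?inE/= ?in_itv/= ?s0 ?(ltW st)//; last first.
    by rewrite ts0/= gerBl ltW.
  rewrite -EFinD -EFinM lee_fin -!sq//.
  have a0 : 0 < Num.sqrt s by rewrite sqrtr_gt0.
  have b0 : 0 < Num.sqrt (t - s) by rewrite sqrtr_gt0.
  have : Num.sqrt t <= Num.sqrt s + Num.sqrt (t - s).
    rewrite -(@ler_pXn2r _ 2)// ?nnegrE ?addr_ge0 ?(ltW a0) ?(ltW b0) ?(ltW st0)//.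
    rewrite sqrrD !sqr_sqrtr ?(ltW s0) ?(ltW ts0) ?(ltW t0)//.
    have : 0 < Num.sqrt s * Num.sqrt (t - s) by exact: mulr_gt0.
    lra.
  rewrite -[_^-1 + _^-1](_ : (Num.sqrt s + Num.sqrt (t - s)) * ((Num.sqrt (t - s))^-1 / Num.sqrt s) = _); last first.
    by field; rewrite !gt_eqF.
  move=> H; rewrite mulrA ler_pMl ?mulr_gt0 ?invr_gt0//.
  by rewrite ler_pdivlMl// mulr1.
rewrite ge0_integralZl//; last 2 first.
- by apply: emeasurable_funD => //; exact: mgt.
- by move=> s _; rewrite adde_ge0.
rewrite ge0_integralD// ge0_integral_reflect//.
apply: (@le_trans _ _ (((Num.sqrt t)^-1)%:E * ((2 * Num.sqrt t)%:E + (2 * Num.sqrt t)%:E))%E).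
  by rewrite lee_wpmul2l ?lee_fin ?invr_ge0 ?(ltW st0)// leeD.
rewrite -EFinD -EFinM lee_fin.
have -> : (Num.sqrt t)^-1 * (2 * Num.sqrt t + 2 * Num.sqrt t) = 4 by field; exact: lt0r_neq0.
lra.
Qed.

End PowerIntegrals.

Section Measurability.
Context {R : realType}.

Lemma measurable_invr : measurable_fun setT (@GRing.inv R).
Proof.
rewrite (_ : GRing.inv = fun x : R => if 0 < x then x `^ (- 1) else - ((- x) `^ (- 1))).
  apply: measurable_fun_ifT => //; first exact: measurable_fun_ltr.
  apply: measurable_funN; apply: (measurableT_comp (measurable_powR _)).
  exact: measurable_funN.
apply/funext => x; case: ifPn => [x0|]; first by rewrite powR_inv1// ltW.
rewrite -leNgt => x0; rewrite powR_inv1 ?oppr_ge0//.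
by rewrite invrN opprK.
Qed.

Lemma measurable_sqrtr : measurable_fun setT (@Num.sqrt R).
Proof. by apply: continuous_measurable_fun; exact: sqrt_continuous. Qed.

Lemma measurable_planeB d (T : measurableType d)
    (f g : T -> (measurableTypeR R * measurableTypeR R)%type) :
  measurable_fun setT f -> measurable_fun setT g ->
  measurable_fun setT (fun z => f z - g z).
Proof.
move=> mf mg.
apply: (@measurable_fun_pair _ _ _ _ _ _ (fun z => (f z).1 - (g z).1) (fun z => (f z).2 - (g z).2)).
- by apply: measurable_funB; exact: (measurableT_comp measurable_fst).
- by apply: measurable_funB; exact: (measurableT_comp measurable_snd).
Qed.

Lemma measurable_refl d (T : measurableType d)
    (f : T -> (measurableTypeR R * measurableTypeR R)%type) :
  measurable_fun setT f -> measurable_fun setT (fun z => refl (f z)).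
Proof.
move=> mf.
apply: (@measurable_fun_pair _ _ _ _ _ _ (fun z => (f z).1) (fun z => - (f z).2)).
- exact: (measurableT_comp measurable_fst).
- by apply: measurable_funN; exact: (measurableT_comp measurable_snd).
Qed.
End Measurability.

(** Measurability by recursion on the syntax of the function. The two rules for a difference concern
    real values and points of the plane; the second is reached by backtracking. *)
Ltac mfun1 := match goal with
 | |- measurable_fun _ (fun _ => ?c) => exact: measurable_cst
 | H : measurable_fun _ ?f |- measurable_fun _ ?f => exact: H
 | |- measurable_fun _ fst => exact: measurable_fst
 | |- measurable_fun _ snd => exact: measurable_snd
 | |- measurable_fun _ (fun z => z) => exact: measurable_id
 | |- measurable_fun _ (fun z => - @?f z) => apply: (@measurable_funN _ _ _ _ f)
 | |- measurable_fun _ (fun z => @?f z - @?g z) => apply: (@measurable_funB _ _ _ _ f g)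
 | |- measurable_fun _ (fun z => @?f z - @?g z) => apply: (@measurable_planeB _ _ _ f g)
 | |- measurable_fun _ (fun z => @?f z + @?g z) => apply: (@measurable_funD _ _ _ _ f g)
 | |- measurable_fun _ (fun z => @?f z * @?g z) => apply: (@measurable_funM _ _ _ _ f g)
 | |- measurable_fun _ (fun z => @?f z ^+ ?n) => apply: (@measurable_funX _ _ _ _ f n)
 | |- measurable_fun _ (fun z => (@?f z)^-1) => apply: (measurableT_comp measurable_invr (g := f))
 | |- measurable_fun _ (fun z => `|@?f z|) => apply: (measurableT_comp (@normr_measurable _ setT) (g := f))
 | |- measurable_fun _ (fun z => Num.sqrt (@?f z)) => apply: (measurableT_comp measurable_sqrtr (g := f))
 | |- measurable_fun _ (fun z => expR (@?f z)) => apply: (measurableT_comp (@measurable_expR _) (g := f))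
 | |- measurable_fun _ (fun z => @?f z `^ ?p) => apply: (measurableT_comp (measurable_powR p) (g := f))
 | |- measurable_fun _ (fun z => (@?f z)%:E) => apply/measurable_EFinP
 | |- measurable_fun _ (fun z => (@?f z + @?g z)%E) => apply: emeasurable_funD
 | |- measurable_fun _ (fun z => (@?f z * @?g z)%E) => apply: emeasurable_funM
 | |- measurable_fun _ (fun z => if _ then _ else _) => apply: measurable_fun_ifT
 | |- measurable_fun _ (fun z => @?f z && @?g z) => apply: (@measurable_and _ _ _ f g)
 | |- measurable_fun _ (fun z => @?f z <= @?g z) => apply: (@measurable_fun_ler _ _ _ _ f g)
 | |- measurable_fun _ (fun z => @?f z < @?g z) => apply: (@measurable_fun_ltr _ _ _ _ f g)
 | |- measurable_fun _ (fun z => (@?f z, @?g z)) => apply: (@measurable_fun_pair _ _ _ _ _ _ f g)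
 | |- measurable_fun _ (fun z => refl (@?f z)) => apply: (@measurable_refl _ _ _ f)
 | |- measurable_fun _ (fun z => (@?f z).1) => apply: (measurableT_comp measurable_fst (g := f))
 | |- measurable_fun _ (fun z => (@?f z).2) => apply: (measurableT_comp measurable_snd (g := f))
 | H : measurable_fun _ ?f |- measurable_fun _ (fun z => ?f (@?g z)) => apply: (measurableT_comp H (g := g))
 end.
Ltac mfun := repeat mfun1.

Section RealIntegrands.
Context d (T : measurableType d) (R : realType) (m : {measure set T -> \bar R}).
Implicit Types f g : T -> R.

Lemma int_ge0 f : (forall x, 0 <= f x) -> (0 <= \int[m]_x (f x)%:E)%E.
Proof. by move=> f0; apply: integral_ge0 => x _; rewrite lee_fin. Qed.

Lemma int_mono f g : measurable_fun setT f -> measurable_fun setT g ->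
  (forall x, 0 <= f x) -> (forall x, f x <= g x) ->
  (\int[m]_x (f x)%:E <= \int[m]_x (g x)%:E)%E.
Proof.
move=> mf mg f0 fg; apply: ge0_le_integral => //.
- by move=> x _; rewrite lee_fin.
- exact/measurable_EFinP.
- exact/measurable_EFinP.
- by move=> x _; rewrite lee_fin.
Qed.

Lemma int_addr f g : measurable_fun setT f -> measurable_fun setT g ->
  (forall x, 0 <= f x) -> (forall x, 0 <= g x) ->
  (\int[m]_x (f x + g x)%:E = \int[m]_x (f x)%:E + \int[m]_x (g x)%:E)%E.
Proof.
move=> mf mg f0 g0; rewrite -ge0_integralD//.
- by move=> x _; rewrite lee_fin.
- exact/measurable_EFinP.
- by move=> x _; rewrite lee_fin.
- exact/measurable_EFinP.
Qed.

Lemma int_scale (c : R) f : measurable_fun setT f ->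
  (forall x, 0 <= f x) -> 0 <= c ->
  (\int[m]_x (c * f x)%:E = c%:E * \int[m]_x (f x)%:E)%E.
Proof.
move=> mf f0 c0; rewrite -ge0_integralZl//.
- exact/measurable_EFinP.
- by move=> x _; rewrite lee_fin.
Qed.

Lemma int_scaler (c : R) f : measurable_fun setT f ->
  (forall x, 0 <= f x) -> 0 <= c ->
  (\int[m]_x (f x * c)%:E = \int[m]_x (f x)%:E * c%:E)%E.
Proof.
move=> mf f0 c0; rewrite muleC -int_scale//.
by apply: eq_integral => x _; rewrite mulrC.
Qed.

End RealIntegrands.

(** * Riesz kernels on the plane *)

Section PlaneKernels.
Context {R : realType}.
Notation mu := (@lebesgue_measure R).
Notation plane := (measurableTypeR R * measurableTypeR R)%type.

(** Convertible with [leb2], but carrying the sigma-finite structure that iterated integrals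
    require. *)
Definition lebp : {sigma_finite_measure set plane -> \bar R} := prodm mu mu.

(** Near and far are separated by a square rather than a disc, so that the integrals over the two
    regions reduce to one variable at a time and polar coordinates are avoided. *)
Definition box (rho : R) (z : R * R) : bool := (`|z.1| <= rho) && (`|z.2| <= rho).

Lemma enorm_ge0 (z : R * R) : 0 <= enorm z.
Proof. exact: sqrtr_ge0. Qed.

Lemma enorm_sqr (z : R * R) : enorm z ^+ 2 = z.1 ^+ 2 + z.2 ^+ 2.
Proof. by rewrite sqr_sqrtr// addr_ge0// sqr_ge0. Qed.

Lemma abs1_le_enorm (z : R * R) : `|z.1| <= enorm z.
Proof. by rewrite -sqrtr_sqr ler_sqrt ?addr_ge0 ?sqr_ge0// lerDl sqr_ge0. Qed.

Lemma abs2_le_enorm (z : R * R) : `|z.2| <= enorm z.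
Proof. by rewrite -sqrtr_sqr ler_sqrt ?addr_ge0 ?sqr_ge0// lerDr sqr_ge0. Qed.

Lemma enorm_eq0 (z : R * R) : (enorm z == 0) = (z.1 == 0) && (z.2 == 0).
Proof. by rewrite -sqrf_eq0 enorm_sqr paddr_eq0 ?sqr_ge0// !sqrf_eq0. Qed.

Lemma enorm_subC (x y : R * R) : enorm (x - y) = enorm (y - x).
Proof.
by rewrite /enorm/= -(sqrrN (x.1 - y.1)) -(sqrrN (x.2 - y.2)) !opprB.
Qed.

Lemma leb2_tonelli1 (f : plane -> \bar R) :
  measurable_fun setT f -> (forall z, 0 <= f z)%E ->
  (\int[leb2]_z f z = \int[mu]_x \int[mu]_y f (x, y))%E.
Proof. by move=> mf f0; exact: prodm_tonelli1. Qed.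

Lemma leb2_tonelli2 (f : plane -> \bar R) :
  measurable_fun setT f -> (forall z, 0 <= f z)%E ->
  (\int[leb2]_z f z = \int[mu]_y \int[mu]_x f (x, y))%E.
Proof. by move=> mf f0; exact: prodm_tonelli2. Qed.

Lemma leb2_reflect (c : plane) (f : plane -> \bar R) :
  measurable_fun setT f -> (forall z, 0 <= f z)%E ->
  (\int[leb2]_z f (c - z)%R = \int[leb2]_z f z)%E.
Proof.
move=> mf f0.
have mfc : measurable_fun [set: plane] (fun z : plane => f (c - z)).
  apply: (measurableT_comp mf (g := fun z : plane => (c.1 - z.1, c.2 - z.2))).
  by mfun.
rewrite (leb2_tonelli1 mfc (fun z => f0 _)) (leb2_tonelli1 mf f0).
rewrite -(@ge0_integral_reflect _ c.1 (fun x => \int[mu]_y f (x, y))%E); last 2 first.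
- by apply: (@measurable_fun_fubini_tonelli_F _ _ _ _ _ mu f).
- by move=> x; apply: integral_ge0.
apply: eq_integral => x _.
rewrite -(@ge0_integral_reflect _ c.2 (fun y => f (c.1 - x, y)))//.
exact: (measurable_fun_pair2 _ mf).
Qed.

Lemma leb2_translate (c : plane) (f : plane -> \bar R) :
  measurable_fun setT f -> (forall z, 0 <= f z)%E ->
  (\int[leb2]_z f (z - c)%R = \int[leb2]_z f z)%E.
Proof.
move=> mf f0.
have mfc : measurable_fun [set: plane] (fun z : plane => f (z - c)).
  apply: (measurableT_comp mf (g := fun z : plane => (z.1 - c.1, z.2 - c.2))).
  by mfun.
rewrite (leb2_tonelli1 mfc (fun z => f0 _)) (leb2_tonelli1 mf f0).
rewrite -(@ge0_integral_translate _ c.1 (fun x => \int[mu]_y f (x, y))%E); last 2 first.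
- by apply: (@measurable_fun_fubini_tonelli_F _ _ _ _ _ mu f).
- by move=> x; apply: integral_ge0.
apply: eq_integral => x _.
rewrite -(@ge0_integral_translate _ c.2 (fun y => f (x - c.1, y)))//.
exact: (measurable_fun_pair2 _ mf).
Qed.

Lemma integral_abs_le_cst (r c : R) : 0 <= r -> 0 <= c ->
  (\int[mu]_s (if `|s| <= r then c else 0)%:E <= (2 * r * c)%:E)%E.
Proof.
move=> r0 c0.
rewrite (_ : (fun s : R => (if `|s| <= r then c else 0)%:E) = (fun s => c%:E * (\1_(`[- r, r]%classic) s)%:E)%E); last first.
  apply/funext => s; rewrite indicE -EFinM; congr (_%:E).
  rewrite ler_norml; case: ifPn => h.
    by rewrite mem_set ?mulr1//= in_itv.
  by rewrite memNset ?mulr0//= in_itv/=; exact/negP.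
rewrite ge0_integralZl//; last first.
  by apply/measurable_EFinP; exact: measurable_indic.
rewrite integral_indic// setIT.
rewrite [X in (_ * X)%E](_ : _ = (2 * r)%:E).
  by rewrite -EFinM lee_fin mulrC.
apply: (etrans (lebesgue_measure_itv _)); rewrite /= lte_fin.
case: ifPn => [_|]; first by rewrite -EFinB; congr (_%:E); ring.
by rewrite -leNgt => h; congr (_%:E); lra.
Qed.

(** By symmetry in the coordinates it suffices to treat the cone [|z.2| <= |z.1|]. There [enorm z]
    is at least [|z.1|] and the slice has length [2 |z.1|], which leaves the integral of
    [2 |r|^(1-p)], convergent at the origin as [p < 2]. The two cones give the factor
    [8 = 2 * 4]. *)
Lemma integral_enorm_near (p rho : R) : 0 < p -> p < 2 -> 0 < rho ->
  (\int[leb2]_z (if box rho z then (enorm z)^-1 `^ p else 0)%:E <=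
   (8 / (2 - p) * rho `^ (2 - p))%:E)%E.
Proof.
move=> p0 p2 r0.
pose a (z : plane) : R := if (`|z.2| <= `|z.1|) && (`|z.1| <= rho) then `|z.1|^-1 `^ p else 0.
have ma : measurable_fun setT a by rewrite /a; mfun.
have a0 z : 0 <= a z by rewrite /a; case: ifP => // _; exact: powR_ge0.
have ma' : measurable_fun setT (fun z : plane => a (z.2, z.1)) by rewrite /a /=; mfun.
have mE : measurable_fun setT (fun z : plane => if box rho z then (enorm z)^-1 `^ p else 0).
  by rewrite /box /enorm; mfun.
have le z : (if box rho z then (enorm z)^-1 `^ p else 0) <= a z + a (z.2, z.1).
  rewrite /box; case: ifPn => [/andP[z1 z2]|_]; last by rewrite addr_ge0.
  have aux (u v : R) : `|v| <= `|u| -> `|u| <= enorm (u, v) -> (enorm (u, v))^-1 `^ p <= `|u|^-1 `^ p.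
    move=> vu ue.
    have [u0|u0] := eqVneq `|u| 0.
      have /eqP -> : v == 0 by rewrite -normr_eq0 eq_le normr_ge0 andbT -u0.
      have /eqP -> : u == 0 by rewrite -normr_eq0 u0.
      by rewrite /enorm/= expr0n/= addr0 sqrtr0 invr0 powR0 ?gt_eqF// powR_ge0.
    have up : 0 < `|u| by rewrite lt_neqAle eq_sym u0 normr_ge0.
    rewrite ge0_ler_powR ?nnegrE ?(ltW p0) ?invr_ge0 ?enorm_ge0//.
    by rewrite lef_pV2 ?posrE// (lt_le_trans up).
  have [h|/ltW h] := leP `|z.2| `|z.1|.
    rewrite -[leLHS]addr0 lerD// /a h z1/=.
    by have := aux z.1 z.2 h (abs1_le_enorm z); case: (z) => ? ?.
  rewrite -[leLHS]add0r lerD// /a/= h z2/=.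
  have := aux z.2 z.1 h; rewrite /enorm/= [X in Num.sqrt X]addrC; apply.
  exact: (abs2_le_enorm z).
have aI : (\int[mu]_x \int[mu]_y (a (x, y))%:E <= (4 / (2 - p) * rho `^ (2 - p))%:E)%E.
  pose f (r : R) : \bar R := (if r <= rho then 2 * r `^ (2 - p - 1) else 0)%:E.
  have mf : measurable_fun setT f by rewrite /f; mfun.
  have f0 r : (0 <= f r)%E.
    by rewrite /f lee_fin; case: ifP => // _; rewrite mulr_ge0// powR_ge0.
  apply: (@le_trans _ _ (\int[mu]_x f `|x|%R)%E).
    apply: ge0_le_integral => //.
    - by move=> x _; apply: integral_ge0 => y _; rewrite lee_fin.
    - apply: (@measurable_fun_fubini_tonelli_F _ _ _ _ _ mu (fun z : plane => (a z)%:E)) => //.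
      exact/measurable_EFinP.
    - exact: (measurableT_comp mf).
    move=> x _; rewrite /a/= /f; case: ifPn => h; last first.
      by under eq_integral do rewrite andbF; rewrite integral0.
    under eq_integral do rewrite andbT.
    apply: (le_trans (integral_abs_le_cst _ _)); rewrite ?powR_ge0//.
    rewrite lee_fin -mulrA ler_wpM2l//.
    have [->|x0] := eqVneq `|x| 0; first by rewrite mul0r powR_ge0.
    have xp : 0 < `|x| by rewrite lt_neqAle eq_sym x0 normr_ge0.
    rewrite -powR_inv1// -powRrM mulN1r -[X in X * _](@powRr1 _ `|x|)//.
    rewrite -powRD; last by rewrite (negbTE x0) implybT.
    by rewrite le_eqVlt; apply/orP; left; apply/eqP; congr (_ `^ _); ring.
  apply: (le_trans (ge0_integral_abs_le mf f0)).
  have -> : (4 / (2 - p) * rho `^ (2 - p))%:E = (2%:E * (2 * (rho `^ (2 - p) / (2 - p)))%:E)%E.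
    by rewrite -EFinM; congr (_%:E); ring.
  rewrite lee_wpmul2l// -integral_itv_obnd_cbnd; last exact: measurable_funTS.
  rewrite /f.
  have mI : measurable (`]0%R, +oo[%classic : set R) by exact: measurable_itv.
  have mJ : measurable (`]0%R, rho]%classic : set R) by exact: measurable_itv.
  apply: (@le_trans _ _ (\int[mu]_(r in `]0%R, rho]) (2%:E * (r `^ (2 - p - 1))%:E))%E).
    rewrite integral_mkcond [leRHS]integral_mkcond.
    rewrite le_eqVlt; apply/orP; left; apply/eqP; apply: eq_integral => r _.
    rewrite !patchE; have [rr|rr] := leP r rho.
      have -> : (r \in `]0%R, +oo[%classic) = (r \in `]0%R, rho]%classic).
        by apply/idP/idP; rewrite !inE/= !in_itv/= andbT ?rr ?andbT.
      by case: ifP => // _; rewrite EFinM.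
    rewrite [in RHS]ifF; first by case: ifP.
    by apply/negbTE/negP; rewrite inE/= in_itv/= leNgt rr andbF.
  rewrite ge0_integralZl//; last 2 first.
  - by apply/measurable_EFinP/measurable_funTS; exact: measurable_powR.
  - by move=> r _; rewrite lee_fin powR_ge0.
  rewrite EFinM lee_wpmul2l//.
  by apply: integral_powR_near0 => //; rewrite subr_gt0.
apply: (@le_trans _ _ (\int[leb2]_z ((a z)%:E + (a (z.2, z.1))%:E))%E).
  apply: ge0_le_integral => //.
  - by move=> z _; rewrite lee_fin; case: ifP => // _; rewrite powR_ge0.
  - exact/measurable_EFinP.
  - by apply: emeasurable_funD; exact/measurable_EFinP.
  - by move=> z _; rewrite -EFinD lee_fin.
rewrite ge0_integralD//; last 4 first.
- by move=> z _; rewrite lee_fin.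
- exact/measurable_EFinP.
- by move=> z _; rewrite lee_fin.
- exact/measurable_EFinP.
rewrite (leb2_tonelli1 (f := fun z => (a z)%:E)); last 2 first.
- exact/measurable_EFinP.
- by move=> z; rewrite lee_fin.
rewrite (leb2_tonelli2 (f := fun z => (a (z.2, z.1))%:E)); last 2 first.
- exact/measurable_EFinP.
- by move=> z; rewrite lee_fin.
apply: (le_trans (leeD aI aI)).
by rewrite -EFinD lee_fin -mulrDl -mulrDl le_eqVlt; apply/orP; left; apply/eqP; congr (_ / _ * _); ring.
Qed.

(** The integrand is at most [1] on [[0, 1]] and at most [r^(-p)] beyond, which is integrable
    because [1 < p]; evenness doubles the result. *)
Lemma integral_oneDsqr_powR (p : R) : 1 < p ->
  (\int[mu]_r (((1 + r ^+ 2)^-1) `^ (p / 2))%:E <= (2 + 2 / (p - 1))%:E)%E.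
Proof.
move=> p1.
pose f (r : R) : \bar R := (((1 + r ^+ 2)^-1) `^ (p / 2))%:E.
have mf : measurable_fun setT f by rewrite /f; mfun.
have f0 r : (0 <= f r)%E by rewrite lee_fin powR_ge0.
have fabs r : f r = f `|r|%R by rewrite /f -[in RHS]normrX (ger0_norm (sqr_ge0 r)).
have pos (r : R) : 0 < 1 + r ^+ 2 by rewrite ltr_pwDl// sqr_ge0.
under eq_integral do rewrite -/(f _) fabs.
apply: (le_trans (ge0_integral_abs_le mf f0)).
have -> : (2 + 2 / (p - 1))%:E = (2%:E * (1%:E + ((p - 1)^-1)%:E))%E.
  by rewrite -EFinD -EFinM; congr (_%:E); ring.
rewrite lee_wpmul2l//.
have mI : measurable (`[1%R, +oo[%classic : set R) by exact: measurable_itv.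
have mJ : measurable (`[0%R, 1%R[%classic : set R) by exact: measurable_itv.
have -> : `[0%R, +oo[%classic = (`[0%R, 1%R[ `|` `[1%R, +oo[)%classic :> set R.
  apply/seteqP; split => r /=; rewrite !in_itv/= ?andbT.
    by move=> r0; have [h|h] := leP 1 r; [right|left; rewrite r0].
  by move=> [/andP[]//|r1]; rewrite (le_trans _ r1).
rewrite ge0_integral_setU//; last 2 first.
- exact: measurable_funTS.
- apply/disj_setPS => r [/=]; rewrite !in_itv/= andbT => /andP[_ r1].
  by rewrite leNgt r1.
rewrite leeD//.
  apply: (@le_trans _ _ (\int[mu]_(r in `[0%R, 1%R[) 1%:E)%E).
    apply: ge0_le_integral => //.
    - exact: measurable_funTS.
    move=> r _; rewrite lee_fin; have one : 1 `^ (p / 2) = 1 by rewrite powR1.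
    rewrite -[leRHS]one ge0_ler_powR ?nnegrE ?invr_ge0 ?(ltW (pos r))//.
      lra.
    by rewrite invf_le1// lerDl sqr_ge0.
  rewrite integral_cst// mul1e [leLHS](_ : _ = 1%:E)//.
  by apply: (etrans (lebesgue_measure_itv _)); rewrite /= lte_fin ltr01 oppr0 adde0.
have e0 : 1 - p < 0 by rewrite subr_lt0.
apply: (@le_trans _ _ (\int[mu]_(r in `[1%R, +oo[) (r `^ (1 - p - 1))%:E)%E).
  apply: ge0_le_integral => //.
  - exact: measurable_funTS.
  - by apply/measurable_EFinP/measurable_funTS; exact: measurable_powR.
  move=> r /=; rewrite in_itv/= andbT => r1.
  have r0 : 0 < r by rewrite (lt_le_trans _ r1).
  rewrite lee_fin (_ : r `^ (1 - p - 1) = (r ^- 2) `^ (p / 2)); last first.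
    rewrite -(@powR_mulrn _ r 2) ?(ltW r0)// -powRN -powRrM; congr (_ `^ _).
    by field.
  rewrite ge0_ler_powR ?nnegrE ?invr_ge0 ?sqr_ge0 ?(ltW (pos r))//.
    lra.
  by rewrite lef_pV2 ?posrE ?exprn_gt0// lerDr.
apply: (le_trans (integral_powR_infty e0)).
by rewrite lee_fin -invrN opprB.
Qed.

End PlaneKernels.

(** * A Hardy-Littlewood-Sobolev inequality with both exponents equal to 4/3 *)

Section HLS.
Context {R : realType}.
Notation mu := (@lebesgue_measure R).
Notation plane := (measurableTypeR R * measurableTypeR R)%type.

(** Outside the square [rho^2 <= |z|^2], so each factor is at most [2 |z|^2]. Radial decay is thus
    dominated by a product of functions of one variable, which Tonelli integrates. *)
Lemma sum_sqr_ge (rho : R) (z : R * R) : ~~ box rho z -> 0 < rho ->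
  (rho ^+ 2 + z.1 ^+ 2) * (rho ^+ 2 + z.2 ^+ 2) <= 4 * enorm z ^+ 4.
Proof.
move=> nb r0; have E : rho ^+ 2 <= z.1 ^+ 2 + z.2 ^+ 2.
  move: nb; rewrite /box negb_and -!ltNge => /orP[] h.
    by rewrite -[leLHS]addr0 lerD ?sqr_ge0// -(real_normK (num_real z.1)) lerXn2r ?nnegrE ?normr_ge0 ?(ltW r0) ?(ltW h).
  by rewrite -[leLHS]add0r lerD ?sqr_ge0// -(real_normK (num_real z.2)) lerXn2r ?nnegrE ?normr_ge0 ?(ltW r0) ?(ltW h).
have -> : enorm z ^+ 4 = (z.1 ^+ 2 + z.2 ^+ 2) ^+ 2 by rewrite -enorm_sqr -exprM.
have := sqr_ge0 z.1; have := sqr_ge0 z.2; have := sqr_ge0 rho.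
move: E; move: (rho ^+ 2) (z.1 ^+ 2) (z.2 ^+ 2) => r a b; nra.
Qed.

Lemma integral_enorm_far (rho : R) : 0 < rho ->
  (\int[leb2]_z (if box rho z then 0 else (enorm z)^-1 ^+ 4)%:E <=
   (4 * (pi / rho) ^+ 2)%:E)%E.
Proof.
move=> r0.
pose h (r : R) := (rho ^+ 2 + r ^+ 2)^-1.
have mh : measurable_fun setT h by rewrite /h; mfun.
have h0 r : 0 <= h r by rewrite invr_ge0 addr_ge0 ?sqr_ge0.
have mhh : measurable_fun setT (fun z : plane => (4 * (h z.1 * h z.2))%:E).
  by rewrite /h; mfun.
apply: (@le_trans _ _ (\int[leb2]_z (4 * (h z.1 * h z.2))%:E)%E).
  apply: ge0_le_integral => //.
  - by move=> z _; rewrite lee_fin; case: ifP => // _; rewrite exprn_ge0// invr_ge0 enorm_ge0.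
  - by rewrite /box /enorm; mfun.
  move=> z _; rewrite lee_fin; case: ifPn => nb; first by rewrite !mulr_ge0.
  have := sum_sqr_ge nb r0 => H.
  have p1 : 0 < rho ^+ 2 + z.1 ^+ 2 by rewrite ltr_pwDl ?exprn_gt0// sqr_ge0.
  have p2 : 0 < rho ^+ 2 + z.2 ^+ 2 by rewrite ltr_pwDl ?exprn_gt0// sqr_ge0.
  have p12 := mulr_gt0 p1 p2.
  have e4 : 0 < enorm z ^+ 4 by have := lt_le_trans p12 H; rewrite pmulr_rgt0.
  by rewrite exprVn /h -invfM ler_pdivlMr// mulrC ler_pdivrMr.
rewrite leb2_tonelli1//; last by move=> z; rewrite lee_fin !mulr_ge0.
have I1 := integral_inv_add_sqr r0.
have mhE : measurable_fun setT (fun y => (h y)%:E) by exact/measurable_EFinP.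
under eq_integral => x _.
  rewrite /= (_ : (fun y => (4 * (h x * h y))%:E) = (fun y => (4 * h x)%:E * (h y)%:E)%E); last first.
    by apply/funext => y; rewrite -EFinM mulrA.
  rewrite ge0_integralZl//; [|by move=> y _; rewrite lee_fin|by rewrite lee_fin mulr_ge0].
  over.
set I := (\int[mu]_y (h y)%:E)%E.
have I0 : (0 <= I)%E by apply: integral_ge0 => y _; rewrite lee_fin.
rewrite ge0_integralZr//; last 2 first.
- by rewrite /h; mfun.
- by move=> y _; rewrite lee_fin mulr_ge0.
rewrite (_ : (fun x => (4 * h x)%:E) = (fun x => 4%:E * (h x)%:E)%E); last first.
  by apply/funext.
rewrite ge0_integralZl//; last by move=> y _; rewrite lee_fin.
rewrite -/I -muleA EFinM lee_wpmul2l// expr2 EFinM lee_pmul//.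
Qed.

Lemma young43 (u v : R) : 0 <= u -> 0 <= v -> u ^+ 3 * v <= u ^+ 4 + v ^+ 4.
Proof.
move=> u0 v0; have [h|/ltW h] := leP v u.
  have : u ^+ 3 * v <= u ^+ 3 * u by rewrite ler_wpM2l ?exprn_ge0.
  by rewrite -exprSr => /le_trans; apply; rewrite lerDl exprn_ge0.
have : u ^+ 3 * v <= v ^+ 3 * v by rewrite ler_wpM2r// lerXn2r.
by rewrite -exprSr => /le_trans; apply; rewrite lerDr exprn_ge0.
Qed.

(* Restricting to [f y <= f x] by symmetry, the inner integral is split at
   distance [kappa * f x ^- (2/3)]: near, [f y] is bounded by [f x]; far, Young's
   inequality applies. *)
Lemma hls_diagonal (f : plane -> R) (A : R) :
  measurable_fun setT f -> (forall z, 0 <= f z) -> 0 < A ->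
  (\int[leb2]_z (f z `^ (4 / 3))%:E <= A%:E)%E ->
  (\int[leb2]_x \int[leb2]_y (f x * f y * (enorm (x - y))^-1)%:E <=
   (2 * (9 + 4 * pi ^+ 2) * (A * Num.sqrt A))%:E)%E.
Proof.
move=> mf f0 A0 fA.
have ff0 (x y : plane) : 0 <= f x * f y * (enorm (x - y))^-1.
  by rewrite !mulr_ge0// invr_ge0 enorm_ge0.
(* The cube root of [f]: with [f = c^3] and [f^(4/3) = c^4] all exponents below become integers and
   the identities are polynomial. *)
pose c (z : plane) := f z `^ (1 / 3).
have c0 z : 0 <= c z by exact: powR_ge0.
have cf z : f z = c z ^+ 3.
  rewrite /c -powR_mulrn ?powR_ge0// -powRrM (_ : 1 / 3 * 3%:R = 1) ?powRr1//; by field.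
have cA z : f z `^ (4 / 3) = c z ^+ 4.
  rewrite /c -powR_mulrn ?powR_ge0// -powRrM; congr (_ `^ _); by field.
have mc : measurable_fun setT c by rewrite /c; mfun.
pose k (z : plane * plane) : R := if f z.2 <= f z.1 then f z.1 * f z.2 * (enorm (z.1 - z.2))^-1 else 0.
have mk : measurable_fun [set: (plane * plane)%type] k.
  by rewrite /k /enorm; mfun.
have k0 z : 0 <= k z by rewrite /k; case: ifP => // _; rewrite !mulr_ge0 ?invr_ge0 ?enorm_ge0.
(* With [kappa^2 = A] and [rho = kappa / c x ^ 2], the near term and the two far terms are [8], [1]
   and [4 pi^2] times the same quantity [kappa * f x ^ (4/3)]; hence the constant [9 + 4 pi^2]. *)
pose kappa := Num.sqrt A.
have kp : 0 < kappa by rewrite sqrtr_gt0.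
have C0 : 0 <= (9 + 4 * pi ^+ 2) * kappa.
  by apply: mulr_ge0; [rewrite addr_ge0// mulr_ge0// sqr_ge0|exact: ltW].
have kA : kappa ^+ 2 = A by rewrite sqr_sqrtr// ltW.
have inner x : (\int[leb2]_y (k (x, y))%:E <= ((9 + 4 * pi ^+ 2) * kappa * f x `^ (4 / 3))%:E)%E.
  rewrite cA; have [cx0|cxn] := eqVneq (c x) 0.
    have fx0 : f x = 0 by rewrite cf cx0 expr0n.
    rewrite (_ : (fun y => _) = cst 0%E); last first.
      by apply/funext => y; rewrite /k/= fx0 !mul0r; case: ifP.
    by rewrite integral0 lee_fin !mulr_ge0 ?exprn_ge0 ?(ltW kp)// addr_ge0// mulr_ge0// sqr_ge0.
  have cp : 0 < c x by rewrite lt_neqAle eq_sym cxn c0.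
  pose rho := kappa * c x ^- 2.
  have r0 : 0 < rho by rewrite mulr_gt0// invr_gt0 exprn_gt0.
  pose n (z : plane) : R := if box rho z then (enorm z)^-1 `^ 1 else 0.
  pose g (z : plane) : R := if box rho z then 0 else (enorm z)^-1 ^+ 4.
  have mn : measurable_fun setT n by rewrite /n /box /enorm; mfun.
  have mg : measurable_fun setT g by rewrite /g /box /enorm; mfun.
  have n0 z : 0 <= n z by rewrite /n; case: ifP => // _; exact: powR_ge0.
  have g0 z : 0 <= g z by rewrite /g; case: ifP => // _; rewrite exprn_ge0// invr_ge0 enorm_ge0.
  have mnx : measurable_fun setT (fun y : plane => n (x - y)) by rewrite /n /box /enorm; mfun.
  have mgx : measurable_fun setT (fun y : plane => g (x - y)) by rewrite /g /box /enorm; mfun.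
  have nI : (\int[leb2]_y (n (x - y))%:E <= (8 * rho)%:E)%E.
    rewrite (@leb2_reflect _ x (fun z => (n z)%:E)); last 2 first.
    - by apply/measurable_EFinP; exact: mn.
    - by move=> z; rewrite lee_fin.
    apply: (le_trans (integral_enorm_near _ _ r0)) => //.
      by rewrite ltr1n.
    rewrite lee_fin; have -> : 2 - 1 = 1 :> R by ring.
    by rewrite powRr1 ?(ltW r0)// divr1.
  have gI : (\int[leb2]_y (g (x - y))%:E <= (4 * (pi / rho) ^+ 2)%:E)%E.
    rewrite (@leb2_reflect _ x (fun z => (g z)%:E)); last 2 first.
    - exact/measurable_EFinP.
    - by move=> z; rewrite lee_fin.
    exact: integral_enorm_far.
  have kcp : 0 < c x ^+ 3 by rewrite exprn_gt0.
  have k40 : 0 <= c x ^+ 4 / kappa by rewrite divr_ge0 ?exprn_ge0// (ltW kp).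
  have k30 : 0 <= kappa ^+ 3 by rewrite exprn_ge0// (ltW kp).
  have c60 : 0 <= c x ^+ 6 by rewrite exprn_ge0.
  have m43 : measurable_fun setT (fun y => f y `^ (4 / 3)) by mfun.
  apply: (@le_trans _ _ (\int[leb2]_y (c x ^+ 6 * n (x - y) + (c x ^+ 4 / kappa * f y `^ (4 / 3) + kappa ^+ 3 * g (x - y)))%:E)%E).
    apply: int_mono => //.
    - exact: (measurable_fun_pair2 x mk).
    - by mfun.
    move=> y; rewrite cA /k/=; case: ifPn => h; last first.
      by rewrite !addr_ge0// mulr_ge0// exprn_ge0.
    rewrite /n /g powRr1 ?invr_ge0 ?enorm_ge0//; case: ifPn => bx.
      rewrite mulr0 addr0 -[leLHS]addr0 lerD//; last first.
        by rewrite mulr_ge0// exprn_ge0.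
      rewrite ler_wpM2r ?invr_ge0 ?enorm_ge0// (_ : 6 = 3 + 3)%N// exprD -!cf.
      by rewrite ler_wpM2l.
    rewrite mulr0 add0r !cf.
    have : 0 <= (enorm (x - y))^-1 by rewrite invr_ge0 enorm_ge0.
    move: (enorm (x - y))^-1 => e e0.
    (* The fourth root [q] of [kappa] distributes the weights in Young's inequality: the fourth
       power of [c x * c y / q] is divided by [kappa], that of [q^3 * e] is multiplied by
       [kappa^3]. *)
    have q0 : 0 < Num.sqrt (Num.sqrt kappa) by rewrite !sqrtr_gt0.
    set q := Num.sqrt (Num.sqrt kappa) in q0.
    have q4 : q ^+ 4 = kappa by rewrite (exprM _ 2 2) !sqr_sqrtr ?sqrtr_ge0// ltW.
    have u0 : 0 <= c x * c y / q by rewrite !mulr_ge0 ?invr_ge0 ?(ltW q0).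
    have v0 : 0 <= q ^+ 3 * e by rewrite mulr_ge0 ?exprn_ge0 ?(ltW q0).
    have qn : q != 0 by rewrite gt_eqF.
    have := young43 u0 v0.
    have -> : (c x * c y / q) ^+ 3 * (q ^+ 3 * e) = c x ^+ 3 * c y ^+ 3 * e by field.
    have -> : (c x * c y / q) ^+ 4 + (q ^+ 3 * e) ^+ 4 =
        c x ^+ 4 / q ^+ 4 * c y ^+ 4 + (q ^+ 4) ^+ 3 * e ^+ 4 by field.
    by rewrite q4.
  rewrite int_addr//; last 4 first.
  - by mfun.
  - by mfun.
  - by move=> y; rewrite mulr_ge0.
  - by move=> y; rewrite addr_ge0// mulr_ge0// powR_ge0.
  rewrite int_addr//; last 4 first.
  - by mfun.
  - by mfun.
  - by move=> y; rewrite mulr_ge0// powR_ge0.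
  - by move=> y; rewrite mulr_ge0.
  rewrite !int_scale//; last by move=> y; exact: powR_ge0.
  apply: (@le_trans _ _ ((c x ^+ 6)%:E * (8 * rho)%:E + ((c x ^+ 4 / kappa)%:E * A%:E + (kappa ^+ 3)%:E * (4 * (pi / rho) ^+ 2)%:E))%E).
    by rewrite leeD// ?lee_wpmul2l// leeD// lee_wpmul2l.
  rewrite -!EFinM -!EFinD lee_fin -kA /rho le_eqVlt; apply/orP; left; apply/eqP; field.
  by rewrite cxn gt_eqF.
pose K (x : plane) := (\int[leb2]_y (k (x, y))%:E)%E.
have mkE : measurable_fun [set: (plane * plane)%type] (fun z => (k z)%:E) by mfun.
have mK : measurable_fun setT K.
  by apply: (@measurable_fun_fubini_tonelli_F _ _ _ _ _ (@lebp R) (fun z : plane * plane => (k z)%:E)) => // z; rewrite lee_fin.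
have K0 x : (0 <= K x)%E by apply: int_ge0 => y.
pose k' (z : plane * plane) := k (z.2, z.1).
have mk' : measurable_fun [set: (plane * plane)%type] k'.
  by rewrite /k' /k/= /enorm; mfun.
pose K' (x : plane) := (\int[leb2]_y (k' (x, y))%:E)%E.
have mK' : measurable_fun setT K'.
  apply: (@measurable_fun_fubini_tonelli_F _ _ _ _ _ (@lebp R) (fun z : plane * plane => (k' z)%:E)).
    by mfun.
  by move=> z; rewrite lee_fin; exact: k0.
have K'0 x : (0 <= K' x)%E by apply: int_ge0 => y; exact: k0.
have sw : (\int[leb2]_x K' x = \int[leb2]_x K x)%E.
  rewrite /K /K'; symmetry.
  by apply: (@fubini_tonelli _ _ _ _ _ (@lebp R) (@lebp R) (fun z : plane * plane => (k z)%:E)) => // z; rewrite lee_fin.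
apply: (@le_trans _ _ (\int[leb2]_x (K x + K' x))%E).
  apply: ge0_le_integral.
  - exact: measurableT.
  - by move=> x _; apply: int_ge0 => y; exact: ff0.
  - apply: (@measurable_fun_fubini_tonelli_F _ _ _ _ _ (@lebp R) (fun z : plane * plane => (f z.1 * f z.2 * (enorm (z.1 - z.2))^-1)%:E)).
      by rewrite /enorm; mfun.
    by move=> z; rewrite lee_fin; exact: ff0.
  - by apply: emeasurable_funD; [exact: mK|exact: mK'].
  move=> x _; rewrite /K /K' -int_addr; last 4 first.
  - exact: (measurable_fun_pair2 x mk).
  - exact: (measurable_fun_pair2 x mk').
  - by move=> y; exact: k0.
  - by move=> y; exact: k0.
  apply: int_mono.
  - by rewrite /enorm; mfun.
  - by apply: measurable_funD; [exact: (measurable_fun_pair2 x mk)|exact: (measurable_fun_pair2 x mk')].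
  - by move=> y; exact: ff0.
  move=> y; rewrite /k' /k/=; have [h|h] := leP (f y) (f x).
    by rewrite lerDl; case: ifP => _; [exact: ff0|exact: lexx].
  rewrite (ltW h) add0r (mulrC (f x)) [in leLHS]enorm_subC; exact: lexx.
rewrite ge0_integralD; last 5 first.
- exact: measurableT.
- by move=> x _; exact: K0.
- exact: mK.
- by move=> x _; exact: K'0.
- exact: mK'.
rewrite sw.
have KI : (\int[leb2]_x K x <= ((9 + 4 * pi ^+ 2) * kappa * A)%:E)%E.
  apply: (@le_trans _ _ (\int[leb2]_x ((9 + 4 * pi ^+ 2) * kappa * f x `^ (4 / 3))%:E)%E).
    apply: ge0_le_integral.
    - exact: measurableT.
    - by move=> x _; exact: K0.
    - exact: mK.
    - by mfun.
    - by move=> x _; exact: inner.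
  rewrite int_scale; [|by mfun|by move=> y; exact: powR_ge0|exact: C0].
  by rewrite [leRHS]EFinM; apply: lee_wpmul2l => //; exact: fA.
apply: (le_trans (leeD KI KI)).
by rewrite -EFinD lee_fin -/kappa le_eqVlt; apply/orP; left; apply/eqP; ring.
Qed.
End HLS.

(** * The kernel of the Biot-Savart law *)

Section VortexKernel.
Context {R : realType}.
Notation mu := (@lebesgue_measure R).
Notation plane := (measurableTypeR R * measurableTypeR R)%type.

(** A component of [N], the first one for [true]. Since the inverse of [0] is [0], its value at the
    origin is [0]. *)
Definition vort (i : bool) (z : R * R) : R :=
  (enorm z ^+ 2)^-1 * (if i then (perp z).1 else (perp z).2).

Lemma vort0 i z : enorm z = 0 -> vort i z = 0.
Proof. by rewrite /vort => ->; rewrite expr0n invr0 mul0r. Qed.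

Lemma vort_le i z : `|vort i z| <= (enorm z)^-1.
Proof.
have [z0|z0] := eqVneq (enorm z) 0; first by rewrite vort0// z0 invr0 normr0.
have zp : 0 < enorm z by rewrite lt_neqAle eq_sym z0 enorm_ge0.
rewrite /vort normrM ger0_norm ?invr_ge0 ?sqr_ge0// expr2 invfM -mulrA ger_pMr ?invr_gt0//.
rewrite ler_pdivrMl// mulr1; case: i => /=; rewrite ?normrN; [exact: abs2_le_enorm|exact: abs1_le_enorm].
Qed.

(** Up to a quarter turn [N] is the inversion [a / |a|^2], for which the distance of the images of
    [a] and [b] is exactly [|a - b| / (|a| |b|)]; a component is bounded by the whole. *)
Lemma vort_diff_le i a b : enorm a != 0 -> enorm b != 0 ->
  `|vort i a - vort i b| <= enorm (a - b) / (enorm a * enorm b).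
Proof.
move=> a0 b0.
have A0 : 0 < enorm a by rewrite lt_neqAle eq_sym a0 enorm_ge0.
have B0 : 0 < enorm b by rewrite lt_neqAle eq_sym b0 enorm_ge0.
rewrite -(@ler_pXn2r _ 2) ?nnegrE ?normr_ge0//; last first.
  by rewrite divr_ge0 ?enorm_ge0// mulr_ge0 ?enorm_ge0.
rewrite real_normK ?num_real// expr_div_n exprMn.
have -> : enorm (a - b) ^+ 2 / (enorm a ^+ 2 * enorm b ^+ 2) =
    (vort true a - vort true b) ^+ 2 + (vort false a - vort false b) ^+ 2.
  rewrite /vort /= (enorm_sqr (a - b)) /=.
  have := enorm_sqr a; have := enorm_sqr b.
  have : enorm a ^+ 2 != 0 by rewrite sqrf_eq0.
  have : enorm b ^+ 2 != 0 by rewrite sqrf_eq0.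
  move: (enorm a ^+ 2) (enorm b ^+ 2) => N M M0 N0 ME NE.
  have -> : (a.1 - b.1) ^+ 2 + (a.2 - b.2) ^+ 2 = N + M - 2 * (a.1 * b.1 + a.2 * b.2).
    by rewrite ME NE; ring.
  apply/eqP; rewrite -subr_eq0; apply/eqP.
  have -> : (N + M - 2 * (a.1 * b.1 + a.2 * b.2)) / (N * M) -
    ((N^-1 * - a.2 - M^-1 * - b.2) ^+ 2 + (N^-1 * a.1 - M^-1 * b.1) ^+ 2) =
    ((N - (a.1 ^+ 2 + a.2 ^+ 2)) * M ^+ 2 + (M - (b.1 ^+ 2 + b.2 ^+ 2)) * N ^+ 2) / (N ^+ 2 * M ^+ 2).
    field; by rewrite M0 N0.
  by rewrite -ME -NE !subrr !mul0r addr0 mul0r.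
by case: i; rewrite ?lerDl ?lerDr sqr_ge0.
Qed.

Definition near_kernel (z : R * R) : R := if box 1 z then (enorm z)^-1 else 0.

(** A product of functions of one variable that dominates [|z|^(-2) / 2] away from the origin. Along
    the axes it decays only like [1 / |z|], yet its power [p] is integrable for every [p > 1]. *)
Definition far_kernel (z : R * R) : R :=
  ((1 + z.1 ^+ 2)^-1 * (1 + z.2 ^+ 2)^-1) `^ (1 / 2).

Definition pair_kernel (z : R * R) : R := near_kernel z + far_kernel z.

Lemma near_kernel_ge0 z : 0 <= near_kernel z.
Proof. by rewrite /near_kernel; case: ifP => // _; rewrite invr_ge0 enorm_ge0. Qed.

Lemma far_kernel_ge0 z : 0 <= far_kernel z.
Proof. exact: powR_ge0. Qed.

Lemma pair_kernel_ge0 z : 0 <= pair_kernel z.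
Proof. by rewrite addr_ge0 ?near_kernel_ge0 ?far_kernel_ge0. Qed.

Lemma one_sqr_gt0 (r : R) : 0 < 1 + r ^+ 2.
Proof. by rewrite ltr_pwDl// sqr_ge0. Qed.

Lemma far_kernel_box z : box 1 z -> 1 / 2 <= far_kernel z.
Proof.
rewrite /box => /andP[h1 h2]; rewrite /far_kernel.
have aux (r : R) : `|r| <= 1 -> 1 / 2 <= (1 + r ^+ 2)^-1.
  move=> r1; rewrite div1r lef_pV2 ?posrE ?one_sqr_gt0//.
  by rewrite -(real_normK (num_real r)); have := @lerXn2r _ 2 `|r| 1 ; rewrite !nnegrE normr_ge0 ler01 r1 expr1n => /(_ isT isT isT); lra.
rewrite -(@ler_pXn2r _ 2) ?nnegrE ?powR_ge0//.
rewrite -(@powR_mulrn _ (_ `^ _)) ?powR_ge0// -powRrM (_ : 1 / 2 * 2%:R = 1); last by field.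
rewrite powRr1 ?mulr_ge0 ?invr_ge0 ?(ltW (one_sqr_gt0 _))//.
by rewrite expr2 ler_pM ?aux//; lra.
Qed.

Lemma far_kernel_far z : ~~ box 1 z -> (enorm z)^-1 ^+ 2 <= 2 * far_kernel z.
Proof.
move=> nb; have := sum_sqr_ge nb ltr01; rewrite expr1n => H.
have P := mulr_gt0 (one_sqr_gt0 z.1) (one_sqr_gt0 z.2).
have e4 : 0 < enorm z ^+ 4 by have := lt_le_trans P H; rewrite pmulr_rgt0.
rewrite -(@ler_pXn2r _ 2) ?nnegrE ?sqr_ge0 ?mulr_ge0 ?powR_ge0//.
have -> : (2 * far_kernel z) ^+ 2 = 4 * ((1 + z.1 ^+ 2)^-1 * (1 + z.2 ^+ 2)^-1).
  rewrite exprMn /far_kernel -[X in _ * X](@powR_mulrn _ (_ `^ _)) ?powR_ge0//.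
  rewrite -powRrM (_ : 1 / 2 * 2%:R = 1); last by field.
  rewrite powRr1 ?mulr_ge0 ?invr_ge0 ?(ltW (one_sqr_gt0 _))//.
  by rewrite -natrX.
by rewrite -exprM exprVn -invfM ler_pdivlMr// mulrC ler_pdivrMr.
Qed.

Lemma box_enorm (z : R * R) : ~~ box 1 z -> 1 <= enorm z.
Proof.
rewrite /box negb_and -!ltNge => /orP[] h; rewrite (le_trans (ltW h))//.
  exact: abs1_le_enorm.
exact: abs2_le_enorm.
Qed.

(** If one of the points lies in the unit square, the two terms are bounded separately: [1 / |u|]
    inside is the near kernel, and constants are absorbed by the far kernel, which is at least [1/2]
    there. If both are outside, the difference formula leaves [1 / (|u| |v|)], at most half the sum
    of the inverse squares, and the gap appears as a factor. *)
Lemma vort_pair_le i (x a b : R * R) :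
  `|vort i (x - a) - vort i (x - b)| <=
  3 * (1 + enorm (a - b)) * (pair_kernel (x - a) + pair_kernel (x - b)).
Proof.
have E : enorm ((x - a) - (x - b)) = enorm (a - b).
  by rewrite /enorm/= -(sqrrN (a.1 - b.1)) -(sqrrN (a.2 - b.2)); congr (Num.sqrt (_ ^+ 2 + _ ^+ 2)); ring.
rewrite -E; move: (x - a) (x - b) => u v {E}.
have d0 := enorm_ge0 (u - v).
have nu := near_kernel_ge0 u; have nv := near_kernel_ge0 v.
have fu := far_kernel_ge0 u; have fv := far_kernel_ge0 v.
have one_near (u' v' : R * R) : box 1 u' -> ~~ box 1 v' ->
    `|vort i u'| + `|vort i v'| <= 3 * (pair_kernel u' + pair_kernel v').
  move=> bu nbv; have h1 := vort_le i u'; have h2 := vort_le i v'.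
  have h3 := far_kernel_box bu.
  have v1 := box_enorm nbv.
  have h4 : (enorm v')^-1 <= 1 by rewrite invf_le1// (lt_le_trans ltr01).
  have := far_kernel_ge0 v'; have := near_kernel_ge0 v'.
  have : near_kernel u' = (enorm u')^-1 by rewrite /near_kernel bu.
  have := enorm_ge0 u'; rewrite -invr_ge0 /pair_kernel; lra.
have wk (S : R) : 0 <= S -> 3 * S <= 3 * (1 + enorm (u - v)) * S.
  by move=> S0; rewrite ler_wpM2r//; lra.
have P0 : 0 <= pair_kernel u + pair_kernel v by rewrite addr_ge0 ?pair_kernel_ge0.
have [bu|nbu] := boolP (box 1 u); have [bv|nbv] := boolP (box 1 v).
- apply: le_trans (wk _ P0); apply: le_trans (ler_normB _ _) _.
  have h1 := vort_le i u; have h2 := vort_le i v.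
  have : near_kernel u = (enorm u)^-1 by rewrite /near_kernel bu.
  have : near_kernel v = (enorm v)^-1 by rewrite /near_kernel bv.
  rewrite /pair_kernel; lra.
- by apply: le_trans (wk _ P0); apply: le_trans (ler_normB _ _) _; exact: one_near.
- apply: le_trans (wk _ P0); apply: le_trans (ler_normB _ _) _.
  by rewrite addrC (addrC (pair_kernel u)); exact: one_near.
have u1 := box_enorm nbu; have v1 := box_enorm nbv.
have u0 : enorm u != 0 by rewrite gt_eqF// (lt_le_trans ltr01).
have v0 : enorm v != 0 by rewrite gt_eqF// (lt_le_trans ltr01).
apply: (le_trans (vort_diff_le i u0 v0)).
have hu := far_kernel_far nbu; have hv := far_kernel_far nbv.
rewrite invfM.
have := sqr_ge0 ((enorm u)^-1 - (enorm v)^-1).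
move: (enorm u)^-1 (enorm v)^-1 hu hv => p q hu hv sq.
have pq : p * q <= far_kernel u + far_kernel v by nra.
apply: (@le_trans _ _ (enorm (u - v) * (far_kernel u + far_kernel v))).
  by rewrite ler_wpM2l.
rewrite ler_pM ?addr_ge0//; last by rewrite /pair_kernel; lra.
lra.
Qed.

Lemma measurable_vort i : measurable_fun setT (vort i : plane -> R).
Proof. by case: i; rewrite /vort /enorm /perp /=; mfun. Qed.

Lemma measurable_pair_kernel : measurable_fun setT (pair_kernel : plane -> R).
Proof. by rewrite /pair_kernel /near_kernel /far_kernel /enorm /box; mfun. Qed.

(** The power of the sum is at most [2^p] times the sum of the powers. The near part converges
    because [p < 2], the far part, a product of two line integrals, because [1 < p]. *)
Lemma integral_pair_kernel (p : R) : 1 < p -> p < 2 ->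
  exists2 C : R, 0 < C & (\int[leb2]_z (pair_kernel z `^ p)%:E <= C%:E)%E.
Proof.
move=> p1 p2.
have p0 : 0 < p by rewrite (lt_trans _ p1).
pose C1 := 8 / (2 - p) * 1 `^ (2 - p).
pose C2 := 2 + 2 / (p - 1).
have C1p : 0 < C1 by rewrite mulr_gt0 ?powR_gt0// divr_gt0// subr_gt0.
have C2p : 0 < C2 by rewrite addr_gt0// divr_gt0// subr_gt0.
exists (2 `^ p * (C1 + C2 ^+ 2)).
  by rewrite mulr_gt0 ?powR_gt0// addr_gt0// exprn_gt0.
pose h (r : R) := ((1 + r ^+ 2)^-1) `^ (p / 2).
have mh : measurable_fun setT h by rewrite /h; mfun.
have h0 r : 0 <= h r by exact: powR_ge0.
pose n (z : plane) := if box 1 z then (enorm z)^-1 `^ p else 0.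
have mn : measurable_fun setT n by rewrite /n /box /enorm; mfun.
have n0 z : 0 <= n z by rewrite /n; case: ifP => // _; exact: powR_ge0.
have mhh : measurable_fun setT (fun z : plane => h z.1 * h z.2) by mfun.
apply: (@le_trans _ _ (\int[leb2]_z (2 `^ p * (n z + h z.1 * h z.2))%:E)%E).
  apply: int_mono.
  - by have mk := measurable_pair_kernel; mfun.
  - by mfun.
  - by move=> z; exact: powR_ge0.
  move=> z; have nn : near_kernel z `^ p = n z.
    by rewrite /near_kernel /n; case: ifP => // _; rewrite powR0 ?gt_eqF.
  have ff : far_kernel z `^ p = h z.1 * h z.2.
    rewrite /far_kernel /h -powRrM (_ : 1 / 2 * p = p / 2); last by field.
    by rewrite powRM// invr_ge0 ltW// one_sqr_gt0.
  rewrite -nn -ff /pair_kernel.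
  have aux (u v : R) : 0 <= u -> 0 <= v -> v <= u -> (u + v) `^ p <= 2 `^ p * (u `^ p + v `^ p).
    move=> u0 v0 vu; apply: (@le_trans _ _ ((2 * u) `^ p)).
      rewrite ge0_ler_powR ?nnegrE ?addr_ge0 ?mulr_ge0 ?(ltW p0)//; lra.
    by rewrite powRM// ler_wpM2l ?powR_ge0// lerDl powR_ge0.
  have [fn|/ltW nf] := leP (far_kernel z) (near_kernel z).
    by rewrite aux ?near_kernel_ge0 ?far_kernel_ge0.
  by rewrite addrC (addrC (near_kernel z `^ p)) aux ?near_kernel_ge0 ?far_kernel_ge0.
rewrite int_scale ?powR_ge0//; last 2 first.
- by mfun.
- by move=> z; rewrite addr_ge0// mulr_ge0.
rewrite [leRHS]EFinM lee_wpmul2l ?lee_fin ?powR_ge0// int_addr//; last first.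
  by move=> z; rewrite mulr_ge0.
rewrite [leRHS]EFinD leeD//; first by apply: integral_enorm_near.
rewrite leb2_tonelli1//; last 2 first.
- by mfun.
- by move=> z; rewrite lee_fin mulr_ge0.
have hI := integral_oneDsqr_powR p1.
under eq_integral => x _ do rewrite /= int_scale//.
rewrite ge0_integralZr//; last 3 first.
- by mfun.
- by move=> y _; rewrite lee_fin.
- exact: int_ge0.
rewrite expr2 EFinM lee_pmul//; exact: int_ge0.
Qed.

Lemma vort_pair_Lp (i : bool) (p : R) : 1 < p -> p < 2 ->
  exists2 C : R, 0 < C & forall a b : R * R,
  (\int[leb2]_x ((`|vort i (x - a) - vort i (x - b)| / (1 + enorm (a - b))) `^ p)%:E <= C%:E)%E.
Proof.
move=> p1 p2; have [C C0 CI] := integral_pair_kernel p1 p2.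
have p0 : 0 < p by rewrite (lt_trans _ p1).
exists (6 `^ p * (C + C)); first by rewrite mulr_gt0 ?powR_gt0// addr_gt0.
move=> a b.
have mk := measurable_pair_kernel.
have mv := measurable_vort i.
have pk0 z : 0 <= pair_kernel z `^ p by exact: powR_ge0.
have e0 : 0 < 1 + enorm (a - b) by rewrite ltr_pwDl// enorm_ge0.
apply: (@le_trans _ _ (\int[leb2]_x (6 `^ p * (pair_kernel (x - a) `^ p + pair_kernel (x - b) `^ p))%:E)%E).
  apply: int_mono.
  - by mfun.
  - by mfun.
  - by move=> z; exact: powR_ge0.
  move=> x.
  apply: (@le_trans _ _ ((3 * (pair_kernel (x - a) + pair_kernel (x - b))) `^ p)).
    rewrite ge0_ler_powR ?nnegrE ?(ltW p0) ?divr_ge0 ?(ltW e0)//.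
      by rewrite mulr_ge0// addr_ge0// pair_kernel_ge0.
    by rewrite ler_pdivrMr// mulrAC; exact: vort_pair_le.
  have aux (u v : R) : 0 <= u -> 0 <= v -> v <= u -> (3 * (u + v)) `^ p <= 6 `^ p * (u `^ p + v `^ p).
    move=> u0 v0 vu; apply: (@le_trans _ _ ((6 * u) `^ p)).
      rewrite ge0_ler_powR ?nnegrE ?mulr_ge0 ?addr_ge0 ?(ltW p0)//; lra.
    by rewrite powRM// ler_wpM2l ?powR_ge0// lerDl powR_ge0.
  have [h|/ltW h] := leP (pair_kernel (x - b)) (pair_kernel (x - a)).
    by rewrite aux ?pair_kernel_ge0.
  by rewrite addrC (addrC (pair_kernel (x - a) `^ p)) aux ?pair_kernel_ge0.
rewrite int_scale; [|by mfun|by move=> z; exact: addr_ge0|exact: powR_ge0].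
rewrite [leRHS]EFinM; apply: lee_wpmul2l; first by rewrite lee_fin powR_ge0.
rewrite int_addr; [|by mfun|by mfun|by move=> z; exact: pk0|by move=> z; exact: pk0].
have mkp : measurable_fun setT (fun z : plane => (pair_kernel z `^ p)%:E) by mfun.
have mkp0 (z : plane) : (0 <= (pair_kernel z `^ p)%:E)%E by rewrite lee_fin.
rewrite EFinD; apply: leeD.
  by rewrite (leb2_translate a mkp mkp0).
by rewrite (leb2_translate b mkp mkp0).
Qed.

End VortexKernel.

(** * Gaussians and Poisson averages *)

Section Gaussian.
Context {R : realType}.
Notation mu := (@lebesgue_measure R).

(** The heat kernel on the line, of which [gauss] is the tensor square. The next two functions are
    its first two derivatives in space; by the heat equation the second is also its derivative in
    time. *)
Definition gau (t r : R) : R := (Num.sqrt (4 * pi * t))^-1 * expR (- r ^+ 2 / (4 * t)).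

Definition dgau (t r : R) : R := - (r / (2 * t)) * gau t r.

Definition ddgau (t r : R) : R := (r ^+ 2 / (4 * t ^+ 2) - (2 * t)^-1) * gau t r.

Lemma gauss_gau (t : R) (x : R * R) : 0 < t -> gauss t x = gau t x.1 * gau t x.2.
Proof.
move=> t0; rewrite /gauss /gau enorm_sqr mulrACA -expRD.
have p0 : 0 <= 4 * pi * t by rewrite !mulr_ge0 ?pi_ge0// ltW.
rewrite -invfM -expr2 sqr_sqrtr//; congr (_ * expR _).
by rewrite opprD mulrDl.
Qed.

Lemma gau_ge0 t r : 0 <= gau t r.
Proof. by rewrite mulr_ge0 ?invr_ge0 ?sqrtr_ge0 ?expR_ge0. Qed.

Lemma gauN t r : gau t (- r) = gau t r.
Proof. by rewrite /gau sqrrN. Qed.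

Lemma dgauN t r : dgau t (- r) = - dgau t r.
Proof. by rewrite /dgau gauN; ring. Qed.

Lemma is_derive_gau (t r : R) : 0 < t -> is_derive r 1 (gau t) (dgau t r).
Proof.
move=> t0; rewrite /gau /dgau; apply: is_derive_eq.
rewrite /gau !scaler0 ?add0r ?addr0 /GRing.scale/=; field.
have p0 : 0 < 4 * pi * t by rewrite !mulr_gt0 ?pi_gt0.
by rewrite !gt_eqF ?sqrtr_gt0.
Qed.

Lemma is_derive_dgau (t r : R) : 0 < t -> is_derive r 1 (dgau t) (ddgau t r).
Proof.
move=> t0; have H := is_derive_gau r t0.
rewrite /ddgau /dgau; apply: is_derive_eq.
rewrite /dgau !scaler0 ?add0r ?addr0 /GRing.scale/=; field.
by rewrite gt_eqF.
Qed.

Lemma continuous_gau t : 0 < t -> continuous (gau t).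
Proof.
move=> t0 r; have [d _] := is_derive_gau r t0.
by apply: differentiable_continuous; apply/derivable1_diffP.
Qed.

Lemma continuous_dgau t : 0 < t -> continuous (dgau t).
Proof.
move=> t0 r; have [d _] := is_derive_dgau r t0.
by apply: differentiable_continuous; apply/derivable1_diffP.
Qed.

Lemma continuous_ddgau t : 0 < t -> continuous (ddgau t).
Proof.
move=> t0 r; rewrite /ddgau; apply: cvgM; last exact: continuous_gau.
apply: cvgB; last exact: cvg_cst.
by apply: cvgM; [exact: exprn_continuous|exact: cvg_cst].
Qed.

Lemma measurable_gau d (T : measurableType d) (f g : T -> R) :
  measurable_fun setT f -> measurable_fun setT g ->
  measurable_fun setT (fun x => gau (f x) (g x)).
Proof. by move=> mf mg; rewrite /gau; mfun. Qed.

Lemma measurable_dgau d (T : measurableType d) (f g : T -> R) :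
  measurable_fun setT f -> measurable_fun setT g ->
  measurable_fun setT (fun x => dgau (f x) (g x)).
Proof. by move=> mf mg; rewrite /dgau /gau; mfun. Qed.

Lemma measurable_ddgau d (T : measurableType d) (f g : T -> R) :
  measurable_fun setT f -> measurable_fun setT g ->
  measurable_fun setT (fun x => ddgau (f x) (g x)).
Proof. by move=> mf mg; rewrite /ddgau /gau; mfun. Qed.

Lemma integral_gau (t : R) : 0 < t -> (\int[mu]_r (gau t r)%:E = 1)%E.
Proof.
move=> t0; have st : 0 < Num.sqrt t by rewrite sqrtr_gt0.
have spi : 0 < Num.sqrt pi :> R by rewrite sqrtr_gt0 pi_gt0.
rewrite (@ge0_integral_affine _ 0 (2 * Num.sqrt t)); last 3 first.
- by rewrite mulf_neq0// gt_eqF.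
- by apply/measurable_EFinP; exact: measurable_gau.
- by move=> r; rewrite lee_fin gau_ge0.
have E r : gau t (0 + 2 * Num.sqrt t * r) = (2 * Num.sqrt t)^-1 * (Num.sqrt pi)^-1 * gauss_fun r.
  rewrite /gau /gauss_fun add0r -invfM; congr (_^-1 * expR _).
    have -> : 4 * pi * t = 2 ^+ 2 * (t * pi) :> R by ring.
    by rewrite sqrtrM ?sqr_ge0// sqrtr_sqr ger0_norm// sqrtrM ?(ltW t0)// mulrA.
  rewrite !exprMn sqr_sqrtr ?(ltW t0)//; field; exact: lt0r_neq0.
under eq_integral do rewrite E.
rewrite int_scale; last 3 first.
- exact: measurable_gauss_fun.
- by move=> r; exact: gauss_fun_ge0.
- by rewrite mulr_ge0 ?invr_ge0 ?mulr_ge0 ?(ltW st) ?(ltW spi).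
rewrite integralT_gauss -!EFinM ger0_norm; last by rewrite mulr_ge0 ?(ltW st).
by congr (_%:E); field; rewrite !gt_eqF.
Qed.

Lemma gau_le_max (t r : R) : 0 < t -> gau t r <= (Num.sqrt (4 * pi * t))^-1.
Proof.
move=> t0; rewrite /gau ler_piMr ?invr_ge0 ?sqrtr_ge0// -[leRHS]expR0 ler_expR.
by rewrite mulNr oppr_le0 divr_ge0 ?sqr_ge0// mulr_ge0// ltW.
Qed.

(* The widened Gaussian [gau (2 * t)] absorbs polynomial factors. *)
Lemma gau_moment (t r : R) (k : nat) : 0 < t -> (k <= 4)%N ->
  `|r| ^+ k * gau t r <= 512 * Num.sqrt t ^+ k * gau (2 * t) r.
Proof.
move=> t0 k4.
pose q := Num.sqrt t; have q0 : 0 < q by rewrite sqrtr_gt0.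
have tq : t = q ^+ 2 by rewrite sqr_sqrtr// ltW.
pose u := `|r| / q; have u0 : 0 <= u by rewrite divr_ge0// ltW.
have ru : `|r| = q * u by rewrite /u mulrCA divff ?mulr1// gt_eqF.
(* Here [s = r^2 / (8 t)] is half of the exponent of [gau t r]. One half pays for the polynomial
   factor, the other is the exponent of the widened Gaussian. *)
pose s := u ^+ 2 / 8.
have s0 : 0 <= s by rewrite divr_ge0// sqr_ge0.
have G : gau t r <= 2 * expR (- s) * gau (2 * t) r.
  rewrite /gau.
  have p0 : 0 < 4 * pi * t by rewrite !mulr_gt0 ?pi_gt0.
  have -> : 4 * pi * (2 * t) = 2 * (4 * pi * t) by ring.
  rewrite (@sqrtrM _ 2)// [in leRHS]invfM.
  have -> : - r ^+ 2 / (4 * t) = - s + - r ^+ 2 / (4 * (2 * t)).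
    rewrite /s /u tq expr_div_n real_normK ?num_real//; field; exact: lt0r_neq0.
  rewrite expRD.
  have E : 1 <= 2 / Num.sqrt 2 :> R.
    rewrite ler_pdivlMr ?sqrtr_gt0// mul1r -[leRHS]ger0_norm// -sqrtr_sqr ler_sqrt ?sqr_ge0//.
    by rewrite -natrX ler_nat.
  have := expR_ge0 (- s); have := expR_ge0 (- r ^+ 2 / (4 * (2 * t))).
  have : 0 <= (Num.sqrt (4 * pi * t))^-1 by rewrite invr_ge0 sqrtr_ge0.
  move: (expR _) (expR _) ((Num.sqrt (4 * pi * t))^-1) => a b c c0 a0 b0.
  have -> : 2 * a * ((Num.sqrt 2)^-1 * c * b) = (2 / Num.sqrt 2) * (c * (a * b)) by ring.
  by rewrite ler_peMl// mulr_ge0// mulr_ge0.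
have e1 : expR (- s) <= 1 by rewrite -[leRHS]expR0 ler_expR oppr_le0.
have e0 := expR_ge0 (- s).
have es : expR (- s) * expR s = 1 by rewrite -expRD addNr expR0.
have es1 : s * expR (- s) <= 1.
  have := expR_ge1Dx s => h; nra.
have es2 : s ^+ 2 * expR (- s) <= 4.
  have h : 1 + s / 2 <= expR (s / 2) by exact: expR_ge1Dx.
  have h2 : expR s = expR (s / 2) ^+ 2 by rewrite expr2 -expRD -splitr.
  have h3 : (1 + s / 2) ^+ 2 <= expR s by rewrite h2 lerXn2r ?nnegrE ?expR_ge0// addr_ge0// divr_ge0.
  have : s ^+ 2 / 4 <= expR s by nra.
  move=> h4; nra.
(* The extreme case is [k = 4], where [u^4 = 64 s^2] and [s^2 exp(-s) <= 4] give [256]. Odd powers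
   are means of their neighbours. The factor [2] in the bound on [gau t r] then yields [512]. *)
have U : u ^+ k * expR (- s) <= 256.
  have us : u ^+ 2 = 8 * s by rewrite /s; field.
  have u4 : u ^+ 4 = 64 * s ^+ 2 by rewrite (exprM u 2 2) us exprMn; ring.
  have k2 : u ^+ 2 * expR (- s) <= 8 by rewrite us; nra.
  have k4' : u ^+ 4 * expR (- s) <= 256 by rewrite u4; nra.
  have u1 : u <= (1 + u ^+ 2) / 2 by have := sqr_ge0 (u - 1); nra.
  have u3 : u ^+ 3 <= (u ^+ 2 + u ^+ 4) / 2.
    have -> : u ^+ 3 = u ^+ 2 * u by ring.
    have -> : (u ^+ 2 + u ^+ 4) / 2 = u ^+ 2 * ((1 + u ^+ 2) / 2) by field.
    by rewrite ler_wpM2l// sqr_ge0.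
  have k1 : u * expR (- s) <= 256.
    apply: (le_trans (ler_wpM2r e0 u1)); move: k2 e1; lra.
  have k3 : u ^+ 3 * expR (- s) <= 256.
    apply: (le_trans (ler_wpM2r e0 u3)); move: k2 k4'; lra.
  case: k k4 => [|[|[|[|[|//]]]]] _; rewrite ?expr0 ?expr1 ?mul1r//; lra.
rewrite ru exprMn.
apply: (@le_trans _ _ (q ^+ k * u ^+ k * (2 * expR (- s) * gau (2 * t) r))).
  by rewrite ler_wpM2l// mulr_ge0 ?exprn_ge0// ltW.
have -> : q ^+ k * u ^+ k * (2 * expR (- s) * gau (2 * t) r) =
  (2 * (u ^+ k * expR (- s))) * (q ^+ k * gau (2 * t) r) by ring.
rewrite -(mulrA 512) ler_wpM2r//; last by lra.
by rewrite mulr_ge0 ?gau_ge0// exprn_ge0 ?ltW.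
Qed.
End Gaussian.

(** * Differentiation under the integral sign and Poisson averages *)

Section DeriveUnder.
Context d (T : measurableType d) {R : realType}.
Variable m : {measure set T -> \bar R}.

Lemma is_derive_under (D : set T) (f df : R -> T -> R) (g : T -> R) (a : R) :
  measurable D -> (forall l, m.-integrable D (EFin \o f l)) ->
  (forall (l : R) y, D y -> is_derive l 1 (f ^~ y) (df l y)) ->
  (forall l y, D y -> `|df l y| <= g y) -> m.-integrable D (EFin \o g) ->
  is_derive a 1 (fun l => \int[m]_(y in D) f l y) (\int[m]_(y in D) df a y).
Proof.
move=> mD If fd dfg Ig.
have aI : `]a - 1, a + 1[%classic a by rewrite /= in_itv/=; apply/andP; split; lra.
have I1 l : `]a - 1, a + 1[%classic l -> m.-integrable D (EFin \o f l) by [].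
have I2 l y : `]a - 1, a + 1[%classic l -> D y -> derivable (f ^~ y) l 1.
  by move=> _ Dy; have [] := fd l y Dy.
have fE l y : D y -> partial1of2 f l y = df l y.
  by move=> Dy; rewrite partial1of2E; have [] := fd l y Dy.
pose g' y := `|g y|.
have I3 y : 0 <= g' y by exact: normr_ge0.
have I4 : m.-integrable D (EFin \o g') by exact: (integrable_abse Ig).
have I5 l y : `]a - 1, a + 1[%classic l -> D y -> `|partial1of2 f l y| <= g' y.
  by move=> _ Dy; rewrite fE// (le_trans (dfg l y Dy))// ler_norm.
apply: DeriveDef.
  exact: (derivable_under_integral mD aI I1 I2 I3 I4 I5).
rewrite -derive1E (differentiation_under_integral mD aI I1 I2 I3 I4 I5).
by apply: eq_Rintegral => y /[!inE] Dy; rewrite /= fE.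
Qed.

End DeriveUnder.

Section PoissonAverage.
Context {R : realType}.
Notation mu := (@lebesgue_measure R).

(** The Cauchy density, that is, the Poisson kernel at height one. *)
Definition cau (v : R) : R := (pi * (1 + v ^+ 2))^-1.

(* [avg q s a] is the harmonic extension of [q] at height [s]: the Poisson
   integral after the substitution [zeta = a - s v], which stays regular down
   to [s = 0]. *)
Definition avg (q : R -> R) (s a : R) : R := \int[mu]_v (q (a - s * v) * cau v).

Lemma cau_gt0 v : 0 < cau v.
Proof. by rewrite invr_gt0 mulr_gt0 ?pi_gt0// ltr_pwDl// sqr_ge0. Qed.

Lemma cau_ge0 v : 0 <= cau v.
Proof. exact/ltW/cau_gt0. Qed.

Lemma measurable_cau d (T : measurableType d) (f : T -> R) :
  measurable_fun setT f -> measurable_fun setT (fun x => cau (f x)).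
Proof. by move=> mf; rewrite /cau; mfun. Qed.

Lemma integral_cau : (\int[mu]_v (cau v)%:E <= 1)%E.
Proof.
have H := integral_inv_add_sqr (@ltr01 R).
have mf : measurable_fun setT (fun x : R => (1 ^+ 2 + x ^+ 2)^-1) by mfun.
have E v : cau v = pi^-1 * (1 ^+ 2 + v ^+ 2)^-1 by rewrite /cau invfM expr1n.
under eq_integral do rewrite E.
rewrite int_scale//; last 2 first.
- by move=> v; rewrite invr_ge0 addr_ge0// sqr_ge0.
- by rewrite invr_ge0 pi_ge0.
rewrite divr1 in H.
apply: (@le_trans _ _ ((pi^-1)%:E * pi%:E)%E).
  by apply: lee_wpmul2l; [rewrite lee_fin invr_ge0 pi_ge0|exact: H].
by rewrite -EFinM mulVf// gt_eqF// pi_gt0.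
Qed.

Lemma integrable_cau : mu.-integrable setT (EFin \o cau).
Proof.
apply/integrableP; split; first by apply/measurable_EFinP; exact: measurable_cau.
rewrite /= (_ : (fun x => `|(cau x)%:E|) = (fun x => (cau x)%:E))%E; last first.
  by apply/funext => v; rewrite /= ger0_norm// cau_ge0.
exact: le_lt_trans integral_cau (ltry _).
Qed.

Lemma integrable_le_cau (f : R -> R) (M : R) : measurable_fun setT f ->
  (forall v, `|f v| <= M) -> mu.-integrable setT (fun v => (f v * cau v)%:E).
Proof.
move=> mf fM.
have M0 : 0 <= M by exact: le_trans (fM 0).
have H : mu.-integrable setT (fun v => (M%:E * (cau v)%:E)%E).
  exact: (integrableZl _ _ integrable_cau).
apply: (le_integrable measurableT _ _ H).
  by apply/measurable_EFinP/measurable_funM => //; exact: measurable_cau.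
move=> v _; rewrite -EFinM /= lee_fin !normrM (ger0_norm (cau_ge0 v)).
by rewrite ler_wpM2r ?cau_ge0// (ger0_norm M0).
Qed.

Section Bounded.
Variables (q : R -> R) (M : R).
Hypothesis (cq : continuous q) (qM : forall r, `|q r| <= M).

Let mq : measurable_fun setT q.
Proof. exact: continuous_measurable_fun. Qed.

Let M0 : 0 <= M. Proof. exact: le_trans (qM 0). Qed.

Lemma measurable_avg_integrand s a :
  measurable_fun setT (fun v : R => q (a - s * v)).
Proof. by mfun. Qed.

Lemma integrable_avg s a :
  mu.-integrable setT (fun v => (q (a - s * v) * cau v)%:E).
Proof. exact: (integrable_le_cau (measurable_avg_integrand s a)). Qed.

Lemma avg_le s a : `|avg q s a| <= M.
Proof.
rewrite -lee_fin /avg EFin_normr_Rintegral//; last exact: integrable_avg.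
apply: le_trans (le_abse_integral mu measurableT _) _.
  by apply/measurable_EFinP/measurable_funM; [exact: measurable_avg_integrand|exact: measurable_cau].
apply: (@le_trans _ _ (\int[mu]_v (M * cau v)%:E)%E).
  apply: int_mono.
  - apply: measurableT_comp => //; apply: measurable_funM; first exact: measurable_avg_integrand.
    exact: measurable_cau.
  - by apply: measurable_funM => //; exact: measurable_cau.
  - by [].
  by move=> v; rewrite normrM (ger0_norm (cau_ge0 v)) ler_wpM2r ?cau_ge0.
rewrite int_scale; [|exact: measurable_cau|exact: cau_ge0|exact: M0].
rewrite -[leRHS]mule1; apply: lee_wpmul2l; first by rewrite lee_fin.
exact: integral_cau.
Qed.

Lemma continuous_avg a : continuous (avg q ^~ a).
Proof.
move=> s.
pose f (l v : R) := q (a - l * v) * cau v.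
have H : {in `]s - 1, s + 1[%classic, continuous (fun l => \int[mu]_(v in setT) f l v)}.
  apply: (@continuity_under_integral _ _ _ mu f setT measurableT (s - 1) (s + 1) _ _ (fun v => M * cau v)).
  - by move=> l _; exact: integrable_avg.
  - apply: aeW => v _ l _; rewrite /f; apply: cvgM; last exact: cvg_cst.
    have C : continuous (fun l : R => a - l * v).
      move=> {}l; apply: cvgB; first exact: cvg_cst.
      by apply: cvgM; [exact: cvg_id|exact: cvg_cst].
    by apply: continuous_cvg; [exact: cq|exact: C].
  - exact: (integrableZl _ M integrable_cau).
  - move=> l _; apply: aeW => v _; rewrite /f normrM (ger0_norm (cau_ge0 v)).
    by rewrite ler_wpM2r ?cau_ge0.
by apply: H; rewrite inE/= in_itv/=; apply/andP; split; lra.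
Qed.

End Bounded.

Lemma is_derive_avg (q dq : R -> R) (M : R) (s a : R) :
  (forall r : R, is_derive r 1 q (dq r)) -> continuous dq ->
  (forall r, `|q r| <= M) -> (forall r, `|dq r| <= M) ->
  is_derive a 1 (avg q s) (avg dq s a).
Proof.
move=> qd cdq qM dqM.
have cq : continuous q.
  move=> r; have [d _] := qd r.
  by apply: differentiable_continuous; apply/derivable1_diffP.
apply: (@is_derive_under _ _ _ mu setT (fun l v => q (l - s * v) * cau v) (fun l v => dq (l - s * v) * cau v) (fun v => M * cau v)).
- exact: measurableT.
- by move=> l; exact: (integrable_avg cq qM).
- move=> l v _.
  have H1 : is_derive l 1 (fun l : R => l - s * v) 1.
    by apply: is_derive_eq; rewrite subr0.
  have H2 := is_derive1_comp (g := fun l : R => l - s * v) (qd (l - s * v)) H1.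
  have H3 := is_deriveM H2 (is_derive_cst (cau v) l 1).
  apply: (is_derive_eq H3).
  by rewrite mulr1 scaler0 add0r /GRing.scale/= mulrC.
- by move=> l v _; rewrite normrM (ger0_norm (cau_ge0 v)) ler_wpM2r ?cau_ge0.
- exact: (integrableZl _ M integrable_cau).
Qed.

End PoissonAverage.

Section QuadraticRemainder.
Context {R : realType}.

(** The difference quotients at [a] are at most [c |h|]. It disposes of the mixed term that arises
    when one variable occurs in two places of an integral. *)
Lemma is_derive_quadratic_remainder (g : R -> R) (a c e : R) : 0 < e ->
  (forall y, `|y - a| < e -> `|g y| <= c * (y - a) ^+ 2) -> is_derive a 1 g 0.
Proof.
move=> e0 gc.
have ga : g a = 0.
  have : `|g a| <= c * (a - a) ^+ 2 by apply: gc; rewrite subrr normr0.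
  by rewrite subrr expr0n mulr0 normr_le0 => /eqP.
have c0 : 0 <= c.
  have : `|g (a + e / 2)| <= c * (a + e / 2 - a) ^+ 2.
    by apply: gc; rewrite addrAC subrr add0r gtr0_norm ?divr_gt0//; lra.
  rewrite addrAC subrr add0r => /(le_trans (normr_ge0 _)).
  by rewrite pmulr_lge0// exprn_gt0// divr_gt0.
have H : h^-1 *: (g (h *: 1 + a) - g a) @[h --> 0^'] --> (0 : R).
  apply/cvgrPdist_le => eps eps0.
  have [k k0 kE] : exists2 k, 0 < k & k <= e /\ c * k <= eps.
    exists (Num.min e (eps / (c + 1))).
      by rewrite lt_min e0 divr_gt0// ltr_wpDl.
    split; first by rewrite ge_min lexx.
    have cp : 0 < c + 1 by rewrite ltr_wpDl.
    apply: (@le_trans _ _ (c * (eps / (c + 1)))).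
      by rewrite ler_wpM2l// ge_min lexx orbT.
    rewrite mulrA ler_pdivrMr// mulrC ler_wpM2l ?(ltW eps0)//; lra.
  have [kE1 kE2] := kE.
  near=> h.
  have h0 : h != 0 by near: h; exact: nbhs_dnbhs_neq.
  have hk : `|h| < k.
    near: h; apply: nbhs_dnbhs; exists k => //= y /=; by rewrite sub0r normrN.
  have hn : 0 < `|h| by rewrite normr_gt0.
  rewrite ga subr0 sub0r normrN /GRing.scale/= mulr1 normrM normfV.
  rewrite ler_pdivrMl//.
  have := gc (h + a); rewrite addrK => /(_ (lt_le_trans hk kE1)) H.
  apply: (le_trans H); rewrite -(real_normK (num_real h)) expr2 mulrA mulrC.
  rewrite ler_wpM2l ?(ltW hn)//.
  by apply: le_trans kE2; rewrite ler_wpM2l// ltW.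
apply: DeriveDef; first by apply/cvg_ex; exists 0.
exact: cvg_lim.
Unshelve. all: by end_near.
Qed.

Lemma Rintegral_itv_le (f : R -> R) (u v c : R) : u <= v -> continuous f ->
  (forall s, u <= s <= v -> `|f s| <= c) ->
  `|\int[lebesgue_measure]_(s in `]u, v]) f s| <= c * (v - u).
Proof.
move=> uv cf fc.
have If : (@lebesgue_measure R).-integrable `[u, v] (EFin \o f).
  apply: continuous_compact_integrable; first exact: segment_compact.
  exact: continuous_subspaceT.
have If' : (@lebesgue_measure R).-integrable `]u, v] (EFin \o f).
  apply: integrableS If => //.
  by apply: subset_itvr; rewrite bnd_simp.
apply: le_trans (le_normr_Rintegral _ If') _ => //.
have -> : c * (v - u) = \int[lebesgue_measure]_(s in `]u, v]) c.
  rewrite Rintegral_cst//.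
  congr (_ * _); transitivity (fine (v - u)%:E) => //.
  congr fine; apply: esym; apply: (etrans (lebesgue_measure_itv _)); rewrite /= lte_fin.
  case: ltP => h /=; first by [].
  by rewrite (le_anti (introT andP (conj uv h))) subrr.
apply: le_Rintegral => //.
- exact: (integrable_norm If').
- have Ic : (@lebesgue_measure R).-integrable `[u, v] (EFin \o cst c).
    apply: continuous_compact_integrable; first exact: segment_compact.
    by apply: continuous_subspaceT => x; exact: cvg_cst.
  by apply: integrableS Ic => //; apply: subset_itvr; rewrite bnd_simp.
- by move=> s; rewrite /= in_itv/= => /andP[h1 h2]; apply: fc; rewrite h2 (ltW h1).
Qed.

End QuadraticRemainder.

(** * Wall integrals and their derivatives *)

Section Wall.
Context {R : realType}.
Notation mu := (@lebesgue_measure R).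

(* [K0] is [wall] up to a factor, with [p] the derivative of the heat kernel and
   [q] the heat kernel itself; its derivatives are again of this form. *)
Definition wall (p q : R -> R) (x y a : R) : R :=
  \int[mu]_(s in `[0, y]) (p (x + y - s) * avg q s a).

Section Bounds.
Variables (p q : R -> R) (Mp Mq : R).
Hypotheses (cp : continuous p) (pM : forall r, `|p r| <= Mp).
Hypotheses (cq : continuous q) (qM : forall r, `|q r| <= Mq).

Lemma continuous_wall_integrand r a : continuous (fun s => p (r - s) * avg q s a).
Proof.
move=> s; apply: cvgM; last exact: (continuous_avg cq qM).
have C : continuous (fun l : R => r - l).
  by move=> l; apply: cvgB; [exact: cvg_cst|exact: cvg_id].
by apply: continuous_cvg; [exact: cp|exact: C].
Qed.

Lemma wall_integrand_le r s a : `|p (r - s) * avg q s a| <= Mp * Mq.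
Proof. by rewrite normrM ler_pM// (avg_le cq qM). Qed.

Lemma integrable_wall r y a :
  mu.-integrable `[0, y] (EFin \o (fun s => p (r - s) * avg q s a)).
Proof.
apply: continuous_compact_integrable; first exact: segment_compact.
apply: continuous_subspaceT; exact: continuous_wall_integrand.
Qed.

Lemma wall_le x y a : 0 <= y -> `|wall p q x y a| <= Mp * Mq * y.
Proof.
move=> y0; rewrite /wall -Rintegral_itv_obnd_cbnd; last first.
  apply: integrableS (integrable_wall (x + y) y a) => //.
  by apply: subset_itvr; rewrite bnd_simp.
rewrite -[X in _ <= _ * X]subr0; apply: Rintegral_itv_le => //.
- exact: continuous_wall_integrand.
- by move=> s _; exact: wall_integrand_le.
Qed.

End Bounds.

Variables (p dp q dq : R -> R) (M : R).
Hypotheses (pd : forall r : R, is_derive r 1 p (dp r)) (cdp : continuous dp).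
Hypotheses (pM : forall r, `|p r| <= M) (dpM : forall r, `|dp r| <= M).
Hypotheses (qd : forall r : R, is_derive r 1 q (dq r)) (cdq : continuous dq).
Hypotheses (qM : forall r, `|q r| <= M) (dqM : forall r, `|dq r| <= M).

Let M0 : 0 <= M. Proof. exact: le_trans (pM 0). Qed.

Let cp : continuous p.
Proof.
move=> r; have [d _] := pd r.
by apply: differentiable_continuous; apply/derivable1_diffP.
Qed.

Let cq : continuous q.
Proof.
move=> r; have [d _] := qd r.
by apply: differentiable_continuous; apply/derivable1_diffP.
Qed.

Let integrable_cst_itv (c y : R) : mu.-integrable `[0, y] (EFin \o cst c).
Proof.
apply: continuous_compact_integrable; first exact: segment_compact.
by apply: continuous_subspaceT => x; exact: cvg_cst.
Qed.

Lemma is_derive_wall_tangential (x y a : R) :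
  is_derive a 1 (wall p q x y) (wall p dq x y a).
Proof.
apply: (@is_derive_under _ _ _ mu _ (fun l s => p (x + y - s) * avg q s l) (fun l s => p (x + y - s) * avg dq s l) (cst (M * M))).
- exact: measurable_itv.
- by move=> l; exact: (integrable_wall cp cq qM).
- move=> l s _; have H := is_derive_avg s l qd cdq qM dqM.
  have H3 := is_deriveM (is_derive_cst (p (x + y - s)) l 1) H.
  by apply: (is_derive_eq H3); rewrite scaler0 addr0.
- by move=> l s _; exact: (wall_integrand_le pM cdq dqM).
- exact: integrable_cst_itv.
Qed.

Let is_derive_shift (y a r0 : R) : is_derive r0 1
  (fun r => \int[mu]_(s in `[0, y]) (p (r - s) * avg q s a))
  (\int[mu]_(s in `[0, y]) (dp (r0 - s) * avg q s a)).
Proof.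
apply: (@is_derive_under _ _ _ mu _ (fun l s => p (l - s) * avg q s a) (fun l s => dp (l - s) * avg q s a) (cst (M * M))).
- exact: measurable_itv.
- by move=> l; exact: (integrable_wall cp cq qM).
- move=> l s _.
  have H1 : is_derive l 1 (fun l : R => l - s) 1.
    by apply: is_derive_eq; rewrite subr0.
  have H2 := is_derive1_comp (g := fun l : R => l - s) (pd (l - s)) H1.
  have H3 := is_deriveM H2 (is_derive_cst (avg q s a) l 1).
  apply: (is_derive_eq H3).
  by rewrite mulr1 scaler0 add0r /GRing.scale/= mulrC.
- by move=> l s _; exact: (wall_integrand_le dpM cq qM).
- exact: integrable_cst_itv.
Qed.

Lemma is_derive_wall_normal (x y a : R) :
  is_derive x 1 (fun x => wall p q x y a) (wall dp q x y a).
Proof.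
have H1 : is_derive x 1 (fun x : R => x + y) 1.
  by apply: is_derive_eq; rewrite addr0.
have := is_derive1_comp (g := fun x : R => x + y) (is_derive_shift y a (x + y)) H1.
by move=> H; apply: (is_derive_eq H); rewrite mulr1.
Qed.

(* The height [y] enters [wall] twice; the mixed second-order term left after
   differentiating in each place separately is quadratic in the increment. *)
Lemma is_derive_wall_height (x y a : R) : 0 < y ->
  is_derive y 1 (fun y => wall p q x y a) (p x * avg q y a + wall dp q x y a).
Proof.
move=> y0.
pose f r s := p (r - s) * avg q s a.
have cf r : continuous (f r) by exact: (continuous_wall_integrand cp cq qM).
have If r u : mu.-integrable `[0, u] (EFin \o f r).
  exact: (integrable_wall cp cq qM).
pose A1 u := \int[mu]_(s in `[0, u]) f (x + y) s.
pose A2 u := \int[mu]_(s in `[0, y]) f (x + u) s.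
(* [A1] moves only the endpoint of the integral and [A2] only the argument of [p]. What remains,
   with the common value at [y] added back, is the double increment [g]. *)
pose g u := wall p q x u a - A1 u - A2 u + A1 y.
have pL (r r' : R) : `|p r - p r'| <= M * `|r - r'|.
  wlog rr : r r' / r <= r'.
    move=> H; have [|/ltW] := leP r r'; first exact: H.
    by move=> /H; rewrite distrC [X in _ -> _ <= _ * X]distrC.
  have [c _] := @MVT_segment R p dp r r' rr (fun _ _ => pd _) (continuous_subspaceT cp).
  by rewrite distrC [X in _ <= _ * X]distrC => ->; rewrite normrM ler_wpM2r.
(* The double increment is an integral over []u, v]] of an increment of [p], at most [M (v - u)],
   times an average bounded by [M]; the length of the interval supplies the second factor
   [v - u]. *)
have gE (u v : R) : 0 < u -> u <= v ->
    `|(\int[mu]_(s in `[0, v]) f (x + v) s - \int[mu]_(s in `[0, v]) f (x + u) s)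
     - (\int[mu]_(s in `[0, u]) f (x + v) s - \int[mu]_(s in `[0, u]) f (x + u) s)|
    <= M * M * (v - u) ^+ 2.
  move=> u0 uv.
  have Id w : mu.-integrable `[0, w] (EFin \o (f (x + v) \- f (x + u))).
    apply: continuous_compact_integrable; first exact: segment_compact.
    by apply: continuous_subspaceT => s; apply: cvgB; exact: cf.
  do 2 (rewrite -RintegralB; [|exact: measurable_itv|exact: If|exact: If]).
  rewrite (Rintegral_itvB (f := fun s => f (x + v) s - f (x + u) s) (Id v)) ?bnd_simp ?(ltW u0)//.
  have -> : M * M * (v - u) ^+ 2 = M * M * (v - u) * (v - u) by ring.
  apply: Rintegral_itv_le => // [s|s _].
    by apply: cvgB; exact: cf.
  rewrite /f -mulrBl normrM mulrAC ler_pM//; last exact: (avg_le cq qM).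
  apply: (le_trans (pL _ _)).
  have -> : x + v - s - (x + u - s) = v - u by ring.
  by rewrite ger0_norm ?subr_ge0.
have wE u : wall p q x u a = \int[mu]_(s in `[0, u]) f (x + u) s by [].
have Dg : is_derive y 1 g 0.
  apply: (@is_derive_quadratic_remainder _ _ _ (M * M) y) => // u uy.
  have u0 : 0 < u by move: uy; rewrite ltr_norml => /andP[]; lra.
  have [uy'|/ltW uy'] := leP u y.
    have := gE _ _ u0 uy'; have -> : (y - u) ^+ 2 = (u - y) ^+ 2 by ring.
    congr (`|_| <= _).
    by rewrite /g wE /A1 /A2; ring.
  have := gE _ _ y0 uy'; congr (`|_| <= _).
  by rewrite /g wE /A1 /A2; ring.
have [DA1 A1E] : derivable A1 y 1 /\ derive1 A1 y = f (x + y) y.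
  apply: (@continuous_FTC1_closed _ _ 0 y (y + 1)).
  - by rewrite ltrDl.
  - exact: If.
  - exact: y0.
  - exact: cf.
have DA1' : is_derive y 1 A1 (f (x + y) y).
  by apply: DeriveDef; [exact: DA1|rewrite -derive1E; exact: A1E].
have DA2 : is_derive y 1 A2 (wall dp q x y a).
  have H1 : is_derive y 1 (fun u : R => x + u) 1.
    rewrite (_ : (fun u => x + u) = (fun u => u + x)); last by apply/funext => u; rewrite addrC.
    by apply: is_derive_eq; rewrite addr0.
  have := is_derive1_comp (g := fun u : R => x + u) (is_derive_shift y a (x + y)) H1.
  by move=> H; apply: (is_derive_eq H); rewrite mulr1.
have -> : (fun u => wall p q x u a) = (fun u => g u + A1 u + A2 u - A1 y).
  by apply/funext => u; rewrite /g; ring.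
have H := is_deriveB (is_deriveD (is_deriveD Dg DA1') DA2) (is_derive_cst (A1 y) y 1).
by apply: (is_derive_eq H); rewrite add0r subr0 /f addrK.
Qed.

End Wall.

(** * The Stokes kernel and its gradient *)

Section GaussianBounds.
Context {R : realType}.
Implicit Types t r : R.

Lemma gau_widen t r : 0 < t -> gau t r <= 512 * gau (2 * t) r.
Proof.
by move=> t0; have := gau_moment r t0 (isT : (0 <= 4)%N); rewrite !expr0 mul1r mulr1.
Qed.

Lemma dgau_le t r : 0 < t -> `|dgau t r| <= 256 / Num.sqrt t * gau (2 * t) r.
Proof.
move=> t0; have := gau_moment r t0 (isT : (1 <= 4)%N); rewrite !expr1 => H.
have q0 : 0 < Num.sqrt t by rewrite sqrtr_gt0.
rewrite /dgau normrM normrN normrM normfV (ger0_norm (gau_ge0 _ _)).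
rewrite (ger0_norm (_ : 0 <= 2 * t)) ?mulr_ge0 ?(ltW t0)//.
have -> : `|r| / (2 * t) * gau t r = (`|r| * gau t r) / (2 * t) by ring.
have -> : 256 / Num.sqrt t * gau (2 * t) r = (512 * Num.sqrt t * gau (2 * t) r) / (2 * t).
  have tq : t = Num.sqrt t ^+ 2 by rewrite sqr_sqrtr// ltW.
  move: (gau _ _) => g; rewrite [X in (2 * X)]tq.
  by move: (Num.sqrt t) q0 => q qp; field; rewrite gt_eqF.
by rewrite ler_wpM2r// invr_ge0 mulr_ge0// ltW.
Qed.

Lemma ddgau_le t r : 0 < t -> `|ddgau t r| <= 512 / t * gau (2 * t) r.
Proof.
move=> t0; have H := gau_moment r t0 (isT : (2 <= 4)%N).
have H0 := gau_widen r t0; have g0 := gau_ge0 t r.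
rewrite sqr_sqrtr ?(ltW t0)// real_normK ?num_real// in H.
rewrite /ddgau normrM (ger0_norm g0).
apply: (@le_trans _ _ ((r ^+ 2 / (4 * t ^+ 2) + (2 * t)^-1) * gau t r)).
  rewrite ler_wpM2r// (le_trans (ler_normB _ _))// !ger0_norm//.
  - by rewrite invr_ge0 mulr_ge0// ltW.
  - by rewrite divr_ge0 ?sqr_ge0// mulr_ge0// sqr_ge0.
have -> : (r ^+ 2 / (4 * t ^+ 2) + (2 * t)^-1) * gau t r =
  (4 * t ^+ 2)^-1 * (r ^+ 2 * gau t r) + (2 * t)^-1 * gau t r by ring.
have -> : 512 / t * gau (2 * t) r = (4 * t ^+ 2)^-1 * (512 * t * gau (2 * t) r) +
   ((2 * t)^-1 * (512 * gau (2 * t) r) + 128 / t * gau (2 * t) r).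
  by move: (gau _ _) => g; field; exact: lt0r_neq0.
apply: lerD; first by rewrite ler_wpM2l// invr_ge0 mulr_ge0// sqr_ge0.
apply: ler_wpDr; first by rewrite mulr_ge0 ?gau_ge0// divr_ge0// ltW.
by rewrite ler_wpM2l// invr_ge0 mulr_ge0// ltW.
Qed.

Lemma gau_bounded t : 0 < t ->
  exists M : R, [/\ forall r, `|gau t r| <= M, forall r, `|dgau t r| <= M
             & forall r, `|ddgau t r| <= M].
Proof.
move=> t0; have t20 : 0 < 2 * t by rewrite mulr_gt0.
have bd (f : R -> R) (A : R) : (forall r, `|f r| <= A * gau (2 * t) r) ->
    forall r, `|f r| <= `|A| * (Num.sqrt (4 * pi * (2 * t)))^-1.
  move=> fA r; apply: (le_trans (fA r)); rewrite ler_pM ?gau_ge0 ?gau_le_max ?ler_norm//.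
  have /(le_trans (normr_ge0 _)) := fA 0; rewrite pmulr_lge0//.
  rewrite mulr_gt0 ?expR_gt0// invr_gt0 sqrtr_gt0 mulr_gt0// mulr_gt0 ?pi_gt0//.
have H0 r : `|gau t r| <= 512 * gau (2 * t) r.
  rewrite (ger0_norm (gau_ge0 _ _)); exact: gau_widen.
have := bd _ _ (fun r => ddgau_le r t0); have := bd _ _ (fun r => dgau_le r t0).
have := bd _ _ H0.
move: (_ * _) (_ * _) (_ * _) => A B C H1 H2 H3.
exists (Num.max A (Num.max B C)); split => r; rewrite !le_max.
- by rewrite H1 !orbT.
- by rewrite H2 orbT.
- by rewrite H3.
Qed.

End GaussianBounds.

(** The inner real integral differs from the extended one only where the latter is infinite, and
    this is a null set because the iterated integral is finite. *)
Lemma Rintegral_iterated d1 d2 (T1 : measurableType d1) (T2 : measurableType d2)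
    (R : realType) (m1 : {sigma_finite_measure set T1 -> \bar R})
    (m2 : {sigma_finite_measure set T2 -> \bar R}) (f : T1 -> T2 -> R) :
  measurable_fun [set: (T1 * T2)%type] (fun z => f z.1 z.2) ->
  (forall x y, 0 <= f x y) ->
  (\int[m1]_x \int[m2]_y (f x y)%:E < +oo)%E ->
  \int[m1]_x \int[m2]_y f x y = fine (\int[m1]_x \int[m2]_y (f x y)%:E)%E.
Proof.
move=> mf f0 If.
pose J x := (\int[m2]_y (f x y)%:E)%E.
have J0 x : (0 <= J x)%E by apply: int_ge0.
have mJ : measurable_fun setT J.
  apply: (measurable_fun_fubini_tonelli_F (fun z : T1 * T2 => (f z.1 z.2)%:E)) => //.
  - exact/measurable_EFinP.
  - by move=> z; rewrite lee_fin.
have IJ : m1.-integrable setT J.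
  apply/integrableP; split => //.
  by under eq_integral do rewrite gee0_abs//.
congr fine; apply: ae_eq_integral => //.
- by apply/measurable_EFinP; exact: (measurableT_comp (fine_measurable measurableT)).
- by have := integrable_ae measurableT IJ; apply: filterS => x Jx _; rewrite fineK// Jx.
Qed.

Lemma patch_itv0 (R : realType) (y : R) (f : R -> R) (s : R) :
  (f \_ `[0, y]) s = if (0 <= s) && (s <= y) then f s else 0.
Proof. by rewrite patchE mem_setE in_itv. Qed.

Section MeasurableWall.
Context {R : realType}.
Notation mu := (@lebesgue_measure R).

Lemma measurable_avg d (T : measurableType d) (q : T -> R -> R) (s a : T -> R) :
  measurable_fun [set: (T * measurableTypeR R)%type] (fun w => q w.1 w.2) ->
  measurable_fun setT s -> measurable_fun setT a ->
  measurable_fun setT (fun z => avg (q z) (s z) (a z)).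
Proof.
move=> mq ms ma; rewrite /avg.
apply: (@measurable_Rintegral_param _ _ _ _ _ mu
  (fun w : T * measurableTypeR R => q w.1 (a w.1 - s w.1 * w.2) * cau w.2)).
apply: measurable_funM; last by apply: measurable_cau; exact: measurable_snd.
apply: (measurableT_comp mq (g := fun w : T * measurableTypeR R => (w.1, a w.1 - s w.1 * w.2))).
by mfun.
Qed.

Lemma measurable_wall d (T : measurableType d) (p q : T -> R -> R) (x y a : T -> R) :
  measurable_fun [set: (T * measurableTypeR R)%type] (fun w => p w.1 w.2) ->
  measurable_fun [set: (T * measurableTypeR R)%type] (fun w => q w.1 w.2) ->
  measurable_fun setT x -> measurable_fun setT y -> measurable_fun setT a ->
  measurable_fun setT (fun z => wall (p z) (q z) (x z) (y z) (a z)).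
Proof.
move=> mp mq mx my ma.
pose f (w : T * measurableTypeR R) := if (0 <= w.2) && (w.2 <= y w.1) then
  p w.1 (x w.1 + y w.1 - w.2) * avg (q w.1) w.2 (a w.1) else 0.
rewrite (_ : (fun _ => _) = (fun z => \int[mu]_s f (z, s))); last first.
  apply/funext => z; rewrite /wall Rintegral_mkcond; apply: eq_Rintegral => s _.
  by rewrite patch_itv0.
apply: measurable_Rintegral_param.
rewrite /f; apply: measurable_fun_ifT; [by mfun| |exact: measurable_cst].
apply: measurable_funM.
- apply: (measurableT_comp mp (g := fun w : T * measurableTypeR R => (w.1, x w.1 + y w.1 - w.2))).
  by mfun.
- apply: (@measurable_avg _ _ (fun w : T * measurableTypeR R => q w.1)); [|by mfun|by mfun].
  by apply: (measurableT_comp mq (g := fun w : T * measurableTypeR R * measurableTypeR R => (w.1.1, w.2))); mfun.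
Qed.

End MeasurableWall.

(** * Closed form of the Stokes kernel and of its gradient *)

Section WallKernel.
Context {R : realType}.
Notation mu := (@lebesgue_measure R).
Implicit Types (t : R) (x y : R * R).

Lemma wall_le0 (p q : R -> R) (x y a : R) : y <= 0 -> wall p q x y a = 0.
Proof.
rewrite le_eqVlt /wall => /predU1P[->|y0]; first by rewrite set_itv1 Rintegral_set1.
by rewrite set_itv_ge ?Rintegral_set0// bnd_simp -ltNge.
Qed.

(** The substitution [zeta1 = y.1 + s v] turns the Poisson kernel at height [s] into the Cauchy
    density; the factor [s] is the Jacobian. *)
Lemma poisson_cau y (v s : R) : 0 < s ->
  s * (pi^-1 * ((y.2 - (y.2 - s)) /
    ((y.1 - (y.1 + s * v)) ^+ 2 + (y.2 - (y.2 - s)) ^+ 2))) = cau v.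
Proof.
move=> s0; rewrite /cau.
have p0 := @pi_gt0 R.
have v0 : 0 < 1 + v ^+ 2 by rewrite ltr_pwDl// sqr_ge0.
have -> : (y.1 - (y.1 + s * v)) ^+ 2 + (y.2 - (y.2 - s)) ^+ 2 = s ^+ 2 * (1 + v ^+ 2) by ring.
have -> : y.2 - (y.2 - s) = s by ring.
move: (1 + v ^+ 2) v0 (@pi R) p0 => w w0 P P0; field.
by rewrite (gt_eqF s0) (gt_eqF P0) (gt_eqF w0).
Qed.

(** The potential under the derivative in [K0]. The planar Gaussian factors; after exchanging the
    integrals, [zeta2 = y.2 - s] measures depth below [y], and rescaling [zeta1] by [s] produces a
    Poisson average at height [s]. All integrands are nonnegative, so the exchange takes place in
    the extended reals and finiteness of the result brings it back to real integrals. *)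
Lemma K0_potential t x y : 0 < t ->
  \int[mu]_zeta1 \int[mu]_(zeta2 in `[0, y.2])
      (gauss t (x - refl (zeta1, zeta2)) * poisson (y - (zeta1, zeta2))) =
  wall (gau t) (gau t) x.2 y.2 (x.1 - y.1).
Proof.
move=> t0.
have [y0|y0] := leP y.2 0.
  rewrite wall_le0//; rewrite [RHS](_ : 0 = \int[mu]_zeta1 0); last first.
    by rewrite Rintegral_cst// mul0r.
  apply: eq_Rintegral => z _; move: y0; rewrite le_eqVlt => /predU1P[->|y0].
    by rewrite set_itv1 Rintegral_set1.
  by rewrite set_itv_ge ?Rintegral_set0// bnd_simp -ltNge.
have [M [gM _ _]] := gau_bounded t0.
have M0 : 0 <= M by exact: le_trans (gM 0).
have mg := @measurable_gau R.
pose I (s : R) := (0 <= s) && (s <= y.2).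
pose f (z1 z2 : R) := if I z2 then
  gau t (x.1 - z1) * gau t (x.2 + z2) * (pi^-1 * ((y.2 - z2) / ((y.1 - z1) ^+ 2 + (y.2 - z2) ^+ 2)))
  else 0.
pose g (s v : R) := if I s then
  gau t (x.2 + y.2 - s) * (gau t (x.1 - y.1 - s * v) * cau v) else 0.
have f0 z1 z2 : 0 <= f z1 z2.
  rewrite /f /I; case: ifPn => // /andP[z0 zy].
  rewrite mulr_ge0 ?mulr_ge0 ?gau_ge0 ?invr_ge0 ?pi_ge0// ?subr_ge0//.
  by rewrite addr_ge0// sqr_ge0.
have g0 s v : 0 <= g s v.
  by rewrite /g; case: ifPn => // _; rewrite mulr_ge0 ?mulr_ge0 ?gau_ge0 ?cau_ge0.
have mf : measurable_fun [set: (measurableTypeR R * measurableTypeR R)%type] (fun z => f z.1 z.2).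
  rewrite /f /I /gau; by mfun.
have mgg : measurable_fun [set: (measurableTypeR R * measurableTypeR R)%type] (fun z => g z.1 z.2).
  rewrite /g /I /gau /cau; by mfun.
have mf2 : measurable_fun [set: (measurableTypeR R * measurableTypeR R)%type] (fun z => f z.2 z.1).
  rewrite /f /I /gau; by mfun.
have E : (\int[mu]_z1 \int[mu]_z2 (f z1 z2)%:E = \int[mu]_s \int[mu]_v (g s v)%:E)%E.
  rewrite (@fubini_tonelli _ _ _ _ _ mu mu (fun z : measurableTypeR R * measurableTypeR R => (f z.1 z.2)%:E)); last 2 first.
  - exact/measurable_EFinP.
  - by move=> z; rewrite lee_fin.
  rewrite /=.
  rewrite -(@ge0_integral_reflect _ y.2 (fun z2 => \int[mu]_z1 (f z1 z2)%:E)%E); last 2 first.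
  - apply: (@measurable_fun_fubini_tonelli_F _ _ _ _ _ mu (fun z : measurableTypeR R * measurableTypeR R => (f z.2 z.1)%:E)).
    + exact/measurable_EFinP.
    + by move=> z; rewrite lee_fin.
  - by move=> z; exact: int_ge0.
  apply: ae_eq_integral => //.
  - apply: (@measurable_fun_fubini_tonelli_F _ _ _ _ _ mu (fun z : measurableTypeR R * measurableTypeR R => (f z.2 (y.2 - z.1))%:E)).
    + apply/measurable_EFinP.
      by apply: (measurableT_comp mf2 (g := fun z : measurableTypeR R * measurableTypeR R => (y.2 - z.1, z.2))); mfun.
    + by move=> z; rewrite lee_fin.
  - apply: (@measurable_fun_fubini_tonelli_F _ _ _ _ _ mu (fun z : measurableTypeR R * measurableTypeR R => (g z.1 z.2)%:E)).
    + exact/measurable_EFinP.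
    + by move=> z; rewrite lee_fin.
  (* The rescaling by [s] degenerates at [s = 0], a single point. *)
  - exists [set 0]; split => //; first exact: lebesgue_measure_set1.
    move=> s /= /not_implyP[_ H]; apply: contrapT => /eqP s0; apply: H.
    rewrite (@ge0_integral_affine _ y.1 s) //; last 2 first.
    - apply/measurable_EFinP.
      by apply: (measurableT_comp mf (g := fun z : measurableTypeR R => (z, y.2 - s))); mfun.
    - by move=> z; rewrite lee_fin.
    rewrite -int_scale; last 3 first.
    - by apply: (measurableT_comp mf (g := fun z : measurableTypeR R => (y.1 + s * z, y.2 - s))); mfun.
    - by move=> z; exact: f0.
    - exact: normr_ge0.
    apply: eq_integral => v _; congr (_%:E); rewrite /f /g /I.
    rewrite subr_ge0 gerBl andbC; case: ifPn => [/andP[s1 s2]|]; last by rewrite mulr0.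
    have sp : 0 < s by rewrite lt_neqAle eq_sym s0.
    rewrite gtr0_norm//.
    rewrite -(poisson_cau y v sp).
    have -> : x.1 - (y.1 + s * v) = x.1 - y.1 - s * v by ring.
    have -> : x.2 + (y.2 - s) = x.2 + y.2 - s by ring.
    by rewrite mulrCA (mulrC (gau t _)) -!mulrA.
have Ig : (\int[mu]_s \int[mu]_v (g s v)%:E < +oo)%E.
  clear E mf2 mf f0 f.
  have Hmu : mu `[0, y.2] = y.2%:E.
    by apply: (etrans (lebesgue_measure_itv _)); rewrite /= lte_fin y0 sube0.
  apply: (@le_lt_trans _ _ (\int[mu]_(s in `[0%R, y.2]) (M * M)%:E)%E); last first.
    rewrite integral_cst; last exact: measurable_itv.
    by rewrite [X in (_ * X)%E](_ : _ = y.2%:E); [rewrite -EFinM ltry|exact: Hmu].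
  rewrite [leRHS]integral_mkcond; apply: ge0_le_integral.
  - exact: measurableT.
  - by move=> s _; exact: int_ge0.
  - apply: (@measurable_fun_fubini_tonelli_F _ _ _ _ _ mu (fun z : measurableTypeR R * measurableTypeR R => (g z.1 z.2)%:E)).
    + exact/measurable_EFinP.
    + by move=> z; rewrite lee_fin.
  - apply/(measurable_restrictT _ _).1; first exact: measurable_itv.
    exact: measurable_cst.
  move=> s _; rewrite patchE mem_setE in_itv /g /I /=; case: ifPn => sy; last first.
    by rewrite integral0.
  apply: (@le_trans _ _ (\int[mu]_v (M * M * cau v)%:E)%E).
    clear Hmu sy mgg g0 g I.
    apply: int_mono.
    - by rewrite /gau /cau; mfun.
    - by rewrite /cau; mfun.
    - by move=> v; rewrite mulr_ge0 ?mulr_ge0 ?gau_ge0 ?cau_ge0.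
    - move=> v; rewrite mulrA; apply: ler_wpM2r; first exact: cau_ge0.
      apply: ler_pM; [exact: gau_ge0|exact: gau_ge0| |]; apply: le_trans (gM _); exact: ler_norm.
  rewrite int_scale; [|by rewrite /cau; mfun|exact: cau_ge0|by rewrite mulr_ge0].
  rewrite -[leRHS]mule1; apply: lee_wpmul2l; first by rewrite lee_fin mulr_ge0.
  exact: integral_cau.
clear mf2 mg M0.
transitivity (\int[mu]_z1 \int[mu]_z2 f z1 z2).
  apply: eq_Rintegral => z1 _; rewrite Rintegral_mkcond; apply: eq_Rintegral => z2 _.
  rewrite patch_itv0 /f /I; case: ifPn => _; last by [].
  by rewrite (gauss_gau _ t0) /poisson /refl /= opprK.
transitivity (\int[mu]_s \int[mu]_v g s v).
  by rewrite !Rintegral_iterated ?E.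
rewrite /wall [RHS]Rintegral_mkcond; apply: eq_Rintegral => s _.
rewrite patch_itv0 /g /I; case: ifPn => _.
  rewrite RintegralZl; first by [].
  - exact: measurableT.
  - exact: (integrable_avg (continuous_gau t0) gM).
by rewrite (Rintegral_cst _ measurableT) mul0r.
Qed.

Lemma K0_wall t x y : 0 < t ->
  K0 x y t = - 2 * wall (dgau t) (gau t) x.2 y.2 (x.1 - y.1).
Proof.
move=> t0; have [M [gM dgM _]] := gau_bounded t0.
rewrite /K0 /d2; congr (_ * _).
under [X in derive1 X]funext => r do rewrite (K0_potential (x.1, r) y t0) /=.
have D := is_derive_wall_normal (fun r => is_derive_gau r t0) dgM
  (fun r => is_derive_gau r t0) gM x.2 y.2 (x.1 - y.1).
by rewrite derive1E; have [_ ->] := D.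
Qed.

(** [K] with the derivative in [K0] carried out. In this form joint measurability and the pointwise
    bounds can be read off. *)
Definition stokes_kernel t x y : R :=
  gau t (x.1 - y.1) * gau t (x.2 - y.2) - gau t (x.1 - y.1) * gau t (x.2 + y.2)
  + 2 * wall (dgau t) (gau t) x.2 y.2 (x.1 - y.1).

Lemma K_stokes_kernel t x y : 0 < t -> K x y t = stokes_kernel t x y.
Proof.
move=> t0; rewrite /K K0_wall// !gauss_gau// /stokes_kernel /refl /= opprK; ring.
Qed.

(* The index [i] selects the first ([true]) or second ([false]) component. *)
Definition heat_grad (i : bool) t (z : R * R) : R :=
  if i then dgau t z.1 * gau t z.2 else gau t z.1 * dgau t z.2.

(** The gradient in [y] of [K] without the free heat kernel [gauss t (x - y)]. In the second
    component the height occurs twice in the wall integral, which produces the extra boundary term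
    with [dgau t x.2]. *)
Definition wall_grad (i : bool) t x y : R :=
  if i then dgau t (x.1 - y.1) * gau t (x.2 + y.2)
            - 2 * wall (dgau t) (dgau t) x.2 y.2 (x.1 - y.1)
  else 2 * (dgau t x.2 * avg (gau t) y.2 (x.1 - y.1)
            + wall (ddgau t) (gau t) x.2 y.2 (x.1 - y.1))
       - gau t (x.1 - y.1) * dgau t (x.2 + y.2).

Lemma is_derive_subl (f : R -> R) (df c r : R) :
  is_derive (c - r) 1 f df -> is_derive r 1 (fun r => f (c - r)) (- df).
Proof.
move=> H.
have H1 : is_derive r 1 (fun r : R => c - r) (- 1).
  by apply: is_derive_eq; rewrite add0r mul1r.
have := is_derive1_comp (g := fun r : R => c - r) H H1.
by move=> H2; apply: (is_derive_eq H2); rewrite mulrN1.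
Qed.

Lemma is_derive_addl (f : R -> R) (df c r : R) :
  is_derive (c + r) 1 f df -> is_derive r 1 (fun r => f (c + r)) df.
Proof.
move=> H.
have H1 : is_derive r 1 (fun r : R => c + r) 1.
  rewrite (_ : (fun u => c + u) = (fun u => u + c)); last by apply/funext => u; rewrite addrC.
  by apply: is_derive_eq; rewrite addr0.
have := is_derive1_comp (g := fun r : R => c + r) H H1.
by move=> H2; apply: (is_derive_eq H2); rewrite mulr1.
Qed.

Lemma is_derive_mulr_cst (f : R -> R) (df c r : R) :
  is_derive r 1 f df -> is_derive r 1 (fun r => f r * c) (df * c).
Proof.
move=> H; have := is_deriveM H (is_derive_cst c r 1).
by move=> H2; apply: (is_derive_eq H2); rewrite scaler0 add0r /GRing.scale/= mulrC.
Qed.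

Lemma is_derive_mull_cst (f : R -> R) (df c r : R) :
  is_derive r 1 f df -> is_derive r 1 (fun r => c * f r) (c * df).
Proof.
move=> /(is_derive_mulr_cst c) H; rewrite mulrC.
by rewrite (_ : (fun r => c * f r) = (fun r => f r * c))//; apply/funext => u; rewrite mulrC.
Qed.

Lemma stokes_kernel_grad1 t x y : 0 < t ->
  d1 (fun y' => K x y' t) y = - heat_grad true t (x - y) + wall_grad true t x y.
Proof.
move=> t0; have [M [gM dgM _]] := gau_bounded t0.
rewrite /d1 derive1E.
rewrite (_ : (fun r => K x (r, y.2) t) = (fun r => gau t (x.1 - r) * gau t (x.2 - y.2)
  - gau t (x.1 - r) * gau t (x.2 + y.2) + 2 * wall (dgau t) (gau t) x.2 y.2 (x.1 - r))); last first.
  by apply/funext => r; rewrite K_stokes_kernel.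
have D0 := is_derive_subl (is_derive_gau (x.1 - y.1) t0).
have D1 := is_derive_mulr_cst (gau t (x.2 - y.2)) D0.
have D2 := is_derive_mulr_cst (gau t (x.2 + y.2)) D0.
have D3 := is_derive_wall_tangential (fun r => is_derive_dgau r t0) dgM
  (fun r => is_derive_gau r t0) (continuous_dgau t0) gM dgM x.2 y.2 (x.1 - y.1).
have D4 := is_derive_mull_cst 2 (is_derive_subl D3).
have D := is_deriveD (is_deriveB D1 D2) D4.
have [_ ->] := D.
rewrite /heat_grad /wall_grad /=; ring.
Qed.

Lemma stokes_kernel_grad2 t x y : 0 < t -> 0 < y.2 ->
  d2 (fun y' => K x y' t) y = - heat_grad false t (x - y) + wall_grad false t x y.
Proof.
move=> t0 y0; have [M [gM dgM ddgM]] := gau_bounded t0.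
rewrite /d2 derive1E.
rewrite (_ : (fun r => K x (y.1, r) t) = (fun r => gau t (x.1 - y.1) * gau t (x.2 - r)
  - gau t (x.1 - y.1) * gau t (x.2 + r) + 2 * wall (dgau t) (gau t) x.2 r (x.1 - y.1))); last first.
  by apply/funext => r; rewrite K_stokes_kernel.
have D1 := is_derive_mull_cst (gau t (x.1 - y.1)) (is_derive_subl (is_derive_gau (x.2 - y.2) t0)).
have D2 := is_derive_mull_cst (gau t (x.1 - y.1)) (is_derive_addl (is_derive_gau (x.2 + y.2) t0)).
have D3 := is_derive_wall_height (fun r => is_derive_dgau r t0) ddgM
  (fun r => is_derive_gau r t0) gM x.2 (x.1 - y.1) y0.
have D := is_deriveD (is_deriveB D1 D2) (is_derive_mull_cst 2 D3).
have [_ ->] := D.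
rewrite /heat_grad /wall_grad /=; ring.
Qed.

End WallKernel.

Section KernelMeasurability.
Context d (T : measurableType d) {R : realType}.
Notation plane := (measurableTypeR R * measurableTypeR R)%type.
Variables (f : T -> R) (x y : T -> plane).
Hypotheses (mf : measurable_fun setT f) (mx : measurable_fun setT x)
  (my : measurable_fun setT y).

Let mf1 : measurable_fun [set: (T * measurableTypeR R)%type] (fun w => f w.1).
Proof. by mfun. Qed.

Let mdg : measurable_fun [set: (T * measurableTypeR R)%type] (fun w => dgau (f w.1) w.2).
Proof. by apply: measurable_dgau; mfun. Qed.

Let mg : measurable_fun [set: (T * measurableTypeR R)%type] (fun w => gau (f w.1) w.2).
Proof. by apply: measurable_gau; mfun. Qed.

Let mddg : measurable_fun [set: (T * measurableTypeR R)%type] (fun w => ddgau (f w.1) w.2).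
Proof. by apply: measurable_ddgau; mfun. Qed.

Lemma measurable_heat_grad (i : bool) :
  measurable_fun setT (fun z => heat_grad i (f z) (x z)).
Proof.
by rewrite /heat_grad; case: i; apply: measurable_funM;
  [apply: measurable_dgau|apply: measurable_gau|apply: measurable_gau|apply: measurable_dgau]; mfun.
Qed.

Lemma measurable_stokes_kernel :
  measurable_fun setT (fun z => stokes_kernel (f z) (x z) (y z)).
Proof.
rewrite /stokes_kernel; apply: measurable_funD.
  by apply: measurable_funB; apply: measurable_funM; apply: measurable_gau; mfun.
apply: measurable_funM; first exact: measurable_cst.
by apply: (measurable_wall mdg mg); mfun.
Qed.

Lemma measurable_wall_grad (i : bool) :
  measurable_fun setT (fun z => wall_grad i (f z) (x z) (y z)).
Proof.
rewrite /wall_grad; case: i; apply: measurable_funB.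
- by apply: measurable_funM; [apply: measurable_dgau|apply: measurable_gau]; mfun.
- apply: measurable_funM; first exact: measurable_cst.
  by apply: (measurable_wall mdg mdg); mfun.
- apply: measurable_funM; first exact: measurable_cst.
  apply: measurable_funD; last by apply: (measurable_wall mddg mg); mfun.
  apply: measurable_funM; first by apply: measurable_dgau; mfun.
  by apply: (measurable_avg mg); mfun.
- by apply: measurable_funM; [apply: measurable_gau|apply: measurable_dgau]; mfun.
Qed.

End KernelMeasurability.

(** * Pointwise and integral bounds for the kernels *)

Section WallEstimates.
Context {R : realType}.
Notation mu := (@lebesgue_measure R).
Notation plane := (measurableTypeR R * measurableTypeR R)%type.
Implicit Types t r s a : R.

Lemma gau_weight t r : 0 < t -> t <= 4 -> (1 + `|r|) * gau t r <= 1536 * gau (2 * t) r.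
Proof.
move=> t0 t4; have H0 := gau_widen r t0.
have := gau_moment r t0 (isT : (1 <= 4)%N); rewrite !expr1 => H1.
have q2 : Num.sqrt t <= 2.
  by rewrite -[leRHS]ger0_norm// -sqrtr_sqr ler_wsqrtr//; lra.
have g0 := gau_ge0 (2 * t) r; rewrite mulrDl mul1r.
have H2 : 512 * Num.sqrt t * gau (2 * t) r <= 1024 * gau (2 * t) r.
  rewrite ler_wpM2r//; lra.
lra.
Qed.

(* On the half line the cross term of the square has a sign. *)
Lemma gau_split t r s : 0 < t -> 0 <= r -> 0 <= s ->
  gau t (r + s) <= Num.sqrt (4 * pi * t) * (gau t r * gau t s).
Proof.
move=> t0 r0 s0; rewrite /gau.
have p0 : 0 < Num.sqrt (4 * pi * t) by rewrite sqrtr_gt0 !mulr_gt0 ?pi_gt0.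
have -> : Num.sqrt (4 * pi * t) * ((Num.sqrt (4 * pi * t))^-1 * expR (- r ^+ 2 / (4 * t)) *
    ((Num.sqrt (4 * pi * t))^-1 * expR (- s ^+ 2 / (4 * t)))) =
    (Num.sqrt (4 * pi * t))^-1 * (expR (- r ^+ 2 / (4 * t)) * expR (- s ^+ 2 / (4 * t))).
  move: (expR _) (expR _) (Num.sqrt _) p0 => A B q q0; field; exact: lt0r_neq0.
rewrite ler_wpM2l ?invr_ge0 ?sqrtr_ge0// -expRD ler_expR -mulrDl.
rewrite ler_wpM2r ?invr_ge0 ?mulr_ge0 ?(ltW t0)//.
have : 0 <= r * s by rewrite mulr_ge0.
by rewrite !expr2; lra.
Qed.

Lemma avg_ge0 (q : R -> R) s a : (forall r, 0 <= q r) -> 0 <= avg q s a.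
Proof. by move=> q0; apply: Rintegral_ge0 => v _; rewrite mulr_ge0 ?cau_ge0. Qed.

Lemma avg_abs_le (p q : R -> R) (B M : R) s a : continuous p -> continuous q ->
  (forall r, `|q r| <= M) -> (forall r, `|p r| <= B * q r) ->
  `|avg p s a| <= B * avg q s a.
Proof.
move=> cp cq qM pq.
have Iq := integrable_avg cq qM s a.
have Ip : mu.-integrable setT (fun v => (p (a - s * v) * cau v)%:E).
  apply: (integrable_avg cp (M := `|B| * M)) => r; rewrite (le_trans (pq r))//.
  rewrite (le_trans (ler_norm _))// normrM ler_wpM2l//.
rewrite /avg -RintegralZl//; apply: (le_trans (le_normr_Rintegral measurableT Ip)).
apply: le_Rintegral.
- exact: measurableT.
- exact: (integrable_norm Ip).
- by have := integrableZl measurableT B Iq; apply: eq_integrable.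
- move=> v _; rewrite normrM (ger0_norm (cau_ge0 v)) mulrA.
  by rewrite ler_wpM2r ?cau_ge0.
Qed.

Lemma integral_avg_gau t s : 0 < t -> (\int[mu]_a (avg (gau t) s a)%:E <= 1)%E.
Proof.
move=> t0; have [M [gM _ _]] := gau_bounded t0.
have mF : measurable_fun [set: plane] (fun z => (gau t (z.1 - s * z.2) * cau z.2)%:E).
  by rewrite /gau /cau; mfun.
have F0 (z : plane) : (0 <= (gau t (z.1 - s * z.2) * cau z.2)%:E)%E.
  by rewrite lee_fin mulr_ge0 ?gau_ge0 ?cau_ge0.
under eq_integral => a _.
  rewrite /avg fineK; last first.
    exact: (integrable_fin_num measurableT (integrable_avg (continuous_gau t0) gM s a)).
  over.
rewrite (@fubini_tonelli _ _ _ _ _ mu mu (fun z : plane => (gau t (z.1 - s * z.2) * cau z.2)%:E))//=.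
apply: le_trans integral_cau.
rewrite le_eqVlt; apply/orP; left; apply/eqP; apply: eq_integral => v _.
rewrite int_scaler; [|by rewrite /gau; mfun|by move=> a; exact: gau_ge0|exact: cau_ge0].
rewrite (ge0_integral_translate (s * v) (f := fun a => (gau t a)%:E)).
- by rewrite integral_gau// mul1e.
- by apply/measurable_EFinP; exact: measurable_gau.
- by move=> a; rewrite lee_fin gau_ge0.
Qed.

Lemma wall_ge0 (p q : R -> R) (x y a : R) :
  (forall r, 0 <= p r) -> (forall r, 0 <= q r) -> 0 <= wall p q x y a.
Proof.
by move=> p0 q0; apply: Rintegral_ge0 => v _; rewrite mulr_ge0 ?avg_ge0.
Qed.

(** At each [s] the Poisson average has mass at most one in [a]; what remains is a part of the
    integral of [gau t (y - s)], at most one for every height [y]. *)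
Lemma integral_wall_gau t y : 0 < t ->
  (\int[mu]_a (wall (gau t) (gau t) 0 y a)%:E <= 1)%E.
Proof.
move=> t0; have [M [gM _ _]] := gau_bounded t0.
have cg := continuous_gau t0.
have mav : measurable_fun [set: plane] (fun z => avg (gau t) z.2 z.1).
  apply: (@measurable_avg _ _ _ (fun=> gau t) (fun z : plane => z.2) (fun z : plane => z.1)); [|by mfun|by mfun].
  by apply: (@measurable_gau _ _ _ (fun=> t)); mfun.
pose F (z : plane) := if (0 <= z.2) && (z.2 <= y) then gau t (0 + y - z.2) * avg (gau t) z.2 z.1 else 0.
have mF : measurable_fun [set: plane] F.
  rewrite /F; apply: measurable_fun_ifT; [by mfun| |exact: measurable_cst].
  by apply: measurable_funM => //; rewrite /gau; mfun.
have F0 z : 0 <= F z.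
  by rewrite /F; case: ifP => // _; rewrite mulr_ge0 ?gau_ge0 ?avg_ge0//; exact: gau_ge0.
have EF a : ((wall (gau t) (gau t) 0 y a)%:E = \int[mu]_s (F (a, s))%:E)%E.
  rewrite /wall /Rintegral fineK; last first.
    apply: integrable_fin_num; first exact: measurable_itv.
    exact: (integrable_wall cg cg gM (0 + y) y a).
  rewrite integral_mkcond; apply: eq_integral => s _.
  by rewrite patchE mem_setE in_itv /F /=; case: ifP.
under eq_integral do rewrite EF.
rewrite (@fubini_tonelli _ _ _ _ _ mu mu (fun z : plane => (F z)%:E)); last 2 first.
- exact/measurable_EFinP.
- by move=> z; rewrite lee_fin.
rewrite -[leRHS](integral_gau t0) -(@ge0_integral_reflect _ (0 + y) (fun s => (gau t s)%:E)); last 2 first.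
- by apply/measurable_EFinP; exact: measurable_gau.
- by move=> a; rewrite lee_fin gau_ge0.
apply: ge0_le_integral.
- exact: measurableT.
- by move=> s _; exact: int_ge0.
- apply: (@measurable_fun_fubini_tonelli_G _ _ _ _ _ mu (fun z : plane => (F z)%:E)).
  + exact/measurable_EFinP.
  + by move=> z; rewrite lee_fin.
- by rewrite /gau; mfun.
move=> s _; case: (boolP ((0 <= s) && (s <= y))) => h; last first.
  rewrite (eq_integral (cst 0%E)); first by rewrite integral0 lee_fin gau_ge0.
  by move=> a _; rewrite /F /= (negbTE h).
rewrite [leLHS](_ : _ = \int[mu]_a (gau t (0 + y - s) * avg (gau t) s a)%:E)%E; last first.
  by apply: eq_integral => a _; rewrite /F /= h.
rewrite int_scale; [|by apply: (measurableT_comp mav (g := fun a : measurableTypeR R => (a, s))); mfun| |exact: gau_ge0].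
  rewrite -[leRHS]mule1; apply: lee_wpmul2l; first by rewrite lee_fin gau_ge0.
  exact: integral_avg_gau.
by move=> a; apply: avg_ge0 => r; exact: gau_ge0.
Qed.

(** For [s <= y], [gau_split] applied to [x] and [y - s] takes the decay in the distance [x] to the
    wall out of the integral and leaves a profile at [x = 0]. The split costs a factor of order
    [sqrt t], which later compensates one derivative. *)
Lemma wall_abs_le t (p q : R -> R) (A B x y a : R) : 0 < t -> 0 <= x ->
  continuous p -> continuous q ->
  (forall r, `|p r| <= A * gau t r) -> (forall r, `|q r| <= B * gau t r) ->
  `|wall p q x y a| <= A * B * Num.sqrt (4 * pi * t) * (gau t x * wall (gau t) (gau t) 0 y a).
Proof.
move=> t0 x0 cp cq pA qB.
have [M [gM _ _]] := gau_bounded t0; have cg := continuous_gau t0.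
have bd (f : R -> R) (C : R) : (forall r, `|f r| <= C * gau t r) -> forall r, `|f r| <= `|C| * M.
  move=> fC r; apply: (le_trans (fC r)); apply: (le_trans (ler_norm _)).
  by rewrite normrM ler_wpM2l.
have A0 : 0 <= A.
  have := le_trans (normr_ge0 _) (pA 0); rewrite pmulr_lge0//.
  by rewrite mulr_gt0 ?expR_gt0// invr_gt0 sqrtr_gt0 !mulr_gt0 ?pi_gt0.
have I1 := integrable_wall cp cq (bd _ _ qB) (x + y) y a.
have I2 := integrable_wall cg cg gM (0 + y) y a.
have mI : measurable (`[0, y]%classic : set (measurableTypeR R)) by exact: measurable_itv.
have I3 : mu.-integrable `[0, y] (EFin \o (fun s => gau t x * (gau t (0 + y - s) * avg (gau t) s a))).
  by have := integrableZl mI (gau t x) I2; apply: eq_integrable.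
rewrite /wall -RintegralZl; [|exact: measurable_itv|exact: I2].
rewrite -RintegralZl; [|exact: measurable_itv|exact: I3].
apply: le_trans (le_normr_Rintegral _ I1) _; first exact: measurable_itv.
apply: le_Rintegral.
- exact: measurable_itv.
- exact: (integrable_norm I1).
- have := integrableZl mI (A * B * Num.sqrt (4 * pi * t)) I3.
  by apply: eq_integrable.
move=> s; rewrite /= in_itv/= => /andP[s0 sy].
rewrite normrM.
apply: (@le_trans _ _ (A * (Num.sqrt (4 * pi * t) * (gau t x * gau t (y - s))) * (B * avg (gau t) s a))).
  rewrite ler_pM//; last exact: (avg_abs_le _ _ cq cg gM qB).
  rewrite -addrA (le_trans (pA _))// ler_wpM2l// gau_split// subr_ge0//.
by rewrite add0r le_eqVlt; apply/orP; left; apply/eqP; ring.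
Qed.

Lemma leb2_prod (f g : R -> R) : measurable_fun setT f -> measurable_fun setT g ->
  (forall r, 0 <= f r) -> (forall r, 0 <= g r) ->
  (\int[leb2]_z (f z.1 * g z.2)%:E = \int[mu]_r (f r)%:E * \int[mu]_r (g r)%:E)%E.
Proof.
move=> mf mg f0 g0.
rewrite leb2_tonelli2; last 2 first.
- by mfun.
- by move=> z; rewrite lee_fin mulr_ge0.
under eq_integral => r _.
  rewrite /= int_scaler//; over.
rewrite ge0_integralZl//.
- exact/measurable_EFinP.
- by move=> r _; rewrite lee_fin.
- exact: int_ge0.
Qed.

End WallEstimates.

Section KernelEstimates.
Context {R : realType}.
Notation mu := (@lebesgue_measure R).
Notation plane := (measurableTypeR R * measurableTypeR R)%type.
Implicit Types (t : R) (x y z : R * R).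

Let sqrt_pi8 t : Num.sqrt (4 * pi * (2 * t)) = Num.sqrt (8 * pi) * Num.sqrt t :> R.
Proof. by rewrite -sqrtrM ?mulr_ge0 ?pi_ge0//; congr Num.sqrt; ring. Qed.

(** One constant for all bounds, hidden so that later computations see a symbol; [1 <= c] absorbs
    products with fewer factors [c], and [t <= 4] leaves room to apply the bounds at [t] and again
    at [2 t]. *)
Lemma gau_bounds : exists c : R, 1 <= c /\ forall t r, 0 < t -> t <= 4 ->
  [/\ gau t r <= c * gau (2 * t) r, `|dgau t r| <= c / Num.sqrt t * gau (2 * t) r,
      `|ddgau t r| <= c / t * gau (2 * t) r & (1 + `|r|) * gau t r <= c * gau (2 * t) r].
Proof.
exists 1536; split; first by lra.
move=> t r t0 t4; have g0 := gau_ge0 (2 * t) r; split.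
- by apply: (le_trans (gau_widen r t0)); rewrite ler_wpM2r//; lra.
- apply: (le_trans (dgau_le r t0)); rewrite ler_wpM2r// ler_wpM2r ?invr_ge0 ?sqrtr_ge0//; lra.
- apply: (le_trans (ddgau_le r t0)); rewrite ler_wpM2r// ler_wpM2r ?invr_ge0 ?(ltW t0)//; lra.
- exact: gau_weight.
Qed.

Lemma enorm_le_sum z : enorm z <= `|z.1| + `|z.2|.
Proof.
rewrite -[leRHS]ger0_norm ?addr_ge0// -sqrtr_sqr; apply: ler_wsqrtr.
rewrite sqrrD !real_normK ?num_real// addrAC lerDl.
by rewrite mulrn_wge0// mulr_ge0.
Qed.

Lemma oneD_enorm_le z : 1 + enorm z <= (1 + `|z.1|) * (1 + `|z.2|).
Proof.
have := enorm_le_sum z; have : 0 <= `|z.1| * `|z.2| by rewrite mulr_ge0.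
lra.
Qed.

(** The weight is at most [(1 + |z.1|) (1 + |z.2|)], so both variables separate. Each Gaussian is
    widened twice: to [2 t] for the derivative and to [4 t] for the weight. *)
Lemma heat_grad_weight_le : exists C : R, 0 < C /\ forall (i : bool) t z, 0 < t -> t <= 1 ->
  (1 + enorm z) * `|heat_grad i t z| <=
  C / Num.sqrt t * (gau (4 * t) z.1 * gau (4 * t) z.2).
Proof.
have [c [c1 cB]] := gau_bounds.
have c0 : 0 <= c by exact: le_trans c1.
exists (c * c * (c * c)); split; first by rewrite !mulr_gt0// (lt_le_trans _ c1).
move=> i t z t0 t1.
have u0 : 0 <= (Num.sqrt t)^-1 by rewrite invr_ge0 sqrtr_ge0.
have t4 : t <= 4 by lra.
have t20 : 0 < 2 * t by rewrite mulr_gt0.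
have t24 : 2 * t <= 4 by lra.
have E4 : 2 * (2 * t) = 4 * t by ring.
have p0 (r : R) : 0 <= 1 + `|r| by rewrite addr_ge0.
have Wg r : (1 + `|r|) * gau t r <= c * c * gau (4 * t) r.
  have [h _ _ _] := cB t r t0 t4; have [_ _ _] := cB _ r t20 t24; rewrite E4 => h'.
  by rewrite (le_trans (ler_wpM2l (p0 r) h))// mulrCA -mulrA ler_wpM2l.
have Wd r : (1 + `|r|) * `|dgau t r| <= c * c / Num.sqrt t * gau (4 * t) r.
  have [_ h _ _] := cB t r t0 t4; have [_ _ _] := cB _ r t20 t24; rewrite E4 => h'.
  rewrite (le_trans (ler_wpM2l (p0 r) h))// mulrCA.
  have -> : c * c / Num.sqrt t * gau (4 * t) r = c / Num.sqrt t * (c * gau (4 * t) r) by ring.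
  by rewrite ler_wpM2l// mulr_ge0.
apply: (le_trans (ler_wpM2r (normr_ge0 _) (oneD_enorm_le z))).
have key (a b : R) : (1 + `|a|) * (1 + `|b|) * (`|dgau t a| * `|gau t b|) <=
    c * c * (c * c) / Num.sqrt t * (gau (4 * t) a * gau (4 * t) b).
  rewrite (ger0_norm (gau_ge0 _ _)) mulrACA.
  have -> : c * c * (c * c) / Num.sqrt t * (gau (4 * t) a * gau (4 * t) b) =
    (c * c / Num.sqrt t * gau (4 * t) a) * (c * c * gau (4 * t) b) by ring.
  apply: ler_pM; [exact: mulr_ge0| |exact: Wd|exact: Wg].
  by apply: mulr_ge0; [exact: p0|exact: gau_ge0].
rewrite /heat_grad; case: i; rewrite normrM; first exact: key.
rewrite (mulrC (1 + _)) (mulrC `|gau _ _|) (mulrC (gau (4 * t) z.1)); exact: key.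
Qed.

(** A bound in [x] for [wall_grad] and for the image and wall parts of [stokes_kernel]. Its terms
    come from the image Gaussian, the wall integral and the boundary term of the normal derivative;
    each is a product whose mass in [x] is at most one, whatever [y]. *)
Definition wall_majorant t x y : R :=
  gau (2 * t) (x.1 - y.1) * gau (4 * t) (x.2 + y.2)
  + (wall (gau (2 * t)) (gau (2 * t)) 0 y.2 (x.1 - y.1) + avg (gau t) y.2 (x.1 - y.1))
    * gau (4 * t) x.2.

(** The powers of [t] balance. The image and boundary terms carry one derivative, of size
    [1 / sqrt t]; the wall integrals carry two, of size [1 / t], but gain [sqrt t] from
    [wall_abs_le]. The weight is absorbed by the Gaussian in [x.2] or in [x.2 + y.2]. *)
Lemma wall_grad_le : exists C : R, 0 < C /\ forall (i : bool) t x y,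
  0 < t -> t <= 1 -> 0 < x.2 -> 0 < y.2 ->
  (1 + 2 * x.2) * `|wall_grad i t x y| <= C / Num.sqrt t * wall_majorant t x y.
Proof.
have [c [c1 cB]] := gau_bounds.
have c0 : 0 <= c by exact: le_trans c1.
pose S : R := Num.sqrt (8 * pi); have S0 : 0 <= S by exact: sqrtr_ge0.
exists (4 * (c * c * c) * (1 + S)); split.
  by rewrite !mulr_gt0// ?(lt_le_trans _ c1)// ltr_wpDr.
move=> i t x y t0 t1 x0 y0.
have t4 : t <= 4 by lra.
have t20 : 0 < 2 * t by rewrite mulr_gt0.
have t24 : 2 * t <= 4 by lra.
have E4 : 2 * (2 * t) = 4 * t by ring.
have q0 : 0 < Num.sqrt t by rewrite sqrtr_gt0.
have [u u0 uq] : exists2 u, 0 <= u & (Num.sqrt t)^-1 = u.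
  by exists (Num.sqrt t)^-1 => //; rewrite invr_ge0 ltW.
have qu : Num.sqrt t * u = 1 by rewrite -uq mulfV// gt_eqF.
have tu : t^-1 = u * u by rewrite -uq -invfM -expr2 sqr_sqrtr// ltW.
pose a := x.1 - y.1; pose G := gau (4 * t) x.2; pose Z := wall (gau (2 * t)) (gau (2 * t)) 0 y.2 a.
pose V := avg (gau t) y.2 a; pose A := gau (2 * t) a; pose B := gau (4 * t) (x.2 + y.2).
have G0 : 0 <= G by exact: gau_ge0.
have A0 : 0 <= A by exact: gau_ge0.
have B0 : 0 <= B by exact: gau_ge0.
have V0 : 0 <= V by apply: avg_ge0 => r; exact: gau_ge0.
have Z0 : 0 <= Z by apply: wall_ge0 => r; exact: gau_ge0.
have w0 : 0 <= 1 + x.2 by rewrite addr_ge0// ltW.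
have W2 : (1 + x.2) * gau (2 * t) x.2 <= c * G.
  have [_ _ _] := cB _ x.2 t20 t24; by rewrite E4 (gtr0_norm x0).
have xy0 : 0 < x.2 + y.2 by rewrite addr_gt0.
have WB : (1 + x.2) * gau (2 * t) (x.2 + y.2) <= c * B.
  have [_ _ _] := cB _ (x.2 + y.2) t20 t24; rewrite E4 (gtr0_norm xy0).
  by apply: le_trans; rewrite ler_wpM2r ?gau_ge0//; lra.
have wl (p q : R -> R) (P Q : R) : continuous p -> continuous q ->
    (forall r, `|p r| <= P * gau (2 * t) r) -> (forall r, `|q r| <= Q * gau (2 * t) r) ->
    0 <= P -> 0 <= Q ->
    (1 + x.2) * `|wall p q x.2 y.2 a| <= P * Q * (S * Num.sqrt t) * (c * G * Z).
  move=> cp cq pP qQ P0 Q0.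
  have := wall_abs_le y.2 a t20 (ltW x0) cp cq pP qQ; rewrite sqrt_pi8 -/S -/Z => h.
  apply: (le_trans (ler_wpM2l w0 h)).
  have -> : (1 + x.2) * (P * Q * (S * Num.sqrt t) * (gau (2 * t) x.2 * Z)) =
    P * Q * (S * Num.sqrt t) * ((1 + x.2) * gau (2 * t) x.2 * Z) by ring.
  apply: ler_wpM2l; last by apply: ler_wpM2r.
  by rewrite !mulr_ge0// ltW.
have gb r : gau t r <= c * gau (2 * t) r by have [] := cB t r t0 t4.
have gb' r : `|gau t r| <= c * gau (2 * t) r by rewrite (ger0_norm (gau_ge0 _ _)).
have db r : `|dgau t r| <= c * u * gau (2 * t) r by rewrite -uq; have [] := cB t r t0 t4.
have ddb r : `|ddgau t r| <= c * (u * u) * gau (2 * t) r by rewrite -tu; have [] := cB t r t0 t4.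
have cu0 : 0 <= c * u by rewrite mulr_ge0.
have cuu0 : 0 <= c * (u * u) by rewrite !mulr_ge0.
have le2 (e : R) : 0 <= e -> (1 + 2 * x.2) * e <= 2 * ((1 + x.2) * e).
  by move=> e0; rewrite mulrA ler_wpM2r//; lra.
have a1 : 0 <= c * c * c * u * (A * B) by rewrite !mulr_ge0.
have a2 : 0 <= c * c * c * u * (Z * G) by rewrite !mulr_ge0.
have a3 : 0 <= c * c * c * u * (V * G) by rewrite !mulr_ge0.
have a4 : 0 <= S * (c * c * c * u * (A * B)) by rewrite mulr_ge0.
have a5 : 0 <= S * (c * c * c * u * (Z * G)) by rewrite mulr_ge0.
have a6 : 0 <= S * (c * c * c * u * (V * G)) by rewrite mulr_ge0.
have cc : c * c * u * (V * G) <= c * c * c * u * (V * G).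
  have -> : c * c * c * u * (V * G) = c * (c * c * u * (V * G)) by ring.
  by rewrite ler_peMl// !mulr_ge0.
rewrite uq /wall_majorant -/a -/G -/Z -/V -/A -/B.
have -> : 4 * (c * c * c) * (1 + S) * u * (A * B + (Z + V) * G) =
  4 * (c * c * c * u * (A * B) + c * c * c * u * (Z * G) + c * c * c * u * (V * G)
     + S * (c * c * c * u * (A * B)) + S * (c * c * c * u * (Z * G)) + S * (c * c * c * u * (V * G))) by ring.
apply: (le_trans (le2 _ (normr_ge0 _))).
rewrite /wall_grad; case: i; rewrite -/a.
- have H1 : (1 + x.2) * (`|dgau t a| * gau t (x.2 + y.2)) <= c * c * c * u * (A * B).
    have -> : c * c * c * u * (A * B) = (c * u * A) * (c * (c * B)) by ring.
    rewrite mulrCA; apply: ler_pM; [exact: normr_ge0| |exact: db|].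
      by rewrite mulr_ge0// gau_ge0.
    apply: (le_trans (ler_wpM2l w0 (gb _))); rewrite mulrCA; exact: ler_wpM2l.
  have H2 := wl _ _ _ _ (continuous_dgau t0) (continuous_dgau t0) db db cu0 cu0.
  have E2 : c * u * (c * u) * (S * Num.sqrt t) * (c * G * Z) = S * (c * c * c * u * (Z * G)) * (Num.sqrt t * u) by ring.
  rewrite E2 qu mulr1 in H2.
  apply: (@le_trans _ _ (2 * ((1 + x.2) * (`|dgau t a| * gau t (x.2 + y.2)) +
      2 * ((1 + x.2) * `|wall (dgau t) (dgau t) x.2 y.2 a|)))).
    rewrite ler_wpM2l// [X in _ <= _ + X]mulrCA -mulrDr ler_wpM2l//.
    apply: (le_trans (ler_normB _ _)); apply: lerD.
      by rewrite normrM (ger0_norm (gau_ge0 t (x.2 + y.2))).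
    by rewrite normrM (ger0_norm (_ : 0 <= 2)).
  lra.
- have H1 : (1 + x.2) * (gau t a * `|dgau t (x.2 + y.2)|) <= c * c * c * u * (A * B).
    have -> : c * c * c * u * (A * B) = (c * A) * (c * u * (c * B)) by ring.
    rewrite mulrCA; apply: ler_pM; [exact: gau_ge0| |exact: gb|].
      by rewrite mulr_ge0.
    apply: (le_trans (ler_wpM2l w0 (db _))); rewrite mulrCA; exact: ler_wpM2l.
  have H2 := wl _ _ _ _ (continuous_ddgau t0) (continuous_gau t0) ddb gb' cuu0 c0.
  have E2 : c * (u * u) * c * (S * Num.sqrt t) * (c * G * Z) = S * (c * c * c * u * (Z * G)) * (Num.sqrt t * u) by ring.
  rewrite E2 qu mulr1 in H2.
  have H3 : (1 + x.2) * (`|dgau t x.2| * V) <= c * c * u * (V * G).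
    have -> : c * c * u * (V * G) = c * u * (c * G) * V by ring.
    rewrite [X in X <= _]mulrA; apply: ler_wpM2r => //.
    apply: (le_trans (ler_wpM2l w0 (db _))); rewrite mulrCA; exact: ler_wpM2l.
  apply: (@le_trans _ _ (2 * (2 * ((1 + x.2) * (`|dgau t x.2| * V)) + 2 * ((1 + x.2) *
      `|wall (ddgau t) (gau t) x.2 y.2 a|) + (1 + x.2) * (gau t a * `|dgau t (x.2 + y.2)|)))).
    rewrite ler_wpM2l//.
    have -> : 2 * ((1 + x.2) * (`|dgau t x.2| * V)) + 2 * ((1 + x.2) *
      `|wall (ddgau t) (gau t) x.2 y.2 a|) + (1 + x.2) * (gau t a * `|dgau t (x.2 + y.2)|) =
      (1 + x.2) * (2 * (`|dgau t x.2| * V + `|wall (ddgau t) (gau t) x.2 y.2 a|) + gau t a * `|dgau t (x.2 + y.2)|) by ring.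
    rewrite ler_wpM2l//.
    apply: (le_trans (ler_normB _ _)); apply: lerD.
      rewrite normrM (ger0_norm (_ : 0 <= 2))// ler_wpM2l//.
      by apply: (le_trans (ler_normD _ _)); rewrite normrM (ger0_norm V0).
    by rewrite normrM (ger0_norm (gau_ge0 _ _)).
  lra.
Qed.

(** The weight is moved to the other variable by [1 + x.2 <= (1 + y.2) (1 + |x.2 - y.2|)]. No
    singularity in time is left: the single derivative in the wall integral is compensated by
    [sqrt t]. It is needed only at the centre [z] of the initial vortex, where the factor [1 + y.2]
    is fixed. *)
Lemma stokes_kernel_le : exists C : R, 0 < C /\ forall t x y,
  0 < t -> t <= 1 -> 0 < x.2 -> 0 < y.2 ->
  (1 + 2 * x.2) * `|stokes_kernel t x y| <= C * (1 + y.2) *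
    (gau (2 * t) (x.1 - y.1) * gau (4 * t) (x.2 - y.2) + wall_majorant t x y).
Proof.
have [c [c1 cB]] := gau_bounds.
have c0 : 0 <= c by exact: le_trans c1.
pose S : R := Num.sqrt (8 * pi); have S0 : 0 <= S by exact: sqrtr_ge0.
exists (4 * (c * c * c) * (1 + S)); split.
  by rewrite !mulr_gt0// ?(lt_le_trans _ c1)// ltr_wpDr.
move=> t x y t0 t1 x0 y0.
have t4 : t <= 4 by lra.
have t20 : 0 < 2 * t by rewrite mulr_gt0.
have t24 : 2 * t <= 4 by lra.
have E4 : 2 * (2 * t) = 4 * t by ring.
have q0 : 0 < Num.sqrt t by rewrite sqrtr_gt0.
have [u u0 uq] : exists2 u, 0 <= u & (Num.sqrt t)^-1 = u.
  by exists (Num.sqrt t)^-1 => //; rewrite invr_ge0 ltW.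
have qu : Num.sqrt t * u = 1 by rewrite -uq mulfV// gt_eqF.
pose a := x.1 - y.1; pose G := gau (4 * t) x.2; pose Z := wall (gau (2 * t)) (gau (2 * t)) 0 y.2 a.
pose V := avg (gau t) y.2 a; pose A := gau (2 * t) a; pose B := gau (4 * t) (x.2 + y.2).
pose B' := gau (4 * t) (x.2 - y.2).
have G0 : 0 <= G by exact: gau_ge0.
have A0 : 0 <= A by exact: gau_ge0.
have B0 : 0 <= B by exact: gau_ge0.
have B'0 : 0 <= B' by exact: gau_ge0.
have V0 : 0 <= V by apply: avg_ge0 => r; exact: gau_ge0.
have Z0 : 0 <= Z by apply: wall_ge0 => r; exact: gau_ge0.
have w0 : 0 <= 1 + x.2 by rewrite addr_ge0// ltW.
have v0 : 0 <= 1 + y.2 by rewrite addr_ge0// ltW.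
have W2 : (1 + x.2) * gau (2 * t) x.2 <= c * G.
  have [_ _ _] := cB _ x.2 t20 t24; by rewrite E4 (gtr0_norm x0).
have gb r : gau t r <= c * gau (2 * t) r by have [] := cB t r t0 t4.
have gb' r : `|gau t r| <= c * gau (2 * t) r by rewrite (ger0_norm (gau_ge0 _ _)).
have db r : `|dgau t r| <= c * u * gau (2 * t) r by rewrite -uq; have [] := cB t r t0 t4.
have Wr r : 1 + x.2 <= (1 + y.2) * (1 + `|r|) ->
    (1 + x.2) * (gau t a * gau t r) <= (1 + y.2) * (c * c * c * (A * gau (4 * t) r)).
  move=> h; have [_ _ _] := cB _ r t20 t24; rewrite E4 => h2.
  have g1 : gau t a * gau t r <= (c * A) * (c * gau (2 * t) r).
    by rewrite ler_pM ?gau_ge0.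
  apply: (le_trans (ler_wpM2l w0 g1)).
  have -> : (1 + x.2) * (c * A * (c * gau (2 * t) r)) = c * A * c * ((1 + x.2) * gau (2 * t) r) by ring.
  have -> : (1 + y.2) * (c * c * c * (A * gau (4 * t) r)) = c * A * c * ((1 + y.2) * (c * gau (4 * t) r)) by ring.
  rewrite ler_wpM2l ?mulr_ge0//.
  apply: (le_trans (ler_wpM2r (gau_ge0 _ _) h)); rewrite -mulrA ler_wpM2l//.
have H1 := Wr (x.2 - y.2); have H2 := Wr (x.2 + y.2).
have {}H1 : (1 + x.2) * (gau t a * gau t (x.2 - y.2)) <= (1 + y.2) * (c * c * c * (A * B')).
  apply: H1; have := ler_norm (x.2 - y.2); have := normr_ge0 (x.2 - y.2).
  by move: `|_| => n n0 nl; nra.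
have {}H2 : (1 + x.2) * (gau t a * gau t (x.2 + y.2)) <= (1 + y.2) * (c * c * c * (A * B)).
  apply: H2; have := ler_norm (x.2 + y.2); have := normr_ge0 (x.2 + y.2).
  by move: `|_| => n n0 nl; nra.
have cu0 : 0 <= c * u by rewrite mulr_ge0.
have H3 : (1 + x.2) * `|wall (dgau t) (gau t) x.2 y.2 a| <= (1 + y.2) * (S * (c * c * c * (Z * G))).
  have := wall_abs_le y.2 a t20 (ltW x0) (continuous_dgau t0) (continuous_gau t0) db gb'.
  rewrite sqrt_pi8 -/S -/Z => h.
  apply: (le_trans (ler_wpM2l w0 h)).
  have -> : (1 + x.2) * (c * u * c * (S * Num.sqrt t) * (gau (2 * t) x.2 * Z)) =
     S * (c * c * ((1 + x.2) * gau (2 * t) x.2 * Z)) * (Num.sqrt t * u) by ring.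
  rewrite qu mulr1.
  apply: (@le_trans _ _ (S * (c * c * c * (Z * G)))).
    rewrite ler_wpM2l//.
    have -> : c * c * c * (Z * G) = c * c * (c * G * Z) by ring.
    by rewrite ler_wpM2l ?mulr_ge0// ler_wpM2r.
  by rewrite ler_peMl ?lerDl ?(ltW y0)// !mulr_ge0.
have le2 (e : R) : 0 <= e -> (1 + 2 * x.2) * e <= 2 * ((1 + x.2) * e).
  by move=> e0; rewrite mulrA ler_wpM2r//; lra.
have b1 : 0 <= (1 + y.2) * (c * c * c * (A * B')) by rewrite !mulr_ge0.
have b2 : 0 <= (1 + y.2) * (c * c * c * (A * B)) by rewrite !mulr_ge0.
have b3 : 0 <= (1 + y.2) * (c * c * c * (Z * G)) by rewrite !mulr_ge0.
have b4 : 0 <= (1 + y.2) * (c * c * c * (V * G)) by rewrite !mulr_ge0.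
have b5 : 0 <= S * ((1 + y.2) * (c * c * c * (A * B'))) by rewrite mulr_ge0.
have b6 : 0 <= S * ((1 + y.2) * (c * c * c * (A * B))) by rewrite mulr_ge0.
have b7 : 0 <= S * ((1 + y.2) * (c * c * c * (Z * G))) by rewrite mulr_ge0.
have b8 : 0 <= S * ((1 + y.2) * (c * c * c * (V * G))) by rewrite mulr_ge0.
rewrite /wall_majorant -/a -/G -/Z -/V -/A -/B -/B'.
apply: (le_trans (le2 _ (normr_ge0 _))).
have -> : 4 * (c * c * c) * (1 + S) * (1 + y.2) * (A * B' + (A * B + (Z + V) * G)) =
  4 * ((1 + y.2) * (c * c * c * (A * B')) + (1 + y.2) * (c * c * c * (A * B))
     + (1 + y.2) * (c * c * c * (Z * G)) + (1 + y.2) * (c * c * c * (V * G))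
     + S * ((1 + y.2) * (c * c * c * (A * B'))) + S * ((1 + y.2) * (c * c * c * (A * B)))
     + S * ((1 + y.2) * (c * c * c * (Z * G))) + S * ((1 + y.2) * (c * c * c * (V * G)))) by ring.
apply: (@le_trans _ _ (2 * ((1 + x.2) * (gau t a * gau t (x.2 - y.2)) + (1 + x.2) * (gau t a * gau t (x.2 + y.2))
   + 2 * ((1 + x.2) * `|wall (dgau t) (gau t) x.2 y.2 a|)))).
  rewrite ler_wpM2l//.
  have -> : (1 + x.2) * (gau t a * gau t (x.2 - y.2)) + (1 + x.2) * (gau t a * gau t (x.2 + y.2))
     + 2 * ((1 + x.2) * `|wall (dgau t) (gau t) x.2 y.2 a|) = (1 + x.2) * (gau t a * gau t (x.2 - y.2)
     + gau t a * gau t (x.2 + y.2) + 2 * `|wall (dgau t) (gau t) x.2 y.2 a|) by ring.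
  rewrite ler_wpM2l//.
  rewrite /stokes_kernel -/a; apply: (le_trans (ler_normD _ _)); apply: lerD.
    apply: (le_trans (ler_normB _ _)).
    by apply: lerD; rewrite ger0_norm// mulr_ge0 ?gau_ge0.
  by rewrite normrM (ger0_norm (_ : 0 <= 2)).
have E : S * ((1 + y.2) * (c * c * c * (Z * G))) = (1 + y.2) * (S * (c * c * c * (Z * G))) by ring.
rewrite -E in H3.
lra.
Qed.

Lemma integral_wall_majorant t y : 0 < t ->
  (\int[leb2]_x (wall_majorant t x y)%:E <= 3%:E)%E.
Proof.
move=> t0; have t20 : 0 < 2 * t by rewrite mulr_gt0.
have t40 : 0 < 4 * t by rewrite mulr_gt0.
have mZ : measurable_fun setT (fun a : R => wall (gau (2 * t)) (gau (2 * t)) 0 y.2 (a - y.1)).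
  apply: (@measurable_wall _ _ _ (fun=> gau (2 * t)) (fun=> gau (2 * t)) (fun=> 0) (fun=> y.2) (fun a : R => a - y.1)); try by mfun.
    by apply: (@measurable_gau _ _ _ (fun=> 2 * t)); mfun.
  by apply: (@measurable_gau _ _ _ (fun=> 2 * t)); mfun.
have mA : measurable_fun setT (fun a : R => avg (gau t) y.2 (a - y.1)).
  apply: (@measurable_avg _ _ _ (fun=> gau t) (fun=> y.2) (fun a : R => a - y.1)); try by mfun.
  by apply: (@measurable_gau _ _ _ (fun=> t)); mfun.
have Z0 a : 0 <= wall (gau (2 * t)) (gau (2 * t)) 0 y.2 a by apply: wall_ge0 => r; exact: gau_ge0.
have A0 a : 0 <= avg (gau t) y.2 a by apply: avg_ge0 => r; exact: gau_ge0.
have mg s c : measurable_fun setT (fun r : R => gau s (r + c)) by rewrite /gau; mfun.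
have mg' s c : measurable_fun setT (fun r : R => gau s (r - c)) by rewrite /gau; mfun.
have mg0 s : measurable_fun setT (@gau R s) by rewrite /gau; mfun.
rewrite /wall_majorant int_addr; last 4 first.
- by apply: measurable_funM; [apply: (measurableT_comp (mg' _ _))|apply: (measurableT_comp (mg _ _))]; mfun.
- apply: measurable_funM; last by apply: (measurableT_comp (mg0 _)); mfun.
  by apply: measurable_funD; [apply: (measurableT_comp mZ)|apply: (measurableT_comp mA)]; mfun.
- by move=> x; rewrite mulr_ge0 ?gau_ge0.
- by move=> x; rewrite mulr_ge0 ?gau_ge0 ?addr_ge0.
rewrite (leb2_prod (f := fun r => gau (2 * t) (r - y.1)) (g := fun r => gau (4 * t) (r + y.2))); last 4 first.
- exact: mg'.
- exact: mg.
- by move=> r; exact: gau_ge0.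
- by move=> r; exact: gau_ge0.
rewrite (leb2_prod (f := fun r => wall (gau (2 * t)) (gau (2 * t)) 0 y.2 (r - y.1) + avg (gau t) y.2 (r - y.1)) (g := gau (4 * t))); last 4 first.
- exact: measurable_funD.
- exact: mg0.
- by move=> r; rewrite addr_ge0.
- by move=> r; exact: gau_ge0.
have Eg s c : 0 < s -> (\int[mu]_r (gau s (r - c))%:E = 1)%E.
  move=> s0; rewrite (ge0_integral_translate c (f := fun a => (gau s a)%:E)) ?integral_gau//.
  - by apply/measurable_EFinP.
  - by move=> r; rewrite lee_fin gau_ge0.
rewrite Eg// -[y.2 in X in (_ * X + _)%E]opprK Eg// integral_gau// mule1 mule1.
rewrite int_addr; [|exact: mZ|exact: mA|by move=> r; exact: Z0|by move=> r; exact: A0].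
have -> : 3%:E = (1 + (1 + 1))%E :> \bar R by rewrite -!EFinD; congr (_%:E); ring.
apply: leeD; first by [].
apply: leeD.
- rewrite (ge0_integral_translate y.1 (f := fun a => (wall (gau (2 * t)) (gau (2 * t)) 0 y.2 a)%:E)).
  + exact: integral_wall_gau.
  + apply/measurable_EFinP; apply: eq_measurable_fun (measurableT_comp mZ (g := fun a : R => a + y.1) _).
      by move=> a _ /=; rewrite addrK.
    by mfun.
  + by move=> a; rewrite lee_fin.
- rewrite (ge0_integral_translate y.1 (f := fun a => (avg (gau t) y.2 a)%:E)).
  + exact: integral_avg_gau.
  + apply/measurable_EFinP; apply: eq_measurable_fun (measurableT_comp mA (g := fun a : R => a + y.1) _).
      by move=> a _ /=; rewrite addrK.
    by mfun.
  + by move=> a; rewrite lee_fin.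
Qed.

End KernelEstimates.

Section KernelIntegrals.
Context {R : realType}.
Notation mu := (@lebesgue_measure R).
Notation plane := (measurableTypeR R * measurableTypeR R)%type.
Implicit Types (t : R) (x y z : R * R).

Lemma integral_gau2 t : 0 < t -> (\int[leb2]_z (gau t z.1 * gau t z.2)%:E = 1 :> \bar R)%E.
Proof.
move=> t0.
have mg : measurable_fun setT (@gau R t) by rewrite /gau; mfun.
have g0 r : 0 <= gau t r by exact: gau_ge0.
by rewrite (leb2_prod mg mg g0 g0) integral_gau// mule1.
Qed.

Lemma measurable_wall_majorant t y :
  measurable_fun [set: plane] (fun x => wall_majorant t x y).
Proof.
rewrite /wall_majorant; apply: measurable_funD.
  by rewrite /gau; mfun.
apply: measurable_funM; last by rewrite /gau; mfun.
apply: measurable_funD.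
- apply: (@measurable_wall _ _ plane (fun=> gau (2 * t)) (fun=> gau (2 * t)) (fun=> 0) (fun=> y.2) (fun x => x.1 - y.1)); try by mfun.
    by apply: (@measurable_gau _ _ _ (fun=> 2 * t)); mfun.
  by apply: (@measurable_gau _ _ _ (fun=> 2 * t)); mfun.
- apply: (@measurable_avg _ _ plane (fun=> gau t) (fun=> y.2) (fun x => x.1 - y.1)); try by mfun.
  by apply: (@measurable_gau _ _ _ (fun=> t)); mfun.
Qed.

Lemma wall_majorant_ge0 t x y : 0 <= wall_majorant t x y.
Proof.
rewrite /wall_majorant addr_ge0 ?mulr_ge0 ?gau_ge0// addr_ge0//.
- by apply: wall_ge0 => r; exact: gau_ge0.
- by apply: avg_ge0 => r; exact: gau_ge0.
Qed.

Lemma integral_heat_grad_weight : exists C : R, 0 < C /\ forall (i : bool) t, 0 < t -> t <= 1 ->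
  (\int[leb2]_z ((1 + enorm z) * `|heat_grad i t z|)%:E <= (C / Num.sqrt t)%:E)%E.
Proof.
have [C [C0 CB]] := @heat_grad_weight_le R; exists C; split => // i t t0 t1.
have t40 : 0 < 4 * t by rewrite mulr_gt0.
have mg : measurable_fun [set: plane] (fun z => gau (4 * t) z.1 * gau (4 * t) z.2).
  by rewrite /gau; mfun.
apply: (@le_trans _ _ (\int[leb2]_z (C / Num.sqrt t * (gau (4 * t) z.1 * gau (4 * t) z.2))%:E)%E).
  apply: int_mono.
  - apply: measurable_funM; first by rewrite /enorm; mfun.
    apply: measurableT_comp => //.
    by apply: (@measurable_heat_grad _ plane _ (fun=> t) id); mfun.
  - by apply: measurable_funM => //; exact: measurable_cst.
  - by move=> z; rewrite mulr_ge0// addr_ge0// enorm_ge0.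
  - by move=> z; exact: CB.
rewrite int_scale.
- by rewrite integral_gau2// mule1.
- exact: mg.
- by move=> z; rewrite mulr_ge0 ?gau_ge0.
- by rewrite divr_ge0 ?sqrtr_ge0// ltW.
Qed.

Lemma integral_wall_grad_weight : exists C : R, 0 < C /\ forall (i : bool) t y,
  0 < t -> t <= 1 -> 0 < y.2 ->
  (\int[leb2]_x (if (0 < x.2)%R then ((1 + 2 * x.2) * `|wall_grad i t x y|)%R else 0%R)%:E
    <= (C / Num.sqrt t)%:E)%E.
Proof.
have [C [C0 CB]] := @wall_grad_le R; exists (C * 3); split; first by rewrite mulr_gt0.
move=> i t y t0 t1 y0.
have c0 : 0 <= C / Num.sqrt t by rewrite divr_ge0 ?sqrtr_ge0// ltW.
apply: (@le_trans _ _ (\int[leb2]_x (C / Num.sqrt t * wall_majorant t x y)%:E)%E).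
  apply: int_mono.
  - apply: measurable_fun_ifT; [by mfun| |exact: measurable_cst].
    apply: measurable_funM; first by mfun.
    apply: measurableT_comp => //.
    by apply: (@measurable_wall_grad _ plane _ (fun=> t) id (fun=> y)); mfun.
  - by apply: measurable_funM; [exact: measurable_cst|exact: measurable_wall_majorant].
  - by move=> x; case: ifP => // x0; rewrite mulr_ge0// addr_ge0// mulr_ge0// ltW.
  - move=> x; case: ifP => x0; first exact: CB.
    by rewrite mulr_ge0// wall_majorant_ge0.
rewrite int_scale; [|exact: measurable_wall_majorant|by move=> x; exact: wall_majorant_ge0|exact: c0].
have -> : (C * 3 / Num.sqrt t)%:E = ((C / Num.sqrt t)%:E * 3%:E)%E by rewrite -EFinM; congr (_%:E); ring.
by apply: lee_wpmul2l; [rewrite lee_fin|exact: integral_wall_majorant].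
Qed.

Lemma integral_stokes_kernel_weight y : 0 < y.2 -> exists C : R, 0 < C /\ forall t,
  0 < t -> t <= 1 ->
  (\int[leb2]_x (if (0 < x.2)%R then ((1 + 2 * x.2) * `|stokes_kernel t x y|)%R else 0%R)%:E
    <= C%:E)%E.
Proof.
move=> y0; have [C [C0 CB]] := @stokes_kernel_le R.
exists (C * (1 + y.2) * 4); split; first by rewrite !mulr_gt0// addr_gt0.
move=> t t0 t1.
have t20 : 0 < 2 * t by rewrite mulr_gt0.
have t40 : 0 < 4 * t by rewrite mulr_gt0.
have c0 : 0 <= C * (1 + y.2) by rewrite mulr_ge0 ?(ltW C0)// addr_ge0// ltW.
have mg : measurable_fun [set: plane] (fun x => gau (2 * t) (x.1 - y.1) * gau (4 * t) (x.2 - y.2)).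
  by rewrite /gau; mfun.
have g0 (x : plane) : 0 <= gau (2 * t) (x.1 - y.1) * gau (4 * t) (x.2 - y.2).
  by rewrite mulr_ge0 ?gau_ge0.
apply: (@le_trans _ _ (\int[leb2]_x (C * (1 + y.2) * (gau (2 * t) (x.1 - y.1) * gau (4 * t) (x.2 - y.2) + wall_majorant t x y))%:E)%E).
  apply: int_mono.
  - apply: measurable_fun_ifT; [by mfun| |exact: measurable_cst].
    apply: measurable_funM; first by mfun.
    apply: measurableT_comp => //.
    by apply: (@measurable_stokes_kernel _ plane _ (fun=> t) id (fun=> y)); mfun.
  - apply: measurable_funM; [exact: measurable_cst|].
    by apply: measurable_funD; [exact: mg|exact: measurable_wall_majorant].
  - by move=> x; case: ifP => // x0; rewrite mulr_ge0// addr_ge0// mulr_ge0// ltW.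
  - move=> x; case: ifP => x0; first exact: CB.
    by rewrite mulr_ge0// addr_ge0 ?wall_majorant_ge0.
rewrite int_scale; last 3 first.
- by apply: measurable_funD; [exact: mg|exact: measurable_wall_majorant].
- by move=> x; rewrite addr_ge0 ?wall_majorant_ge0.
- exact: c0.
rewrite [leRHS]EFinM; apply: lee_wpmul2l; first by rewrite lee_fin.
rewrite int_addr; [|exact: mg|exact: measurable_wall_majorant|exact: g0|by move=> x; exact: wall_majorant_ge0].
have -> : 4%:E = (1 + 3%:E)%E :> \bar R by rewrite -!EFinD; congr (_%:E); ring.
apply: leeD; last exact: integral_wall_majorant.
have mg1 s (c : R) : measurable_fun setT (fun r : R => gau s (r - c)) by rewrite /gau; mfun.
have g1 s (c r : R) : 0 <= gau s (r - c) by exact: gau_ge0.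
rewrite (leb2_prod (mg1 (2 * t) y.1) (mg1 (4 * t) y.2) (g1 _ _) (g1 _ _)).
have Eg (s c : R) : 0 < s -> (\int[mu]_r (gau s (r - c))%:E = 1)%E.
  move=> s0; rewrite (ge0_integral_translate c (f := fun a => (gau s a)%:E)); first exact: integral_gau.
  - by apply/measurable_EFinP; exact: measurable_gau.
  - by move=> r; rewrite lee_fin gau_ge0.
by rewrite !Eg// mule1.
Qed.

Lemma heat_gradN (i : bool) t z : heat_grad i t (- z) = - heat_grad i t z.
Proof. by rewrite /heat_grad /= !gauN !dgauN; case: i; rewrite ?mulNr ?mulrN. Qed.

Lemma integrable_heat_grad (i : bool) t y : 0 < t -> t <= 1 ->
  leb2.-integrable setT (fun x : plane => (heat_grad i t (x - y))%:E).
Proof.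
move=> t0 t1; have [C [C0 CB]] := integral_heat_grad_weight.
have mh : measurable_fun [set: plane] (fun z => heat_grad i t z).
  by apply: (@measurable_heat_grad _ plane _ (fun=> t) id); mfun.
apply/integrableP; split.
  by apply/measurable_EFinP; apply: (measurableT_comp mh); mfun.
rewrite (leb2_translate y (f := fun z => `|(heat_grad i t z)%:E|)%E); last 2 first.
- by apply: measurableT_comp => //; apply/measurable_EFinP.
- by move=> z; exact: abse_ge0.
apply: (le_lt_trans _ (ltry (C / Num.sqrt t))); apply: le_trans (CB i t t0 t1).
apply: int_mono.
- exact: measurableT_comp.
- apply: measurable_funM; first by rewrite /enorm; mfun.
  exact: measurableT_comp.
- by [].
- by move=> z; rewrite ler_peMl// lerDl enorm_ge0.
Qed.

(* By oddness: the positive and negative parts are exchanged by [z |-> - z]. *)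
Lemma integral_heat_grad0 (i : bool) t y : 0 < t -> t <= 1 ->
  \int[leb2]_x heat_grad i t (x - y) = 0.
Proof.
move=> t0 t1.
have I := integrable_heat_grad i 0 t0 t1.
have mh : measurable_fun [set: plane] (fun z => (heat_grad i t z)%:E).
  by apply/measurable_EFinP; apply: (@measurable_heat_grad _ plane _ (fun=> t) id); mfun.
pose h (z : plane) : \bar R := (heat_grad i t z)%:E.
have Ep : (\int[leb2]_x (fun x : plane => h (x - y)%R)^\+ x = \int[leb2]_x h^\+ x)%E.
  rewrite -(leb2_translate y (f := h^\+%E)); last 2 first.
  - exact: measurable_funepos.
  - by move=> z; exact: funepos_ge0.
  by apply: eq_integral => x _; rewrite !funeposE.
have En : (\int[leb2]_x (fun x : plane => h (x - y)%R)^\- x = \int[leb2]_x h^\+ x)%E.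
  rewrite -(leb2_reflect y (f := h^\+%E)); last 2 first.
  - exact: measurable_funepos.
  - by move=> z; exact: funepos_ge0.
  apply: eq_integral => x _.
  by rewrite funeposE funenegE /h -(opprB x y) heat_gradN EFinN.
have Ih : leb2.-integrable setT h.
  by apply: eq_integrable I => // z _; rewrite /= subr0.
have E : (\int[leb2]_x (h (x - y)%R) = 0)%E.
  rewrite integralE Ep En subee//.
  exact: (integrable_fin_num measurableT (integrable_funepos measurableT Ih)).
by rewrite /Rintegral E.
Qed.

End KernelIntegrals.

Lemma lipschitz_MVT (R : realType) (f df : R -> R) (M a b : R) : a <= b ->
  (forall r : R, a <= r <= b -> is_derive r 1 f (df r)) ->
  (forall r, a <= r <= b -> `|df r| <= M) -> `|f b - f a| <= M * (b - a).
Proof.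
move=> ab fd dM.
have cf : {within `[a, b], continuous f}.
  apply: continuous_in_subspaceT => r; rewrite inE/= in_itv/= => rab.
  have [d _] := fd r rab.
  by apply: differentiable_continuous; apply/derivable1_diffP.
have fd' (r : R) : r \in `]a, b[%R -> is_derive r 1 f (df r).
  by rewrite in_itv/= => /andP[h1 h2]; apply: fd; rewrite !ltW.
have [c + ->] := MVT_segment ab fd' cf.
rewrite in_itv/= => cab; rewrite normrM (ger0_norm (_ : 0 <= b - a)) ?subr_ge0//.
by rewrite ler_wpM2r ?subr_ge0// dM.
Qed.

(** * The kernel at fixed time and point as a test function *)

Section TestFunction.
Context {R : realType}.
Notation mu := (@lebesgue_measure R).
Notation plane := (measurableTypeR R * measurableTypeR R)%type.
Implicit Types (t s a r : R) (x y : R * R).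

Let lip (f df : R -> R) (M a b : R) :
  (forall r : R, is_derive r 1 f (df r)) -> (forall r, `|df r| <= M) ->
  `|f b - f a| <= M * `|b - a|.
Proof.
move=> fd dM; have [ab|/ltW ab] := leP a b.
  rewrite (ger0_norm (_ : 0 <= b - a)) ?subr_ge0//; exact: (lipschitz_MVT ab).
rewrite distrC (distrC b) (ger0_norm (_ : 0 <= a - b)) ?subr_ge0//.
exact: (lipschitz_MVT ab).
Qed.

(* The weight [1 + s + |a|] is split between the two factors of the integrand:
   [|a| <= |a - s v| + s |v|]. *)
Lemma avg_gau_decay t : 0 < t -> t <= 4 -> exists C : R, 0 < C /\ forall s a, 0 <= s ->
  (1 + s + `|a|) * avg (gau t) s a <= C.
Proof.
move=> t0 t4; have [c [c1 cB]] := @gau_bounds R.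
have c0 : 0 <= c by exact: le_trans c1.
have t20 : 0 < 2 * t by rewrite mulr_gt0.
have [M [gM _ _]] := gau_bounded t0.
have [M2 [gM2 _ _]] := gau_bounded t20.
have M20 : 0 <= M2 by exact: le_trans (gM2 0).
have M0 : 0 <= M by exact: le_trans (gM 0).
exists (c * M2 + 1); split.
  by rewrite ltr_wpDl// mulr_ge0.
move=> s a s0.
have Ig := integrable_avg (continuous_gau t0) gM s a.
rewrite -lee_fin EFinM /avg fineK; last exact: (integrable_fin_num measurableT Ig).
have w0 : 0 <= 1 + s + `|a| by rewrite !addr_ge0.
have mg : measurable_fun setT (fun v : R => gau t (a - s * v)) by rewrite /gau; mfun.
have mc : measurable_fun setT (@cau R) by rewrite /cau; mfun.
rewrite -int_scale; [|exact: measurable_funM|by move=> v; rewrite mulr_ge0 ?gau_ge0 ?cau_ge0|exact: w0].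
have cau1 v : cau v + `|v| * cau v <= 1 :> R.
  have p2 : 2 <= pi :> R by exact: pi_ge2.
  have v1 : 0 < 1 + v ^+ 2 by rewrite ltr_pwDl// sqr_ge0.
  rewrite -[X in X + _]mul1r -mulrDl /cau ler_pdivrMr ?mul1r ?mulr_gt0 ?pi_gt0//.
  have : 1 + `|v| <= 2 * (1 + v ^+ 2).
    have : `|v| ^+ 2 = v ^+ 2 by rewrite real_normK// num_real.
    by move: `|v| => n <-; nra.
  by move=> h; apply: (le_trans h); rewrite ler_wpM2r// ltW.
apply: (@le_trans _ _ (\int[mu]_v ((c * M2) * cau v + s * gau t (a - s * v))%:E)%E).
  apply: int_mono.
  - by apply: measurable_funM; [exact: measurable_cst|exact: measurable_funM].
  - by apply: measurable_funD; apply: measurable_funM => //; exact: measurable_cst.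
  - by move=> v; rewrite mulr_ge0 ?mulr_ge0 ?gau_ge0 ?cau_ge0.
  move=> v; have [_ _ _ W] := cB t (a - s * v) t0 t4.
  have W' : (1 + `|a - s * v|) * gau t (a - s * v) <= c * M2.
    apply: (le_trans W); rewrite ler_wpM2l//.
    by apply: le_trans (gM2 _); exact: ler_norm.
  have ta : `|a| <= `|a - s * v| + s * `|v|.
    rewrite -(ger0_norm s0) -normrM (ger0_norm s0).
    by rewrite -[X in `|X| <= _](subrK (s * v) a); exact: ler_normD.
  have g0 := gau_ge0 t (a - s * v); have k0 := cau_ge0 v.
  apply: (@le_trans _ _ ((1 + `|a - s * v|) * gau t (a - s * v) * cau v
      + s * gau t (a - s * v) * (cau v + `|v| * cau v))).
    have : (1 + s + `|a|) * (gau t (a - s * v) * cau v) <=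
       (1 + s + (`|a - s * v| + s * `|v|)) * (gau t (a - s * v) * cau v).
      by rewrite ler_wpM2r ?mulr_ge0// lerD2l.
    move=> /le_trans; apply; rewrite le_eqVlt; apply/orP; left; apply/eqP; ring.
  apply: lerD; first by rewrite ler_wpM2r.
  by rewrite -[leRHS]mulr1 ler_wpM2l// mulr_ge0.
rewrite int_addr; last 4 first.
- by apply: measurable_funM => //; exact: measurable_cst.
- by apply: measurable_funM => //; exact: measurable_cst.
- by move=> v; rewrite !mulr_ge0 ?cau_ge0.
- by move=> v; rewrite mulr_ge0 ?gau_ge0.
rewrite [leRHS]EFinD; apply: leeD.
  rewrite int_scale; [|exact: mc|exact: cau_ge0|exact: mulr_ge0].
  rewrite -[leRHS]mule1; apply: lee_wpmul2l; first by rewrite lee_fin mulr_ge0.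
  exact: integral_cau.
rewrite int_scale; [|exact: mg|by move=> v; exact: gau_ge0|exact: s0].
have [->|sn0] := eqVneq s 0; first by rewrite mul0e lee_fin.
have := @ge0_integral_affine _ a (- s) (fun r => (gau t r)%:E).
rewrite oppr_eq0 normrN (ger0_norm s0) integral_gau// => /(_ sn0) H.
have -> : (s%:E * \int[mu]_v (gau t (a - s * v))%:E = 1)%E.
  rewrite H; last 2 first.
  - by apply/measurable_EFinP; exact: measurable_gau.
  - by move=> r; rewrite lee_fin gau_ge0.
  by congr (_ * _)%E; apply: eq_integral => v _; rewrite mulNr.
exact: lexx.
Qed.

(** As [1 + y + |a|] is at most [(1 + |y - s|) (1 + s + |a|)], one factor is absorbed by the
    Gaussian in [y - s] and the other by the decay of the Poisson average. *)
Lemma wall_gau_decay t : 0 < t -> t <= 4 -> exists C : R, 0 < C /\ forall y a : R, 0 <= y ->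
  (1 + y + `|a|) * wall (gau t) (gau t) 0 y a <= C.
Proof.
move=> t0 t4; have [c [c1 cB]] := @gau_bounds R.
have c0 : 0 <= c by exact: le_trans c1.
have t20 : 0 < 2 * t by rewrite mulr_gt0.
have [C [C0 CB]] := avg_gau_decay t0 t4.
have [M [gM _ _]] := gau_bounded t0.
have cg := continuous_gau t0.
exists (c * C); split; first by rewrite mulr_gt0// (lt_le_trans _ c1).
move=> y a y0.
have w0 : 0 <= 1 + y + `|a| by rewrite !addr_ge0.
have I1 := integrable_wall cg cg gM (0 + y) y a.
have mg : measurable_fun setT (fun s : R => gau (2 * t) (y - s)) by rewrite /gau; mfun.
have mE (D : set R) (f : R -> R) : measurable_fun setT f -> measurable D ->
    measurable_fun D (fun s => (f s)%:E).
  by move=> mf mD; apply/measurable_EFinP; exact: measurable_funTS.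
have cgy : continuous (fun s : R => gau t (0 + y - s) * avg (gau t) s a).
  exact: (continuous_wall_integrand cg cg gM).
have mw : measurable_fun setT (fun s : R => gau t (0 + y - s) * avg (gau t) s a).
  exact: continuous_measurable_fun.
rewrite -lee_fin EFinM /wall /Rintegral fineK; last first.
  apply: integrable_fin_num; [exact: measurable_itv|exact: I1].
have f0 s : 0 <= gau t (0 + y - s) * avg (gau t) s a.
  by rewrite mulr_ge0 ?gau_ge0// avg_ge0// => r; exact: gau_ge0.
rewrite -ge0_integralZl; last 4 first.
- exact: measurable_itv.
- apply: mE => //; exact: measurable_itv.
- by move=> s _; rewrite lee_fin.
- by rewrite lee_fin.
apply: (@le_trans _ _ (\int[mu]_(s in `[0%R, y]) (c * C * gau (2 * t) (y - s))%:E)%E).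
  apply: ge0_le_integral.
  - exact: measurable_itv.
  - by move=> s _; rewrite -EFinM lee_fin mulr_ge0.
  - apply: (@eq_measurable_fun _ _ _ _ _ (fun s => ((1 + y + `|a|) * (gau t (0 + y - s) * avg (gau t) s a))%:E)).
      by move=> s _; rewrite EFinM.
    apply: mE; [by apply: measurable_funM => //; exact: measurable_cst|exact: measurable_itv].
  - apply: mE; [by apply: measurable_funM => //; exact: measurable_cst|exact: measurable_itv].
  move=> s; rewrite /= in_itv/= => /andP[s0 sy].
  rewrite -EFinM lee_fin add0r.
  have av0 : 0 <= avg (gau t) s a by apply: avg_ge0 => r; exact: gau_ge0.
  have h1 := CB s a s0.
  have [_ _ _ W] := cB t (y - s) t0 t4.
  have h2 : 1 + y + `|a| <= (1 + `|y - s|) * (1 + s + `|a|).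
    rewrite (ger0_norm (_ : 0 <= y - s)) ?subr_ge0//.
    by have := normr_ge0 a; move: `|a| => n n0; nra.
  apply: (@le_trans _ _ ((1 + `|y - s|) * (1 + s + `|a|) * (gau t (y - s) * avg (gau t) s a))).
    by rewrite ler_wpM2r// mulr_ge0// gau_ge0.
  rewrite mulrACA [leRHS]mulrAC; apply: ler_pM => //.
    by rewrite mulr_ge0 ?addr_ge0// gau_ge0.
  by rewrite mulr_ge0 ?addr_ge0.
rewrite integral_mkcond.
apply: (@le_trans _ _ (\int[mu]_s (c * C * gau (2 * t) (y - s))%:E)%E).
  apply: ge0_le_integral.
  - exact: measurableT.
  - move=> s _; rewrite patchE; case: ifP => // _.
    by rewrite lee_fin !mulr_ge0 ?gau_ge0// ltW.
  - apply/(measurable_restrictT _ _).1; first exact: measurable_itv.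
    apply: mE; [by apply: measurable_funM => //; exact: measurable_cst|exact: measurable_itv].
  - apply: mE; last exact: measurableT.
    by apply: measurable_funM => //; exact: measurable_cst.
  - move=> s _; rewrite patchE; case: ifP => // _.
    by rewrite lee_fin !mulr_ge0 ?gau_ge0// ltW.
rewrite int_scale; last 3 first.
- exact: mg.
- by move=> s; exact: gau_ge0.
- by rewrite mulr_ge0// ltW.
rewrite (ge0_integral_reflect y (f := fun s => (gau (2 * t) s)%:E)); last 2 first.
- by apply/measurable_EFinP; exact: measurable_gau.
- by move=> s; rewrite lee_fin gau_ge0.
by rewrite integral_gau// mule1.
Qed.

(** Joint continuity from separate information: the function is Lipschitz in the tangential
    variable, with a constant locally bounded in the height, and differentiable in the height. *)
Lemma continuous_wall_kernel t x y : 0 < t -> 0 < y.2 ->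
  {for y, continuous (fun y => wall (dgau t) (gau t) x.2 y.2 (x.1 - y.1))}.
Proof.
move=> t0 y0; have [M [gM dgM ddgM]] := gau_bounded t0.
have M0 : 0 <= M by exact: le_trans (gM 0).
pose F (u v : R) := wall (dgau t) (gau t) x.2 v (x.1 - u).
have F1 (u u' v : R) : 0 <= v -> `|F u v - F u' v| <= M * M * v * `|u - u'|.
  move=> v0.
  have -> : `|u - u'| = `|(x.1 - u) - (x.1 - u')|.
    by rewrite distrC; congr `|_|; ring.
  apply: (@lip (wall (dgau t) (gau t) x.2 v) (wall (dgau t) (dgau t) x.2 v)).
    move=> r; exact: (is_derive_wall_tangential (fun r => is_derive_dgau r t0) dgM
      (fun r => is_derive_gau r t0) (continuous_dgau t0) gM dgM).
  move=> r; exact: (wall_le (continuous_dgau t0) dgM (continuous_dgau t0) dgM).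
have F2 : {for y.2, continuous (F y.1)}.
  have [d _] := is_derive_wall_height (fun r => is_derive_dgau r t0) ddgM
    (fun r => is_derive_gau r t0) gM x.2 (x.1 - y.1) y0.
  by apply: differentiable_continuous; apply/derivable1_diffP.
rewrite /continuous_at -/(F y.1 y.2).
rewrite (_ : (fun y => wall _ _ _ _ _) = (fun z : R * R => (F z.1 z.2 - F y.1 z.2) + F y.1 z.2)); last first.
  by apply/funext => z; rewrite subrK.
suff : (F z.1 z.2 - F y.1 z.2 + F y.1 z.2) @[z --> y] --> 0 + F y.1 y.2 by rewrite add0r.
apply: cvgD; last first.
  by apply: (@cvg_comp _ _ _ snd (F y.1)); [exact: cvg_snd|exact: F2].
apply: norm_cvg0.
apply: (@squeeze_cvgr _ _ _ _ (cst 0) (fun z : R * R => M * M * z.2 * `|z.1 - y.1|)).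
- have : \forall z \near y, 0 < z.2.
    have C2 : z.2 @[z --> y] --> y.2 by exact: cvg_snd.
    by apply: (C2 [set r | 0 < r]); exact: lt_nbhsr.
  apply: filterS => z z0; rewrite normr_ge0/=; exact: F1 (ltW z0).
- exact: cvg_cst.
- have -> : 0 = M * M * y.2 * `|y.1 - y.1| by rewrite subrr normr0 mulr0.
  apply: cvgM; first by apply: cvgM; [exact: cvg_cst|exact: cvg_snd].
  apply: cvg_norm; apply: cvgB; [exact: cvg_fst|exact: cvg_cst].
Unshelve. all: by end_near.
Qed.

Lemma continuous_stokes_kernel t x y : 0 < t -> 0 < y.2 ->
  {for y, continuous (stokes_kernel t x)}.
Proof.
move=> t0 y0.
have c1 : (x.1 - z.1) @[z --> y] --> x.1 - y.1.
  by apply: cvgB; [exact: cvg_cst|exact: cvg_fst].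
have c2 : (x.2 - z.2) @[z --> y] --> x.2 - y.2.
  by apply: cvgB; [exact: cvg_cst|exact: cvg_snd].
have c3 : (x.2 + z.2) @[z --> y] --> x.2 + y.2.
  by apply: cvgD; [exact: cvg_cst|exact: cvg_snd].
have cg : continuous (gau t) := continuous_gau t0.
apply: cvgD.
  apply: cvgB; apply: cvgM.
  - by apply: continuous_cvg; [exact: cg|exact: c1].
  - by apply: continuous_cvg; [exact: cg|exact: c2].
  - by apply: continuous_cvg; [exact: cg|exact: c1].
  - by apply: continuous_cvg; [exact: cg|exact: c3].
apply: cvgM; first exact: cvg_cst.
exact: continuous_wall_kernel.
Qed.

(** On the wall the direct and image Gaussians cancel and the wall integral extends over a point.
    Off the wall each of these two contributions is at most [2 M^2 y.2]. *)
Lemma stokes_kernel_boundary t x : 0 < t -> exists C : R, forall y, 0 <= y.2 ->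
  `|stokes_kernel t x y| <= C * y.2.
Proof.
move=> t0; have [M [gM dgM ddgM]] := gau_bounded t0.
have M0 : 0 <= M by exact: le_trans (gM 0).
exists (4 * (M * M)) => y y0.
have h1 := wall_le (continuous_dgau t0) dgM (continuous_gau t0) gM x.2 (x.1 - y.1) y0.
have h2 : `|gau t (x.2 - y.2) - gau t (x.2 + y.2)| <= M * (2 * y.2).
  have := @lip (gau t) (dgau t) M (x.2 + y.2) (x.2 - y.2) (fun r => is_derive_gau r t0) dgM.
  have -> : x.2 - y.2 - (x.2 + y.2) = - (2 * y.2) by ring.
  by rewrite normrN (ger0_norm (_ : 0 <= 2 * y.2)) ?mulr_ge0.
rewrite /stokes_kernel -mulrBr; apply: (le_trans (ler_normD _ _)).
rewrite normrM (normrM 2) (ger0_norm (_ : 0 <= 2))//.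
have h3 : `|gau t (x.1 - y.1)| * `|gau t (x.2 - y.2) - gau t (x.2 + y.2)| <= M * (M * (2 * y.2)).
  by rewrite ler_pM.
have : 4 * (M * M) * y.2 = M * (M * (2 * y.2)) + 2 * (M * M * y.2) by ring.
lra.
Qed.

(** The factor [w] moves the weight from [y] to [x - y]; the Gaussians absorb it in the direct and
    image terms, [wall_gau_decay] in the wall term. *)
Lemma stokes_kernel_decay t x : 0 < t -> t <= 1 -> 0 < x.2 -> exists C : R, forall y, 0 < y.2 ->
  (1 + enorm y) * `|stokes_kernel t x y| <= C.
Proof.
move=> t0 t1 x0; have [c [c1 cB]] := @gau_bounds R.
have c0 : 0 <= c by exact: le_trans c1.
have t4 : t <= 4 by lra.
have t20 : 0 < 2 * t by rewrite mulr_gt0.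
have t24 : 2 * t <= 4 by lra.
have [D [D0 DB]] := wall_gau_decay t20 t24.
have [M [gM dgM ddgM]] := gau_bounded t0.
have [M2 [gM2 _ _]] := gau_bounded t20.
have M20 : 0 <= M2 by exact: le_trans (gM2 0).
have db r : `|dgau t r| <= c / Num.sqrt t * gau (2 * t) r by have [] := cB t r t0 t4.
have gb' r : `|gau t r| <= c * gau (2 * t) r.
  by rewrite (ger0_norm (gau_ge0 _ _)); have [] := cB t r t0 t4.
pose w := (1 + `|x.1|) * (1 + `|x.2|).
have w0 : 0 <= w by rewrite mulr_ge0 ?addr_ge0.
pose P := c / Num.sqrt t * c * Num.sqrt (4 * pi * (2 * t)) * gau (2 * t) x.2.
have P0 : 0 <= P by rewrite !mulr_ge0 ?gau_ge0 ?sqrtr_ge0// invr_ge0 sqrtr_ge0.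
exists (w * (2 * (c * M2 * (c * M2)) + 2 * (P * D))) => y y0.
pose a := x.1 - y.1.
have W r : (1 + `|r|) * gau t r <= c * M2.
  have [_ _ _ h] := cB t r t0 t4; apply: (le_trans h); rewrite ler_wpM2l//.
  by apply: le_trans (gM2 _); exact: ler_norm.
have e0 : 0 <= enorm y := enorm_ge0 y.
have te r : `|y.2| <= `|r| + `|x.2| -> 1 + enorm y <= w * ((1 + `|a|) * (1 + `|r|)).
  move=> h; apply: (le_trans (oneD_enorm_le y)).
  have h1 : `|y.1| <= `|a| + `|x.1|.
    by rewrite /a -[X in `|X| <= _](subKr x.1 y.1) (le_trans (ler_normB _ _))// addrC.
  rewrite /w mulrACA ler_pM ?addr_ge0//.
    by have := normr_ge0 a; have := normr_ge0 x.1; move: `|a| `|x.1| h1 => n m h1 n0 m0; nra.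
  by have := normr_ge0 r; have := normr_ge0 x.2; move: `|r| `|x.2| h => n m h2 n0 m0; nra.
have key r : `|y.2| <= `|r| + `|x.2| -> (1 + enorm y) * (gau t a * gau t r) <= w * (c * M2 * (c * M2)).
  move=> /te h; apply: (le_trans (ler_wpM2r _ h)); first by rewrite mulr_ge0 ?gau_ge0.
  have -> : w * ((1 + `|a|) * (1 + `|r|)) * (gau t a * gau t r) =
    w * ((1 + `|a|) * gau t a * ((1 + `|r|) * gau t r)) by ring.
  by rewrite ler_wpM2l// ler_pM ?W// mulr_ge0 ?gau_ge0// addr_ge0.
have k1 := key (x.2 - y.2); have k2 := key (x.2 + y.2).
have {}k1 : (1 + enorm y) * (gau t a * gau t (x.2 - y.2)) <= w * (c * M2 * (c * M2)).
  by apply: k1; rewrite -[X in `|X| <= _](subKr x.2 y.2) (le_trans (ler_normB _ _))// addrC.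
have {}k2 : (1 + enorm y) * (gau t a * gau t (x.2 + y.2)) <= w * (c * M2 * (c * M2)).
  by apply: k2; rewrite -[X in `|X| <= _](addKr x.2 y.2) (le_trans (ler_normD _ _))// normrN addrC.
have k3 : (1 + enorm y) * `|wall (dgau t) (gau t) x.2 y.2 a| <= w * (P * D).
  have h := wall_abs_le y.2 a t20 (ltW x0) (continuous_dgau t0) (continuous_gau t0) db gb'.
  have Z0 : 0 <= wall (gau (2 * t)) (gau (2 * t)) 0 y.2 a by apply: wall_ge0 => r; exact: gau_ge0.
  have h1 : 1 + enorm y <= w * (1 + y.2 + `|a|).
    apply: (@le_trans _ _ (1 + (`|y.1| + `|y.2|))); first by rewrite lerD2l; exact: enorm_le_sum.
    have : `|y.1| <= `|a| + `|x.1|.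
      by rewrite /a -[X in `|X| <= _](subKr x.1 y.1) (le_trans (ler_normB _ _))// addrC.
    rewrite /w (gtr0_norm y0); have := normr_ge0 a; have := normr_ge0 x.1; have := normr_ge0 x.2.
    by move: `|a| `|x.1| `|x.2| `|y.1| => n m k l k0 m0 n0 hl; have : 0 <= m * k; [exact: mulr_ge0|nra].
  have e1 : 0 <= 1 + enorm y by rewrite addr_ge0.
  apply: (le_trans (ler_wpM2l e1 h)).
  have -> : (1 + enorm y) * (c / Num.sqrt t * c * Num.sqrt (4 * pi * (2 * t)) *
      (gau (2 * t) x.2 * wall (gau (2 * t)) (gau (2 * t)) 0 y.2 a)) =
      P * ((1 + enorm y) * wall (gau (2 * t)) (gau (2 * t)) 0 y.2 a) by rewrite /P; ring.
  rewrite (mulrCA w); apply: ler_wpM2l => //.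
  apply: (le_trans (ler_wpM2r Z0 h1)); rewrite -mulrA; apply: ler_wpM2l => //.
  exact: DB (ltW y0).
have e1 : 0 <= 1 + enorm y by rewrite addr_ge0.
apply: (@le_trans _ _ ((1 + enorm y) * (gau t a * gau t (x.2 - y.2)) + (1 + enorm y) * (gau t a * gau t (x.2 + y.2))
  + 2 * ((1 + enorm y) * `|wall (dgau t) (gau t) x.2 y.2 a|))).
  have -> : (1 + enorm y) * (gau t a * gau t (x.2 - y.2)) + (1 + enorm y) * (gau t a * gau t (x.2 + y.2))
     + 2 * ((1 + enorm y) * `|wall (dgau t) (gau t) x.2 y.2 a|) = (1 + enorm y) * (gau t a * gau t (x.2 - y.2)
     + gau t a * gau t (x.2 + y.2) + 2 * `|wall (dgau t) (gau t) x.2 y.2 a|) by ring.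
  rewrite ler_wpM2l// /stokes_kernel -/a; apply: (le_trans (ler_normD _ _)); apply: lerD.
    apply: (le_trans (ler_normB _ _)).
    by apply: lerD; rewrite ger0_norm// mulr_ge0 ?gau_ge0.
  by rewrite (normrM 2) (ger0_norm (_ : 0 <= 2)).
have -> : w * (2 * (c * M2 * (c * M2)) + 2 * (P * D)) = w * (c * M2 * (c * M2)) + w * (c * M2 * (c * M2)) + 2 * (w * (P * D)) by ring.
by apply: lerD; [exact: lerD|rewrite ler_wpM2l].
Qed.

Lemma stokes_kernel_in_C0 t x : 0 < t -> t <= 1 -> 0 < x.2 ->
  in_C0 (fun y => K x y t).
Proof.
move=> t0 t1 x0.
have -> : (fun y => K x y t) = stokes_kernel t x.
  by apply/funext => y; rewrite K_stokes_kernel.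
split.
- apply: continuous_in_subspaceT => y; rewrite inE => y0; exact: continuous_stokes_kernel.
- move=> e e0; have [C CB] := stokes_kernel_decay t0 t1 x0.
  exists (C / e) => y y0; rewrite ltr_pdivrMr// => h.
  have en0 : 0 <= enorm y := enorm_ge0 y.
  rewrite -(ltr_pM2l (_ : 0 < 1 + enorm y)) ?ltr_wpDr//.
  apply: (le_lt_trans (CB y y0)); apply: (lt_le_trans h).
  by rewrite ler_wpM2r ?(ltW e0)// lerDr.
- move=> b; have [C CB] := stokes_kernel_boundary x t0.
  apply: norm_cvg0.
  apply: (@squeeze_cvgr _ _ _ _ (cst 0) (fun y : R * R => C * y.2)).
  + near=> y; rewrite normr_ge0/=; apply: CB.
    have : Hplus y by near: y; exact: withinT.
    exact: ltW.
  + exact: cvg_cst.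
  + suff : (C * y.2) @[y --> within Hplus (nbhs (b, 0))] --> C * 0 by rewrite mulr0.
    apply: cvgM; first exact: cvg_cst.
    apply: cvg_within_filter; exact: (cvg_snd (F := nbhs b) (G := nbhs (0 : R))).
Unshelve. all: by end_near.
Qed.

End TestFunction.

(** * Lipschitz dependence of the kernel on time *)

Section TimeContinuity.
Context {R : realType}.
Implicit Types (t s a r : R) (x y : R * R).

(** The heat equation in one dimension. *)
Lemma is_derive_gau_time s r : 0 < s -> is_derive s 1 (fun s => gau s r) (ddgau s r).
Proof.
move=> s0.
have p0 : 0 < 4 * pi * s by rewrite !mulr_gt0 ?pi_gt0.
have q0 : 0 < Num.sqrt (4 * pi * s) by rewrite sqrtr_gt0.
have H1 : is_derive s 1 (fun s : R => 4 * pi * s) (4 * pi).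
  by apply: is_derive_eq; rewrite /GRing.scale/= mulr1 ?scaler0 ?addr0 ?add0r.
have H2 := is_derive1_comp (g := fun s : R => 4 * pi * s) (is_derive1_sqrt p0) H1.
have H3 := is_deriveV (f := fun s : R => Num.sqrt (4 * pi * s)) (lt0r_neq0 q0) H2.
have H4 : is_derive s 1 (fun s : R => - r ^+ 2 / (4 * s)) (r ^+ 2 / (4 * s ^+ 2)).
  have H5 : is_derive s 1 (fun s : R => 4 * s) 4.
    by apply: is_derive_eq; rewrite /GRing.scale/= mulr1 ?scaler0 ?addr0 ?add0r.
  have s4 : 4 * s != 0 by rewrite gt_eqF// mulr_gt0.
  have H6 := is_derive_mull_cst (- r ^+ 2) (is_deriveV s4 H5).
  apply: (is_derive_eq H6); rewrite /GRing.scale/=; field; exact: lt0r_neq0.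
have H7 := is_derive1_comp (g := fun s : R => - r ^+ 2 / (4 * s)) (is_derive_expR _) H4.
have H8 := is_deriveM H3 H7.
apply: (is_derive_eq H8).
rewrite /ddgau /gau /GRing.scale/=.
(* Expressing [4 pi] through the square of the root leaves the root as the only atom, so that the
   identity becomes one of rational functions. *)
have Q : 4 * pi = Num.sqrt (4 * pi * s) ^+ 2 / s by rewrite sqr_sqrtr ?(ltW p0)// mulfK ?gt_eqF.
clear H1 H2 H3 H4 H7 H8 p0.
set q := Num.sqrt (4 * pi * s) in Q q0 *; set E := expR _; rewrite Q.
clearbody q E; field; by rewrite !gt_eqF.
Qed.

Lemma gau_time_widen t s r : 0 < t -> t / 2 <= s -> s <= t ->
  gau (2 * s) r <= 2 * gau (2 * t) r.
Proof.
move=> t0 ts st.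
have s0 : 0 < s by lra.
rewrite /gau [leRHS]mulrA; apply: ler_pM; rewrite ?invr_ge0 ?sqrtr_ge0 ?expR_ge0//.
- have qs : 0 < Num.sqrt (4 * pi * (2 * s)) by rewrite sqrtr_gt0 !mulr_gt0 ?pi_gt0.
  have qt : 0 < Num.sqrt (4 * pi * (2 * t)) by rewrite sqrtr_gt0 !mulr_gt0 ?pi_gt0.
  rewrite -[leLHS]mul1r ler_pdivrMr// mulrAC ler_pdivlMr// mul1r.
  rewrite -[X in _ <= X * _](@ger0_norm _ 2)// -sqrtr_sqr -sqrtrM ?sqr_ge0//.
  apply: ler_wsqrtr; have p0 := @pi_gt0 R; nra.
- rewrite ler_expR !mulNr lerN2 ler_wpM2l ?sqr_ge0// lef_pV2 ?posrE ?mulr_gt0//.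
  by rewrite !ler_wpM2l.
Qed.

(** The derivative of [dgau] in time, hence by the heat equation the third space derivative of
    [gau]. *)
Definition tdgau (t r : R) : R := r / (2 * t ^+ 2) * gau t r - r / (2 * t) * ddgau t r.

Lemma is_derive_dgau_time s r : 0 < s -> is_derive s 1 (fun s => dgau s r) (tdgau s r).
Proof.
move=> s0.
have H5 : is_derive s 1 (fun s : R => 2 * s) 2.
  by apply: is_derive_eq; rewrite /GRing.scale/= mulr1 ?scaler0 ?addr0 ?add0r.
have s2 : 2 * s != 0 by rewrite gt_eqF// mulr_gt0.
have H6 := is_derive_mull_cst (- r) (is_deriveV s2 H5).
have H8 := is_deriveM H6 (is_derive_gau_time r s0).
rewrite (_ : (fun s => dgau s r) = (fun s => - r / (2 * s) * gau s r)); last first.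
  by apply/funext => w; rewrite /dgau; congr (_ * _); rewrite mulNr.
apply: (is_derive_eq H8).
rewrite /tdgau /GRing.scale/=; move: (gau s r) (ddgau s r) => G G'; field; exact: lt0r_neq0.
Qed.

Lemma tdgau_le : exists C : R, 0 < C /\ forall t r, 0 < t -> t <= 1 ->
  `|tdgau t r| <= C * (t^-1) ^+ 3 * gau (2 * t) r.
Proof.
have [k [k0 kB]] : exists k : R, 0 < k /\ forall t r j, 0 < t -> (j <= 4)%N ->
    `|r| ^+ j * gau t r <= k * Num.sqrt t ^+ j * gau (2 * t) r.
  by exists 512; split=> [|t r j]; [rewrite ltr0n|exact: gau_moment].
exists (k * 2); split; first by rewrite mulr_gt0.
move=> t r t0 t1.
have g0 := gau_ge0 t r; have g20 := gau_ge0 (2 * t) r.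
have q1 : Num.sqrt t <= 1 by rewrite -[leRHS]sqrtr1; exact: ler_wsqrtr.
have q0 : 0 <= Num.sqrt t := sqrtr_ge0 t.
have := kB t r 1%N t0 isT; rewrite !expr1 => H1.
have H3 := kB t r 3%N t0 isT.
have {}H1 : `|r| * gau t r <= k * gau (2 * t) r.
  by apply: (le_trans H1); rewrite ler_wpM2r// -[leRHS]mulr1 ler_wpM2l// ltW.
have {}H3 : `|r| ^+ 3 * gau t r <= k * gau (2 * t) r.
  by apply: (le_trans H3); rewrite ler_wpM2r// -[leRHS]mulr1 ler_wpM2l ?(ltW k0)// exprn_ile1.
rewrite /tdgau /ddgau.
have v1 : 1 <= t^-1 by rewrite invf_ge1.
have -> : r / (2 * t ^+ 2) * gau t r - r / (2 * t) * ((r ^+ 2 / (4 * t ^+ 2) - (2 * t)^-1) * gau t r)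
  = (3 / 4 * (t^-1) ^+ 2) * (r * gau t r) - (8^-1 * (t^-1) ^+ 3) * (r ^+ 3 * gau t r).
  move: (gau t r) => G; field; exact: lt0r_neq0.
move: (t^-1) v1 => v v1.
have v0 : 0 <= v by exact: le_trans v1.
have a1 : 0 <= 3 / 4 * v ^+ 2 by rewrite mulr_ge0// sqr_ge0.
have a2 : 0 <= 8^-1 * v ^+ 3 by rewrite mulr_ge0 ?invr_ge0// exprn_ge0.
apply: (le_trans (ler_normB _ _)).
rewrite (normrM (_ * v ^+ 2)) (normrM (_ * v ^+ 3)) (ger0_norm a1) (ger0_norm a2).
rewrite (normrM r) (normrM (r ^+ 3)) (ger0_norm g0) normrX.
apply: (@le_trans _ _ (3 / 4 * v ^+ 2 * (k * gau (2 * t) r) + 8^-1 * v ^+ 3 * (k * gau (2 * t) r))).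
  by apply: lerD; rewrite ler_wpM2l.
have h : 3 / 4 * v ^+ 2 + 8^-1 * v ^+ 3 <= 2 * v ^+ 3.
  have : v ^+ 2 <= v ^+ 3 by rewrite (exprS v 2) ler_peMl// sqr_ge0.
  have := exprn_ge0 3 v0; lra.
rewrite -mulrDl; have -> : k * 2 * v ^+ 3 * gau (2 * t) r = 2 * v ^+ 3 * (k * gau (2 * t) r) by ring.
by rewrite ler_wpM2r// mulr_ge0// ltW.
Qed.

(** The mean value theorem in time. For [s] between [t / 2] and [t] the negative powers of time are
    bounded by those of [t / 2] and [gau (2 s)] by twice [gau (2 t)]; the dependence of the constant
    on [t] is harmless, since [t] stays fixed while the initial time tends to zero. *)
Lemma gau_time_lip t : 0 < t -> t <= 1 -> exists C : R, 0 < C /\ forall s r,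
  t / 2 <= s -> s <= t ->
  `|gau s r - gau t r| <= C * (t - s) * gau (2 * t) r /\
  `|dgau s r - dgau t r| <= C * (t - s) * gau (2 * t) r.
Proof.
move=> t0 t1; have [c [c1 cB]] := @gau_bounds R.
have c0 : 0 < c by exact: lt_le_trans c1.
have [k [k0 kB]] := tdgau_le.
pose v := (t / 2)^-1.
have v0 : 0 < v by rewrite invr_gt0 divr_gt0.
pose A := c * v * 2; pose B := k * v ^+ 3 * 2.
have A0 : 0 < A by rewrite !mulr_gt0.
have B0 : 0 < B by rewrite mulr_gt0// mulr_gt0// exprn_gt0.
exists (A + B); split; first exact: addr_gt0.
move=> s r ts st.
have g0 := gau_ge0 (2 * t) r.
have ub (w : R) : s <= w <= t -> [/\ 0 < w, w <= 1, w^-1 <= v & gau (2 * w) r <= 2 * gau (2 * t) r].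
  move=> /andP[w1 w2]; have w0 : 0 < w by lra.
  split; [exact: w0|lra| |].
    by rewrite lef_pV2 ?posrE ?divr_gt0// (le_trans ts).
  by apply: gau_time_widen => //; lra.
have ts0 : 0 <= t - s by rewrite subr_ge0.
split; rewrite distrC.
- apply: (@le_trans _ _ (A * gau (2 * t) r * (t - s))); last first.
    by rewrite mulrAC ler_wpM2r// ler_wpM2r// lerDl ltW.
  apply: (lipschitz_MVT (f := fun w => gau w r) st (df := fun w => ddgau w r)) => w /ub[w0 w1 wv wg].
    exact: is_derive_gau_time.
  have w4 : w <= 4 by lra.
  have [_ _ h _] := cB w r w0 w4; apply: (le_trans h).
  rewrite /A -(mulrA (c * v)); apply: ler_pM => //.
  + by rewrite mulr_ge0 ?(ltW c0)// invr_ge0 ltW.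
  + exact: gau_ge0.
  + by rewrite ler_wpM2l// ltW.
- apply: (@le_trans _ _ (B * gau (2 * t) r * (t - s))); last first.
    by rewrite mulrAC ler_wpM2r// ler_wpM2r// lerDr ltW.
  apply: (lipschitz_MVT (f := fun w => dgau w r) st (df := fun w => tdgau w r)) => w /ub[w0 w1 wv wg].
    exact: is_derive_dgau_time.
  apply: (le_trans (kB w r w0 w1)).
  rewrite /B -(mulrA (k * v ^+ 3)); apply: ler_pM => //.
  + by rewrite mulr_ge0 ?(ltW k0)// exprn_ge0// invr_ge0 ltW.
  + exact: gau_ge0.
  + rewrite ler_wpM2l ?(ltW k0)//; apply: lerXn2r; [|by rewrite nnegrE ltW|exact: wv].
    by rewrite nnegrE invr_ge0 ltW.
Qed.

End TimeContinuity.

Section KernelTimeContinuity.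
Context {R : realType}.
Implicit Types (t s a r : R) (x y : R * R).

(** Products are telescoped, and so is [wall], which is bilinear: one factor at a time passes from
    [s] to [t]. The bound is uniform in [y], so it can be integrated against a vorticity known only
    in [L^1]. *)
Lemma stokes_kernel_time_lip t x : 0 < t -> t <= 1 -> 0 < x.2 ->
  exists C : R, forall s y, t / 2 <= s -> s <= t -> 0 < y.2 ->
  `|stokes_kernel s x y - stokes_kernel t x y| <= C * (t - s).
Proof.
move=> t0 t1 x0; have [L [L0 LB]] := gau_time_lip t0 t1.
have [c [c1 cB]] := @gau_bounds R.
have c0 : 0 < c by exact: lt_le_trans c1.
have t4 : t <= 4 by lra.
have t20 : 0 < 2 * t by rewrite mulr_gt0.
have t24 : 2 * t <= 4 by lra.
have [D [D0 DB]] := wall_gau_decay t20 t24.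
have [M [gM _ _]] := gau_bounded t20.
have M0 : 0 <= M by exact: le_trans (gM 0).
pose S := Num.sqrt (4 * pi * (2 * t)); have S0 : 0 <= S by exact: sqrtr_ge0.
pose B := 2 * c + L + c / Num.sqrt t.
have q0 : 0 <= c / Num.sqrt t by rewrite divr_ge0 ?sqrtr_ge0// ltW.
have B0 : 0 <= B by rewrite !addr_ge0 ?mulr_ge0// ltW.
exists (4 * (L * M * (B * M)) + 4 * (L * B * S * (M * D))).
move=> s y ts st y0.
have s0 : 0 < s by lra.
have s4 : s <= 4 by lra.
have ts0 : 0 <= t - s by rewrite subr_ge0.
pose a := x.1 - y.1.
have G0 r : 0 <= gau (2 * t) r by exact: gau_ge0.
have gM' r : gau (2 * t) r <= M by exact: le_trans (ler_norm _) (gM r).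
have cB' : c <= B by rewrite /B; lra.
have gsb r : `|gau s r| <= B * gau (2 * t) r.
  rewrite (ger0_norm (gau_ge0 _ _)); have [h _ _ _] := cB s r s0 s4.
  apply: (le_trans h); apply: (le_trans (ler_wpM2l (ltW c0) (gau_time_widen r t0 ts st))).
  by rewrite mulrA ler_wpM2r// /B; lra.
have gtb r : `|gau t r| <= B * gau (2 * t) r.
  rewrite (ger0_norm (gau_ge0 _ _)); have [h _ _ _] := cB t r t0 t4.
  by apply: (le_trans h); rewrite ler_wpM2r.
have dtb r : `|dgau t r| <= B * gau (2 * t) r.
  have [_ h _ _] := cB t r t0 t4; apply: (le_trans h).
  by rewrite ler_wpM2r// /B; lra.
have dg r : `|gau s r - gau t r| <= L * (t - s) * gau (2 * t) r by have [] := LB s r ts st.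
have ddg r : `|dgau s r - dgau t r| <= L * (t - s) * gau (2 * t) r by have [] := LB s r ts st.
have Z0 : 0 <= wall (gau (2 * t)) (gau (2 * t)) 0 y.2 a by apply: wall_ge0 => r; exact: gau_ge0.
have ZD : wall (gau (2 * t)) (gau (2 * t)) 0 y.2 a <= D.
  apply: le_trans (DB y.2 a (ltW y0)); rewrite ler_peMl//.
  by rewrite -addrA lerDl addr_ge0// ltW.
have prodB r : `|gau s a * gau s r - gau t a * gau t r| <= (t - s) * (2 * (L * M * (B * M))).
  have -> : gau s a * gau s r - gau t a * gau t r =
    (gau s a - gau t a) * gau s r + gau t a * (gau s r - gau t r) by ring.
  apply: (le_trans (ler_normD _ _)).
  rewrite (normrM (_ - _)) (normrM (gau t a)).
  have h1 : `|gau s a - gau t a| <= L * (t - s) * M.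
    by apply: (le_trans (dg a)); rewrite ler_wpM2l// mulr_ge0// ltW.
  have h2 : `|gau s r - gau t r| <= L * (t - s) * M.
    by apply: (le_trans (dg r)); rewrite ler_wpM2l// mulr_ge0// ltW.
  have h3 : `|gau s r| <= B * M by apply: (le_trans (gsb r)); rewrite ler_wpM2l.
  have h4 : `|gau t a| <= B * M by apply: (le_trans (gtb a)); rewrite ler_wpM2l.
  have -> : (t - s) * (2 * (L * M * (B * M))) = L * (t - s) * M * (B * M) + B * M * (L * (t - s) * M) by ring.
  by apply: lerD; apply: ler_pM.
have cgs := continuous_gau s0; have cgt := continuous_gau t0.
have cds := continuous_dgau s0; have cdt := continuous_dgau t0.
have bnd (f : R -> R) (A : R) : 0 <= A -> (forall r, `|f r| <= A * gau (2 * t) r) ->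
    forall r, `|f r| <= A * M.
  by move=> A0 fA r; apply: (le_trans (fA r)); rewrite ler_wpM2l.
have LT0 : 0 <= L * (t - s) by rewrite mulr_ge0// ltW.
have cdd : continuous (fun r => dgau s r - dgau t r).
  by move=> r; apply: cvgB; [exact: cds|exact: cdt].
have cgg : continuous (fun r => gau s r - gau t r).
  by move=> r; apply: cvgB; [exact: cgs|exact: cgt].
have W1 := wall_abs_le y.2 a t20 (ltW x0) cdd cgs ddg gsb.
have W2 := wall_abs_le y.2 a t20 (ltW x0) cdt cgg dtb dg.
have I1 := integrable_wall cds cgs (bnd _ _ B0 gsb) (x.2 + y.2) y.2 a.
have I2 := integrable_wall cdt cgs (bnd _ _ B0 gsb) (x.2 + y.2) y.2 a.
have I3 := integrable_wall cdt cgt (bnd _ _ B0 gtb) (x.2 + y.2) y.2 a.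
have E1 : wall (fun r => dgau s r - dgau t r) (gau s) x.2 y.2 a =
    wall (dgau s) (gau s) x.2 y.2 a - wall (dgau t) (gau s) x.2 y.2 a.
  rewrite /wall -RintegralB; [|exact: measurable_itv|exact: I1|exact: I2].
  by apply: eq_Rintegral => v _; rewrite mulrBl.
have Aeq v : avg (fun r => gau s r - gau t r) v a = avg (gau s) v a - avg (gau t) v a.
  rewrite /avg -RintegralB; [|exact: measurableT|exact: (integrable_avg cgs (bnd _ _ B0 gsb))
    |exact: (integrable_avg cgt (bnd _ _ B0 gtb))].
  by apply: eq_Rintegral => u _; rewrite mulrBl.
have E2 : wall (dgau t) (fun r => gau s r - gau t r) x.2 y.2 a =
    wall (dgau t) (gau s) x.2 y.2 a - wall (dgau t) (gau t) x.2 y.2 a.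
  rewrite /wall -RintegralB; [|exact: measurable_itv|exact: I2|exact: I3].
  by apply: eq_Rintegral => v _; rewrite Aeq mulrBr.
have fin (A A' : R) : 0 <= A * A' * S -> A * A' * S * (gau (2 * t) x.2 * wall (gau (2 * t)) (gau (2 * t)) 0 y.2 a) <= A * A' * S * (M * D).
  by move=> A0; rewrite ler_wpM2l// ler_pM.
have {}W1 := le_trans W1 (fin _ _ (mulr_ge0 (mulr_ge0 LT0 B0) S0)).
have {}W2 := le_trans W2 (fin _ _ (mulr_ge0 (mulr_ge0 B0 LT0) S0)).
rewrite E1 in W1; rewrite E2 in W2.
have P1 := prodB (x.2 - y.2); have P2 := prodB (x.2 + y.2).
rewrite /stokes_kernel -/a.
move: W1 W2 P1 P2.
move: (wall (dgau s) (gau s) _ _ _) (wall (dgau t) (gau s) _ _ _) (wall (dgau t) (gau t) _ _ _).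
move: (gau s a * gau s (x.2 - y.2)) (gau s a * gau s (x.2 + y.2)) (gau t a * gau t (x.2 - y.2)) (gau t a * gau t (x.2 + y.2)).
move=> g1 g2 g3 g4 w1 w2 w3 W1 W2 P1 P2.
have -> : g1 - g2 + 2 * w1 - (g3 - g4 + 2 * w3) = (g1 - g3) - (g2 - g4) + 2 * ((w1 - w2) + (w2 - w3)) by ring.
apply: (le_trans (ler_normD _ _)).
have h1 : `|g1 - g3 - (g2 - g4)| <= (t - s) * (2 * (L * M * (B * M))) + (t - s) * (2 * (L * M * (B * M))).
  by apply: (le_trans (ler_normB _ _)); exact: lerD.
have h2 : `|2 * (w1 - w2 + (w2 - w3))| <= 2 * (L * (t - s) * B * S * (M * D) + B * (L * (t - s)) * S * (M * D)).
  rewrite normrM (ger0_norm (_ : 0 <= 2))// ler_wpM2l//.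
  by apply: (le_trans (ler_normD _ _)); exact: lerD.
apply: (le_trans (lerD h1 h2)).
by rewrite le_eqVlt; apply/orP; left; apply/eqP; ring.
Qed.

End KernelTimeContinuity.

(** * Jointly measurable versions *)

Section JointVersion.
Context d (Y : measurableType d) {R : realType}.
Variables (m : {measure set Y -> \bar R}) (T : R) (h : R -> Y -> R).
Hypothesis mh : forall s, 0 < s < T -> measurable_fun setT (h s).

Let D (s r : R) : \bar R := (\int[m]_y (`|h s y - h r y|)%:E)%E.

Hypothesis ch : forall s, 0 < s < T -> D r s @[r --> s] --> 0%E.

Let mdiff s r : 0 < s < T -> 0 < r < T -> measurable_fun setT (fun y => `|h s y - h r y|).
Proof. by move=> sT rT; apply: measurableT_comp => //; apply: measurable_funB; exact: mh. Qed.

Let D_sym s r : D s r = D r s.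
Proof. by apply: eq_integral => y _; rewrite distrC. Qed.

Let D_triangle s r t : 0 < s < T -> 0 < r < T -> 0 < t < T -> (D s t <= D s r + D r t)%E.
Proof.
move=> sT rT tT; rewrite /D -int_addr; [|exact: mdiff|exact: mdiff|by []|by []].
apply: int_mono; [exact: mdiff|apply: measurable_funD; exact: mdiff|by []|].
by move=> y; rewrite (le_trans _ (ler_normD _ _))// addrA subrK.
Qed.

(** An enumeration of the rationals. Indices that encode no rational give [0], which the condition
    [0 < q i] in [U] discards. *)
Let q (i : nat) : R := ratr (odflt 0 (unpickle i : option rat)).

Let eps (k : nat) : R := 1 / (2 ^ k.+1)%:R.

Let eps0 k : 0 < eps k.
Proof. by rewrite divr_gt0// ltr0n expn_gt0. Qed.

Let U (k i : nat) : set R := [set s | [/\ 0 < s < T, 0 < q i < T & (D s (q i) < (eps k)%:E)%E]].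

Let near_itv s : 0 < s < T -> \forall r \near s, 0 < r < T.
Proof.
move=> /andP[s0 sT]; near=> r; apply/andP; split; near: r; [exact: lt_nbhsr|exact: lt_nbhsl].
Unshelve. all: by end_near.
Qed.

Let near_D s (e : R) : 0 < s < T -> 0 < e -> \forall r \near s, (D r s < e%:E)%E.
Proof.
move=> sT e0; have := ch sT.
by move=> /(_ [set z | (z < e%:E)%E]); apply; exact: lt_nbhsl.
Qed.

(** Continuity in [L^1] and the triangle inequality. Openness is what makes the choice of a sample
    time measurable. *)
Let open_U k i : open (U k i).
Proof.
rewrite openE => s [sT qT Dsq].
have D0 : (0 <= D s (q i))%E by apply: int_ge0.
have [u u0 uE] : exists2 u, 0 <= u & D s (q i) = u%:E.
  exists (fine (D s (q i))); first exact: fine_ge0.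
  by rewrite fineK// ge0_fin_numE// (lt_trans Dsq)// ltry.
have eu : 0 < eps k - u by rewrite subr_gt0; move: Dsq; rewrite uE lte_fin.
rewrite /interior/=; near=> r.
have rT : 0 < r < T by near: r; exact: near_itv.
split => //; apply: (le_lt_trans (D_triangle rT sT qT)).
have Drs : (D r s < (eps k - u)%:E)%E by near: r; exact: near_D.
rewrite uE; have -> : eps k = eps k - u + u by rewrite subrK.
by rewrite EFinD lteD2rE.
Unshelve. all: by end_near.
Qed.

Let cover_U k s : 0 < s < T -> exists i, U k i s.
Proof.
move=> sT.
have : \forall r \near s, 0 < r < T /\ (D r s < (eps k)%:E)%E.
  by near=> r; split; near: r; [exact: near_itv|exact: near_D].
move=> /nbhs_ballP[e /= e0 eP].
have /rat_in_itvoo[x] : s - e < s + e by rewrite ltrD2l gtrN.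
rewrite in_itv/= => /andP[xl xr]; exists (pickle x).
have qE : q (pickle x) = ratr x by rewrite /q pickleK.
have /eP[rT Drs] : ball s e (ratr x) by rewrite ball_itv/= in_itv/= xl xr.
by split; rewrite ?qE// D_sym.
Unshelve. all: by end_near.
Qed.

(** The least index of a sample time within [eps k] of [s]; [seqDU] makes the sets disjoint so that
    it is unique. *)
Let I (k : nat) (s : R) : nat := xget 0%N [set i | seqDU (U k) i s].

Let I_spec k s : 0 < s < T -> seqDU (U k) (I k s) s.
Proof.
move=> sT; have : (\bigcup_i U k i) s by have [i Ui] := cover_U k sT; exists i.
rewrite seqDU_bigcup_eq => -[i _ Ui]; rewrite /I; case: xgetP => [j -> //|/(_ i)].
by move=> /(_ Ui).
Qed.

Let I_eq k i s : seqDU (U k) i s -> I k s = i.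
Proof.
move=> Ui; have sT : 0 < s < T by case: Ui => -[].
apply: (@trivIset_seqDU _ (U k)) => //.
by exists s; split => //; exact: I_spec.
Qed.

Let g (k : nat) (z : measurableTypeR R * Y) : R :=
  if (0 < z.1) && (z.1 < T) then h (q (I k z.1)) z.2 else 0.

(** Time is cut into countably many measurable pieces, and above each of them [g k] is one fixed
    function [h (q i)] of the second variable. *)
Let mg k : measurable_fun setT (g k).
Proof.
pose E i : set (measurableTypeR R * Y) := fst @^-1` (seqDU (U k) i).
have mU i : measurable (seqDU (U k) i : set (measurableTypeR R)).
  apply: measurableD; first exact: open_measurable.
  by apply: bigsetU_measurable => j _; exact: open_measurable.
have mE i : measurable (E i).
  by rewrite -[E i]setTI; apply: measurable_fst.
have gE : g k = (fun z => h (q (I k z.1)) z.2) \_ (\bigcup_i E i).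
  apply/funext => z; rewrite patchE /g.
  case: ifPn => [zT|zT]; case: ifPn => //.
    rewrite notin_setE => H; exfalso; apply: H.
    by exists (I k z.1) => //; exact: I_spec.
  by rewrite inE => -[i _ [[zT' _ _] _]]; rewrite zT' in zT.
rewrite gE; apply/(measurable_restrictT _ _).1.
  exact: bigcup_measurable.
apply/measurable_fun_bigcup => // i.
have [E0|/set0P[s0 Us0]] := eqVneq (seqDU (U k) i) set0.
  have -> : E i = set0 by rewrite /E E0 preimage_set0.
  exact: measurable_fun_set0.
have qT : 0 < q i < T by case: Us0 => -[].
apply: (@eq_measurable_fun _ _ _ _ _ (fun z => h (q i) z.2)).
  by move=> z; rewrite inE => /I_eq ->.
apply: measurable_funTS; exact: (measurableT_comp (mh qT) measurable_snd).
Qed.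

Let g_close k s : 0 < s < T -> (\int[m]_y (`|g k (s, y) - h s y|)%:E <= (eps k)%:E)%E.
Proof.
move=> sT; have [[_ _ /ltW DU] _] := I_spec k sT.
apply: le_trans DU; rewrite D_sym le_eqVlt; apply/orP; left; apply/eqP.
by apply: eq_integral => y _; rewrite /g /= sT.
Qed.

(* Sampling [h] at rational times within [2^-k] in [L^1] gives jointly measurable
   functions that converge to [h s] almost everywhere, by summability. *)
Lemma jointly_measurable_version : exists v : measurableTypeR R * Y -> R,
  measurable_fun setT v /\ forall s, 0 < s < T -> {ae m, forall y, v (s, y) = h s y}.
Proof.
(* The upper limit exists everywhere and is measurable; wherever the samples converge, its finite
   part is their limit. *)
exists (fun z => fine (limn_esup (fun k => (g k z)%:E))); split.
  apply: (measurableT_comp (@fine_measurable R setT measurableT)).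
  by apply: measurable_fun_limn_esup => k; apply/measurable_EFinP; exact: mg.
move=> s sT.
pose a (k : nat) (y : Y) := (`|g k (s, y) - h s y|%:E)%E.
have a0 k y : (0 <= a k y)%E by rewrite lee_fin.
have ma k : measurable_fun setT (a k).
  apply/measurable_EFinP; apply: measurableT_comp => //.
  apply: measurable_funB; last exact: mh.
  exact: (measurableT_comp (mg k) (measurable_pair1 s)).
have Sfin : (\int[m]_y (\sum_(k <oo) a k y) < +oo)%E.
  rewrite integral_nneseries//.
  apply: (@le_lt_trans _ _ (\sum_(k <oo) (eps k)%:E)%E).
    apply: lee_nneseries => [k _ _|k _]; first exact: integral_ge0.
    exact: g_close.
  apply: (@le_lt_trans _ _ 1%:E); last exact: ltry.
  exact: epsilon_trick0.
have mS : measurable_fun setT (fun y => \sum_(k <oo) a k y)%E.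
  by apply: ge0_emeasurable_sum.
have IS : m.-integrable setT (fun y => \sum_(k <oo) a k y)%E.
  apply/integrableP; split => //.
  under eq_integral do rewrite gee0_abs ?nneseries_ge0//.
  exact: Sfin.
have := integrable_ae measurableT IS; apply: filterS => y /(_ Logic.I) Sy.
have Sy' : (\sum_(0 <= k <oo) a k y < +oo)%E.
  by rewrite -ge0_fin_numE// nneseries_ge0.
have tail := nneseries_tail_cvg Sy' (fun k _ => a0 k y).
have cvg0 : a k y @[k --> \oo] --> 0%E.
  apply: (@squeeze_cvge _ _ _ _ (cst 0%E) _ (fun N => \sum_(N <= k <oo) a k y)%E) => //.
  - apply: nearW => k; rewrite a0/=.
    rewrite (@nneseries_split _ _ k 1%N)//.
    rewrite addn1 big_nat1 leeDl// nneseries_ge0//.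
  - exact: cvg_cst.
have gh : (g k (s, y))%:E @[k --> \oo] --> (h s y)%:E.
  apply/fine_cvgP; split; first exact: nearW.
  apply/subr_cvg0; apply: norm_cvg0.
  by move/fine_cvgP : cvg0 => [_].
by have [_ ->] := cvg_limn_einf_sup gh.
Qed.

End JointVersion.

(** * Velocity and flux of the vorticity *)

(** No integrability is required: if the integral is infinite, the left-hand side is [0]. *)
Lemma le_abs_Rintegral d (T : measurableType d) (R : realType)
    (m : {measure set T -> \bar R}) (g : T -> R) : measurable_fun setT g ->
  (`|\int[m]_x g x|%:E <= \int[m]_x (`|g x|)%:E)%E.
Proof.
move=> mg; have mE : measurable_fun setT (fun x => (g x)%:E) by exact/measurable_EFinP.
apply: le_trans (le_abse_integral m measurableT mE).
rewrite /Rintegral; move: (\int[m]_x (g x)%:E)%E => [r| |] //=;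
  by rewrite normr0 ?leey// lee_fin.
Qed.

Section BiotSavart.
Context {R : realType}.
Notation mu := (@lebesgue_measure R).
Notation plane := (measurableTypeR R * measurableTypeR R)%type.
Implicit Types (f g : R * R -> R) (x y : R * R) (i : bool).

(** Extension by zero, written as a plain conditional, which the syntactic treatment of
    measurability understands; integrals then run over the whole plane. *)
Definition onH f x : R := if 0 < x.2 then f x else 0.

Lemma onH_patch f : f \_ Hplus = onH f.
Proof. by apply/funext => x; rewrite patchE mem_setE. Qed.

Lemma measurable_Hplus : measurable (Hplus : set plane).
Proof.
have m : measurable_fun [set: plane] (fun x : plane => 0 < x.2) by mfun.
rewrite (_ : Hplus = [set: plane] `&` (fun x : plane => 0 < x.2) @^-1` [set true]).
  by apply: m.
by apply/seteqP; split=> x /=; [move=> ->|case].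
Qed.

Lemma measurable_onH f : measurable_fun (Hplus : set plane) (f : plane -> R) ->
  measurable_fun [set: plane] (onH f).
Proof.
move=> mf; rewrite -onH_patch; apply/(measurable_restrictT _ _).1.
  exact: measurable_Hplus.
exact: mf.
Qed.

Lemma Rintegral_Hplus f : \int[leb2]_(x in Hplus) f x = \int[leb2]_x onH f x.
Proof. by rewrite Rintegral_mkcond onH_patch. Qed.

Definition halfbs i x y : R := vort i (x - y) - vort i (x - refl y).

Definition bs i f x : R := (2 * pi)^-1 * \int[leb2]_y (halfbs i x y * f y).

Lemma BS_bs f x : BS f x = (bs true (onH f) x, bs false (onH f) x).
Proof.
rewrite /BS /bs !Rintegral_Hplus; congr (_ * _, _ * _); apply: eq_Rintegral => y _;
  by rewrite /onH; case: ifP; rewrite ?mulr0.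
Qed.

Lemma measurable_halfbs i d (T : measurableType d) (a b : T -> plane) :
  measurable_fun setT a -> measurable_fun setT b ->
  measurable_fun setT (fun z => halfbs i (a z) (b z)).
Proof.
move=> ma mb; apply: measurable_funB.
- by apply: (measurableT_comp (measurable_vort i)); mfun.
- by apply: (measurableT_comp (measurable_vort i)); mfun.
Qed.

Lemma measurable_bs i d (T : measurableType d) (v : T * plane -> R) (a : T -> plane) :
  measurable_fun [set: (T * plane)%type] v -> measurable_fun setT a ->
  measurable_fun setT (fun z => bs i (fun y : plane => v (z, y)) (a z)).
Proof.
move=> mv ma; apply: measurable_funM; first exact: measurable_cst.
apply: (@measurable_Rintegral_param _ _ _ _ _ lebp (fun w : T * plane => halfbs i (a w.1) w.2 * v w)).
apply: measurable_funM; last exact: mv.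
by apply: measurable_halfbs; mfun.
Qed.

Lemma leb2_set1 (x : plane) : leb2 [set x] = 0%E.
Proof.
have -> : [set x] = [set x.1] `*` [set x.2] :> set plane.
  by apply/seteqP; split=> [y ->|[y1 y2] [/= -> ->]] //; case: x.
rewrite (_ : leb2 _ = mu [set x.1] * mu [set x.2])%E.
  by rewrite lebesgue_measure_set1 mul0e.
by apply: product_measure1E; exact: measurable_set1.
Qed.

Lemma enorm_refl_le x y : 0 < x.2 -> 0 < y.2 -> enorm (x - y) <= enorm (x - refl y).
Proof. by move=> x0 y0; rewrite /enorm /=; apply: ler_wsqrtr; nra. Qed.

(** Within the half-plane the mirror image of [y] is farther from [x] than [y], so both terms of the
    kernel are at most [1 / |x - y|], and [2 <= pi] absorbs the factor [2]. *)
Lemma bs_le i f x : measurable_fun [set: plane] f -> (forall y, y.2 <= 0 -> f y = 0) ->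
  0 < x.2 -> (`|bs i f x|%:E <= \int[leb2]_y (`|f y| * (enorm (x - y))^-1)%:E)%E.
Proof.
move=> mf f0 x0.
have mhf : measurable_fun [set: plane] (fun y => halfbs i x y * f y).
  by apply: measurable_funM => //; apply: measurable_halfbs; mfun.
have mef : measurable_fun [set: plane] (fun y : plane => `|f y| * (enorm (x - y))^-1).
  by apply: measurable_funM; [exact: measurableT_comp|rewrite /enorm; mfun].
have p2 : 2 <= pi :> R by exact: pi_ge2.
rewrite /bs normrM EFinM (ger0_norm (_ : 0 <= (2 * pi)^-1)) ?invr_ge0 ?mulr_ge0 ?pi_ge0//.
apply: (@le_trans _ _ ((2^-1)%:E * \int[leb2]_y (`|halfbs i x y * f y|)%:E)%E).
  apply: lee_pmul.
  - by rewrite lee_fin invr_ge0 mulr_ge0 ?pi_ge0.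
  - by rewrite lee_fin.
  - by rewrite lee_fin lef_pV2 ?posrE ?mulr_gt0 ?pi_gt0//; lra.
  - exact: le_abs_Rintegral.
rewrite -int_scale; [|exact: measurableT_comp|by []|by rewrite invr_ge0].
apply: ae_ge0_le_integral.
- exact: measurableT.
- by move=> y _; rewrite lee_fin mulr_ge0// invr_ge0.
- by apply/measurable_EFinP; apply: measurable_funM; [exact: measurable_cst|exact: measurableT_comp].
- by move=> y _; rewrite lee_fin mulr_ge0// invr_ge0 enorm_ge0.
- exact/measurable_EFinP.
(* The bound fails at [y = x], where the inverse distance is [0] by convention while the image term
   is not; the point is negligible. *)
exists [set x]; split; [|exact: leb2_set1|].
  rewrite (_ : [set x] = [set x.1] `*` [set x.2] :> set plane).
    by apply: measurableX; exact: measurable_set1.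
  by apply/seteqP; split=> [y ->|[y1 y2] [/= -> ->]] //; case: x {x0 mhf mef}.
move=> y /= /not_implyP[_ H]; apply: contrapT => /eqP yx; apply: H.
rewrite lee_fin normrM mulrA (mulrC `|f y|).
have [y0|y0] := leP y.2 0; first by rewrite f0// normr0 !mulr0.
apply: ler_wpM2r => //; rewrite ler_pdivrMl//.
have er := enorm_refl_le x0 y0.
have e0 : 0 < enorm (x - y).
  rewrite lt_neqAle enorm_ge0 andbT eq_sym enorm_eq0 /= !subr_eq0.
  by apply: contra yx => /andP[/eqP h1 /eqP h2]; apply/eqP; case: x y h1 h2 {x0 y0 mhf mef er} => [? ?] [? ?] /= -> ->.
rewrite /halfbs (le_trans (ler_normB _ _))//.
apply: (@le_trans _ _ ((enorm (x - y))^-1 + (enorm (x - y))^-1)); last by rewrite mulrDl mul1r.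
apply: lerD; first exact: vort_le.
apply: (le_trans (vort_le _ _)); rewrite lef_pV2 ?posrE//.
exact: lt_le_trans er.
Qed.

Lemma integral_vorticity_flux i f (A : R) : measurable_fun [set: plane] f ->
  (forall y, y.2 <= 0 -> f y = 0) -> 0 < A ->
  (\int[leb2]_z (`|f z| `^ (4 / 3))%:E <= A%:E)%E ->
  (\int[leb2]_x (`|f x| * `|bs i f x|)%:E <= (2 * (9 + 4 * pi ^+ 2) * (A * Num.sqrt A))%:E)%E.
Proof.
move=> mf f0 A0 fA.
have mnf : measurable_fun [set: plane] (fun x => `|f x|) by exact: measurableT_comp.
apply: le_trans (hls_diagonal mnf _ A0 fA) => [|z]; last exact: normr_ge0.
have mF : measurable_fun [set: (plane * plane)%type]
    (fun z : plane * plane => (`|f z.1| * `|f z.2| * (enorm (z.1 - z.2))^-1)%:E).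
  apply/measurable_EFinP; apply: measurable_funM; last by rewrite /enorm; mfun.
  by apply: measurable_funM; [apply: (measurableT_comp mnf)|apply: (measurableT_comp mnf)]; mfun.
have mbs : measurable_fun [set: plane] (fun x => bs i f x).
  apply: (@measurable_bs i _ plane (fun w => f w.2) id); last exact: measurable_id.
  exact: (measurableT_comp mf measurable_snd).
apply: ge0_le_integral.
- exact: measurableT.
- by move=> x _; rewrite lee_fin mulr_ge0.
- by apply/measurable_EFinP; apply: measurable_funM => //; exact: measurableT_comp.
- apply: (@measurable_fun_fubini_tonelli_F _ _ _ _ _ (@lebp R)
    (fun z : plane * plane => (`|f z.1| * `|f z.2| * (enorm (z.1 - z.2))^-1)%:E)) => //.
  by move=> z; rewrite lee_fin !mulr_ge0// invr_ge0 enorm_ge0.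
move=> x _; have [x0|x0] := leP x.2 0.
  rewrite f0// normr0 mul0r; apply: int_ge0 => y.
  by rewrite mulr_ge0 ?mulr_ge0// invr_ge0 enorm_ge0.
rewrite EFinM; apply: (@le_trans _ _ (`|f x|%:E * \int[leb2]_y (`|f y| * (enorm (x - y))^-1)%:E)%E).
  by apply: lee_wpmul2l; [rewrite lee_fin|exact: bs_le].
rewrite -int_scale; last 3 first.
- by apply: measurable_funM => //; rewrite /enorm; mfun.
- by move=> y; rewrite mulr_ge0// invr_ge0 enorm_ge0.
- exact: normr_ge0.
rewrite le_eqVlt; apply/orP; left; apply/eqP; apply: eq_integral => y _.
by rewrite mulrA.
Qed.

Lemma LpnormX p f : 0 < p -> (Lpnorm p f `^ p = \int[leb2]_x (`|onH f x| `^ p)%:E)%E.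
Proof.
move=> p0; by rewrite /Lpnorm onH_patch poweR_Lnorm ?gt_eqF.
Qed.

Lemma Lpnorm1E f : Lpnorm 1 f = (\int[leb2]_x (`|onH f x|)%:E)%E.
Proof. by rewrite /Lpnorm onH_patch Lnorm1. Qed.

Lemma sup_time_le (T : R) (g : R -> \bar R) t : 0 < t < T -> (g t <= sup_time T g)%E.
Proof. by move=> tT; apply: ereal_sup_ubound; exists t => //; rewrite /= in_itv. Qed.

Lemma sup_time_bound (T : R) (g : R -> \bar R) : (sup_time T g < +oo)%E ->
  exists M : R, 0 < M /\ forall t, 0 < t < T -> (g t <= M%:E)%E.
Proof.
have := @sup_time_le T g; move: (sup_time T g) => [r| |] ub //.
- exists (`|r| + 1); split; first by rewrite ltr_wpDl.
  move=> t tT; apply: (le_trans (ub t tT)); rewrite lee_fin.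
  by rewrite (le_trans (ler_norm r))// lerDl.
- by exists 1; split => // t tT; apply: (le_trans (ub t tT)); exact: leNye.
Qed.

(** One third of the exponent is spent on the maximum of the Gaussian, at most [1 / t]; the rest is
    a probability density. *)
Lemma integral_gauss_powR (z : R * R) t : 0 < t ->
  (\int[leb2]_x (gauss t (x - z) `^ (4 / 3))%:E <= (t `^ (- (1 / 3)))%:E)%E.
Proof.
move=> t0.
have mg : measurable_fun [set: plane] (fun x => gau t x.1 * gau t x.2) by rewrite /gau; mfun.
have g0 (x : R * R) : 0 <= gau t x.1 * gau t x.2 by rewrite mulr_ge0 ?gau_ge0.
have mgz : measurable_fun [set: plane] (fun x : plane => gau t (x.1 - z.1) * gau t (x.2 - z.2)).
  by rewrite /gau; mfun.
apply: (@le_trans _ _ (\int[leb2]_x (t `^ (- (1 / 3)) * (gau t (x.1 - z.1) * gau t (x.2 - z.2)))%:E)%E).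
  under eq_integral do rewrite gauss_gau//.
  apply: int_mono.
  - exact: (measurableT_comp (measurable_powR _)).
  - by apply: measurable_funM => //; exact: measurable_cst.
  - by move=> x; exact: powR_ge0.
  move=> x; set G := gau _ _ * gau _ _.
  have G0 : 0 <= G by exact: g0 (x - z).
  have Gt : G <= t^-1.
    have P0 : 0 < 4 * pi * t by rewrite !mulr_gt0 ?pi_gt0.
    apply: (@le_trans _ _ ((Num.sqrt (4 * pi * t))^-1 * (Num.sqrt (4 * pi * t))^-1)).
      by apply: ler_pM; rewrite ?gau_ge0 ?gau_le_max.
    rewrite -invfM -expr2 sqr_sqrtr ?(ltW P0)// lef_pV2 ?posrE//.
    by rewrite ler_peMl ?(ltW t0)//; have := @pi_ge2 R; lra.
  have [->|Gn] := eqVneq G 0.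
    by rewrite powR0 ?mulr0// gt_eqF.
  have Gp : 0 < G by rewrite lt_neqAle eq_sym Gn.
  rewrite (_ : 4 / 3 = 1 / 3 + 1); last by field.
  rewrite powRD ?(negbTE Gn) ?implybT// powRr1// ler_wpM2r//.
  have -> : t `^ (- (1 / 3)) = t^-1 `^ (1 / 3).
    by rewrite -(powR_inv1 (ltW t0)) -powRrM mulN1r.
  by rewrite ge0_ler_powR ?nnegrE ?invr_ge0 ?(ltW t0)// divr_ge0.
rewrite int_scale; [|exact: mgz|by move=> x; rewrite mulr_ge0 ?gau_ge0|exact: powR_ge0].
rewrite -[leRHS]mule1; apply: lee_wpmul2l; first by rewrite lee_fin powR_ge0.
have -> : (\int[leb2]_x (gau t (x.1 - z.1) * gau t (x.2 - z.2))%:E = \int[leb2]_x (gau t x.1 * gau t x.2)%:E)%E.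
  rewrite -(leb2_translate z (f := fun x => (gau t x.1 * gau t x.2)%:E)); first by [].
  - exact/measurable_EFinP.
  - by move=> x; rewrite lee_fin.
by rewrite integral_gau2.
Qed.

End BiotSavart.

(** * The vorticity in L^(4/3) and the flux in L^1 near the initial time *)

Section FluxEstimate.
Context {R : realType}.
Notation mu := (@lebesgue_measure R).
Notation plane := (measurableTypeR R * measurableTypeR R)%type.
Variables (alpha T beta : R) (omega : R -> R * R -> R) (z : R * R).
Hypothesis T1 : T <= 1.
Hypothesis beta4 : beta < 1 / 4.
Hypothesis Lomega : forall t, 0 < t < T -> inLp (4 / 3) (omega t).
Hypothesis Somega : (sup_time T (fun t =>
        (t `^ beta)%:E *
        Lpnorm (4 / 3) (fun x => (omega t x - alpha * gauss t (x - z))%R))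
       < +oo)%E.

(** The rate [t^(-1/3)] is the power [4/3] of [t^(-1/4)], the size of the [L^(4/3)] norm of the
    Gaussian. The error obeys the same rate because [beta < 1/4] and [t <= 1]. *)
Lemma vorticity_L43 : exists C : R, 0 < C /\ forall t, 0 < t < T ->
  (\int[leb2]_x (`|onH (omega t) x| `^ (4 / 3))%:E <= (C * t `^ (- (1 / 3)))%:E)%E.
Proof.
pose D t x := omega t x - alpha * gauss t (x - z).
have [M [M0 MB]] := sup_time_bound Somega.
have p0 : 0 < 4 / 3 :> R by rewrite divr_gt0.
have pge0 : 0 <= 4 / 3 :> R by exact: ltW.
pose C := 2 `^ (4 / 3) * (M `^ (4 / 3) + `|alpha| `^ (4 / 3)).
exists (C + 1); split.
  by rewrite ltr_wpDl// mulr_ge0 ?powR_ge0// addr_ge0 ?powR_ge0.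
move=> t tT; have /andP[t0 tT'] := tT.
have t1 : t <= 1 by rewrite (le_trans (ltW tT')).
have mG : measurable_fun [set: plane] (fun x => gauss t (x - z)).
  rewrite (_ : (fun x => gauss t (x - z)) = (fun x => gau t (x.1 - z.1) * gau t (x.2 - z.2))).
    by rewrite /gau; mfun.
  by apply/funext => x; rewrite gauss_gau.
have G0 x : 0 <= gauss t (x - z) by rewrite gauss_gau// mulr_ge0 ?gau_ge0.
have mo : measurable_fun [set: plane] (onH (omega t)).
  by apply: measurable_onH; have [] := Lomega tT.
have mD : measurable_fun [set: plane] (onH (D t)).
  apply: measurable_onH; apply: measurable_funB; first by have [] := Lomega tT.
  by apply: measurable_funTS; apply: measurable_funM => //; exact: measurable_cst.
have m1 : measurable_fun [set: plane] (fun x => `|onH (D t) x| `^ (4 / 3)).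
  by apply: (measurableT_comp (measurable_powR _)); exact: measurableT_comp.
have m2 : measurable_fun [set: plane] (fun x => `|alpha| `^ (4 / 3) * gauss t (x - z) `^ (4 / 3)).
  by apply: measurable_funM; [exact: measurable_cst|exact: (measurableT_comp (measurable_powR _))].
have n2 x : 0 <= `|alpha| `^ (4 / 3) * gauss t (x - z) `^ (4 / 3) by rewrite mulr_ge0 ?powR_ge0.
have n1 x : 0 <= `|onH (D t) x| `^ (4 / 3) by exact: powR_ge0.
have c2 : 0 <= 2 `^ (4 / 3) :> R by exact: powR_ge0.
apply: (@le_trans _ _ (\int[leb2]_x (2 `^ (4 / 3) * (`|onH (D t) x| `^ (4 / 3) + `|alpha| `^ (4 / 3) * gauss t (x - z) `^ (4 / 3)))%:E)%E).
  apply: int_mono.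
  - by apply: (measurableT_comp (measurable_powR _)); exact: measurableT_comp.
  - by apply: measurable_funM; [exact: measurable_cst|exact: measurable_funD].
  - by move=> x; exact: powR_ge0.
  move=> x; rewrite -powRM//.
  have a0 : 0 <= `|alpha| * gauss t (x - z) by exact: mulr_ge0.
  have tri : `|onH (omega t) x| <= `|onH (D t) x| + `|alpha| * gauss t (x - z).
    rewrite /onH; case: ifP => _; last by rewrite normr0 add0r.
    rewrite -[X in _ <= _ + _ * X](ger0_norm (G0 x)) -normrM.
    by apply: le_trans (ler_normD _ _); rewrite /D subrK.
  move: tri; move: `|onH (D t) x| (normr_ge0 (onH (D t) x)) (_ * gauss _ _) a0 => u u0 v v0 tri.
  apply: (@le_trans _ _ ((2 * Num.max u v) `^ (4 / 3))).
    rewrite ge0_ler_powR ?nnegrE// ?mulr_ge0// ?le_max ?u0//.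
    apply: (le_trans tri); rewrite -[2]/(1 + 1) mulrDl mul1r.
    by apply: lerD; rewrite le_max lexx ?orbT.
  rewrite powRM ?le_max ?u0// ler_wpM2l//.
  by rewrite /Num.max; case: ifP => _; rewrite ?lerDl ?lerDr powR_ge0.
rewrite int_scale; [|exact: measurable_funD|by move=> x; rewrite addr_ge0|exact: c2].
rewrite int_addr//.
have t3 : 0 <= t `^ (- (1 / 3)) by exact: powR_ge0.
have I1 : (\int[leb2]_x (`|onH (D t) x| `^ (4 / 3))%:E <= (M `^ (4 / 3) * t `^ (- (1 / 3)))%:E)%E.
  rewrite -LpnormX//.
  have := MB t tT; rewrite -/(D t).
  have L0 : (0 <= Lpnorm (4 / 3) (D t))%E by exact: Lnorm_ge0.
  have tb : 0 < t `^ beta by rewrite powR_gt0.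
  case: (Lpnorm (4 / 3) (D t)) L0 => [l l0|_|//]; last by rewrite gt0_muley ?lte_fin.
  rewrite -EFinM lee_fin => lM; rewrite poweR_EFin lee_fin.
  have l0' : 0 <= l by rewrite -lee_fin.
  have {}lM : l <= M * t `^ (- beta).
    by rewrite powRN ler_pdivlMr// mulrC.
  apply: (@le_trans _ _ ((M * t `^ (- beta)) `^ (4 / 3))).
    by rewrite ge0_ler_powR ?nnegrE// mulr_ge0 ?powR_ge0// ltW.
  rewrite powRM ?powR_ge0 ?(ltW M0)// ler_wpM2l ?powR_ge0// -powRrM.
  have -> : - beta * (4 / 3) = - (beta * (4 / 3)) by ring.
  have b3 : beta * (4 / 3) <= 1 / 3 by move: beta4 => b4; lra.
  by apply: ger_powR; [rewrite t0 t1|rewrite lerN2].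
have I2 : (\int[leb2]_x (`|alpha| `^ (4 / 3) * gauss t (x - z) `^ (4 / 3))%:E <=
    (`|alpha| `^ (4 / 3) * t `^ (- (1 / 3)))%:E)%E.
  rewrite int_scale; [|exact: (measurableT_comp (measurable_powR _))|by move=> x; exact: powR_ge0|exact: powR_ge0].
  rewrite EFinM; apply: lee_wpmul2l; first by rewrite lee_fin powR_ge0.
  exact: integral_gauss_powR.
apply: (@le_trans _ _ ((2 `^ (4 / 3))%:E * (M `^ (4 / 3) * t `^ (- (1 / 3)) + `|alpha| `^ (4 / 3) * t `^ (- (1 / 3)))%:E)%E).
  by apply: lee_wpmul2l; [rewrite lee_fin|rewrite EFinD; exact: leeD].
by rewrite -mulrDl -EFinM mulrA -/C lee_fin ler_wpM2r// lerDl.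
Qed.

(** The quadratic bound scales like [A^(3/2)], and with [A] proportional to [t^(-1/3)] this is
    [t^(-1/2)]. *)
Lemma vorticity_flux_L1 : exists C : R, 0 < C /\ forall (i : bool) t, 0 < t < T ->
  (\int[leb2]_x (`|onH (omega t) x| * `|bs i (onH (omega t)) x|)%:E <= (C / Num.sqrt t)%:E)%E.
Proof.
have [C [C0 CB]] := vorticity_L43.
have pi0 : 0 < 2 * (9 + 4 * pi ^+ 2) :> R.
  by rewrite mulr_gt0// ltr_wpDr// mulr_ge0// sqr_ge0.
exists (2 * (9 + 4 * pi ^+ 2) * (C * Num.sqrt C)); split.
  by rewrite mulr_gt0// mulr_gt0// sqrtr_gt0.
move=> i t tT; have /andP[t0 tT'] := tT.
have A0 : 0 < C * t `^ (- (1 / 3)) by rewrite mulr_gt0// powR_gt0.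
have mo : measurable_fun [set: plane] (onH (omega t)).
  by apply: measurable_onH; have [] := Lomega tT.
have o0 y : y.2 <= 0 -> onH (omega t) y = 0 by move=> y0; rewrite /onH ltNge y0.
apply: (le_trans (integral_vorticity_flux i mo o0 A0 (CB t tT))).
have E : C * t `^ (- (1 / 3)) * Num.sqrt (C * t `^ (- (1 / 3))) = C * Num.sqrt C * (Num.sqrt t)^-1.
  rewrite sqrtrM ?(ltW C0)// mulrACA; congr (_ * _).
  rewrite -(powR12_sqrt (powR_ge0 t (- (1 / 3)))) -powRrM -powRD; last by rewrite (gt_eqF t0) implybT.
  rewrite (_ : - (1 / 3) + - (1 / 3) / 2 = - 2^-1); last by field.
  by rewrite powRN powR12_sqrt// ltW.
by rewrite lee_fin E -!mulrA.
Qed.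

End FluxEstimate.

(** * Duhamel representation of the vorticity *)

Section RintegralTools.
Context {R : realType}.

Lemma ae_eq_Rintegral d (T : measurableType d) (m : {measure set T -> \bar R}) (f g : T -> R) :
  measurable_fun setT f -> measurable_fun setT g ->
  {ae m, forall x, f x = g x} -> \int[m]_x f x = \int[m]_x g x.
Proof.
move=> mf mg fg; congr fine; apply: ae_eq_integral.
- exact: measurableT.
- exact/measurable_EFinP.
- exact/measurable_EFinP.
- by apply: filterS fg => x + _ => ->.
Qed.

Lemma Rintegral_prod12 d1 d2 (T1 : measurableType d1) (T2 : measurableType d2)
    (m1 : {sigma_finite_measure set T1 -> \bar R})
    (m2 : {sigma_finite_measure set T2 -> \bar R}) (f : T1 * T2 -> R) :
  (prodm m1 m2).-integrable setT (EFin \o f) ->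
  \int[m1]_x \int[m2]_y f (x, y) = \int[prodm m1 m2]_z f z.
Proof.
move=> If; rewrite /Rintegral.
have E : (\int[m1]_x fubini_F m2 (EFin \o f) x = \int[prodm m1 m2]_z (f z)%:E)%E.
  exact: integral12_prod_meas1.
rewrite -E; congr fine.
have IF := integrable_fubini_F If.
have mF := measurable_fubini_F If.
apply: ae_eq_integral.
- exact: measurableT.
- apply/measurable_EFinP; exact: (measurableT_comp (@fine_measurable R setT measurableT) mF).
- exact: mF.
- have := integrable_ae measurableT IF; apply: filterS => x /(_ Logic.I) Fx _.
  exact: fineK.
Qed.

Lemma Rintegral_prod21 d1 d2 (T1 : measurableType d1) (T2 : measurableType d2)
    (m1 : {sigma_finite_measure set T1 -> \bar R})
    (m2 : {sigma_finite_measure set T2 -> \bar R}) (f : T1 * T2 -> R) :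
  (prodm m1 m2).-integrable setT (EFin \o f) ->
  \int[m2]_y \int[m1]_x f (x, y) = \int[prodm m1 m2]_z f z.
Proof.
move=> If; rewrite /Rintegral.
have E : (\int[m2]_y fubini_G m1 (EFin \o f) y = \int[prodm m1 m2]_z (f z)%:E)%E.
  exact: integral21_prod_meas1.
rewrite -E; congr fine.
have mF := measurable_fubini_G If.
apply: ae_eq_integral.
- exact: measurableT.
- apply/measurable_EFinP; exact: (measurableT_comp (@fine_measurable R setT measurableT) mF).
- exact: mF.
- have := ae_integrable2 If; apply: filterS => x Fx _.
  by apply: fineK; exact: (integrable_fin_num measurableT Fx).
Qed.

Lemma integrable_abs_lty d (T : measurableType d) (m : {measure set T -> \bar R}) (f : T -> R) :
  measurable_fun setT f -> (\int[m]_x (`|f x|)%:E < +oo)%E -> m.-integrable setT (EFin \o f).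
Proof. by move=> mf If; apply/integrableP; split; [exact/measurable_EFinP|]. Qed.

Lemma ae_integral_lty d1 d2 (T1 : measurableType d1) (T2 : measurableType d2)
    (m1 : {sigma_finite_measure set T1 -> \bar R})
    (m2 : {sigma_finite_measure set T2 -> \bar R}) (f : T1 -> T2 -> R) :
  measurable_fun [set: (T1 * T2)%type] (fun z => f z.1 z.2) -> (forall x y, 0 <= f x y) ->
  (\int[m2]_y \int[m1]_x (f x y)%:E < +oo)%E ->
  {ae m1, forall x, (\int[m2]_y (f x y)%:E < +oo)%E}.
Proof.
move=> mf f0 If.
pose F (z : T1 * T2) := (f z.1 z.2)%:E.
have mF : measurable_fun setT F by exact/measurable_EFinP.
have F0 z : (0 <= F z)%E by rewrite lee_fin.
rewrite -(@fubini_tonelli _ _ _ _ _ m1 m2 F) in If; [|by []|by []].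
have I : m1.-integrable setT (fun x => \int[m2]_y F (x, y))%E.
  apply/integrableP; split; first exact: measurable_fun_fubini_tonelli_F.
  under eq_integral do rewrite gee0_abs ?integral_ge0//.
  exact: If.
have := integrable_ae measurableT I; apply: filterS => x /(_ Logic.I).
by rewrite ge0_fin_numE// integral_ge0.
Qed.

End RintegralTools.

(** * Total mass of a weighted Duhamel integrand *)

Section Duhamel.
Context {R : realType}.
Notation mu := (@lebesgue_measure R).
Notation plane := (measurableTypeR R * measurableTypeR R)%type.
Notation spacetime := (measurableTypeR R * plane)%type.

Definition lst : {sigma_finite_measure set spacetime -> \bar R} := prodm mu lebp.

Variables (t A C : R) (f : spacetime -> R) (k : spacetime * plane -> R).
Hypotheses (t0 : 0 < t) (A0 : 0 <= A) (C0 : 0 <= C) (mf : measurable_fun setT f) (mk : measurable_fun setT k).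
Hypothesis k0 : forall z, 0 <= k z.
Hypothesis f0 : forall s (y : plane), y.2 <= 0 -> f (s, y) = 0.
Hypothesis fA : forall s, 0 < s < t -> (\int[leb2]_y (`|f (s, y)|)%:E <= (A / Num.sqrt s)%:E)%E.
Hypothesis kC : forall s y, 0 < s < t -> 0 < y.2 ->
  (\int[leb2]_x (k ((s, y), x))%:E <= (C / Num.sqrt (t - s))%:E)%E.

Definition duhamel_weight (z : spacetime * plane) : R :=
  if (0 < z.1.1) && (z.1.1 < t) then k z * `|f z.1| else 0.

Lemma measurable_duhamel_weight : measurable_fun setT duhamel_weight.
Proof.
apply: measurable_fun_ifT; [by mfun| |exact: measurable_cst].
apply: measurable_funM; first exact: mk.
by apply: measurableT_comp => //; exact: (measurableT_comp mf measurable_fst).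
Qed.

Lemma duhamel_weight_ge0 z : 0 <= duhamel_weight z.
Proof. by rewrite /duhamel_weight; case: ifP => // _; rewrite mulr_ge0. Qed.

(** Tonelli with [x] innermost: the kernel bound is uniform in [y], so it leaves the [L^1] norm of
    the flux and then the product of two inverse square roots in time, whose integral supplies the
    [8]. *)
Lemma integral_duhamel_weight :
  (\int[lst]_l \int[leb2]_x (duhamel_weight (l, x))%:E <= (8 * A * C)%:E)%E.
Proof.
have mJ : measurable_fun setT (fun l => \int[leb2]_x (duhamel_weight (l, x))%:E)%E.
  apply: (@measurable_fun_fubini_tonelli_F _ _ _ _ _ (@lebp R) (fun z => (duhamel_weight z)%:E)).
  - by apply/measurable_EFinP; exact: measurable_duhamel_weight.
  - by move=> z; rewrite lee_fin duhamel_weight_ge0.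
have J0 l : (0 <= \int[leb2]_x (duhamel_weight (l, x))%:E)%E.
  by apply: int_ge0 => x; exact: duhamel_weight_ge0.
rewrite /lst prodm_tonelli1//.
have mJs : measurable_fun setT (fun s => \int[lebp]_y \int[leb2]_x (duhamel_weight ((s, y), x))%:E)%E.
  by apply: (@measurable_fun_fubini_tonelli_F _ _ _ _ _ (@lebp R) (fun l => \int[leb2]_x (duhamel_weight (l, x))%:E)%E).
pose B (s : R) : R := if (0 < s) && (s < t) then A * C * ((Num.sqrt (t - s))^-1 * (Num.sqrt s)^-1) else 0.
have mB : measurable_fun setT B by rewrite /B; mfun.
apply: (@le_trans _ _ (\int[mu]_s (B s)%:E)%E).
  apply: ge0_le_integral.
  - exact: measurableT.
  - by move=> s _; apply: integral_ge0.
  - exact: mJs.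
  - exact/measurable_EFinP.
  move=> s _; rewrite /B; have [sT|sT] := boolP (0 < s < t); last first.
    rewrite (eq_integral (cst 0%E)) ?integral0// => y _.
    rewrite (eq_integral (cst 0%E)) ?integral0// => x _.
    by rewrite /duhamel_weight /= (negbTE sT).
  have c0 : 0 <= C / Num.sqrt (t - s) by rewrite divr_ge0 ?sqrtr_ge0.
  have mfs : measurable_fun [set: plane] (fun y => `|f (s, y)|).
    by apply: measurableT_comp => //; exact: (measurableT_comp mf (measurable_pair1 s)).
  apply: (@le_trans _ _ (\int[leb2]_y (C / Num.sqrt (t - s) * `|f (s, y)|)%:E)%E).
    apply: ge0_le_integral.
    - exact: measurableT.
    - by move=> y _; exact: J0.
    - exact: (measurableT_comp mJ (measurable_pair1 s)).
    - by apply/measurable_EFinP; apply: measurable_funM => //; exact: measurable_cst.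
    move=> y _.
    have mks : measurable_fun [set: plane] (fun x => k ((s, y), x)).
      exact: (measurableT_comp mk (measurable_pair1 (s, y))).
    rewrite /duhamel_weight /= sT.
    have [y0|y0] := leP y.2 0.
      by rewrite f0// normr0 mulr0; under eq_integral do rewrite mulr0; rewrite integral0.
    rewrite int_scaler// EFinM; apply: lee_wpmul2r; first by rewrite lee_fin.
    exact: kC.
  rewrite int_scale//.
  have -> : A * C * ((Num.sqrt (t - s))^-1 / Num.sqrt s) = C / Num.sqrt (t - s) * (A / Num.sqrt s) by ring.
  by rewrite [leRHS]EFinM; apply: lee_wpmul2l; [rewrite lee_fin|exact: fA].
have AC : 0 <= A * C by exact: mulr_ge0.
have -> : (\int[mu]_s (B s)%:E = \int[mu]_(s in `]0%R, t[) (A * C * ((Num.sqrt (t - s))^-1 * (Num.sqrt s)^-1))%:E)%E.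
  rewrite [RHS]integral_mkcond; apply: eq_integral => s _.
  by rewrite patchE mem_setE in_itv /B /=; case: ifP.
under eq_integral do rewrite EFinM.
rewrite ge0_integralZl; last 4 first.
- exact: measurable_itv.
- by apply/measurable_EFinP; apply: measurable_funTS; mfun.
- by move=> s _; rewrite lee_fin mulr_ge0 ?invr_ge0 ?sqrtr_ge0.
- by rewrite lee_fin.
have -> : 8 * A * C = A * C * 8 by ring.
by rewrite [leRHS]EFinM; apply: lee_wpmul2l; [rewrite lee_fin|exact: integral_invsqrt_itv].
Qed.

End Duhamel.

Lemma stokes_onH (R : realType) (s : R) (f : R * R -> R) x : 0 < s ->
  stokes s f x = \int[leb2]_y (stokes_kernel s x y * onH f y).
Proof.
move=> s0; rewrite /stokes Rintegral_Hplus; apply: eq_Rintegral => y _.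
by rewrite /onH K_stokes_kernel//; case: ifP => _; rewrite ?mulr0.
Qed.

Opaque stokes_kernel wall_grad heat_grad K vort.

Section Representation.
Context {R : realType}.
Notation mu := (@lebesgue_measure R).
Notation plane := (measurableTypeR R * measurableTypeR R)%type.
Notation spacetime := (measurableTypeR R * plane)%type.

Variables (alpha T : R) (omega : R -> R * R -> R) (z : R * R).
Hypothesis T1 : T <= 1.
Hypothesis z0 : 0 < z.2.
Hypothesis omega_mild : mild_solution T omega.
Hypothesis omega_init : weak_cvg_dirac omega alpha z.
Hypothesis omega_L1 : (sup_time T (fun t => Lpnorm 1 (omega t)) < +oo)%E.

Let inL1 t : 0 < t < T -> inLp 1 (omega t).
Proof. by move=> tT; have [+ _ _ _] := omega_mild => /(_ t tT)[[]]. Qed.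

Let momega t : 0 < t < T -> measurable_fun [set: plane] (onH (omega t)).
Proof. by move=> tT; apply: measurable_onH; have [] := inL1 tT. Qed.

(** Continuity of the curve in [L^1] is all that the jointly measurable version requires. It is then
    set to zero at every point outside the half-plane, not merely almost everywhere. *)
Lemma vorticity_version : exists v : spacetime -> R, [/\ measurable_fun setT v,
  forall s, 0 < s < T -> {ae leb2, forall y, v (s, y) = onH (omega s) y} &
  forall s (y : plane), y.2 <= 0 -> v (s, y) = 0].
Proof.
have [|v [mv vE]] := @jointly_measurable_version _ plane R leb2 T (fun s => onH (omega s)) momega.
  move=> s sT; have [_ + _ _] := omega_mild => /(_ s sT); apply: cvg_trans.
  apply: near_eq_cvg; near=> r; rewrite Lpnorm1E; apply: eq_integral => y _.
  by rewrite /onH /=; case: ifP; rewrite ?subrr.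
exists (fun l => if 0 < l.2.2 then v l else 0); split.
- by apply: measurable_fun_ifT => //; mfun.
- move=> s sT; have := vE s sT; apply: filterS => y vy /=.
  by rewrite vy /onH; case: (0 < y.2).
- by move=> s y y0; rewrite ltNge y0.
Unshelve. all: by end_near.
Qed.

(* The time increment of the kernel is uniformly small, and at time [t] the
   kernel is an admissible test function. *)
Lemma stokes_initial t (tn : nat -> R) x : 0 < t < T -> 0 < x.2 ->
  (forall n, 0 < tn n <= t / 2) -> tn @ \oo --> 0 ->
  stokes (t - tn n) (omega (tn n)) x @[n --> \oo] --> alpha * stokes_kernel t x z.
Proof.
move=> /andP[t0 tT] x0 tn0 tnc.
have t1 : t <= 1 by rewrite (le_trans (ltW tT)).
have tnT n : 0 < tn n < T by have /andP[-> h] := tn0 n; lra.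
have [M [M0 MB]] := sup_time_bound omega_L1.
have [C CB] := stokes_kernel_time_lip t0 t1 x0.
have C1 : 0 <= `|C| by [].
have W := omega_init (stokes_kernel_in_C0 t0 t1 x0).
have Wn : stokes t (omega (tn n)) x @[n --> \oo] --> alpha * stokes_kernel t x z.
  have -> : stokes_kernel t x z = \int[\d_z]_(y in Hplus) K x y t.
    rewrite /Rintegral integral_dirac; last 2 first.
    - exact: measurable_Hplus.
    - apply/measurable_EFinP; apply: measurable_funTS.
      rewrite (_ : (fun y => K x y t) = (fun y => stokes_kernel t x y)).
        by apply: (@measurable_stokes_kernel _ plane _ (fun=> t) (fun=> x) id); mfun.
      by apply/funext => y; rewrite K_stokes_kernel.
    by rewrite diracE mem_set// mul1e K_stokes_kernel.
  move/cvg_at_rightP : W => /(_ tn); apply; split => [n|//].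
  by have /andP[] := tn0 n.
have mS (u s : R) : measurable_fun [set: plane] (fun y => stokes_kernel s x y).
  by apply: (@measurable_stokes_kernel _ plane _ (fun=> s) (fun=> x) id); mfun.
have I1 n : leb2.-integrable setT (fun y : plane => (onH (omega (tn n)) y)%:E).
  apply: integrable_abs_lty; first exact: momega.
  by rewrite -Lpnorm1E; have [] := inL1 (tnT n).
have [B BB] := stokes_kernel_decay t0 t1 x0.
have Bk y : 0 < y.2 -> `|stokes_kernel t x y| <= B.
  move=> y0; apply: le_trans (BB y y0); rewrite ler_peMl// lerDl enorm_ge0 //.
have It n : leb2.-integrable setT (fun y : plane => (stokes_kernel t x y * onH (omega (tn n)) y)%:E).
  have IB := integrableZl measurableT `|B| (I1 n).
  apply: (le_integrable measurableT _ _ IB).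
    by apply/measurable_EFinP; apply: measurable_funM; [exact: mS|exact: momega].
  move=> y _; rewrite -EFinM /= lee_fin !normrM normr_id.
  rewrite /onH; case: ifP => [y0|_]; last by rewrite normr0 !mulr0.
  by rewrite ler_wpM2r// (le_trans (Bk y y0))// ler_norm.
have Dn n : `|stokes (t - tn n) (omega (tn n)) x - stokes t (omega (tn n)) x|
    <= `|C| * M * tn n.
  have /andP[tp th] := tn0 n.
  have tm : 0 < t - tn n by lra.
  rewrite (stokes_onH _ _ tm) -/(stokes t (omega (tn n)) x) (stokes_onH _ _ t0).
  have Id : leb2.-integrable setT (fun y : plane => ((stokes_kernel (t - tn n) x y - stokes_kernel t x y) * onH (omega (tn n)) y)%:E).
    have IB := integrableZl measurableT (`|C| * tn n) (I1 n).
    apply: (le_integrable measurableT _ _ IB).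
      apply/measurable_EFinP; apply: measurable_funM; last exact: momega.
      by apply: measurable_funB; exact: mS.
    move=> y _; rewrite -EFinM /= lee_fin !normrM normr_id (ger0_norm (ltW tp)).
    rewrite /onH; case: ifP => [y0|_]; last by rewrite normr0 !mulr0.
    rewrite ler_wpM2r//.
    have := CB (t - tn n) y; rewrite (_ : t - (t - tn n) = tn n); last by ring.
    move=> h; apply: (le_trans (h _ _ y0)); [lra|lra|].
    by rewrite ler_wpM2r ?(ltW tp)// ler_norm.
  have Im : leb2.-integrable setT (fun y : plane => (stokes_kernel (t - tn n) x y * onH (omega (tn n)) y)%:E).
    have := integrableD measurableT Id (It n).
    by apply: eq_integrable => // y _; rewrite /= -EFinD -mulrDl subrK.
  rewrite -RintegralB; [|exact: measurableT|exact: Im|exact: It n].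
  rewrite (_ : \int[leb2]_x0 _ = \int[leb2]_y ((stokes_kernel (t - tn n) x y - stokes_kernel t x y) * onH (omega (tn n)) y)); last first.
    by apply: eq_Rintegral => y _; rewrite mulrBl.
  rewrite -lee_fin; apply: (le_trans (le_abs_Rintegral _ _)).
    by apply: measurable_funM; [apply: measurable_funB; exact: mS|exact: momega].
  apply: (@le_trans _ _ (\int[leb2]_y (`|C| * tn n * `|onH (omega (tn n)) y|)%:E)%E).
    apply: int_mono.
    - apply: measurableT_comp => //; apply: measurable_funM; last exact: momega.
      by apply: measurable_funB; exact: mS.
    - apply: measurable_funM; first exact: measurable_cst.
      by apply: measurableT_comp => //; exact: momega.
    - by [].
    - move=> y; rewrite normrM /onH; case: ifP => [y0|_]; last by rewrite normr0 !mulr0.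
      rewrite ler_wpM2r//.
      have := CB (t - tn n) y; rewrite (_ : t - (t - tn n) = tn n); last by ring.
      move=> h; apply: (le_trans (h _ _ y0)); [lra|lra|].
      by rewrite ler_wpM2r ?(ltW tp)// ler_norm.
  rewrite int_scale; last 3 first.
  - by apply: measurableT_comp => //; exact: momega.
  - by [].
  - by rewrite mulr_ge0// ltW.
  have -> : `|C| * M * tn n = `|C| * tn n * M by ring.
  rewrite [leRHS]EFinM; apply: lee_wpmul2l; first by rewrite lee_fin mulr_ge0// ltW.
  by rewrite -Lpnorm1E; exact: MB.
have D0 : (stokes (t - tn n) (omega (tn n)) x - stokes t (omega (tn n)) x) @[n --> \oo] --> 0.
  apply: norm_cvg0.
  apply: (@squeeze_cvgr _ _ _ _ (cst 0) (fun n => `|C| * M * tn n)).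
  - by apply: nearW => n; rewrite normr_ge0 /=; exact: Dn.
  - exact: cvg_cst.
  - rewrite -[X in _ --> X](mulr0 (`|C| * M)); apply: cvgM; [exact: cvg_cst|exact: tnc].
have H := cvgD D0 Wn; rewrite add0r in H.
rewrite (_ : (fun n => stokes (t - tn n) (omega (tn n)) x) =
  (fun n => stokes (t - tn n) (omega (tn n)) x - stokes t (omega (tn n)) x)
    \+ (fun n => stokes t (omega (tn n)) x)); first exact: H.
by apply/funext => n /=; rewrite subrK.
Qed.

End Representation.

(** * The flux and the weighted gradient kernels *)

Section Flux.
Context {R : realType}.
Notation mu := (@lebesgue_measure R).
Notation plane := (measurableTypeR R * measurableTypeR R)%type.
Notation spacetime := (measurableTypeR R * plane)%type.
Variables (T A : R) (omega : R -> R * R -> R) (v : spacetime -> R).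
Hypothesis momega : forall t, 0 < t < T -> measurable_fun [set: plane] (onH (omega t)).
Hypothesis mv : measurable_fun setT v.
Hypothesis vE : forall s, 0 < s < T -> {ae leb2, forall y, v (s, y) = onH (omega s) y}.
Hypothesis v0 : forall s (y : plane), y.2 <= 0 -> v (s, y) = 0.
Hypothesis omegaA : forall (i : bool) t, 0 < t < T ->
  (\int[leb2]_x (`|onH (omega t) x| * `|bs i (onH (omega t)) x|)%:E <= (A / Num.sqrt t)%:E)%E.

(** A component of [F], formed from the jointly measurable version so that it is measurable in time
    and space together. *)
Definition flux (i : bool) (l : spacetime) : R := v l * bs i (fun y => v (l.1, y)) l.2.

Lemma measurable_flux i : measurable_fun setT (flux i).
Proof.
apply: measurable_funM; first exact: mv.
apply: (@measurable_bs _ i _ spacetime (fun w => v (w.1.1, w.2)) snd); last exact: measurable_snd.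
by apply: (measurableT_comp mv (g := fun w : spacetime * plane => (w.1.1, w.2))); mfun.
Qed.

Lemma flux0 i s (y : plane) : y.2 <= 0 -> flux i (s, y) = 0.
Proof. by move=> y0; rewrite /flux v0// mul0r. Qed.

Let mvs s : measurable_fun [set: plane] (fun y => v (s, y)).
Proof. exact: (measurableT_comp mv (measurable_pair1 s)). Qed.

(** The velocity is an integral of the vorticity, so a change on a null set does not affect it at
    any point. *)
Lemma flux_bs i s x : 0 < s < T -> bs i (fun y => v (s, y)) x = bs i (onH (omega s)) x.
Proof.
move=> sT; congr (_ * _); apply: ae_eq_Rintegral.
- by apply: measurable_funM => //; apply: measurable_halfbs; mfun.
- by apply: measurable_funM; [apply: measurable_halfbs; mfun|exact: momega].
- by have := vE sT; apply: filterS => y ->.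
Qed.

Lemma flux_le i s : 0 < s < T ->
  (\int[leb2]_y (`|flux i (s, y)|)%:E <= (A / Num.sqrt s)%:E)%E.
Proof.
move=> sT; apply: le_trans (omegaA i sT).
have mo := momega sT.
rewrite le_eqVlt; apply/orP; left; apply/eqP; apply: ge0_ae_eq_integral.
- exact: measurableT.
- apply/measurable_EFinP; apply: measurableT_comp => //.
  exact: (measurableT_comp (measurable_flux i) (measurable_pair1 s)).
- apply/measurable_EFinP; apply: measurable_funM; apply: measurableT_comp => //.
  apply: (@measurable_bs _ i _ plane (fun w => onH (omega s) w.2) id); last exact: measurable_id.
  exact: (measurableT_comp mo measurable_snd).
- by move=> y _; rewrite lee_fin.
- by move=> y _; rewrite lee_fin mulr_ge0.
- have := vE sT; apply: filterS => y vy _.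
  by rewrite /flux /= flux_bs// vy normrM.
Qed.

Definition heat_weight (i : bool) (t : R) (z : spacetime * plane) : R :=
  (1 + enorm (z.2 - z.1.2)) * `|heat_grad i (t - z.1.1) (z.2 - z.1.2)|.

Definition wall_weight (i : bool) (t : R) (z : spacetime * plane) : R :=
  if 0 < z.2.2 then (1 + 2 * z.2.2) * `|wall_grad i (t - z.1.1) z.2 z.1.2| else 0.

Lemma measurable_enorm d (U : measurableType d) (a : U -> plane) :
  measurable_fun setT a -> measurable_fun setT (fun z => enorm (a z)).
Proof. by move=> ma; rewrite /enorm; mfun. Qed.

Lemma measurable_heat_weight i t : measurable_fun setT (heat_weight i t).
Proof.
apply: measurable_funM.
  by apply: measurable_funD; [exact: measurable_cst|apply: measurable_enorm; mfun].
by apply: measurableT_comp => //; apply: measurable_heat_grad; mfun.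
Qed.

Lemma measurable_wall_weight i t : measurable_fun setT (wall_weight i t).
Proof.
apply: measurable_fun_ifT; [by mfun| |exact: measurable_cst].
apply: measurable_funM; first by mfun.
by apply: measurableT_comp => //; apply: measurable_wall_grad; mfun.
Qed.

Lemma heat_weight_ge0 i t z : 0 <= heat_weight i t z.
Proof. by rewrite mulr_ge0// addr_ge0// enorm_ge0. Qed.

Lemma wall_weight_ge0 i t z : 0 <= wall_weight i t z.
Proof.
by rewrite /wall_weight; case: ifP => // x0; rewrite mulr_ge0// addr_ge0// mulr_ge0// ltW.
Qed.

Lemma integral_flux_weights : T <= 1 -> 0 <= A -> exists C : R, 0 < C /\ forall i t, 0 < t < T ->
  (\int[lst]_l \int[leb2]_x (duhamel_weight t (flux i) (heat_weight i t) (l, x))%:E <= (8 * A * C)%:E)%E /\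
  (\int[lst]_l \int[leb2]_x (duhamel_weight t (flux i) (wall_weight i t) (l, x))%:E <= (8 * A * C)%:E)%E.
Proof.
move=> T1 A0.
have [C1 [C10 C1B]] := @integral_heat_grad_weight R.
have [C2 [C20 C2B]] := @integral_wall_grad_weight R.
exists (Num.max C1 C2); split; first by rewrite lt_max C10.
move=> i t /andP[t0 tT].
have M0 : 0 <= Num.max C1 C2 by rewrite le_max (ltW C10).
have fA s : 0 < s < t -> (\int[leb2]_y (`|flux i (s, y)|)%:E <= (A / Num.sqrt s)%:E)%E.
  by move=> /andP[s0 st]; apply: flux_le; rewrite s0 (lt_trans st).
have st1 s : 0 < s < t -> 0 < t - s /\ t - s <= 1 by move=> /andP[s0 st]; lra.
split; apply: integral_duhamel_weight => //.
- exact: measurable_flux.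
- exact: measurable_heat_weight.
- exact: heat_weight_ge0.
- exact: flux0.
- move=> s y /st1[ts0 ts1] y0; rewrite /heat_weight /=.
  rewrite (leb2_translate y (f := fun x => ((1 + enorm x) * `|heat_grad i (t - s) x|)%:E)); last 2 first.
  + apply/measurable_EFinP; apply: measurable_funM.
      by apply: measurable_funD; [exact: measurable_cst|apply: measurable_enorm; mfun].
    by apply: measurableT_comp => //; apply: measurable_heat_grad; mfun.
  + by move=> x; rewrite lee_fin mulr_ge0// addr_ge0// enorm_ge0.
  apply: (le_trans (C1B i (t - s) ts0 ts1)); rewrite lee_fin ler_wpM2r ?invr_ge0 ?sqrtr_ge0//.
  by rewrite le_max lexx.
- exact: measurable_flux.
- exact: measurable_wall_weight.
- exact: wall_weight_ge0.
- exact: flux0.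
- move=> s y /st1[ts0 ts1] y0.
  apply: (le_trans (C2B i (t - s) y ts0 ts1 y0)); rewrite lee_fin ler_wpM2r ?invr_ge0 ?sqrtr_ge0//.
  by rewrite le_max lexx orbT.
Qed.

End Flux.

Lemma int_addr_lty d (T : measurableType d) (R : realType)
    (m : {measure set T -> \bar R}) (f g : T -> R) :
  measurable_fun setT f -> measurable_fun setT g ->
  (forall x, 0 <= f x) -> (forall x, 0 <= g x) ->
  (\int[m]_x (f x)%:E < +oo)%E -> (\int[m]_x (g x)%:E < +oo)%E ->
  (\int[m]_x (f x + g x)%:E < +oo)%E.
Proof. by move=> *; rewrite int_addr//; exact: lte_add_pinfty. Qed.

(** True without integrability: as soon as the positive or the negative part has infinite integral,
    both sides are [0]. *)
Lemma RintegralN d (T : measurableType d) (R : realType)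
    (m : {measure set T -> \bar R}) (f : T -> R) : \int[m]_x (- f x) = - \int[m]_x f x.
Proof.
rewrite /Rintegral integralE [in RHS]integralE.
have E : (fun x => (- f x)%:E) = (\- (fun x => (f x)%:E))%E by apply/funext.
rewrite E funeposN funenegN.
have := @integral_ge0 _ _ _ m setT (fun x => (fun x => (f x)%:E)^\+%E x) (fun x _ => funepos_ge0 _ x).
have := @integral_ge0 _ _ _ m setT (fun x => (fun x => (f x)%:E)^\-%E x) (fun x _ => funeneg_ge0 _ x).
move: (\int[m]_x _)%E (\int[m]_x _)%E => [a| |] [b| |] //= _ _; rewrite ?oppr0 ?opprB //.
Qed.

Lemma cvg_Rintegral_dominated d (T : measurableType d) (R : realType)
    (m : {measure set T -> \bar R}) (f_ : nat -> T -> R) (f g : T -> R) :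
  (forall n, measurable_fun setT (f_ n)) -> measurable_fun setT f ->
  (forall x, f_ n x @[n --> \oo] --> f x) ->
  m.-integrable setT (EFin \o g) -> (forall n x, `|f_ n x| <= g x) ->
  \int[m]_x f_ n x @[n --> \oo] --> \int[m]_x f x.
Proof.
move=> mf_ mf cf Ig fg.
have mE n : measurable_fun setT (fun x => (f_ n x)%:E) by exact/measurable_EFinP.
have mfE : measurable_fun setT (fun x => (f x)%:E) by exact/measurable_EFinP.
have cE : {ae m, forall x, setT x -> (f_ n x)%:E @[n --> \oo] --> (f x)%:E}.
  by apply: aeW => x _; apply: cvg_EFin; [exact: nearW|exact: cf].
have bE : {ae m, forall x n, setT x -> (`|(f_ n x)%:E| <= (EFin \o g) x)%E}.
  by apply: aeW => x n _; rewrite lee_fin.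
have [If _ H] := @dominated_convergence _ _ _ m setT measurableT (fun n x => (f_ n x)%:E)
  (fun x => (f x)%:E) (EFin \o g) mE mfE cE Ig bE.
by apply: fine_cvg; rewrite fineK //; exact: (integrable_fin_num measurableT If).
Qed.

Section DuhamelFormula.
Context {R : realType}.
Notation mu := (@lebesgue_measure R).
Notation plane := (measurableTypeR R * measurableTypeR R)%type.
Notation spacetime := (measurableTypeR R * plane)%type.

Definition duhamel_heat (v : spacetime -> R) (i : bool) (t : R) (z : spacetime * plane) : R :=
  if (0 < z.1.1) && (z.1.1 < t) then heat_grad i (t - z.1.1) (z.2 - z.1.2) * flux v i z.1 else 0.

Definition duhamel_wall (v : spacetime -> R) (i : bool) (t : R) (z : spacetime * plane) : R :=
  if (0 < z.1.1) && (z.1.1 < t) then wall_grad i (t - z.1.1) z.2 z.1.2 * flux v i z.1 else 0.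

Lemma measurable_duhamel_heat v i t : measurable_fun setT v ->
  measurable_fun setT (duhamel_heat v i t).
Proof.
move=> mv; apply: measurable_fun_ifT; [by mfun| |exact: measurable_cst].
apply: measurable_funM; first by apply: measurable_heat_grad; mfun.
exact: (measurableT_comp (measurable_flux mv i) measurable_fst).
Qed.

Lemma measurable_duhamel_wall v i t : measurable_fun setT v ->
  measurable_fun setT (duhamel_wall v i t).
Proof.
move=> mv; apply: measurable_fun_ifT; [by mfun| |exact: measurable_cst].
apply: measurable_funM; first by apply: measurable_wall_grad; mfun.
exact: (measurableT_comp (measurable_flux mv i) measurable_fst).
Qed.

Lemma duhamel_heat_le v i t z :
  `|duhamel_heat v i t z| <= duhamel_weight t (flux v i) (heat_weight i t) z.
Proof.
rewrite /duhamel_heat /duhamel_weight; case: ifP => _; last by rewrite normr0.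
by rewrite normrM ler_wpM2r// /heat_weight ler_peMl// lerDl enorm_ge0.
Qed.

Lemma duhamel_wall_le v i t z : 0 < z.2.2 ->
  `|duhamel_wall v i t z| <= duhamel_weight t (flux v i) (wall_weight i t) z.
Proof.
move=> z0; rewrite /duhamel_wall /duhamel_weight; case: ifP => _; last by rewrite normr0.
rewrite normrM ler_wpM2r// /wall_weight z0 ler_peMl// lerDl.
by rewrite mulr_ge0// ltW.
Qed.

Variables (alpha T A : R) (omega : R -> R * R -> R) (v : spacetime -> R) (z : R * R).
Hypothesis T1 : T <= 1.
Hypothesis A0 : 0 <= A.
Hypothesis z0 : 0 < z.2.
Hypothesis omega_mild : mild_solution T omega.
Hypothesis omega_init : weak_cvg_dirac omega alpha z.
Hypothesis omega_L1 : (sup_time T (fun t => Lpnorm 1 (omega t)) < +oo)%E.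
Hypothesis mv : measurable_fun setT v.
Hypothesis vE : forall s, 0 < s < T -> {ae leb2, forall y, v (s, y) = onH (omega s) y}.
Hypothesis v0 : forall s (y : plane), y.2 <= 0 -> v (s, y) = 0.
Hypothesis omegaA : forall (i : bool) t, 0 < t < T ->
  (\int[leb2]_x (`|onH (omega t) x| * `|bs i (onH (omega t)) x|)%:E <= (A / Num.sqrt t)%:E)%E.

Let momega t : 0 < t < T -> measurable_fun [set: plane] (onH (omega t)).
Proof.
by move=> tT; apply: measurable_onH; have [+ _ _ _] := omega_mild => /(_ t tT)[[[]]].
Qed.

Lemma ae_weight_lty (w : spacetime * plane -> R) (C : R) : measurable_fun setT w ->
  (forall y, 0 <= w y) -> (\int[lst]_l \int[leb2]_x (w (l, x))%:E <= C%:E)%E ->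
  {ae leb2, forall x, (\int[lst]_l (w (l, x))%:E < +oo)%E}.
Proof.
move=> mw w0 wC.
apply: (@ae_integral_lty _ _ _ plane spacetime (@lebp R) (@lst R) (fun x l => w (l, x))).
- by apply: (measurableT_comp mw (g := fun u : plane * spacetime => (u.2, u.1))); mfun.
- by move=> x l; exact: w0.
- exact: (le_lt_trans wC (ltry _)).
Qed.

(** The integrand [grad_y K(x, y, t - s) . F(s, y)] of the representation, extended by zero to times
    outside []0, t[]. *)
Definition duhamel_sum (t : R) (x : plane) (l : spacetime) : R :=
  (duhamel_wall v true t (l, x) - duhamel_heat v true t (l, x)) +
  (duhamel_wall v false t (l, x) - duhamel_heat v false t (l, x)).

Lemma stokes_div_duhamel t s x : 0 < s < t -> t < T ->
  stokes_div (t - s) (fun y => omega s y *: BS (omega s) y) x =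
  - \int[lebp]_y duhamel_sum t x (s, y).
Proof.
move=> st tT; have /andP[s0 ts] := st.
have ts0 : 0 < t - s by rewrite subr_gt0.
have sT : 0 < s < T by rewrite s0 (lt_trans ts).
have mo := momega sT.
pose g i y := (wall_grad i (t - s) x y - heat_grad i (t - s) (x - y)) *
  (onH (omega s) y * bs i (onH (omega s)) y).
have mbs i : measurable_fun [set: plane] (fun y => bs i (onH (omega s)) y).
  apply: (@measurable_bs _ i _ plane (fun w => onH (omega s) w.2) id); last exact: measurable_id.
  exact: (measurableT_comp mo measurable_snd).
have mg i : measurable_fun [set: plane] (g i).
  apply: measurable_funM; last exact: measurable_funM.
  apply: measurable_funB.
    by apply: (@measurable_wall_grad _ plane _ (fun=> t - s) (fun=> x) id); mfun.
  by apply: (@measurable_heat_grad _ plane _ (fun=> t - s) (fun y => x - y)); mfun.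
rewrite /stokes_div Rintegral_Hplus; congr (- _).
transitivity (\int[lebp]_y (g true y + g false y)).
  apply: eq_Rintegral => y _; rewrite [LHS]/onH /g; case: ifPn => [y0|y0]; last first.
    by rewrite /onH (negbTE y0) !mul0r !mulr0 addr0.
  have -> : onH (omega s) y = omega s y by rewrite /onH y0.
  rewrite BS_bs /dot stokes_kernel_grad1// stokes_kernel_grad2//.
  by rewrite /fst /snd !(addrC (- heat_grad _ _ _)).
apply: ae_eq_Rintegral.
- exact: measurable_funD.
- have m1 : measurable_fun [set: plane] (fun y => ((s, y), x) : spacetime * plane) by mfun.
  by rewrite /duhamel_sum; apply: measurable_funD; apply: measurable_funB;
    [apply: (measurableT_comp (measurable_duhamel_wall _ _ mv) m1)
    |apply: (measurableT_comp (measurable_duhamel_heat _ _ mv) m1)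
    |apply: (measurableT_comp (measurable_duhamel_wall _ _ mv) m1)
    |apply: (measurableT_comp (measurable_duhamel_heat _ _ mv) m1)].
- have := vE sT; apply: filterS => y vy.
  rewrite /duhamel_sum /duhamel_wall /duhamel_heat /= st /g /flux /= vy.
  by rewrite !(flux_bs momega mv vE _ _ sT) -!mulrBl.
Qed.

(** The exceptional set is fixed before the limit: off it, all the mild identities along a sequence
    of initial times hold and the weighted integrands are finite in [l]. For such an [x] dominated
    convergence handles the Duhamel term and [stokes_initial] the first one. *)
Lemma vorticity_duhamel t : 0 < t < T -> {ae leb2, forall x : plane, 0 < x.2 ->
  omega t x = alpha * stokes_kernel t x z + \int[lst]_l duhamel_sum t x l}.
Proof.
move=> tT; have /andP[t0 tT'] := tT.
(* Starting at [t / 2] keeps every [t - tn n] in [[t / 2, t]], the range where the kernel is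
   Lipschitz in time. *)
pose tn (n : nat) := t / n.+2%:R.
have tn0 n : 0 < tn n <= t / 2.
  rewrite divr_gt0 ?ltr0n//= ler_wpM2l ?(ltW t0)// lef_pV2 ?posrE ?ltr0n// ler_nat //.
have tnt n : tn n < t by have /andP[_ h] := tn0 n; lra.
have tnc : tn @ \oo --> 0.
  rewrite -[X in _ --> X](mulr0 t); apply: cvgM; first exact: cvg_cst.
  have := @cvg_harmonic R; rewrite /harmonic => H.
  by move: H; rewrite -cvg_shiftS.
have [C [C0 CB]] := integral_flux_weights momega mv vE v0 omegaA T1 A0.
have mwh i : measurable_fun setT (duhamel_weight t (flux v i) (heat_weight i t)).
  by apply: measurable_duhamel_weight; [exact: measurable_flux|exact: measurable_heat_weight].
have mww i : measurable_fun setT (duhamel_weight t (flux v i) (wall_weight i t)).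
  by apply: measurable_duhamel_weight; [exact: measurable_flux|exact: measurable_wall_weight].
have wh0 i y : 0 <= duhamel_weight t (flux v i) (heat_weight i t) y.
  by apply: duhamel_weight_ge0 => u; exact: heat_weight_ge0.
have ww0 i y : 0 <= duhamel_weight t (flux v i) (wall_weight i t) y.
  by apply: duhamel_weight_ge0 => u; exact: wall_weight_ge0.
have ah i := ae_weight_lty (mwh i) (wh0 i) (CB i t tT).1.
have aw i := ae_weight_lty (mww i) (ww0 i) (CB i t tT).2.
(* Only countably many initial times occur, so that one null set serves them all. *)
have am : {ae leb2, forall x, forall n, Hplus x -> omega t x = stokes (t - tn n) (omega (tn n)) x
    - \int[mu]_(s in `]tn n, t[) stokes_div (t - s) (fun y => omega s y *: BS (omega s) y) x}.
  apply: ae_foralln => n; have [_ _ _ H] := omega_mild.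
  by apply: H => //; have /andP[] := tn0 n.
have ahw i : {ae leb2, forall x,
    (\int[lst]_l (duhamel_weight t (flux v i) (heat_weight i t) (l, x))%:E < +oo)%E /\
    (\int[lst]_l (duhamel_weight t (flux v i) (wall_weight i t) (l, x))%:E < +oo)%E}.
  by move: (ah i) (aw i); apply: filterS2 => x.
move: (ahw true) (ahw false) am; apply: filterS3 => x [h1 w1] [h2 w2] mild x0.
(* The weights are at least one, so the weighted integrands dominate [duhamel_sum] itself. *)
pose g l := duhamel_weight t (flux v true) (heat_weight true t) (l, x) +
   duhamel_weight t (flux v false) (heat_weight false t) (l, x) +
   (duhamel_weight t (flux v true) (wall_weight true t) (l, x) +
   duhamel_weight t (flux v false) (wall_weight false t) (l, x)).
have ml : measurable_fun setT (fun l : spacetime => (l, x)) by mfun.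
have mwhl i := measurableT_comp (mwh i) ml.
have mwwl i := measurableT_comp (mww i) ml.
have mg1 := measurable_funD (mwhl true) (mwhl false).
have mg2 := measurable_funD (mwwl true) (mwwl false).
have mg : measurable_fun setT g := measurable_funD mg1 mg2.
have g0 l : 0 <= g l by rewrite !addr_ge0.
have Ig : lst.-integrable setT (EFin \o g).
  apply: integrable_abs_lty => //.
  under eq_integral do rewrite ger0_norm//.
  have pg1 l : 0 <= duhamel_weight t (flux v true) (heat_weight true t) (l, x) +
      duhamel_weight t (flux v false) (heat_weight false t) (l, x) by exact: addr_ge0.
  have pg2 l : 0 <= duhamel_weight t (flux v true) (wall_weight true t) (l, x) +
      duhamel_weight t (flux v false) (wall_weight false t) (l, x) by exact: addr_ge0.
  apply: (int_addr_lty mg1 mg2 pg1 pg2).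
    exact: (int_addr_lty (mwhl true) (mwhl false) (fun l => wh0 true (l, x)) (fun l => wh0 false (l, x)) h1 h2).
  exact: (int_addr_lty (mwwl true) (mwwl false) (fun l => ww0 true (l, x)) (fun l => ww0 false (l, x)) w1 w2).
have mD : measurable_fun setT (duhamel_sum t x).
  by rewrite /duhamel_sum; apply: measurable_funD; apply: measurable_funB;
    [apply: (measurableT_comp (measurable_duhamel_wall _ _ mv) ml)
    |apply: (measurableT_comp (measurable_duhamel_heat _ _ mv) ml)
    |apply: (measurableT_comp (measurable_duhamel_wall _ _ mv) ml)
    |apply: (measurableT_comp (measurable_duhamel_heat _ _ mv) ml)].
have Dg l : `|duhamel_sum t x l| <= g l.
  have a1 := duhamel_heat_le v true t (l, x); have a2 := duhamel_heat_le v false t (l, x).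
  have b1 := @duhamel_wall_le v true t (l, x) x0; have b2 := @duhamel_wall_le v false t (l, x) x0.
  rewrite /duhamel_sum /g; apply: (le_trans (ler_normD _ _)).
  have c1 := ler_normB (duhamel_wall v true t (l, x)) (duhamel_heat v true t (l, x)).
  have c2 := ler_normB (duhamel_wall v false t (l, x)) (duhamel_heat v false t (l, x)).
  apply: (le_trans (lerD c1 c2)); rewrite addrACA addrC.
  exact: lerD (lerD a1 a2) (lerD b1 b2).
(* The integrand of the Duhamel term started at [tn n]; at each positive time the cut-off is
   eventually inactive. *)
pose D n (l : spacetime) := if tn n < l.1 then duhamel_sum t x l else 0.
have mDn n : measurable_fun setT (D n).
  by apply: measurable_fun_ifT => //; mfun.
have Dng n l : `|D n l| <= g l.
  by rewrite /D; case: ifP => _; rewrite ?normr0.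
have cD l : D n l @[n --> \oo] --> duhamel_sum t x l.
  have [l0|l0] := leP l.1 0.
    have -> : duhamel_sum t x l = 0.
      by rewrite /duhamel_sum /duhamel_wall /duhamel_heat /= !(ltNge 0 l.1) l0 /= !subr0 addr0.
    rewrite (_ : D^~ l = cst 0); first exact: cvg_cst.
    by apply/funext => n; rewrite /D ltNge (le_trans l0)//; have /andP[/ltW] := tn0 n.
  apply: cvg_near_cst; near=> n; rewrite /D ifT//.
  by near: n; move: tnc => /(_ [set r | r < l.1]); apply; exact: lt_nbhsl.
have limD := cvg_Rintegral_dominated mDn mD cD Ig Dng.
have ID n : lst.-integrable setT (EFin \o D n).
  apply: (le_integrable measurableT _ _ Ig); first exact/measurable_EFinP.
  by move=> l _; rewrite /= lee_fin (ger0_norm (g0 l)).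
have limS := stokes_initial T1 z0 omega_mild omega_init omega_L1 tT x0 tn0 tnc.
have E n : omega t x = stokes (t - tn n) (omega (tn n)) x + \int[lst]_l D n l.
  rewrite (mild n x0); congr (_ + _); rewrite -(Rintegral_prod12 (ID n)).
  rewrite [in LHS]Rintegral_mkcond -RintegralN; apply: eq_Rintegral => s _.
  rewrite patchE; case: ifPn => [|sI].
    rewrite inE /= in_itv /= => /andP[s1 s2].
    have sp : 0 < s by have /andP[h _] := tn0 n; exact: lt_trans s1.
    rewrite stokes_div_duhamel ?sp// opprK; apply: eq_Rintegral => y _.
    by rewrite /D s1.
  suff -> : \int[lebp]_y D n (s, y) = 0 by exact: oppr0.
  rewrite /Rintegral integral0_eq// => y _; congr EFin.
  rewrite /D; case: ifPn => //= s1.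
  have s2 : (s < t) = false.
    by apply: contraNF sI => s2; rewrite inE /= in_itv /= s1.
  by rewrite /duhamel_sum /duhamel_wall /duhamel_heat /= s2 !andbF !subr0 addr0.
have lim := cvgD limS limD.
have c : stokes (t - tn n) (omega (tn n)) x + \int[lst]_l D n l @[n --> \oo] --> omega t x.
  by apply: cvg_near_cst; apply: nearW => n; rewrite -E.
by rewrite -(cvg_lim (@norm_hausdorff _ R^o) c); apply: cvg_lim => //; exact: lim.
Unshelve. all: by end_near.
Qed.

End DuhamelFormula.

(** * The velocity in L^p *)

Section Newton.
Context {R : realType}.
Notation plane := (measurableTypeR R * measurableTypeR R)%type.

(** Inside the unit square around [c] the Gaussian is at most [1] and [1 / |x - c|] integrates to at
    most [8]; outside, [1 / |x - c|] is at most [1] and the Gaussian has mass one. *)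
Lemma integral_gau_newton (c : plane) :
  (\int[leb2]_x (gau 1 x.1 * gau 1 x.2 * (enorm (x - c))^-1)%:E <= 9%:E)%E.
Proof.
pose near_c (x : plane) : R := if box 1 (x - c) then (enorm (x - c))^-1 `^ 1 else 0.
have mn0 : measurable_fun [set: plane] (fun x : plane => if box 1 x then (enorm x)^-1 `^ 1 else 0 : R).
  by rewrite /box /enorm; mfun.
have mn : measurable_fun [set: plane] near_c by apply: (measurableT_comp mn0); mfun.
have n0 x : 0 <= near_c x by rewrite /near_c; case: ifP => // _; exact: powR_ge0.
have mg : measurable_fun [set: plane] (fun x : plane => gau 1 x.1 * gau 1 x.2 : R) by rewrite /gau; mfun.
have g0 (x : plane) : 0 <= gau 1 x.1 * gau 1 x.2 :> R by rewrite mulr_ge0 ?gau_ge0.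
have g1 r : gau 1 r <= 1 :> R.
  apply: (le_trans (gau_le_max _ ltr01)); rewrite invf_le1 ?sqrtr_gt0 ?mulr1 ?mulr_gt0 ?pi_gt0//.
  by rewrite -[leLHS]sqrtr1 ler_wsqrtr//; have := @pi_ge2 R; lra.
apply: (@le_trans _ _ (\int[leb2]_x (near_c x + gau 1 x.1 * gau 1 x.2)%:E)%E).
  apply: int_mono.
  - by apply: measurable_funM => //; rewrite /enorm; mfun.
  - exact: measurable_funD.
  - by move=> x; rewrite mulr_ge0// invr_ge0 enorm_ge0.
  move=> x; have e0 := enorm_ge0 (x - c); have G0 := g0 x.
  have G1 : gau 1 x.1 * gau 1 x.2 <= 1 :> R by rewrite mulr_ile1 ?gau_ge0.
  rewrite /near_c; case: ifPn => [_|nb].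
    rewrite powRr1 ?invr_ge0//; apply: ler_wpDr => //.
    by rewrite ler_piMl// invr_ge0.
  rewrite add0r ler_piMr// invf_le1.
    move: nb; rewrite /box negb_and -!ltNge => /orP[h|h].
    - by apply: ltW; apply: lt_le_trans h (abs1_le_enorm _).
    - by apply: ltW; apply: lt_le_trans h (abs2_le_enorm _).
  move: nb; rewrite /box negb_and -!ltNge => /orP[h|h].
  - by apply: lt_le_trans (abs1_le_enorm _); exact: lt_trans h.
  - by apply: lt_le_trans (abs2_le_enorm _); exact: lt_trans h.
rewrite int_addr// integral_gau2// (_ : 9%:E = 8%:E + 1)%E; last by rewrite -EFinD; congr EFin; lra.
apply: leeD => //; rewrite /near_c.
rewrite (leb2_translate c (f := fun x => (if box 1 x then (enorm x)^-1 `^ 1 else 0)%:E)); last 2 first.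
- by apply/measurable_EFinP; exact: mn0.
- by move=> x; rewrite lee_fin; case: ifP => // _; exact: powR_ge0.
have := @integral_enorm_near R 1 1 ltr01 (ltr1n _ 2) ltr01.
by rewrite powR1 mulr1 (_ : 2 - 1 = 1) ?divr1//; lra.
Qed.

(** The function [1 / |x|] is not integrable over the plane. Integrated first against a Gaussian,
    which is positive everywhere, the potential of a finite mass becomes finite, hence it is finite
    at almost every point. *)
Lemma ae_newton_lty d (Y : measurableType d) (m : {sigma_finite_measure set Y -> \bar R})
    (phi : Y -> R) (c : Y -> plane) :
  measurable_fun setT phi -> measurable_fun setT c -> (forall y, 0 <= phi y) ->
  (\int[m]_y (phi y)%:E < +oo)%E ->
  {ae leb2, forall x, (\int[m]_y ((enorm (x - c y))^-1 * phi y)%:E < +oo)%E}.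
Proof.
move=> mphi mc phi0 phioo.
pose rho (x : plane) : R := gau 1 x.1 * gau 1 x.2.
have rho0 x : 0 < rho x.
  by rewrite !mulr_gt0 ?expR_gt0// invr_gt0 sqrtr_gt0 !mulr_gt0 ?pi_gt0.
have mrho : measurable_fun setT rho by rewrite /rho /gau; mfun.
have e0 x y : 0 <= (enorm (x - c y))^-1 by rewrite invr_ge0 enorm_ge0.
have me : measurable_fun [set: (plane * Y)%type] (fun z : plane * Y => (enorm (z.1 - c z.2))^-1).
  have mc2 : measurable_fun [set: (plane * Y)%type] (fun z => c z.2) by exact: (measurableT_comp mc measurable_snd).
  have mc1 := measurableT_comp measurable_fst mc2.
  have mc3 := measurableT_comp measurable_snd mc2.
  rewrite /enorm /=; mfun.
have ae1 : {ae leb2, forall x, (\int[m]_y (rho x * ((enorm (x - c y))^-1 * phi y))%:E < +oo)%E}.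
  apply: (@ae_integral_lty R _ _ plane Y (@lebp R) m).
  - apply: measurable_funM; first exact: (measurableT_comp mrho measurable_fst).
    by apply: measurable_funM; [exact: me|exact: (measurableT_comp mphi measurable_snd)].
  - by move=> x y; rewrite !mulr_ge0// ltW.
  have mex y : measurable_fun [set: plane] (fun x => rho x * (enorm (x - c y))^-1).
    by apply: measurable_funM => //; rewrite /enorm; mfun.
  apply: (@le_lt_trans _ _ (\int[m]_y (9 * phi y)%:E)%E).
    apply: ge0_le_integral.
    - exact: measurableT.
    - by move=> y _; apply: int_ge0 => x; rewrite !mulr_ge0// ltW.
    - apply: (@measurable_fun_fubini_tonelli_G _ _ plane Y _ (@lebp R) (fun z : plane * Y => (rho z.1 * ((enorm (z.1 - c z.2))^-1 * phi z.2))%:E)).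
      + apply/measurable_EFinP; apply: measurable_funM; first exact: (measurableT_comp mrho measurable_fst).
        by apply: measurable_funM; [exact: me|exact: (measurableT_comp mphi measurable_snd)].
      + by move=> z; rewrite lee_fin !mulr_ge0// ltW.
    - by apply/measurable_EFinP; apply: measurable_funM => //; exact: measurable_cst.
    move=> y _; rewrite [leRHS]EFinM.
    rewrite (_ : \int[leb2]_x _ = \int[leb2]_x ((rho x * (enorm (x - c y))^-1) * phi y)%:E)%E; last first.
      by apply: eq_integral => x _; rewrite mulrA.
    rewrite int_scaler//; last by move=> x; rewrite mulr_ge0// ltW.
    by apply: lee_wpmul2r; [rewrite lee_fin|exact: integral_gau_newton].
  by rewrite int_scale// lte_mul_pinfty.
move: ae1; apply: filterS => x; rewrite int_scale; last 3 first.
- by apply: measurable_funM => //; rewrite /enorm; mfun.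
- by move=> y; rewrite mulr_ge0.
- exact: ltW.
by case: (\int[m]_y _)%E => [r| |] //; rewrite ?ltry// gt0_muley ?lte_fin.
Qed.

End Newton.

(** * Vortex pairs and the velocity as their superposition *)

Section PairKernel.
Context {R : realType}.
Notation plane := (measurableTypeR R * measurableTypeR R)%type.
Implicit Types (i : bool) (x a b : plane).

(** Divided by [1 + |a - b|], so that its [L^p] norm in [x] is bounded uniformly in the positions of
    the two vortices. *)
Definition pairk i x a b : R := `|vort i (x - a) - vort i (x - b)| / (1 + enorm (a - b)).

Lemma pairk_ge0 i x a b : 0 <= pairk i x a b.
Proof. by rewrite divr_ge0// addr_ge0// enorm_ge0. Qed.

Lemma pairkE i x a b : `|vort i (x - a) - vort i (x - b)| = pairk i x a b * (1 + enorm (a - b)).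
Proof. by rewrite divfK// gt_eqF// ltr_pwDl// enorm_ge0. Qed.

Lemma measurable_pairk i d (U : measurableType d) (f g h : U -> plane) :
  measurable_fun setT f -> measurable_fun setT g -> measurable_fun setT h ->
  measurable_fun setT (fun u => pairk i (f u) (g u) (h u)).
Proof.
move=> mf mg mh; rewrite /pairk /enorm.
have mf1 := measurableT_comp measurable_fst mf; have mf2 := measurableT_comp measurable_snd mf.
have mg1 := measurableT_comp measurable_fst mg; have mg2 := measurableT_comp measurable_snd mg.
have mh1 := measurableT_comp measurable_fst mh; have mh2 := measurableT_comp measurable_snd mh.
have m1 : measurable_fun setT (fun u => vort i (f u - g u)).
  by apply: (measurableT_comp (measurable_vort i)); mfun.
have m2 : measurable_fun setT (fun u => vort i (f u - h u)).
  by apply: (measurableT_comp (measurable_vort i)); mfun.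
have m3 : measurable_fun setT (fun u => (1 + Num.sqrt ((g u - h u).1 ^+ 2 + (g u - h u).2 ^+ 2))^-1) by mfun.
by apply: measurable_funM => //; apply: measurableT_comp => //; exact: measurable_funB.
Qed.

Lemma enorm_reflB x : enorm (x - refl x) = 2 * `|x.2|.
Proof.
rewrite /enorm /= subrr expr0n add0r opprK sqrtr_sqr.
by rewrite (_ : x.2 + x.2 = 2 * x.2) ?normrM ?(@ger0_norm _ 2)//; ring.
Qed.

Lemma enorm_refl_refl x a : enorm (refl x - refl a) = enorm (x - a).
Proof. by rewrite /enorm /= -opprD sqrrN. Qed.

(** All pairs that occur: [x'] with its mirror image for the wall part; [x'] with [y], and their
    mirror images, for the heat part; and [y] with its mirror image when [x'] lies below the wall.
    In the last case [y.2 <= |x' - y|], so that [1 + 2 y.2] is at most [2 (1 + |x' - y|)], whence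
    the factor [2]. *)
Definition pairs i x x' y : R :=
  pairk i x x' (refl x') + (pairk i x x' y + (pairk i x (refl x') (refl y) + 2 * pairk i x y (refl y))).

Lemma pairs_ge0 i x x' y : 0 <= pairs i x x' y.
Proof.
have k0 := pairk_ge0.
by rewrite /pairs addr_ge0 ?addr_ge0 ?addr_ge0 ?k0//; apply: mulr_ge0 => //; exact: k0.
Qed.

Lemma pairs_Lp i p : 1 < p -> p < 2 -> exists2 C : R, 0 < C & forall x' y,
  (\int[leb2]_x (pairs i x x' y `^ p)%:E <= C%:E)%E.
Proof.
move=> p1 p2; have [C C0 CB] := @vort_pair_Lp R i p p1 p2.
have p0 : 0 <= p by lra.
exists (4 `^ p * (C + (C + (C + 2 `^ p * C)))).
  by rewrite mulr_gt0 ?powR_gt0// !addr_gt0 ?mulr_gt0 ?powR_gt0.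
move=> x' y.
have mk a b : measurable_fun [set: plane] (fun x => pairk i x a b `^ p).
  by apply: (measurableT_comp (measurable_powR p)); apply: measurable_pairk; mfun.
have k0 a b x : 0 <= pairk i x a b `^ p by exact: powR_ge0.
have mk2 a b : measurable_fun [set: plane] (fun x => 2 `^ p * pairk i x a b `^ p).
  by apply: measurable_funM => //; exact: measurable_cst.
have k02 a b x : 0 <= 2 `^ p * pairk i x a b `^ p by rewrite mulr_ge0 ?powR_ge0.
apply: (@le_trans _ _ (\int[leb2]_x (4 `^ p * (pairk i x x' (refl x') `^ p + (pairk i x x' y `^ p + (pairk i x (refl x') (refl y) `^ p + 2 `^ p * pairk i x y (refl y) `^ p))))%:E)%E).
  apply: int_mono.
  - apply: (measurableT_comp (measurable_powR p)).
    by apply: measurable_funD; [|apply: measurable_funD; [|apply: measurable_funD; [|apply: measurable_funM]]];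
     try exact: measurable_cst; apply: measurable_pairk; mfun.
  - by apply: measurable_funM; [exact: measurable_cst|do 3 apply: measurable_funD => //].
  - by move=> x; exact: powR_ge0.
  move=> x; rewrite -powRM ?pairk_ge0// /pairs.
  move: (pairk i x x' _) (pairk_ge0 i x x' (refl x')) (pairk i x x' y) (pairk_ge0 i x x' y) => a a0 b b0.
  move: (pairk i x _ _) (pairk_ge0 i x (refl x') (refl y)) => c c0.
  have := pairk_ge0 i x y (refl y); move: (pairk i x y _) => e e0.
  have {}e0 : 0 <= 2 * e by rewrite mulr_ge0.
  move: (2 * e) e0 => {}e e0.
  pose m := Num.max (Num.max a b) (Num.max c e).
  have m0 : 0 <= m by rewrite /m !le_max a0.
  have [ma mb mc me] : [/\ a <= m, b <= m, c <= m & e <= m] by rewrite /m !le_max !lexx !orbT.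
  apply: (@le_trans _ _ ((4 * m) `^ p)); first by rewrite ge0_ler_powR ?nnegrE ?mulr_ge0 ?addr_ge0//; lra.
  rewrite powRM// ler_wpM2l ?powR_ge0//.
  have pa := powR_ge0 a p; have pb := powR_ge0 b p; have pc := powR_ge0 c p; have pe := powR_ge0 e p.
  have : m = a \/ m = b \/ m = c \/ m = e.
    by rewrite /m /Num.max; do ! case: ifP => _; tauto.
  case=> [->|[->|[->|->]]].
  - by rewrite lerDl !addr_ge0.
  - by rewrite addrCA lerDl !addr_ge0.
  - by rewrite addrA addrCA lerDl !addr_ge0.
  - by rewrite !addrA lerDr !addr_ge0.
have m3 := measurable_funD (mk (refl x') (refl y)) (mk2 y (refl y)).
have m2 := measurable_funD (mk x' y) m3.
have m1 := measurable_funD (mk x' (refl x')) m2.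
have n3 x : 0 <= pairk i x (refl x') (refl y) `^ p + 2 `^ p * pairk i x y (refl y) `^ p by exact: addr_ge0.
have n2 x := addr_ge0 (k0 x' y x) (n3 x).
have n1 x := addr_ge0 (k0 x' (refl x') x) (n2 x).
rewrite (int_scale _ m1 n1) ?powR_ge0// EFinM; apply: lee_wpmul2l; first by rewrite lee_fin powR_ge0.
rewrite (int_addr _ (mk x' (refl x')) m2)// (int_addr _ (mk x' y) m3)//.
rewrite (int_addr _ (mk (refl x') (refl y)) (mk2 y (refl y)))//.
rewrite (int_scale _ (mk y (refl y)))// ?powR_ge0//.
rewrite !EFinD; apply: leeD; first exact: CB.
apply: leeD; first exact: CB.
apply: leeD; first exact: CB.
by rewrite EFinM; apply: lee_wpmul2l; [rewrite lee_fin powR_ge0|exact: CB].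
Qed.

End PairKernel.

Section VelocityKernel.
Context {R : realType}.
Notation mu := (@lebesgue_measure R).
Notation plane := (measurableTypeR R * measurableTypeR R)%type.
Notation spacetime := (measurableTypeR R * plane)%type.
Variables (v : spacetime -> R).
Hypothesis mv : measurable_fun setT v.
Hypothesis v0 : forall s (y : plane), y.2 <= 0 -> v (s, y) = 0.
Implicit Types (i j : bool) (x y : plane) (z : spacetime * plane).

Lemma duhamel_heat_weight j t z : (1 + enorm (z.2 - z.1.2)) * `|duhamel_heat v j t z| =
  duhamel_weight t (flux v j) (heat_weight j t) z.
Proof.
rewrite /duhamel_heat /duhamel_weight; case: ifP => _; last by rewrite normr0 mulr0.
by rewrite normrM mulrA.
Qed.

Lemma duhamel_wall_weight j t z : 0 < z.2.2 -> (1 + 2 * z.2.2) * `|duhamel_wall v j t z| =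
  duhamel_weight t (flux v j) (wall_weight j t) z.
Proof.
move=> z0; rewrite /duhamel_wall /duhamel_weight; case: ifP => _; last by rewrite normr0 mulr0.
by rewrite normrM mulrA /wall_weight z0.
Qed.

Definition duhamel_total t z : R :=
  duhamel_weight t (flux v true) (heat_weight true t) z +
  duhamel_weight t (flux v false) (heat_weight false t) z +
  (duhamel_weight t (flux v true) (wall_weight true t) z +
  duhamel_weight t (flux v false) (wall_weight false t) z).

Definition velocity_density i t x z : R :=
  if 0 < z.2.2 then halfbs i x z.2 * duhamel_sum v t z.2 z.1 else 0.

Definition heat_sum t z : R := duhamel_heat v true t z + duhamel_heat v false t z.

Lemma halfbs_le i x y : 0 <= y.2 -> `|halfbs i x y| = pairk i x y (refl y) * (1 + 2 * y.2).
Proof. by move=> y0; rewrite pairkE enorm_reflB ger0_norm. Qed.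

(** Reflection is an isometry, so the pair of mirror images has the same gap as the pair itself. *)
Lemma halfbs_diff_le i x x' y : `|halfbs i x x' - halfbs i x y| <=
  (pairk i x x' y + pairk i x (refl x') (refl y)) * (1 + enorm (x' - y)).
Proof.
rewrite mulrDl -pairkE -(enorm_refl_refl x' y) -pairkE.
rewrite (_ : _ - _ = (vort i (x - x') - vort i (x - y)) -
  (vort i (x - refl x') - vort i (x - refl y))); last by rewrite /halfbs; ring.
exact: ler_normB.
Qed.

Lemma duhamel_weights_ge0 j t z : 0 <= duhamel_weight t (flux v j) (heat_weight j t) z /\
  0 <= duhamel_weight t (flux v j) (wall_weight j t) z.
Proof.
by split; apply: duhamel_weight_ge0 => u; [exact: heat_weight_ge0|exact: wall_weight_ge0].
Qed.

Lemma duhamel_total_ge0 t z : 0 <= duhamel_total t z.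
Proof.
have [? ?] := duhamel_weights_ge0 true t z; have [? ?] := duhamel_weights_ge0 false t z.
by rewrite /duhamel_total !addr_ge0.
Qed.

(* The heat gradient has zero mean, so a multiple of it may be added to the
   density: on the half-plane this turns the kernel into a difference. *)
Lemma velocity_density_le i t x z :
  `|velocity_density i t x z + halfbs i x z.1.2 * heat_sum t z| <=
  pairs i x z.2 z.1.2 * duhamel_total t z.
Proof.
have [h1 w1] := duhamel_weights_ge0 true t z; have [h2 w2] := duhamel_weights_ge0 false t z.
have T0 := duhamel_total_ge0 t z.
have P0 := pairs_ge0 i x z.2 z.1.2.
have [y0|y0] := leP z.1.2.2 0.
  have F j : flux v j z.1 = 0.
    by case: z y0 {T0 P0 h1 h2 w1 w2} => [[s y] x'] /= y0; exact: flux0.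
  have H0 j : duhamel_heat v j t z = 0 by rewrite /duhamel_heat F mulr0; case: ifP.
  have W0 j : duhamel_wall v j t z = 0 by rewrite /duhamel_wall F mulr0; case: ifP.
  have D0 : duhamel_sum v t z.2 z.1 = 0.
    by case: z H0 W0 {T0 P0 h1 h2 w1 w2 y0 F} => [l x'] /= H0 W0; rewrite /duhamel_sum !H0 !W0 subr0 addr0.
  by rewrite /heat_sum !H0 /velocity_density D0 addr0 !mulr0 addr0 if_same normr0 mulr_ge0.
have Hh : (1 + enorm (z.2 - z.1.2)) * `|heat_sum t z| <=
    duhamel_weight t (flux v true) (heat_weight true t) z + duhamel_weight t (flux v false) (heat_weight false t) z.
  rewrite -!duhamel_heat_weight -mulrDr ler_wpM2l ?addr_ge0 ?enorm_ge0//.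
  exact: ler_normD.
have e0 := enorm_ge0 (z.2 - z.1.2).
have hs0 := normr_ge0 (heat_sum t z).
have a0 := pairk_ge0 i x z.2 (refl z.2).
have b0 := pairk_ge0 i x z.2 z.1.2.
have c0 := pairk_ge0 i x (refl z.2) (refl z.1.2).
have d0 := pairk_ge0 i x z.1.2 (refl z.1.2).
rewrite /velocity_density; case: ifPn => [x0|].
  pose ws := duhamel_wall v true t z + duhamel_wall v false t z.
  have -> : duhamel_sum v t z.2 z.1 = ws - heat_sum t z.
    rewrite /duhamel_sum /ws /heat_sum -surjective_pairing.
    by rewrite opprD addrACA.
  have Hw : (1 + 2 * z.2.2) * `|ws| <=
      duhamel_weight t (flux v true) (wall_weight true t) z + duhamel_weight t (flux v false) (wall_weight false t) z.
    rewrite -!duhamel_wall_weight// -mulrDr ler_wpM2l ?ler_normD//.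
    by rewrite addr_ge0// mulr_ge0// ltW.
  have -> : halfbs i x z.2 * (ws - heat_sum t z) + halfbs i x z.1.2 * heat_sum t z =
      halfbs i x z.2 * ws - (halfbs i x z.2 - halfbs i x z.1.2) * heat_sum t z by ring.
  apply: (le_trans (ler_normB _ _)).
  rewrite (normrM (halfbs i x z.2)) (halfbs_le _ _ (ltW x0)) (normrM (_ - _)).
  have D := ler_wpM2r hs0 (halfbs_diff_le i x z.2 z.1.2).
  apply: (le_trans (lerD (lexx _) D)).
  rewrite -(mulrA (pairk _ _ _ _)) -(mulrA (_ + _)).
  apply: (le_trans (lerD (ler_wpM2l a0 Hw) (ler_wpM2l (addr_ge0 b0 c0) Hh))).
  rewrite /pairs /duhamel_total.
  move: a0 b0 c0 d0 h1 w1 h2 w2; clear.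
  move: (pairk _ _ _ _) (pairk _ _ _ _) (pairk _ _ _ _) (pairk _ _ _ _) => a b c d.
  move: (duhamel_weight _ _ _ _) (duhamel_weight _ _ _ _) (duhamel_weight _ _ _ _) (duhamel_weight _ _ _ _) => e f g h.
  move=> a0 b0 c0 d0 e0 g0 f0 h0.
  rewrite -subr_ge0 (_ : _ - _ = d * (h + f) + (c + b) * (g + e) + 2 * a * (h + f + (g + e))); last by ring.
  by rewrite !addr_ge0// mulr_ge0// ?addr_ge0// mulr_ge0.
rewrite -leNgt add0r => x0.
rewrite normrM (halfbs_le _ _ (ltW y0)).
have ye : z.1.2.2 <= enorm (z.2 - z.1.2).
  by apply: le_trans (abs2_le_enorm _); rewrite /= distrC ger0_norm ?subr_ge0; lra.
apply: (@le_trans _ _ (pairk i x z.1.2 (refl z.1.2) * 2 * ((1 + enorm (z.2 - z.1.2)) * `|heat_sum t z|))).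
  rewrite !mulrA ler_wpM2r// -mulrA ler_wpM2l//; lra.
rewrite -mulrA; apply: (le_trans (ler_wpM2l d0 (ler_wpM2l _ Hh))) => //.
rewrite mulrA /pairs /duhamel_total.
move: a0 b0 c0 d0 h1 w1 h2 w2; clear.
move: (pairk _ _ _ _) (pairk _ _ _ _) (pairk _ _ _ _) (pairk _ _ _ _) => a b c d.
move: (duhamel_weight _ _ _ _) (duhamel_weight _ _ _ _) (duhamel_weight _ _ _ _) (duhamel_weight _ _ _ _) => e f g h.
move=> a0 b0 c0 d0 e0 g0 f0 h0.
rewrite -subr_ge0 (_ : _ - _ = (d + c + b) * (h + f + (g + e)) + 2 * a * (g + e)); last by ring.
by rewrite !addr_ge0// mulr_ge0// ?addr_ge0// mulr_ge0.
Qed.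

End VelocityKernel.

Lemma Rintegral_swap d1 d2 (T1 : measurableType d1) (T2 : measurableType d2) (R : realType)
    (m1 : {sigma_finite_measure set T1 -> \bar R})
    (m2 : {sigma_finite_measure set T2 -> \bar R}) (f : T1 * T2 -> R) :
  (prodm m1 m2).-integrable setT (EFin \o f) ->
  m2.-integrable setT (EFin \o (fun y => \int[m1]_x f (x, y))) /\
  \int[m2]_y \int[m1]_x f (x, y) = \int[m1]_x \int[m2]_y f (x, y).
Proof.
move=> If; split; last by rewrite Rintegral_prod21// Rintegral_prod12.
have [mf oo] := integrableP _ _ _ If.
have mF : measurable_fun setT f by exact/measurable_EFinP.
have mN : measurable_fun setT (fun z => `|f z|%:E) by apply/measurable_EFinP; exact: measurableT_comp.
have N0 z : (0 <= `|f z|%:E)%E by rewrite lee_fin.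
have mI : measurable_fun setT (fun y => \int[m1]_x f (x, y)).
  exact: (measurableT_comp (@fine_measurable R setT measurableT) (measurable_fubini_G If)).
apply: integrable_abs_lty; first exact: mI.
apply: le_lt_trans oo; rewrite (prodm_tonelli2 m1 m2 (f := fun z => `|f z|%:E)%E)//.
apply: ge0_le_integral.
- exact: measurableT.
- by move=> y _; rewrite lee_fin.
- by apply/measurable_EFinP; exact: measurableT_comp.
- exact: (@measurable_fun_fubini_tonelli_G _ _ _ _ _ m1 (fun z => `|f z|%:E)).
move=> y _; apply: le_abs_Rintegral.
exact: (measurableT_comp mF (measurable_pair2 y)).
Qed.

Lemma poweR_add_le (R : realType) (p : R) (a b : \bar R) : 0 < p -> (0 <= a)%E -> (0 <= b)%E ->
  ((a + b) `^ p <= (2 `^ p)%:E * (a `^ p + b `^ p))%E.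
Proof.
move=> p0 a0 b0; have p0' : 0 <= p by exact: ltW.
have c0 : 0 < 2 `^ p :> R by exact: powR_gt0.
move: a b a0 b0 => [a| |] [b| |] // a0 b0; last 3 first.
- by rewrite poweRyr ?gt_eqF// addey ?gt0_muley ?leey ?lte_fin.
- by rewrite poweRyr ?gt_eqF// addye ?gt0_muley ?leey ?lte_fin.
- by rewrite poweRyr ?gt_eqF// addye ?gt0_muley ?leey ?lte_fin.
move: a0 b0; rewrite !lee_fin => a0 b0; change ((((a + b) `^ p)%:E <= (2 `^ p * (a `^ p + b `^ p))%:E)%E); rewrite lee_fin.
apply: (@le_trans _ _ ((2 * Num.max a b) `^ p)).
  rewrite ge0_ler_powR ?nnegrE ?addr_ge0// ?mulr_ge0// ?le_max ?a0//.
  by rewrite -[2]/(1 + 1) mulrDl mul1r; apply: lerD; rewrite le_max lexx ?orbT.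
rewrite powRM ?le_max ?a0// ler_wpM2l ?powR_ge0//.
by rewrite /Num.max; case: ifP => _; rewrite ?lerDl ?lerDr powR_ge0.
Qed.

Section HeatSum.
Context {R : realType}.
Notation mu := (@lebesgue_measure R).
Notation plane := (measurableTypeR R * measurableTypeR R)%type.
Notation spacetime := (measurableTypeR R * plane)%type.
Variables (v : spacetime -> R) (t : R).
Hypothesis mv : measurable_fun setT v.
Hypothesis t1 : t <= 1.
Hypothesis v0 : forall s (y : plane), y.2 <= 0 -> v (s, y) = 0.

Lemma duhamel_heat_zero_mean j l : leb2.-integrable setT (fun x : plane => (duhamel_heat v j t (l, x))%:E) /\
  \int[lebp]_x duhamel_heat v j t (l, x) = 0.
Proof.
pose f (x : plane) := duhamel_heat v j t (l, x).
change (leb2.-integrable setT (EFin \o f) /\ \int[lebp]_x f x = 0).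
have [/andP[s0 st]|/negbTE st] := boolP ((0 < l.1) && (l.1 < t)); last first.
  have -> : f = cst 0 by apply/funext => x; rewrite /f /duhamel_heat /= st.
  by split; [exact: integrable0|rewrite /Rintegral integral0].
have -> : f = (fun x => heat_grad j (t - l.1) (x - l.2) * flux v j l).
  by apply/funext => x; rewrite /f /duhamel_heat /= s0 st.
have ts0 : 0 < t - l.1 by rewrite subr_gt0.
have ts1 : t - l.1 <= 1 by rewrite (le_trans _ t1)// gerBl ltW.
have I := integrable_heat_grad j l.2 ts0 ts1.
split.
  have := integrableZr measurableT (flux v j l) I.
  by apply: eq_integrable => // x _; rewrite /= EFinM.
rewrite RintegralZr; [|exact: measurableT|exact: I].
by rewrite (@integral_heat_grad0 R j (t - l.1) l.2)// mul0r.
Qed.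

Lemma heat_sum_zero_mean l : leb2.-integrable setT (fun x : plane => (heat_sum v t (l, x))%:E) /\
  \int[lebp]_x heat_sum v t (l, x) = 0.
Proof.
have [I1 E1] := duhamel_heat_zero_mean true l; have [I2 E2] := duhamel_heat_zero_mean false l.
split.
  by have := integrableD measurableT I1 I2; apply: eq_integrable => // x _; rewrite /= EFinD.
by rewrite RintegralD; [rewrite E1 E2 addr0|exact: measurableT|exact: I1|exact: I2].
Qed.

Lemma measurable_duhamel_total : measurable_fun setT (duhamel_total v t).
Proof.
have h j := measurable_duhamel_weight t (measurable_flux mv j) (@measurable_heat_weight R j t).
have w j := measurable_duhamel_weight t (measurable_flux mv j) (@measurable_wall_weight R j t).
exact: (measurable_funD (measurable_funD (h true) (h false)) (measurable_funD (w true) (w false))).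
Qed.

Lemma measurable_heat_sum : measurable_fun setT (heat_sum v t).
Proof. by apply: measurable_funD; exact: measurable_duhamel_heat. Qed.

Lemma measurable_duhamel_sum : measurable_fun setT (fun z => duhamel_sum v t z.2 z.1).
Proof.
have w j := measurable_duhamel_wall j t mv; have h j := measurable_duhamel_heat j t mv.
have := measurable_funD (measurable_funB (w true) (h true)) (measurable_funB (w false) (h false)).
by apply: eq_measurable_fun => -[l x] _.
Qed.

Lemma measurable_velocity_density i x : measurable_fun setT (velocity_density v i t x).
Proof.
apply: measurable_fun_ifT; [by mfun| |exact: measurable_cst].
apply: measurable_funM; last exact: measurable_duhamel_sum.
by apply: measurable_halfbs; mfun.
Qed.

Lemma duhamel_sum_le z : 0 < z.2.2 -> `|duhamel_sum v t z.2 z.1| <= duhamel_total v t z.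
Proof.
move=> x0; rewrite /duhamel_sum -surjective_pairing.
have a j := duhamel_heat_le v j t z; have b j := duhamel_wall_le v j t x0.
apply: (le_trans (ler_normD _ _)).
apply: (le_trans (lerD (ler_normB _ _) (ler_normB _ _))); rewrite addrACA addrC.
exact: lerD (lerD (a true) (a false)) (lerD (b true) (b false)).
Qed.

(** The exchange puts [x'] innermost. At fixed [l] the point [y] is then constant, and the zero mean
    allows the multiple of [heat_sum] with factor [halfbs i x y] to be added under the integral. *)
Lemma velocity_superposition i x :
  (prodm lst lebp).-integrable setT (EFin \o velocity_density v i t x) ->
  leb2.-integrable setT (fun x' : plane => (\int[lst]_l velocity_density v i t x (l, x'))%:E) /\
  (`|\int[lebp]_x' \int[lst]_l velocity_density v i t x (l, x')|%:E <=
   \int[prodm lst lebp]_z (pairs i x z.2 z.1.2 * duhamel_total v t z)%:E)%E.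
Proof.
move=> I; have [I2 ->] := Rintegral_swap I; split; first exact: I2.
have mV := measurable_velocity_density i x.
have mkw : measurable_fun [set: (spacetime * plane)%type] (fun z => pairs i x z.2 z.1.2 * duhamel_total v t z).
  apply: measurable_funM; last exact: measurable_duhamel_total.
  rewrite /pairs.
  have P a b : measurable_fun setT a -> measurable_fun setT b ->
    measurable_fun [set: (spacetime * plane)%type] (fun z => pairk i x (a z) (b z)).
    by move=> ma mb; apply: measurable_pairk => //; exact: measurable_cst.
  apply: measurable_funD; first by apply: P; mfun.
  apply: measurable_funD; first by apply: P; mfun.
  apply: measurable_funD; first by apply: P; mfun.
  by apply: measurable_funM; [exact: measurable_cst|apply: P; mfun].
have kw0 z : 0 <= pairs i x z.2 z.1.2 * duhamel_total v t z.
  by rewrite mulr_ge0 ?pairs_ge0 ?duhamel_total_ge0.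
have mR : measurable_fun setT (fun l => \int[lebp]_x' velocity_density v i t x (l, x')).
  exact: measurable_Rintegral_param.
rewrite prodm_tonelli1; [|exact/measurable_EFinP|by move=> z; rewrite lee_fin kw0].
apply: (le_trans (le_abs_Rintegral _ mR)).
apply: ge0_le_integral.
- exact: measurableT.
- by move=> l _; rewrite lee_fin.
- by apply/measurable_EFinP; exact: measurableT_comp.
- apply: (@measurable_fun_fubini_tonelli_F _ _ _ _ _ (@lebp R)
    (fun z => (pairs i x z.2 z.1.2 * duhamel_total v t z)%:E)); first exact/measurable_EFinP.
  by move=> z; rewrite lee_fin.
move=> l _.
pose G x' := velocity_density v i t x (l, x') + halfbs i x l.2 * heat_sum v t (l, x').
have ml : measurable_fun [set: plane] (fun x' => (l, x') : spacetime * plane) by mfun.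
have mVl := measurableT_comp mV ml.
have mHl := measurableT_comp measurable_heat_sum ml.
have mG : measurable_fun setT G.
  by apply: measurable_funD => //; apply: measurable_funM => //; exact: measurable_cst.
have GE : (\int[lebp]_x' (`|G x'|)%:E <= \int[lebp]_x' (pairs i x x' l.2 * duhamel_total v t (l, x'))%:E)%E.
  apply: int_mono.
  - exact: measurableT_comp.
  - exact: (measurableT_comp mkw ml).
  - by [].
  - by move=> x'; exact: (velocity_density_le v0 i t x (l, x')).
(* An infinite majorant leaves nothing to prove; a finite one makes [G] integrable, so that the
   mean-zero term can be split off. *)
have [->|] := eqVneq (\int[lebp]_x' (pairs i x x' l.2 * duhamel_total v t (l, x'))%:E)%E +oo%E.
  by rewrite leey.
rewrite -ltey => fin.
have IG : leb2.-integrable setT (EFin \o G) by apply: integrable_abs_lty => //; exact: le_lt_trans GE fin.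
have [IH H0] := heat_sum_zero_mean l.
suff -> : \int[lebp]_x' velocity_density v i t x (l, x') = \int[lebp]_x' G x'.
  by apply: le_trans GE; exact: le_abs_Rintegral.
have IcH := integrableZl measurableT (halfbs i x l.2) IH.
have -> : \int[lebp]_x' velocity_density v i t x (l, x') =
   \int[lebp]_x' (G x' - halfbs i x l.2 * heat_sum v t (l, x')).
  by apply: eq_Rintegral => x' _; rewrite /G addrK.
rewrite RintegralB; [|exact: measurableT|exact: IG|exact: IcH].
by rewrite RintegralZl; [rewrite H0 mulr0 subr0|exact: measurableT|exact: IH].
Qed.

End HeatSum.

(** Again without integrability: a factor can be moved across a Duhamel integral even at points
    where its convergence has not been examined. *)
Lemma Rintegral_scale d (T : measurableType d) (R : realType)
    (m : {measure set T -> \bar R}) (c : R) (f : T -> R) : measurable_fun setT f ->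
  \int[m]_x (c * f x) = c * \int[m]_x f x.
Proof.
have pos (a : R) (g : T -> R) : 0 < a -> measurable_fun setT g ->
    \int[m]_x (a * g x) = a * \int[m]_x g x.
  move=> a0 mg; have mE : measurable_fun setT (EFin \o g) by exact/measurable_EFinP.
  have a0' := ltW a0.
  rewrite /Rintegral integralE [in RHS]integralE.
  rewrite (_ : (fun x => (a * g x)%:E) = (fun x => a%:E * (EFin \o g) x)%E)//.
  rewrite (ge0_funeposM _ a0') (ge0_funenegM _ a0').
  rewrite ge0_integralZl//; last exact: measurable_funepos.
  rewrite ge0_integralZl//; last exact: measurable_funeneg.
  have := @integral_ge0 _ _ _ m setT (EFin \o g)^\+%E (fun x _ => funepos_ge0 _ x).
  have := @integral_ge0 _ _ _ m setT (EFin \o g)^\-%E (fun x _ => funeneg_ge0 _ x).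
  move: (\int[m]_x (EFin \o g)^\- x)%E (\int[m]_x (EFin \o g)^\+ x)%E => [u| |] [w| |] // _ _ /=.
  - by rewrite mulrBr.
  - by rewrite gt0_muley ?lte_fin//= mulr0.
  - by rewrite gt0_muley ?lte_fin//= mulr0.
  - by rewrite gt0_muley ?lte_fin//= mulr0.
move=> mf; have [c0|c0|->] := ltgtP c 0; last 1 first.
- by rewrite mul0r; under eq_Rintegral do rewrite mul0r; rewrite /Rintegral integral0.
- rewrite -[c]opprK mulNr -(pos (- c))// ?oppr_gt0// -RintegralN.
  by apply: eq_Rintegral => x _; rewrite mulNr.
- exact: pos.
Qed.

(** * The L^p bound on the velocity *)

Section VelocityLp.
Context {R : realType}.
Notation mu := (@lebesgue_measure R).
Notation plane := (measurableTypeR R * measurableTypeR R)%type.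
Notation spacetime := (measurableTypeR R * plane)%type.
Variables (alpha T A : R) (omega : R -> R * R -> R) (v : spacetime -> R) (z : R * R).
Hypothesis T1 : T <= 1.
Hypothesis A0 : 0 <= A.
Hypothesis z0 : 0 < z.2.
Hypothesis omega_mild : mild_solution T omega.
Hypothesis omega_init : weak_cvg_dirac omega alpha z.
Hypothesis omega_L1 : (sup_time T (fun t => Lpnorm 1 (omega t)) < +oo)%E.
Hypothesis mv : measurable_fun setT v.
Hypothesis vE : forall s, 0 < s < T -> {ae leb2, forall y, v (s, y) = onH (omega s) y}.
Hypothesis v0 : forall s (y : plane), y.2 <= 0 -> v (s, y) = 0.
Hypothesis omegaA : forall (i : bool) t, 0 < t < T ->
  (\int[leb2]_x (`|onH (omega t) x| * `|bs i (onH (omega t)) x|)%:E <= (A / Num.sqrt t)%:E)%E.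

Let momega t : 0 < t < T -> measurable_fun [set: plane] (onH (omega t)).
Proof.
by move=> tT; apply: measurable_onH; have [+ _ _ _] := omega_mild => /(_ t tT)[[[]]].
Qed.

Lemma integral_duhamel_total : exists C : R, 0 < C /\ forall t, 0 < t < T ->
  (\int[prodm lst lebp]_u (duhamel_total v t u)%:E <= C%:E)%E.
Proof.
have [C [C0 CB]] := integral_flux_weights momega mv vE v0 omegaA T1 A0.
pose B := 8 * A * C.
have B0 : 0 <= B by rewrite /B !mulr_ge0// ltW.
exists (B + B + (B + B) + 1); split; first by rewrite ltr_wpDl// !addr_ge0.
move=> t tT.
have mh j := measurable_duhamel_weight t (measurable_flux mv j) (@measurable_heat_weight R j t).
have mw j := measurable_duhamel_weight t (measurable_flux mv j) (@measurable_wall_weight R j t).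
have h0 j u : 0 <= duhamel_weight t (flux v j) (heat_weight j t) u by have [] := duhamel_weights_ge0 v j t u.
have w0 j u : 0 <= duhamel_weight t (flux v j) (wall_weight j t) u by have [] := duhamel_weights_ge0 v j t u.
have Ih j : (\int[prodm lst lebp]_u (duhamel_weight t (flux v j) (heat_weight j t) u)%:E <= B%:E)%E.
  rewrite prodm_tonelli1; [exact: (CB j t tT).1|by apply/measurable_EFinP; exact: mh|by move=> u; rewrite lee_fin h0].
have Iw j : (\int[prodm lst lebp]_u (duhamel_weight t (flux v j) (wall_weight j t) u)%:E <= B%:E)%E.
  rewrite prodm_tonelli1; [exact: (CB j t tT).2|by apply/measurable_EFinP; exact: mw|by move=> u; rewrite lee_fin w0].
rewrite /duhamel_total.
rewrite (int_addr _ (measurable_funD (mh true) (mh false)) (measurable_funD (mw true) (mw false))); last 2 first.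
- by move=> u; exact: (addr_ge0 (h0 true u) (h0 false u)).
- by move=> u; exact: (addr_ge0 (w0 true u) (w0 false u)).
rewrite (int_addr _ (mh true) (mh false) (h0 true) (h0 false)).
rewrite (int_addr _ (mw true) (mw false) (w0 true) (w0 false)).
apply: (@le_trans _ _ (B%:E + B%:E + (B%:E + B%:E))%E).
  by apply: leeD; [exact: leeD (Ih true) (Ih false)|exact: leeD (Iw true) (Iw false)].
by rewrite -!EFinD lee_fin lerDl.
Qed.

(** The kernel is at most the sum of the inverse distances of [x] to [x'] and to its mirror image;
    both potentials of the finite mass [duhamel_total] are finite for almost every [x]. This
    licenses the exchange of integrals in the velocity. *)
Lemma integrable_velocity_density i t : 0 < t < T ->
  {ae leb2, forall x, (prodm lst lebp).-integrable setT (EFin \o velocity_density v i t x)}.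
Proof.
move=> tT; have [C [C0 CB]] := integral_duhamel_total.
have mt := measurable_duhamel_total t mv.
have t0 := duhamel_total_ge0 v t.
have lt := le_lt_trans (CB t tT) (ltry C).
have mrefl : measurable_fun [set: (spacetime * plane)%type] (fun u => refl u.2 : plane).
  by rewrite /refl; mfun.
have := ae_newton_lty mt mrefl t0 lt.
have := @ae_newton_lty R _ _ (prodm lst lebp) _ snd mt measurable_snd t0 lt.
apply: (@filterS2 _ _ (ae_filter_ringOfSetsType leb2)) => x h1 h2.
have mV := measurable_velocity_density t mv i x.
apply: integrable_abs_lty; first exact: mV.
have me (c : spacetime * plane -> plane) : measurable_fun setT c ->
    measurable_fun setT (fun u => (enorm (x - c u))^-1 * duhamel_total v t u).
  move=> mc; apply: measurable_funM; last exact: mt.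
  have mc1 := measurableT_comp measurable_fst mc; have mc2 := measurableT_comp measurable_snd mc.
  by rewrite /enorm; mfun.
have e0 (c : spacetime * plane -> plane) u : 0 <= (enorm (x - c u))^-1 * duhamel_total v t u.
  by rewrite mulr_ge0// invr_ge0 enorm_ge0.
apply: le_lt_trans (int_addr_lty (me _ measurable_snd) (me _ mrefl) (e0 _) (e0 _) h1 h2).
apply: int_mono.
- exact: measurableT_comp.
- exact: (measurable_funD (me _ measurable_snd) (me _ mrefl)).
- by [].
move=> u; rewrite /velocity_density; case: ifP => [u0|_]; last first.
  by rewrite normr0; exact: (addr_ge0 (e0 snd u) (e0 (fun u => refl u.2) u)).
rewrite normrM -mulrDl; apply: ler_pM => //; last exact: duhamel_sum_le.
by apply: (le_trans (ler_normB _ _)); apply: lerD; exact: vort_le.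
Qed.

Definition initial_weight t (x : plane) : R :=
  if 0 < x.2 then `|alpha| * ((1 + 2 * x.2) * `|stokes_kernel t x z|) else 0.

Lemma initial_weight_ge0 t x : 0 <= initial_weight t x.
Proof.
rewrite /initial_weight; case: ifP => // x0.
by rewrite !mulr_ge0// addr_ge0// mulr_ge0// ltW.
Qed.

Lemma measurable_initial_weight t : measurable_fun setT (initial_weight t).
Proof.
have ms : measurable_fun [set: plane] (fun x => stokes_kernel t x z).
  by apply: (@measurable_stokes_kernel _ plane _ (fun=> t) id (fun=> z)); mfun.
apply: measurable_fun_ifT; [by mfun| |exact: measurable_cst].
apply: measurable_funM; first exact: measurable_cst.
by apply: measurable_funM; [mfun|exact: measurableT_comp].
Qed.

(** The velocity of the first term in the representation is paired through the mirror image alone,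
    since the centre [z] is fixed and [stokes_kernel] has a bounded first moment in height there.
    The second integral collects the pairs from the Duhamel term. *)
Lemma bs_superposition i t : 0 < t < T -> {ae leb2, forall x,
  (`|bs i (onH (omega t)) x|%:E <=
    \int[lebp]_x' (pairk i x x' (refl x') * initial_weight t x')%:E +
    \int[prodm lst lebp]_u (pairs i x u.2 u.1.2 * duhamel_total v t u)%:E)%E}.
Proof.
move=> tT; have /andP[t0 tT'] := tT.
have t1 : t <= 1 by rewrite (le_trans (ltW tT')).
have rep := vorticity_duhamel T1 A0 z0 omega_mild omega_init omega_L1 mv vE v0 omegaA tT.
have := integrable_velocity_density i tT; apply: filterS => x I.
have [I2 le2] := velocity_superposition mv t1 v0 I.
pose a0 (x' : plane) : R := if 0 < x'.2 then halfbs i x x' * (alpha * stokes_kernel t x' z) else 0.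
have ms : measurable_fun [set: plane] (fun x => stokes_kernel t x z).
  by apply: (@measurable_stokes_kernel _ plane _ (fun=> t) id (fun=> z)); mfun.
have mh : measurable_fun [set: plane] (fun x' => halfbs i x x') by apply: measurable_halfbs; mfun.
have ma0 : measurable_fun setT a0.
  apply: measurable_fun_ifT; [by mfun| |exact: measurable_cst].
  by apply: measurable_funM => //; apply: measurable_funM => //; exact: measurable_cst.
have mw : measurable_fun [set: plane] (fun x' => pairk i x x' (refl x') * initial_weight t x').
  apply: measurable_funM; last exact: measurable_initial_weight.
  by apply: measurable_pairk; rewrite /refl; mfun.
have le1 : (\int[lebp]_x' (`|a0 x'|)%:E <= \int[lebp]_x' (pairk i x x' (refl x') * initial_weight t x')%:E)%E.
  apply: int_mono => //; first exact: measurableT_comp.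
  move=> x'; rewrite /a0 /initial_weight; case: ifP => [x0|_]; last by rewrite normr0 mulr0.
  rewrite normrM (halfbs_le _ _ (ltW x0)) normrM.
  by rewrite -(mulrA (pairk _ _ _ _)) (mulrCA (1 + _)).
(* If the first integral on the right is infinite the inequality is trivial; otherwise [a0] is
   integrable and the two contributions separate. *)
have [oo|] := eqVneq (\int[lebp]_x' (pairk i x x' (refl x') * initial_weight t x')%:E)%E +oo%E.
  by rewrite oo addye ?leey// gt_eqF// (lt_le_trans (ltNyr 0))// int_ge0// => u; rewrite mulr_ge0 ?pairs_ge0 ?duhamel_total_ge0.
rewrite -ltey => fin.
have I1 : leb2.-integrable setT (EFin \o a0) by apply: integrable_abs_lty => //; exact: le_lt_trans le1 fin.
pose b0 (x' : plane) := \int[lst]_l velocity_density v i t x (l, x').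
have E : \int[lebp]_x' (halfbs i x x' * onH (omega t) x') = \int[lebp]_x' (a0 x' + b0 x').
  apply: ae_eq_Rintegral.
  - by apply: measurable_funM => //; exact: momega.
  - apply: measurable_funD => //; have [+ _] := integrableP _ _ _ I2.
    by move=> /measurable_EFinP.
  move: rep; apply: filterS => x' H; rewrite /onH /a0 /b0 /velocity_density /=.
  case: ifP => x0; last by rewrite /Rintegral integral0 mulr0 addr0.
  rewrite (H x0) mulrDr -Rintegral_scale//.
  have ml : measurable_fun [set: spacetime] (fun l => (l, x') : spacetime * plane) by mfun.
  exact: (measurableT_comp (measurable_duhamel_sum t mv) ml).
rewrite /bs E normrM (ger0_norm (_ : 0 <= (2 * pi)^-1)) ?invr_ge0 ?mulr_ge0 ?pi_ge0//.
apply: (@le_trans _ _ (`|\int[lebp]_x' (a0 x' + b0 x')|)%:E).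
  rewrite lee_fin ler_piMl// invf_le1 ?mulr_gt0 ?pi_gt0//.
  by rewrite mulr_ege1 ?ler1n// (le_trans _ (@pi_ge2 R)) ?ler1n.
rewrite RintegralD; [|exact: measurableT|exact: I1|exact: I2].
apply: (@le_trans _ _ (`|\int[lebp]_x' a0 x'|%:E + `|\int[lebp]_x' b0 x'|%:E)%E).
  by rewrite -EFinD lee_fin ler_normD.
apply: leeD; last exact: le2.
by apply: le_trans le1; exact: le_abs_Rintegral.
Qed.

(** Each of the two superpositions has weights of mass bounded uniformly in [t] and kernels bounded
    in [L^p] uniformly in the parameter, which is what [integral_pow_superposition] requires. *)
Lemma bs_Lp i p : 1 < p -> p < 2 -> exists C : R, 0 < C /\ forall t, 0 < t < T ->
  (\int[leb2]_x (`|bs i (onH (omega t)) x| `^ p)%:E <= C%:E)%E.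
Proof.
move=> p1 p2.
have p0 : 0 < p by lra.
have [C1 C10 C1B] := @vort_pair_Lp R i p p1 p2.
have [C2 C20 C2B] := @pairs_Lp R i p p1 p2.
have [W2 [W20 W2B]] := integral_duhamel_total.
have [D [D0 DB]] := integral_stokes_kernel_weight z0.
(* The added [1] keeps the bound positive when [alpha] is [0]. *)
pose W1 := `|alpha| * D + 1.
have W10 : 0 < W1 by rewrite /W1 ltr_wpDl// mulr_ge0// ltW.
pose B1 := 2 `^ p * W1 `^ p * C1; pose B2 := 2 `^ p * W2 `^ p * C2.
exists (2 `^ p * (B1 + B2)); split.
  by rewrite mulr_gt0 ?powR_gt0// addr_gt0// !mulr_gt0 ?powR_gt0.
move=> t tT; have /andP[t0 tT'] := tT.
have t1 : t <= 1 by rewrite (le_trans (ltW tT')).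
pose k1 (u : plane * plane) := pairk i u.1 u.2 (refl u.2).
pose k2 (u : plane * (spacetime * plane)) := pairs i u.1 u.2.2 u.2.1.2.
have mk1 : measurable_fun setT k1 by apply: measurable_pairk; rewrite /refl; mfun.
have mk2 : measurable_fun setT k2.
  rewrite /k2 /pairs.
  have P a b : measurable_fun setT a -> measurable_fun setT b ->
    measurable_fun [set: (plane * (spacetime * plane))%type] (fun u => pairk i u.1 (a u) (b u)).
    by move=> ma mb; apply: measurable_pairk => //; exact: measurable_fst.
  apply: measurable_funD; first by apply: P; mfun.
  apply: measurable_funD; first by apply: P; mfun.
  apply: measurable_funD; first by apply: P; mfun.
  by apply: measurable_funM; [exact: measurable_cst|apply: P; mfun].
have miw := measurable_initial_weight t.
have mdt := measurable_duhamel_total t mv.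
have iw0 := initial_weight_ge0 t.
have dt0 := duhamel_total_ge0 v t.
have k10 u : 0 <= k1 u by exact: pairk_ge0.
have k20 u : 0 <= k2 u by exact: pairs_ge0.
have IW1 : (\int[lebp]_x (initial_weight t x)%:E <= W1%:E)%E.
  have E x : initial_weight t x = `|alpha| * (if 0 < x.2 then (1 + 2 * x.2) * `|stokes_kernel t x z| else 0).
    by rewrite /initial_weight; case: ifP; rewrite ?mulr0.
  under eq_integral do rewrite E.
  rewrite int_scale.
  - apply: (@le_trans _ _ (`|alpha| * D)%:E); last by rewrite lee_fin lerDl.
    by rewrite [leRHS]EFinM; apply: lee_wpmul2l; [rewrite lee_fin|exact: DB].
  - apply: measurable_fun_ifT; [by mfun| |exact: measurable_cst].
    apply: measurable_funM; first by mfun.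
    apply: measurableT_comp => //.
    by apply: (@measurable_stokes_kernel _ plane _ (fun=> t) id (fun=> z)); mfun.
  - by move=> x; case: ifP => // x0; rewrite mulr_ge0// addr_ge0// mulr_ge0// ltW.
  - by [].
have S1 := integral_pow_superposition (m1 := @lebp R) (m2 := @lebp R) p1 (ltW C10) W10 mk1 miw k10 iw0 (fun x' => C1B x' (refl x')) IW1.
have S2 := integral_pow_superposition (m1 := @lebp R) (m2 := prodm lst lebp) p1 (ltW C20) W20 mk2 mdt k20 dt0 (fun u => C2B u.2 u.1.2) (W2B t tT).
pose U1 (x : plane) := (\int[lebp]_x' (k1 (x, x') * initial_weight t x')%:E)%E.
pose U2 (x : plane) := (\int[prodm lst lebp]_u (k2 (x, u) * duhamel_total v t u)%:E)%E.
have U10 x : (0 <= U1 x)%E by apply: int_ge0 => u; rewrite mulr_ge0.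
have U20 x : (0 <= U2 x)%E by apply: int_ge0 => u; rewrite mulr_ge0.
have mU1 : measurable_fun setT U1.
  apply: (@measurable_fun_fubini_tonelli_F _ _ _ _ _ (@lebp R) (fun w => (k1 w * initial_weight t w.2)%:E)).
  + by apply/measurable_EFinP; exact: (measurable_funM mk1 (measurableT_comp miw measurable_snd)).
  + by move=> w; rewrite lee_fin; apply: mulr_ge0.
have mU2 : measurable_fun setT U2.
  apply: (@measurable_fun_fubini_tonelli_F _ _ _ _ _ (prodm lst lebp) (fun w => (k2 w * duhamel_total v t w.2)%:E)).
  + by apply/measurable_EFinP; exact: (measurable_funM mk2 (measurableT_comp mdt measurable_snd)).
  + by move=> w; rewrite lee_fin; apply: mulr_ge0.
have mUp (U : plane -> \bar R) : measurable_fun setT U -> measurable_fun setT (fun x => U x `^ p)%E.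
  by move=> mU; exact: (measurableT_comp (measurable_poweR p) mU).
have c0 : (0 <= (2 `^ p)%:E :> \bar R)%E by rewrite lee_fin powR_ge0.
have mo := momega tT.
have mbs : measurable_fun [set: plane] (fun x => bs i (onH (omega t)) x).
  apply: (@measurable_bs _ i _ plane (fun w => onH (omega t) w.2) id); last exact: measurable_id.
  exact: (measurableT_comp mo measurable_snd).
apply: (@le_trans _ _ (\int[lebp]_x ((2 `^ p)%:E * (U1 x `^ p + U2 x `^ p)))%E).
  apply: ae_ge0_le_integral.
  - exact: measurableT.
  - by move=> x _; rewrite lee_fin powR_ge0.
  - apply/measurable_EFinP; apply: (measurableT_comp (measurable_powR p)).
    exact: measurableT_comp.
  - by move=> x _; rewrite mule_ge0// adde_ge0// poweR_ge0.
  - apply: emeasurable_funM; first exact: measurable_cst.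
    by apply: emeasurable_funD; exact: mUp.
  have := bs_superposition i tT; apply: (@filterS _ _ (ae_filter_ringOfSetsType leb2)) => x H _.
  apply: le_trans (poweR_add_le p0 (U10 x) (U20 x)).
  rewrite -poweR_EFin; apply: gt0_ler_poweR.
  - exact: ltW.
  - by rewrite in_itv/= leey andbT lee_fin.
  - by rewrite in_itv/= leey andbT adde_ge0.
  exact: H.
rewrite ge0_integralZl//; last 2 first.
- by apply: emeasurable_funD; exact: mUp.
- by move=> x _; rewrite adde_ge0// poweR_ge0.
rewrite (ge0_integralD leb2 measurableT (fun x _ => poweR_ge0 _ _) (mUp _ mU1)
  (fun x _ => poweR_ge0 _ _) (mUp _ mU2)).
by rewrite [leRHS]EFinM EFinD; apply: lee_wpmul2l => //; exact: leeD S1 S2.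
Qed.

End VelocityLp.

(** * Kinetic energy *)

Section KineticEnergy.
Context {R : realType}.
Notation plane := (measurableTypeR R * measurableTypeR R)%type.

(* Where [|bs i f| >= 2 M] the far part of the kernel contributes at most half of
   [bs i f], and weighted AM-GM on the near part gives [|bs i f|^2 <= 4 K J] with
   [J = |f|^(4/3) * near^(4/3)]; elsewhere [|bs i f|^2] is at most
   [(2 M)^(1/2) |bs i f|^(3/2)]. *)
Lemma bs_sqr_lty i (f : plane -> R) (M A D : R) : measurable_fun [set: plane] f ->
  (forall y, y.2 <= 0 -> f y = 0) -> 0 < M -> 0 < A ->
  (\int[leb2]_y (`|f y|)%:E <= M%:E)%E ->
  (\int[leb2]_y (`|f y| `^ (4 / 3))%:E <= A%:E)%E ->
  (\int[leb2]_x (`|bs i f x| `^ (3 / 2))%:E <= D%:E)%E ->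
  (\int[leb2]_x (if (0 < x.2)%R then (`|bs i f x| ^+ 2)%R else 0%R)%:E < +oo)%E.
Proof.
have lin1 (b m q : R) : b <= q + (b / 4 + m) -> 2 * m <= b -> b / 4 <= q by lra.
have lin2 (b k : R) : b / 4 * b <= k -> b * b <= 4 * k by lra.
move=> mf f0 M0 A0 fM fA bD.
(* Cube root of the near part of the Newtonian kernel; together with the cube root [a] of [|f|] it
   makes every exponent an integer. *)
pose c (z : plane) : R := if box 1 z then (enorm z)^-1 `^ (1 / 3) else 0.
have mc : measurable_fun setT c by rewrite /c /box /enorm; mfun.
have c0 z : 0 <= c z by rewrite /c; case: ifP => // _; exact: powR_ge0.
have X3 (r : R) : 0 <= r -> (r `^ (1 / 3)) ^+ 3 = r.
  by move=> r0; rewrite -powR_mulrn ?powR_ge0// -powRrM (_ : 1 / 3 * 3%:R = 1) ?powRr1//; field.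
have X4 (r : R) : 0 <= r -> (r `^ (1 / 3)) ^+ 4 = r `^ (4 / 3).
  by move=> r0; rewrite -powR_mulrn ?powR_ge0// -powRrM; congr (_ `^ _); field.
have mc4 : measurable_fun setT (fun z => c z ^+ 4) by mfun.
pose B : R := 8 / (2 - 4 / 3) * 1 `^ (2 - 4 / 3).
have c4B : (\int[leb2]_z (c z ^+ 4)%:E <= B%:E)%E.
  have h1 : 0 < 4 / 3 :> R by lra.
  have h2 : 4 / 3 < 2 :> R by lra.
  apply: le_trans (integral_enorm_near h1 h2 ltr01).
  rewrite le_eqVlt; apply/orP; left; apply/eqP; apply: eq_integral => z _.
  by rewrite /c; case: ifP => _; rewrite ?expr0n// X4// invr_ge0 enorm_ge0.
have B0 : 0 < B by rewrite /B mulr_gt0 ?powR_gt0// divr_gt0//; lra.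
pose a y := `|f y| `^ (1 / 3).
have a0 y : 0 <= a y by exact: powR_ge0.
have ma : measurable_fun setT a.
  by apply: (measurableT_comp (measurable_powR _)); exact: measurableT_comp.
have ma4 : measurable_fun setT (fun y => a y ^+ 4) by mfun.
have a4A : (\int[leb2]_y (a y ^+ 4)%:E <= A%:E)%E.
  by under eq_integral do rewrite X4//.
pose J x := (\int[leb2]_y (c (x - y) ^+ 4 * a y ^+ 4)%:E)%E.
have mcxy : measurable_fun [set: (plane * plane)%type] (fun u => c (u.1 - u.2)).
  by apply: (measurableT_comp mc); mfun.
have mca : measurable_fun [set: (plane * plane)%type] (fun u => c (u.1 - u.2) ^+ 4 * a u.2 ^+ 4).
  apply: measurable_funM; first by mfun.
  exact: (measurableT_comp ma4 measurable_snd).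
have ca0 x y : 0 <= c (x - y) ^+ 4 * a y ^+ 4 by rewrite mulr_ge0// exprn_ge0.
have J0 x : (0 <= J x)%E by apply: int_ge0 => y; exact: ca0.
have mJ : measurable_fun setT J.
  apply: (@measurable_fun_fubini_tonelli_F _ _ _ _ _ (@lebp R) (fun u : plane * plane => (c (u.1 - u.2) ^+ 4 * a u.2 ^+ 4)%:E)).
    exact/measurable_EFinP.
  by move=> u; rewrite lee_fin.
(* A convolution of two integrable functions: the near kernel to the power [4/3] is integrable
   because [4/3 < 2]. *)
have IJ : (\int[leb2]_x J x <= (B * A)%:E)%E.
  have -> : (\int[leb2]_x J x = \int[leb2]_y \int[leb2]_x (c (x - y) ^+ 4 * a y ^+ 4)%:E)%E.
    apply: (@fubini_tonelli _ _ _ _ _ (@lebp R) (@lebp R) (fun u : plane * plane => (c (u.1 - u.2) ^+ 4 * a u.2 ^+ 4)%:E)).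
      exact/measurable_EFinP.
    by move=> u; rewrite lee_fin.
  apply: (@le_trans _ _ (\int[leb2]_y (B * a y ^+ 4)%:E)%E).
    apply: ge0_le_integral.
    - exact: measurableT.
    - by move=> y _; apply: int_ge0 => x; exact: ca0.
    - apply: (@measurable_fun_fubini_tonelli_G _ _ _ _ _ (@lebp R) (fun u : plane * plane => (c (u.1 - u.2) ^+ 4 * a u.2 ^+ 4)%:E)).
        exact/measurable_EFinP.
      by move=> u; rewrite lee_fin.
    - by apply/measurable_EFinP; apply: measurable_funM => //; exact: measurable_cst.
    move=> y _; rewrite int_scaler.
    - rewrite [leRHS]EFinM; apply: lee_wpmul2r; first by rewrite lee_fin exprn_ge0.
      rewrite (leb2_translate y (f := fun z => (c z ^+ 4)%:E))//.
      + exact/measurable_EFinP.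
      + by move=> z; rewrite lee_fin exprn_ge0.
    - by apply: (measurableT_comp mc4); mfun.
    - by move=> x; rewrite exprn_ge0.
    - by rewrite exprn_ge0.
  rewrite int_scale//; last 2 first.
  - by move=> y; rewrite exprn_ge0.
  - exact: ltW.
  by rewrite [leRHS]EFinM; apply: lee_wpmul2l => //; rewrite lee_fin ltW.
pose K := (A + B) / 2.
have K0 : 0 < K by rewrite divr_gt0// addr_gt0.
have pw x : 0 < x.2 -> 2 * M <= `|bs i f x| -> ((`|bs i f x| ^+ 2)%:E <= (4 * K)%:E * J x)%E.
  move=> x0 bM; have := bs_le i mf f0 x0; set b := `|bs i f x| => bI.
  have b0 : 0 < b by apply: lt_le_trans bM; rewrite mulr_gt0.
  (* The parameter of the weighted inequality, chosen so that the term in [A + B] equals [b / 4] and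
     the term in [J] equals [K J / b]. With [M <= b / 2] a quarter of [b] remains on the left. *)
  pose l := 2 * K / b; have l0 : 0 < l by rewrite divr_gt0// mulr_gt0.
  have mcx : measurable_fun [set: plane] (fun y => c (x - y)) by apply: (measurableT_comp mc); mfun.
  have mcx4 : measurable_fun [set: plane] (fun y => c (x - y) ^+ 4).
    by apply: measurable_funX; exact: mcx.
  have mnf : measurable_fun [set: plane] (fun y => `|f y|) by exact: measurableT_comp.
  have mcax : measurable_fun [set: plane] (fun y => c (x - y) ^+ 4 * a y ^+ 4) by apply: measurable_funM.
  have bound : (b%:E <= \int[leb2]_y (l / 2 * (c (x - y) ^+ 4 * a y ^+ 4) + ((4 * l)^-1 * (a y ^+ 4 + c (x - y) ^+ 4) + `|f y|))%:E)%E.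
    apply: (le_trans bI); apply: int_mono.
    - by apply: measurable_funM => //; rewrite /enorm; mfun.
    - apply: measurable_funD; first by apply: measurable_funM => //; exact: measurable_cst.
      apply: measurable_funD => //; apply: measurable_funM; first exact: measurable_cst.
      exact: measurable_funD.
    - by move=> y; rewrite mulr_ge0// invr_ge0 enorm_ge0.
    move=> y; have fE : `|f y| = a y ^+ 3 by rewrite X3.
    have q0 := a0 y; have r0 := c0 (x - y).
    (* Outside the unit square the inverse distance is at most [1], which costs [|f y|], of total
       mass at most [M]. *)
    have le1 : `|f y| * (enorm (x - y))^-1 <= (c (x - y) * a y) ^+ 3 + `|f y|.
      rewrite exprMn -fE /c; case: ifPn => [_|nb].
        by rewrite X3 ?invr_ge0 ?enorm_ge0// mulrC lerDl.
      rewrite expr0n /= mul0r add0r ler_piMr// invf_le1.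
        move: nb; rewrite /box negb_and -!ltNge => /orP[h|h].
        - by apply: ltW; apply: lt_le_trans h (abs1_le_enorm _).
        - by apply: ltW; apply: lt_le_trans h (abs2_le_enorm _).
      move: nb; rewrite /box negb_and -!ltNge => /orP[h|h].
      - by apply: lt_le_trans (abs1_le_enorm _); exact: lt_trans h.
      - by apply: lt_le_trans (abs2_le_enorm _); exact: lt_trans h.
    apply: (le_trans le1); rewrite addrA lerD2r.
    move: (a y) (c (x - y)) q0 r0 => u w u0 w0.
    rewrite -subr_ge0.
    (* With [p = w u], the inequality combines [p^3 <= l p^4 / 2 + p^2 / (2 l)] with
       [p^2 <= (u^4 + w^4) / 2]; the difference of the two sides is a sum of squares. *)
    have -> : l / 2 * (w ^+ 4 * u ^+ 4) + (4 * l)^-1 * (u ^+ 4 + w ^+ 4) - (w * u) ^+ 3 =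
      (2 * l)^-1 * (w * u) ^+ 2 * (l * (w * u) - 1) ^+ 2 + (4 * l)^-1 * (u ^+ 2 - w ^+ 2) ^+ 2.
      by field; rewrite gt_eqF.
    by rewrite addr_ge0// mulr_ge0 ?sqr_ge0// ?mulr_ge0 ?sqr_ge0// invr_ge0 mulr_ge0// ltW.
  have l20 : 0 <= l / 2 by rewrite divr_ge0// ltW.
  have l40 : 0 <= (4 * l)^-1 by rewrite invr_ge0 mulr_ge0// ltW.
  have ac0 y : 0 <= a y ^+ 4 + c (x - y) ^+ 4 by rewrite addr_ge0// exprn_ge0.
  have mac := measurable_funD ma4 mcx4.
  have mS1 : measurable_fun [set: plane] (fun y => l / 2 * (c (x - y) ^+ 4 * a y ^+ 4)).
    by apply: measurable_funM => //; exact: measurable_cst.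
  have mS2 : measurable_fun [set: plane] (fun y => (4 * l)^-1 * (a y ^+ 4 + c (x - y) ^+ 4)).
    by apply: measurable_funM => //; exact: measurable_cst.
  have cx4 : (\int[leb2]_y (c (x - y) ^+ 4)%:E <= B%:E)%E.
    rewrite (leb2_reflect x (f := fun z => (c z ^+ 4)%:E)); first exact: c4B.
    - by apply/measurable_EFinP; exact: mc4.
    - by move=> z; rewrite lee_fin exprn_ge0.
  have bE : (b%:E <= (l / 2)%:E * J x + ((4 * l)^-1%:E * (A + B)%:E + M%:E))%E.
    apply: (le_trans bound).
    rewrite (int_addr _ mS1 (measurable_funD mS2 mnf)); last 2 first.
    - by move=> y; rewrite mulr_ge0.
    - by move=> y; exact: (addr_ge0 (mulr_ge0 l40 (ac0 y)) (normr_ge0 _)).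
    rewrite (int_scale _ mcax (ca0 x) l20); apply: leeD; first exact: lexx.
    rewrite (int_addr _ mS2 mnf)//; last by move=> y; rewrite mulr_ge0.
    apply: leeD; last exact: fM.
    rewrite (int_scale _ mac ac0 l40); apply: lee_wpmul2l; first by rewrite lee_fin.
    rewrite (int_addr _ ma4 mcx4); last 2 first.
    - by move=> y; rewrite exprn_ge0.
    - by move=> y; rewrite exprn_ge0.
    by rewrite [leRHS]EFinD; exact: leeD a4A cx4.
  move: bE; case: (J x) (J0 x) => [j| |] // j0; last first.
    by move=> _; rewrite gt0_muley ?leey// lte_fin mulr_gt0.
  rewrite -!EFinM -!EFinD !lee_fin => bE.
  have E1 : (4 * l)^-1 * (A + B) = b / 4.
    rewrite /l /K; field.
    by rewrite !gt_eqF ?addr_gt0.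
  have E2 : l / 2 * j = K * j / b by rewrite /l; field; rewrite gt_eqF.
  rewrite E1 E2 in bE.
  have bM2 : 2 * M <= b by exact: bM.
  have : b / 4 <= K * j / b by exact: lin1 bE bM2.
  rewrite ler_pdivlMr// => h; rewrite expr2 -mulrA; exact: lin2.
have mbs : measurable_fun [set: plane] (fun x => bs i f x).
  apply: (@measurable_bs _ i _ plane (fun w => f w.2) id); last exact: measurable_id.
  exact: (measurableT_comp mf measurable_snd).
have mb32 : measurable_fun [set: plane] (fun x => `|bs i f x| `^ (3 / 2)).
  by apply: (measurableT_comp (measurable_powR _)); exact: measurableT_comp.
apply: (@le_lt_trans _ _ (\int[leb2]_x ((4 * K)%:E * J x + ((2 * M) `^ (1 / 2))%:E * (`|bs i f x| `^ (3 / 2))%:E))%E).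
  have t10 x : (0 <= (4 * K)%:E * J x)%E by rewrite mule_ge0// lee_fin mulr_ge0// ltW.
  have t20 x : (0 <= ((2 * M) `^ (1 / 2))%:E * (`|bs i f x| `^ (3 / 2))%:E)%E.
    by rewrite mule_ge0// lee_fin powR_ge0.
  apply: ge0_le_integral.
  - exact: measurableT.
  - by move=> x _; rewrite lee_fin; case: ifP => // _; exact: sqr_ge0.
  - apply/measurable_EFinP; apply: measurable_fun_ifT; [by mfun| |exact: measurable_cst].
    by apply: measurable_funX; exact: measurableT_comp.
  - apply: emeasurable_funD; apply: emeasurable_funM; try exact: measurable_cst.
      exact: mJ.
    by apply/measurable_EFinP.
  move=> x _; case: ifPn => x0; last by rewrite adde_ge0.
  have [bM|bM] := leP (2 * M) `|bs i f x|.
    by apply: (le_trans (pw x x0 bM)); rewrite leeDl.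
  apply: (@le_trans _ _ (((2 * M) `^ (1 / 2))%:E * (`|bs i f x| `^ (3 / 2))%:E)%E); last by rewrite leeDr.
  rewrite -EFinM lee_fin; have b0 := normr_ge0 (bs i f x).
  have [->|bn] := eqVneq `|bs i f x| 0; first by rewrite expr0n/= mulr_ge0 ?powR_ge0.
  have -> : `|bs i f x| ^+ 2 = `|bs i f x| `^ (1 / 2) * `|bs i f x| `^ (3 / 2).
    rewrite -powRD; last by rewrite bn implybT.
    by rewrite (_ : 1 / 2 + 3 / 2 = 2%:R) ?powR_mulrn//; field.
  by rewrite ler_wpM2r ?powR_ge0// ge0_ler_powR ?nnegrE// ?(ltW bM)// mulr_ge0// ltW.
have k4 : (0 <= (4 * K)%:E :> \bar R)%E by rewrite lee_fin mulr_ge0// ltW.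
have k2 : (0 <= ((2 * M) `^ (1 / 2))%:E :> \bar R)%E by rewrite lee_fin powR_ge0.
have mE32 : measurable_fun [set: plane] (fun x => (`|bs i f x| `^ (3 / 2))%:E) by apply/measurable_EFinP.
have h0 x : (0 <= (`|bs i f x| `^ (3 / 2))%:E)%E by rewrite lee_fin powR_ge0.
rewrite (ge0_integralD leb2 measurableT (fun x _ => mule_ge0 k4 (J0 x))
  (emeasurable_funM (measurable_cst _) mJ) (fun x _ => mule_ge0 k2 (h0 x))
  (emeasurable_funM (measurable_cst _) mE32)).
rewrite (ge0_integralZl leb2 measurableT mJ (fun x _ => J0 x) k4).
rewrite (ge0_integralZl leb2 measurableT mE32 (fun x _ => h0 x) k2).
apply: lte_add_pinfty.
  by apply: lte_mul_pinfty => //; exact: le_lt_trans IJ (ltry _).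
by apply: lte_mul_pinfty => //; exact: le_lt_trans bD (ltry _).
Qed.

End KineticEnergy.

Section EnergyBounds.
Context {R : realType}.
Notation plane := (measurableTypeR R * measurableTypeR R)%type.
Implicit Types (f : R * R -> R) (p : R).

Lemma Lpnorm_poweR p f : 0 < p -> Lpnorm p f = ((\int[leb2]_x (`|onH f x| `^ p)%:E) `^ p^-1)%E.
Proof.
move=> p0; rewrite -LpnormX// -poweRrM divff ?gt_eqF// poweRe1//.
exact: Lnorm_ge0.
Qed.

Lemma Lpnorm_BS_le p f (C : R) : 1 <= p -> 0 <= C ->
  measurable_fun [set: plane] (onH f) ->
  (forall i, \int[leb2]_x (if (0 < x.2)%R then (`|bs i (onH f) x| `^ p)%R else 0%R)%:E <= C%:E)%E ->
  (Lpnorm p (fun x => enorm (BS f x)) <= ((2 `^ p * (C + C)) `^ p^-1)%:E)%E.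
Proof.
move=> p1 C0 mo CB; have p0 : 0 < p by rewrite (lt_le_trans _ p1).
have p0' := ltW p0.
rewrite Lpnorm_poweR// -poweR_EFin.
apply: gt0_ler_poweR.
- by rewrite invr_ge0.
- by rewrite in_itv/= leey andbT; apply: int_ge0 => x; exact: powR_ge0.
- by rewrite in_itv/= leey andbT lee_fin mulr_ge0 ?powR_ge0// addr_ge0.
have mbs i : measurable_fun [set: plane] (fun x => bs i (onH f) x).
  apply: (@measurable_bs _ i _ plane (fun w => onH f w.2) id); last exact: measurable_id.
  exact: (measurableT_comp mo measurable_snd).
pose b i (x : plane) : R := if 0 < x.2 then `|bs i (onH f) x| `^ p else 0.
have b0 i x : 0 <= b i x by rewrite /b; case: ifP => // _; exact: powR_ge0.
have mb i : measurable_fun setT (b i).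
  apply: measurable_fun_ifT; [by mfun| |exact: measurable_cst].
  by apply: (measurableT_comp (measurable_powR _)); exact: measurableT_comp.
have mE : measurable_fun [set: plane] (onH (fun x => enorm (BS f x))).
  apply: measurable_fun_ifT; [by mfun| |exact: measurable_cst].
  rewrite (_ : (fun x => enorm (BS f x)) = (fun x : plane => enorm (bs true (onH f) x, bs false (onH f) x))).
    have m1 := mbs true; have m2 := mbs false.
    by rewrite /enorm /=; mfun.
  by apply/funext => x; rewrite BS_bs.
apply: (@le_trans _ _ (\int[leb2]_x (2 `^ p * (b true x + b false x))%:E)%E).
  apply: int_mono.
  - by apply: (measurableT_comp (measurable_powR _)); exact: measurableT_comp.
  - apply: measurable_funM; first exact: measurable_cst.
    exact: (measurable_funD (mb true) (mb false)).
  - by move=> x; exact: powR_ge0.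
  move=> x; rewrite /onH /b; case: ifP => x0; last by rewrite normr0 powR0 ?gt_eqF// addr0 mulr0.
  rewrite -/(onH f) (ger0_norm (enorm_ge0 _)) BS_bs.
  apply: (@le_trans _ _ ((`|bs true (onH f) x| + `|bs false (onH f) x|) `^ p)).
    by rewrite ge0_ler_powR ?nnegrE ?enorm_ge0 ?addr_ge0//; exact: enorm_le_sum.
  have := poweR_add_le p0 (_ : 0 <= `|bs true (onH f) x|%:E)%E (_ : 0 <= `|bs false (onH f) x|%:E)%E.
  by rewrite !lee_fin; apply.
rewrite (int_scale _ (measurable_funD (mb true) (mb false))) ?powR_ge0//; last first.
  by move=> x; exact: addr_ge0 (b0 true x) (b0 false x).
rewrite [leRHS]EFinM; apply: lee_wpmul2l; first by rewrite lee_fin powR_ge0.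
rewrite (int_addr _ (mb true) (mb false) (b0 true) (b0 false)) [leRHS]EFinD.
exact: leeD (CB true) (CB false).
Qed.

End EnergyBounds.

Theorem corollary5p3 (R : realType) (alpha : R) :
  exists T0 : R, 0 < T0 /\
  forall (T : R) (omega : R -> R * R -> R),
    0 < T -> T <= T0 ->
    mild_solution T omega ->
    weak_cvg_dirac omega alpha (0, 1) ->
    (sup_time T (fun t => Lpnorm 1 (omega t)) < +oo)%E ->
    (exists beta : R, beta < 1 / 4 /\
      (sup_time T (fun t =>
        (t `^ beta)%:E *
        Lpnorm (4 / 3) (fun x => (omega t x - alpha * gauss t (x - (0, 1)))%R))
       < +oo)%E) ->
    (forall p : R, 1 < p -> p < 2 ->
      (sup_time T (fun t => Lpnorm p (fun x => enorm (BS (omega t) x)))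
       < +oo)%E) /\
    (forall t : R, 0 < t -> t < T ->
      (Lpnorm 2 (fun x => enorm (BS (omega t) x)) ^+ 2 < +oo)%E).
Proof.
(* The kernel bounds hold for times up to [1], so [T0] can be taken to be [1]. *)
exists 1; split=> [//|T omega _ T1 mild init L1 [beta [beta4 L43]]].
have inL t : 0 < t < T -> inLp 1 (omega t) /\ inLp (4 / 3) (omega t).
  by move=> tT; have [+ _ _ _] := mild => /(_ t tT)[[]].
have L43' t (tT : 0 < t < T) := (inL t tT).2.
have momega t : 0 < t < T -> measurable_fun [set: measurableTypeR R * measurableTypeR R] (onH (omega t)).
  by move=> tT; apply: measurable_onH; have [[]] := inL t tT.
have [A [A0 omegaA]] := vorticity_flux_L1 T1 beta4 L43' L43.
have [v [mv vE v0]] := vorticity_version mild.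
have z0 : 0 < (0 : R, 1 : R).2 := ltr01.
have Lp i p : 1 < p -> p < 2 -> exists C : R, 0 < C /\ forall t, 0 < t < T ->
    (\int[leb2]_x (`|bs i (onH (omega t)) x| `^ p)%:E <= C%:E)%E.
  exact: (bs_Lp T1 (ltW A0) z0 mild init L1 mv vE v0 omegaA).
split=> [p p1 p2|t t0 tT].
  have [C1 [C10 C1B]] := Lp true p p1 p2; have [C2 [C20 C2B]] := Lp false p p1 p2.
  pose C := C1 + C2.
  have C0 : 0 <= C by rewrite addr_ge0 ?ltW.
  apply: (@le_lt_trans _ _ ((2 `^ p * (C + C)) `^ p^-1)%:E); last exact: ltry.
  apply: ge_ereal_sup => _ [t tT <-]; rewrite /= in_itv/= in tT.
  apply: Lpnorm_BS_le => //; [exact: ltW|exact: momega|move=> i].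
  have mb : measurable_fun [set: measurableTypeR R * measurableTypeR R] (fun x => `|bs i (onH (omega t)) x| `^ p).
    apply: (measurableT_comp (measurable_powR _)); apply: measurableT_comp => //.
    apply: (@measurable_bs _ i _ _ (fun w => onH (omega t) w.2) id); last exact: measurable_id.
    exact: (measurableT_comp (momega t tT) measurable_snd).
  apply: (@le_trans _ _ (\int[leb2]_x (`|bs i (onH (omega t)) x| `^ p)%:E)%E).
    apply: int_mono.
    - by apply: measurable_fun_ifT; [mfun|exact: mb|exact: measurable_cst].
    - exact: mb.
    - by move=> x; case: ifP => // _; exact: powR_ge0.
    - by move=> x; case: ifP => // _; exact: powR_ge0.
  case: i {mb}; [apply: (le_trans (C1B t tT))|apply: (le_trans (C2B t tT))];
    by rewrite lee_fin /C ?lerDl ?lerDr ltW.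
have tI : 0 < t < T by rewrite t0.
have [M [M0 MB]] := sup_time_bound L1.
have [B [B0 BB]] := vorticity_L43 T1 beta4 L43' L43.
have fM : (\int[leb2]_y (`|onH (omega t) y|)%:E <= M%:E)%E by rewrite -Lpnorm1E; exact: MB.
have f0 y : y.2 <= 0 -> onH (omega t) y = 0 by move=> y0; rewrite /onH ltNge y0.
have A1 : 0 < B * t `^ (- (1 / 3)) by rewrite mulr_gt0// powR_gt0.
have fin i : (\int[leb2]_x (if (0 < x.2)%R then (`|bs i (onH (omega t)) x| ^+ 2)%R else 0%R)%:E < +oo)%E.
  have h1 : 1 < 3 / 2 :> R by lra.
  have h2 : 3 / 2 < 2 :> R by lra.
  have [D [D0 DB]] := Lp i (3 / 2) h1 h2.
  exact: (bs_sqr_lty (momega t tI) f0 M0 A1 fM (BB t tI) (DB t tI)).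
have bnd i : exists D : R, 0 <= D /\
    (\int[leb2]_x (if (0 < x.2)%R then (`|bs i (onH (omega t)) x| ^+ 2)%R else 0%R)%:E <= D%:E)%E.
  have I0 : (0 <= \int[leb2]_x (if (0 < x.2)%R then (`|bs i (onH (omega t)) x| ^+ 2)%R else 0%R)%:E)%E.
    by apply: int_ge0 => x; case: ifP => // _; exact: sqr_ge0.
  by move: (fin i) I0; case: (\int[leb2]_x _)%E => [d _ d0| |] //; exists d.
have [D1 [D10 D1B]] := bnd true; have [D2 [D20 D2B]] := bnd false.
pose C := D1 + D2.
have C0 : 0 <= C by exact: addr_ge0.
have L2 : (Lpnorm 2 (fun x => enorm (BS (omega t) x)) <= ((2 `^ 2 * (C + C)) `^ 2^-1)%:E)%E.
  apply: Lpnorm_BS_le => //; [exact: ler1n|exact: momega|move=> i].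
  rewrite (_ : \int[leb2]_x _ = \int[leb2]_x (if (0 < x.2)%R then (`|bs i (onH (omega t)) x| ^+ 2)%R else 0%R)%:E)%E; last first.
    by apply: eq_integral => x _; rewrite powR_mulrn.
  case: i; [apply: (le_trans D1B)|apply: (le_trans D2B)];
    by rewrite lee_fin /C ?lerDl ?lerDr.
have L0 : (0 <= Lpnorm 2 (fun x => enorm (BS (omega t) x)))%E by exact: Lnorm_ge0.
by move: L2 L0; case: (Lpnorm _ _) => [l _ _| |] //; rewrite -EFin_expe ltry.
Qed.
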